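(* The category $\mathrm{MDVB}$ of metric double vector bundles and the category $[2]\text{-}\mathrm{Man}$ of $[2]$-manifolds (i.e. $\mathbb N$-graded manifolds of degree $2$) are equivalent.
   Context: Everything is smooth. **$[2]$-manifolds.** A $[2]$-manifold $\mathcal M$ of dimension $(p;r_1,r_2)$ is a smooth $p$-manifold $M$ with a sheaf $C^\infty(\mathcal M)$ of $\mathbb N$-graded, graded commutative, associative, unital $\mathbb R$-algebras whose degree $0$ part is $C^\infty(M)$ and which is locally freely generated over $C^\infty(M)$ by $r_1$ generators of degree $1$ and $r_2$ generators of degree $2$. A morphism $\mu:\mathcal M\to\mathcal N$ is a smooth map $\mu_0:M\to N$ with a morphism of sheaves of graded algebras $\mu^\star: C^\infty(\mathcal N)\to C^\infty(\mathcal M)$ over $\mu_0$ such that $\mu^\star f=\mu_0^*f$ for $f\in C^\infty(N)$. **Double vector bundles.** A double vector bundle $(D;A,B;M)$ is a commutative square of vector bundles $\pi_A:D\to A$, $\pi_B:D\to B$, $q_A:A\to M$, $q_B:B\to M$ such that the projection, addition and scalar multiplication of $D\to B$ are vector bundle morphisms over the corresponding maps of $A\to M$. The vector bundles $A,B$ are the sides; the core $C=\ker\pi_A\cap\ker\pi_B$ is a vector bundle over $M$. Morphisms of double vector bundles are maps that are vector bundle morphisms for both structures. The dual $D^*_A$ of $D\to A$ is a double vector bundle with sides $A$ and $C^*$ and core $B^*$; similarly $D^*_B$ has sides $B$ and $C^*$ and core $A^*$. **Metric double vector bundles.** A metric double vector bundle $(\mathbb E;Q,B;M)$ is a double vector bundle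 with sides $Q,B$ and a symmetric nondegenerate fibrewise pairing on the vector bundle $\mathbb E\to B$ which is linear: the induced map $\boldsymbol\beta:\mathbb E\to \mathbb E^*_B$ is an isomorphism of double vector bundles. In particular the core is identified with $Q^*$. $\overline{\mathbb E}$ denotes $\mathbb E$ with the pairing multiplied by $-1$. **Morphisms in $\mathrm{MDVB}$.** Let $(\mathbb F;P,A;N)$ and $(\mathbb E;Q,B;M)$ be metric double vector bundles. A morphism $\Omega:\mathbb F\dashrightarrow\mathbb E$ is a relation $\Omega\subseteq\overline{\mathbb F}\times\mathbb E$, isotropic for the product pairing (over $A\times B$), which is dual to a morphism of double vector bundles $\omega:\mathbb F^*_P\to\mathbb E^*_Q$ (duals over $P$, resp. $Q$) over a vector bundle map $\omega_P:P\to Q$ covering a smooth map $\omega_0:N\to M$. That is, $\Omega=\{(\omega_p^*e,e)\mid p\in P,\ e\in\mathbb E,\ \pi_Q(e)=\omega_P(p)\}$, where $\omega_p$ is the restriction of $\omega$ to the fibre over $p$. Composition is given by composition of the maps $\omega$. *)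

(* Defs.v *)
From HB Require Import structures.
From mathcomp Require Import all_boot all_order all_algebra.
From mathcomp Require Import all_classical all_reals all_analysis.

Set Implicit Arguments.
Unset Strict Implicit.
Unset Printing Implicit Defensive.

Import Order.TTheory GRing.Theory Num.Theory.
Import numFieldNormedType.Exports.

Local Open Scope classical_set_scope.
Local Open Scope ring_scope.

Record category := Category {
  obj : Type;
  mor : obj -> obj -> Type;
  idm : forall x, mor x x;
  comp : forall x y z, mor y z -> mor x y -> mor x z;
  comp_idl : forall x y (f : mor x y), comp (idm y) f = f;
  comp_idr : forall x y (f : mor x y), comp f (idm x) = f;
  comp_assoc : forall x y z t (h : mor z t) (g : mor y z) (f : mor x y),
    comp h (comp g f) = comp (comp h g) f }.

Record functor (C D : category) := Functor {
  fobj :> obj C -> obj D;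
  fmap : forall x y, mor x y -> mor (fobj x) (fobj y);
  fmap_id : forall x, fmap (idm x) = idm (fobj x);
  fmap_comp : forall x y z (g : mor y z) (f : mor x y),
    fmap (comp g f) = comp (fmap g) (fmap f) }.

Definition is_iso (C : category) (x y : obj C) (f : mor x y) : Prop :=
  exists g : mor y x, comp g f = idm x /\ comp f g = idm y.

Definition equivalent (C D : category) : Prop :=
  exists (F : functor C D) (G : functor D C)
    (u : forall x : obj C, mor x (G (F x)))
    (v : forall y : obj D, mor (F (G y)) y),
  [/\ forall x, is_iso (u x),
      forall x x' (f : mor x x'),
        comp (u x') f = comp (fmap G (fmap F f)) (u x),
      forall y, is_iso (v y) &
      forall y y' (g : mor y y'),
        comp (v y') (fmap F (fmap G g)) = comp g (v y)].

(* A category presented by ambient types of arrows, in which the morphisms are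
   singled out by a predicate. *)
Record precat := Precat {
  aobj : Type;
  arr : aobj -> aobj -> Type;
  ahom : forall x y, set (arr x y);
  aid : forall x, arr x x;
  acomp : forall x y z, arr y z -> arr x y -> arr x z }.

Record is_category (C : precat) : Prop := IsCategory {
  cat_id : forall x : aobj C, ahom (aid x);
  cat_comp : forall (x y z : aobj C) (g : arr y z) (f : arr x y),
    ahom g -> ahom f -> ahom (acomp g f);
  cat_idl : forall (x y : aobj C) (f : arr x y), acomp (aid y) f = f;
  cat_idr : forall (x y : aobj C) (f : arr x y), acomp f (aid x) = f;
  cat_assoc : forall (x y z t : aobj C) (h : arr z t) (g : arr y z)
    (f : arr x y), acomp h (acomp g f) = acomp (acomp h g) f }.

Section CategoryOf.
Variables (C : precat) (hC : is_category C).

Let cmor (x y : aobj C) : Type := {f : arr x y | ahom f}.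
Let cid x : cmor x x := exist _ _ (cat_id hC x).
Let ccomp x y z (g : cmor y z) (f : cmor x y) : cmor x z :=
  exist _ _ (cat_comp hC (svalP g) (svalP f)).

Let ccomp_idl x y (f : cmor x y) : ccomp (cid y) f = f.
Proof. apply: eq_sig_hprop => [? ? ?|]; [exact: Prop_irrelevance|exact: (cat_idl hC)]. Qed.

Let ccomp_idr x y (f : cmor x y) : ccomp f (cid x) = f.
Proof. apply: eq_sig_hprop => [? ? ?|]; [exact: Prop_irrelevance|exact: (cat_idr hC)]. Qed.

Let ccomp_assoc x y z t (h : cmor z t) (g : cmor y z) (f : cmor x y) :
  ccomp h (ccomp g f) = ccomp (ccomp h g) f.
Proof. apply: eq_sig_hprop => [? ? ?|]; [exact: Prop_irrelevance|exact: (cat_assoc hC)]. Qed.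

Definition category_of : category :=
  Category ccomp_idl ccomp_idr ccomp_assoc.

End CategoryOf.

(* [clip d x] is [x] as an element of [{x | P x}]; the default [d] is used
   when [P x] fails. *)
Definition clip (T : Type) (P : T -> Prop) (d : {x | P x}) (x : T) : {x | P x} :=
  if pselect (P x) is left h then exist P x h else d.

Section Manifolds.
Variable R : realType.

(* Class C^k on an open subset U of R^n: all iterated partial derivatives up
   to order k exist and are continuous on U. *)
Fixpoint Ck (n k : nat) (U : set 'rV[R]_n) (f : 'rV[R]_n -> R) : Prop :=
  (forall x, U x -> {for x, continuous f}) /\
  if k is k'.+1 then
    forall i : 'I_n, (forall x, U x -> derivable f x (delta_mx 0 i)) /\
                     Ck k' U (fun x => 'D_(delta_mx 0 i) f x)
  else True.

Definition Cinfty (n : nat) (U : set 'rV[R]_n) (f : 'rV[R]_n -> R) : Prop :=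
  forall k, Ck k U f.

(* A smooth structure is given by a set of charts on a bare set; the topology
   is the one for which the charts are homeomorphisms onto open sets. *)
Record chart (T : Type) := Chart {
  cdim : nat;
  dom : set T;
  crd : T -> 'rV[R]_cdim }.

Record space := Space { pt :> Type; atlas : set (chart pt) }.
Arguments atlas : clear implicits.

Definition compat (T : Type) (c d : chart T) : Prop :=
  open (crd c @` (dom c `&` dom d)) /\
  exists tau : 'rV[R]_(cdim c) -> 'rV[R]_(cdim d),
    (forall j, Cinfty (crd c @` (dom c `&` dom d)) (fun v => tau v 0 j)) /\
    (forall x, dom c x -> dom d x -> crd d x = tau (crd c x)).

(* charts of the maximal atlas *)
Definition mchart (X : space) (c : chart X) : Prop :=
  {in dom c &, injective (crd c)} /\
  forall d, atlas X d -> compat c d /\ compat d c.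

Definition opn (X : space) (U : set X) : Prop :=
  forall c, atlas X c -> open (crd c @` (U `&` dom c)).

Record is_manifold (n : nat) (X : space) : Prop := IsManifold {
  mfd_cover : forall x : X, exists2 c, atlas X c & dom c x;
  mfd_chart : forall c, atlas X c -> cdim c = n /\ mchart c;
  mfd_hausdorff : forall x y : X, x <> y -> exists U V : set X,
    [/\ opn U, opn V, U x, V y & U `&` V = set0];
  mfd_second_countable : exists B : nat -> set X, (forall i, opn (B i)) /\
    forall (U : set X) x, opn U -> U x -> exists i, B i x /\ B i `<=` U }.

Definition smooth_on (X : space) (U : set X) (f : X -> R) : Prop :=
  forall c, atlas X c -> exists2 g : 'rV[R]_(cdim c) -> R,
    Cinfty (crd c @` (U `&` dom c)) g &
    forall x, U x -> dom c x -> f x = g (crd c x).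

Definition cont_map (X Y : space) (F : X -> Y) : Prop :=
  forall V : set Y, opn V -> opn (F @^-1` V).

Definition smooth_map (X Y : space) (F : X -> Y) : Prop :=
  cont_map F /\ forall d, atlas Y d -> forall j,
    smooth_on (F @^-1` dom d) (fun x => crd d (F x) 0 j).

(* The smooth structure on an embedded submanifold S, given by slice charts. *)
Inductive slice_chart (X : space) (S : set X) : chart {x : X | S x} -> Prop :=
| SliceChart (k l : nat) (U : set X) (f : X -> 'rV[R]_(k + l)) :
    mchart (Chart U f) ->
    (forall x, U x -> (S x <-> rsubmx (f x) = 0)) ->
    slice_chart (Chart (fun x : {x | S x} => U (sval x))
                       (fun x : {x | S x} => lsubmx (f (sval x)))).

Definition subspace (X : space) (S : set X) : space :=
  Space (@slice_chart X S).

(* Vector bundles.  [vadd] is relevant only for two elements of one fibre. *)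

Record vb_ops (M E : Type) := VbOps {
  vproj : E -> M;
  vzero : M -> E;
  vadd : E -> E -> E;
  vscale : R -> E -> E }.

(* [xi] is a fibrewise linear isomorphism onto R^r over the domain of [c], and
   (c, xi) is a chart of the total space. *)
Definition vb_chart (M E : space) (v : vb_ops M E) (c : chart M) (r : nat)
    (xi : E -> 'rV[R]_r) : Prop :=
  [/\ mchart c,
      forall e e', dom c (vproj v e) -> vproj v e = vproj v e' ->
        xi (vadd v e e') = xi e + xi e',
      forall t e, dom c (vproj v e) -> xi (vscale v t e) = t *: xi e,
      forall m w, dom c m -> exists2 e, vproj v e = m & xi e = w &
      @mchart E (Chart (fun e => dom c (vproj v e))
                       (fun e => row_mx (crd c (vproj v e)) (xi e)))].

(* The vector space axioms in the fibres follow from [vb_triv], by transport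
   along the fibrewise bijections xi. *)
Record is_vbundle (r : nat) (M E : space) (v : vb_ops M E) : Prop :=
  IsVbundle {
  vb_base : exists n, is_manifold n M;
  vb_total : exists n, is_manifold n E;
  vb_proj_zero : forall m, vproj v (vzero v m) = m;
  vb_proj_add : forall e e', vproj v e = vproj v e' ->
    vproj v (vadd v e e') = vproj v e;
  vb_proj_scale : forall t e, vproj v (vscale v t e) = vproj v e;
  vb_scale0 : forall e, vscale v 0 e = vzero v (vproj v e);
  vb_triv : forall m, exists c (xi : E -> 'rV[R]_r), dom c m /\ vb_chart v c xi }.

Record vb_mor (M E M' E' : space) (v : vb_ops M E) (v' : vb_ops M' E')
    (F : E -> E') (f : M -> M') : Prop := VbMor {
  vbm_smooth : smooth_map F;
  vbm_smooth_base : smooth_map f;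
  vbm_proj : forall e, vproj v' (F e) = f (vproj v e);
  vbm_add : forall e e', vproj v e = vproj v e' ->
    F (vadd v e e') = vadd v' (F e) (F e');
  vbm_scale : forall t e, F (vscale v t e) = vscale v' t (F e) }.

(* The dual bundle.  An element over m is a linear form on the fibre over m,
   encoded as a function on E vanishing outside that fibre. *)

Definition is_form (M E : Type) (v : vb_ops M E) (x : M * (E -> R)) : Prop :=
  [/\ forall e, vproj v e <> x.1 -> x.2 e = 0,
      forall e e', vproj v e = x.1 -> vproj v e' = x.1 ->
        x.2 (vadd v e e') = x.2 e + x.2 e' &
      forall t e, vproj v e = x.1 -> x.2 (vscale v t e) = t * x.2 e].

Definition lform (M E : Type) (v : vb_ops M E) : Type := {x | is_form v x}.

Definition base (M E : Type) (v : vb_ops M E) (P : lform v) : M := (sval P).1.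
Definition ev (M E : Type) (v : vb_ops M E) (P : lform v) : E -> R := (sval P).2.

Lemma zero_form_subproof (M E : Type) (v : vb_ops M E) (m : M) :
  is_form v (m, fun=> 0).
Proof. by split=> [//|e e' _ _|t e _] /=; rewrite ?addr0 ?mulr0. Qed.

Definition zero_form (M E : Type) (v : vb_ops M E) (m : M) : lform v :=
  exist _ _ (zero_form_subproof v m).

(* the form on the fibre over m which is the restriction of phi, when this
   restriction is linear *)
Definition mkform (M E : Type) (v : vb_ops M E) (m : M) (phi : E -> R) : lform v :=
  clip (zero_form v m) (m, fun e => if `[< vproj v e = m >] then phi e else 0).

(* The coordinates (c, zeta) on the dual bundle, zeta being the components of
   a form in the dual of the local frame defined by xi. *)
Inductive dual_chart (M E : space) (v : vb_ops M E) : chart (lform v) -> Prop :=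
| DualChart (c : chart M) (r : nat) (xi : E -> 'rV[R]_r)
    (zeta : lform v -> 'rV[R]_r) :
    vb_chart v c xi ->
    (forall P e, dom c (base P) -> vproj v e = base P ->
       ev P e = \sum_j zeta P 0 j * xi e 0 j) ->
    dual_chart (Chart (fun P => dom c (base P))
                      (fun P => row_mx (crd c (base P)) (zeta P))).

Definition dual_space (M E : space) (v : vb_ops M E) : space :=
  Space (@dual_chart M E v).

Definition dual_ops (M E : space) (v : vb_ops M E) : vb_ops M (dual_space v) :=
  @VbOps M (dual_space v) (@base M E v) (zero_form v)
    (fun P P' => mkform v (base P) (fun e => ev P e + ev P' e))
    (fun t P => mkform v (base P) (fun e => t * ev P e)).

(* Double vector bundles (D; A, B; M). *)

Record dvb_data := DvbData {
  dvM : space; dvA : space; dvB : space; dvD :> space;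
  opA : vb_ops dvM dvA;
  opB : vb_ops dvM dvB;
  opDA : vb_ops dvA dvD;
  opDB : vb_ops dvB dvD }.

(* The conditions [dv_proj_*], [dv_add_*] and [dv_scale_*] say respectively that
   the projection D -> B, the addition D x_B D -> D and the scalar
   multiplications D -> D of D -> B are linear over q_A : A -> M, over the
   addition A x_M A -> A and over the scalar multiplications of A.  Smoothness
   of these maps follows from the local triviality of the bundles. *)
Record is_dvb (D : dvb_data) : Prop := IsDvb {
  dv_vbA : exists r, is_vbundle r (opA D);
  dv_vbB : exists r, is_vbundle r (opB D);
  dv_vbDA : exists r, is_vbundle r (opDA D);
  dv_vbDB : exists r, is_vbundle r (opDB D);
  dv_square : forall d : D,
    vproj (opA D) (vproj (opDA D) d) = vproj (opB D) (vproj (opDB D) d);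
  dv_proj_add : forall d d' : D, vproj (opDA D) d = vproj (opDA D) d' ->
    vproj (opDB D) (vadd (opDA D) d d') =
    vadd (opB D) (vproj (opDB D) d) (vproj (opDB D) d');
  dv_proj_scale : forall t (d : D),
    vproj (opDB D) (vscale (opDA D) t d) = vscale (opB D) t (vproj (opDB D) d);
  dv_add_proj : forall d d' : D, vproj (opDB D) d = vproj (opDB D) d' ->
    vproj (opDA D) (vadd (opDB D) d d') =
    vadd (opA D) (vproj (opDA D) d) (vproj (opDA D) d');
  dv_add_add : forall d1 d2 d3 d4 : D,
    vproj (opDB D) d1 = vproj (opDB D) d2 ->
    vproj (opDB D) d3 = vproj (opDB D) d4 ->
    vproj (opDA D) d1 = vproj (opDA D) d3 ->
    vproj (opDA D) d2 = vproj (opDA D) d4 ->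
    vadd (opDA D) (vadd (opDB D) d1 d2) (vadd (opDB D) d3 d4) =
    vadd (opDB D) (vadd (opDA D) d1 d3) (vadd (opDA D) d2 d4);
  dv_add_scale : forall t (d d' : D), vproj (opDB D) d = vproj (opDB D) d' ->
    vscale (opDA D) t (vadd (opDB D) d d') =
    vadd (opDB D) (vscale (opDA D) t d) (vscale (opDA D) t d');
  dv_scale_proj : forall t (d : D),
    vproj (opDA D) (vscale (opDB D) t d) = vscale (opA D) t (vproj (opDA D) d);
  dv_scale_add : forall t (d d' : D), vproj (opDA D) d = vproj (opDA D) d' ->
    vscale (opDB D) t (vadd (opDA D) d d') =
    vadd (opDA D) (vscale (opDB D) t d) (vscale (opDB D) t d');
  dv_scale_scale : forall s t (d : D),
    vscale (opDB D) s (vscale (opDA D) t d) =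
    vscale (opDA D) t (vscale (opDB D) s d) }.

Record dvb := Dvb { dvb_of :> dvb_data; dvbP : is_dvb dvb_of }.

Definition flip_data (D : dvb_data) : dvb_data :=
  DvbData (opB D) (opA D) (opDB D) (opDA D).

Lemma is_dvb_flip (D : dvb_data) : is_dvb D -> is_dvb (flip_data D).
Proof.
by case=> hA hB hDA hDB sq pa ps ap aa asc sp sa ss; split=> //= *;
  rewrite ?aa.
Qed.

Definition flip (D : dvb) : dvb := Dvb (is_dvb_flip (dvbP D)).

Definition dvb_mor (D D' : dvb_data) (F : D -> D') (fA : dvA D -> dvA D')
    (fB : dvB D -> dvB D') (fM : dvM D -> dvM D') : Prop :=
  [/\ vb_mor (opDA D) (opDA D') F fA, vb_mor (opDB D) (opDB D') F fB,
      vb_mor (opA D) (opA D') fA fM & vb_mor (opB D) (opB D') fB fM].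

Definition dvb_iso (D D' : dvb_data) (F : D -> D') : Prop :=
  (exists fA fB fM, dvb_mor F fA fB fM) /\
  exists G : D' -> D, [/\ exists fA fB fM, dvb_mor G fA fB fM,
    cancel F G & cancel G F].

(* The core. *)

Definition is_core (D : dvb_data) (d : D) : Prop :=
  let m := vproj (opA D) (vproj (opDA D) d) in
  vproj (opDA D) d = vzero (opA D) m /\ vproj (opDB D) d = vzero (opB D) m.

Definition core (D : dvb_data) : space := subspace (@is_core D).

Lemma is_core_zero (D : dvb) (m : dvM D) :
  is_core (vzero (opDA D) (vzero (opA D) m)).
Proof.
case: (dvbP D) => -[rA hA] [rB hB] [rDA hDA] _ sq _ ps _ _ _ _ _ _.
rewrite /is_core (vb_proj_zero hDA) (vb_proj_zero hA); split=> //.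
have /(congr1 (vproj (opDB D))) :=
  vb_scale0 hDA (vzero (opDA D) (vzero (opA D) m)).
rewrite (vb_proj_zero hDA) ps (vb_scale0 hB) -sq => <-.
by rewrite (vb_proj_zero hDA) (vb_proj_zero hA).
Qed.

Definition core_zero (D : dvb) (m : dvM D) : core D :=
  exist _ _ (is_core_zero m).

(* On the core, the two additions and the two scalar multiplications of D
   agree. *)
Definition core_ops (D : dvb) : vb_ops (dvM D) (core D) :=
  @VbOps (dvM D) (core D)
    (fun c => vproj (opA D) (vproj (opDA D) (sval c)))
    (@core_zero D)
    (fun c c' => clip c (vadd (opDA D) (sval c) (sval c')))
    (fun t c => clip c (vscale (opDA D) t (sval c))).

Definition core_dual (D : dvb) : space := dual_space (core_ops D).

(* The dual over A, a double vector bundle with sides A and C^*.  In the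
   formulas below P, P' are in the dual over A, k is in C^*. *)

(* <proj P, c> = <P, 0_a +_B c> for P over a *)
Definition dA_proj (D : dvb) (P : lform (opDA D)) : core_dual D :=
  mkform (core_ops D) (vproj (opA D) (base P))
    (fun c => ev P (vadd (opDB D) (vzero (opDA D) (base P)) (sval c))).

(* <0_k, 0_b +_A c> = <k, c> for k over m and b over m, where 0_k is over 0_m
   in A; the core element c is d -_A 0_b for d = 0_b +_A c. *)
Definition dA_zero (D : dvb) (k : core_dual D) : lform (opDA D) :=
  mkform (opDA D) (vzero (opA D) (base k))
    (fun d => ev k (clip (core_zero (base k))
       (vadd (opDA D) d
          (vscale (opDA D) (-1) (vzero (opDB D) (vproj (opDB D) d)))))).

(* <P + P', d +_B d'> = <P, d> + <P', d'>; the value does not depend on the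
   decomposition since P and P' have the same projection to C^*. *)
Definition dA_add (D : dvb) (P P' : lform (opDA D)) : lform (opDA D) :=
  mkform (opDA D) (vadd (opA D) (base P) (base P'))
    (fun x => xget 0 [set s | exists d d' : D,
       [/\ vproj (opDA D) d = base P, vproj (opDA D) d' = base P',
           vproj (opDB D) d = vproj (opDB D) d',
           x = vadd (opDB D) d d' & s = ev P d + ev P' d']]).

(* <t . P, t ._B d> = t <P, d> *)
Definition dA_scale (D : dvb) (t : R) (P : lform (opDA D)) : lform (opDA D) :=
  if t == 0 then dA_zero (dA_proj P)
  else mkform (opDA D) (vscale (opA D) t (base P))
         (fun d => t * ev P (vscale (opDB D) t^-1 d)).

Definition dualA (D : dvb) : dvb_data :=
  @DvbData (dvM D) (dvA D) (core_dual D) (dual_space (opDA D))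
    (opA D) (dual_ops (core_ops D)) (dual_ops (opDA D))
    (@VbOps (core_dual D) (dual_space (opDA D))
       (@dA_proj D) (@dA_zero D) (@dA_add D) (@dA_scale D)).

(* Metric double vector bundles (E; Q, B; M): A is Q, and the pairing is on
   the bundle E -> B. *)

Definition metric_map (E : dvb) (g : E -> E -> R) (e : E) : dualA (flip E) :=
  mkform (opDB E) (vproj (opDB E) e) (g e).

Record is_metric (E : dvb) (g : E -> E -> R) : Prop := IsMetric {
  met_add : forall e e1 e2, vproj (opDB E) e = vproj (opDB E) e1 ->
    vproj (opDB E) e = vproj (opDB E) e2 ->
    g e (vadd (opDB E) e1 e2) = g e e1 + g e e2;
  met_scale : forall t e e1, vproj (opDB E) e = vproj (opDB E) e1 ->
    g e (vscale (opDB E) t e1) = t * g e e1;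
  met_sym : forall e e1, vproj (opDB E) e = vproj (opDB E) e1 -> g e e1 = g e1 e;
  met_iso : @dvb_iso (flip E) (dualA (flip E)) (metric_map g) }.

Record mdvb := Mdvb {
  mdvb_dvb :> dvb;
  pairing : mdvb_dvb -> mdvb_dvb -> R;
  mdvbP : is_metric pairing }.

(* The relation dual to w : F^*_P -> E^*_Q over wP : P -> Q, that is the pairs
   (w_p^* e, e) with e over wP(p). *)
Definition dual_rel (F E : mdvb) (w : dualA F -> dualA E)
    (wP : dvA F -> dvA E) : set (F * E) :=
  [set fe | exists p : dvA F,
     [/\ vproj (opDA E) fe.2 = wP p, vproj (opDA F) fe.1 = p &
         forall X : dualA F, base X = p -> ev X fe.1 = ev (w X) fe.2]].

Definition isotropic (F E : mdvb) (O : set (F * E)) : Prop :=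
  forall x y, O x -> O y ->
    vproj (opDB F) x.1 = vproj (opDB F) y.1 ->
    vproj (opDB E) x.2 = vproj (opDB E) y.2 ->
    - pairing x.1 y.1 + pairing x.2 y.2 = 0.

(* A morphism is given by the map w; w and its dual relation determine each
   other. *)
Definition mdvb_mor (F E : mdvb) (w : dualA F -> dualA E) : Prop :=
  exists (wP : dvA F -> dvA E) (wC : core_dual F -> core_dual E)
    (w0 : dvM F -> dvM E),
  @dvb_mor (dualA F) (dualA E) w wP wC w0 /\ isotropic (dual_rel w wP).

Definition MDVB : precat :=
  @Precat mdvb (fun F E => dualA F -> dualA E) mdvb_mor
    (fun F => id) (fun F E G w' w => w' \o w).

(* [2]-manifolds.  [sec U] is the direct sum of the homogeneous components
   [deg U n] of the graded algebra over U, and [fn U] identifies the smooth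
   functions on U with the component of degree 0.  The scalar multiplication by
   a real number is the multiplication by the corresponding constant function,
   so that no separate R-module structure is needed.  (The structure type is
   [pzRingType] as the algebra over the empty set is zero.)  Only open sets U
   matter. *)

Record gsheaf (M : space) := Gsheaf {
  sec : set M -> pzRingType;
  deg : forall U, nat -> set (sec U);
  res : forall U V, sec U -> sec V;
  fn : forall U, (M -> R) -> sec U }.

Arguments sec {M}.
Arguments deg {M} _ U _.
Arguments res {M} _ U V _.
Arguments fn {M} _ U _.

Record is_graded_algebra (M : space) (A : gsheaf M) (U : set M) : Prop :=
  IsGradedAlgebra {
  ga_zero : forall n, deg A U n 0;
  ga_sub : forall n a b, deg A U n a -> deg A U n b -> deg A U n (a - b);
  ga_mul : forall m n a b, deg A U m a -> deg A U n b ->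
    deg A U (m + n)%N (a * b);
  ga_comm : forall m n a b, deg A U m a -> deg A U n b ->
    a * b = (-1) ^+ (m * n)%N * (b * a);
  ga_sum : forall a, exists N (c : nat -> sec A U),
    (forall n, deg A U n (c n)) /\ a = \sum_(n < N) c n;
  ga_direct : forall N (c : nat -> sec A U), (forall n, deg A U n (c n)) ->
    \sum_(n < N) c n = 0 -> forall n, (n < N)%N -> c n = 0;
  ga_fn_deg : forall f, smooth_on U f -> deg A U 0 (fn A U f);
  ga_fn_surj : forall a, deg A U 0 a -> exists2 f, smooth_on U f & a = fn A U f;
  ga_fn_inj : forall f g, smooth_on U f -> smooth_on U g ->
    (fn A U f = fn A U g <-> forall x, U x -> f x = g x);
  ga_fn_one : fn A U (fun=> 1) = 1;
  ga_fn_add : forall f g, smooth_on U f -> smooth_on U g ->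
    fn A U (fun x => f x + g x) = fn A U f + fn A U g;
  ga_fn_mul : forall f g, smooth_on U f -> smooth_on U g ->
    fn A U (fun x => f x * g x) = fn A U f * fn A U g }.

(* Each homogeneous component is a sheaf (the direct sum need not be one). *)
Record is_sheaf (M : space) (A : gsheaf M) : Prop := IsSheaf {
  sh_res_morph : forall U V, opn U -> opn V -> V `<=` U ->
    zmod_morphism (res A U V) /\ monoid_morphism (res A U V);
  sh_res_deg : forall U V n a, opn U -> opn V -> V `<=` U ->
    deg A U n a -> deg A V n (res A U V a);
  sh_res_fn : forall U V f, opn U -> opn V -> V `<=` U -> smooth_on U f ->
    res A U V (fn A U f) = fn A V f;
  sh_res_id : forall U a, opn U -> res A U U a = a;
  sh_res_comp : forall U V W a, opn U -> opn V -> opn W ->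
    W `<=` V -> V `<=` U -> res A V W (res A U V a) = res A U W a;
  sh_glue : forall n (F : set (set M)) (s : forall V, sec A V),
    (forall V, F V -> opn V /\ deg A V n (s V)) ->
    (forall V W, F V -> F W ->
       res A V (V `&` W) (s V) = res A W (V `&` W) (s W)) ->
    exists! a : sec A (\bigcup_(V in F) V),
      deg A _ n a /\ forall V, F V -> res A _ V a = s V }.

(* exponents of monomials in r1 generators of degree 1, which square to zero,
   and r2 generators of degree 2 *)
Definition expo (r1 r2 n : nat) : finType :=
  ({set 'I_r1} * {ffun 'I_r2 -> 'I_n.+1})%type.

Definition expo_deg (r1 r2 n : nat) (k : expo r1 r2 n) : nat :=
  (#|k.1| + 2 * \sum_j k.2 j)%N.

Definition lincomb (M : space) (A : gsheaf M) (V : set M) (r1 r2 n : nat)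
    (xi : 'I_r1 -> sec A V) (eta : 'I_r2 -> sec A V)
    (f : expo r1 r2 n -> M -> R) : sec A V :=
  \sum_(k | expo_deg k == n)
    fn A V (f k) * (\prod_(i | i \in k.1) xi i * \prod_j eta j ^+ k.2 j).

Definition is_free_on (M : space) (A : gsheaf M) (U : set M) (r1 r2 : nat) : Prop :=
  exists (xi : 'I_r1 -> sec A U) (eta : 'I_r2 -> sec A U),
  [/\ forall i, deg A U 1 (xi i), forall j, deg A U 2 (eta j) &
      forall V n, opn V -> V `<=` U ->
        let L := @lincomb M A V r1 r2 n
                   (fun i => res A U V (xi i)) (fun j => res A U V (eta j)) in
        (forall a, deg A V n a ->
           exists2 f, forall k, smooth_on V (f k) & a = L f) /\
        (forall f g, (forall k, smooth_on V (f k)) ->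
           (forall k, smooth_on V (g k)) -> L f = L g ->
           forall k x, expo_deg k = n -> V x -> f k x = g k x)].

Record man2 := Man2 {
  body :> space;
  fns : gsheaf body;
  man2_manifold : exists p, is_manifold p body;
  man2_graded : forall U, opn U -> is_graded_algebra fns U;
  man2_sheaf : is_sheaf fns;
  man2_free : exists r1 r2, forall x : body, exists U,
    [/\ opn U, U x & is_free_on fns U r1 r2] }.

(* A morphism is a (continuous) map mu0 with a family of maps mu^*, indexed by
   the open subsets of the target. *)

Record cmap (X Y : space) := Cmap { cfun :> X -> Y; cfunP : cont_map cfun }.
Arguments cfunP {X Y} c [V] _.

Definition cmap_id (X : space) : cmap X X :=
  @Cmap X X id (fun V h => h).

Definition cmap_comp (X Y Z : space) (g : cmap Y Z) (f : cmap X Y) : cmap X Z :=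
  @Cmap X Z (g \o f) (fun V h => cfunP f (cfunP g h)).

Record man2_arr (M N : man2) := Man2Arr {
  mor0 :> cmap M N;
  pull : forall V : set N, opn V ->
    sec (fns N) V -> sec (fns M) (mor0 @^-1` V) }.

Record man2_mor (M N : man2) (mu : man2_arr M N) : Prop := Man2Mor {
  mm_smooth : smooth_map mu;
  mm_morph : forall V (h : opn V),
    zmod_morphism (pull mu h) /\ monoid_morphism (pull mu h);
  mm_deg : forall V (h : opn V) n a, deg (fns N) V n a ->
    deg (fns M) _ n (pull mu h a);
  mm_res : forall V W (h : opn V) (h' : opn W) a, W `<=` V ->
    pull mu h' (res (fns N) V W a) =
    res (fns M) (mu @^-1` V) (mu @^-1` W) (pull mu h a);
  mm_fn : forall V (h : opn V) f, smooth_on V f ->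
    pull mu h (fn (fns N) V f) = fn (fns M) (mu @^-1` V) (f \o mu) }.

Definition man2_id (M : man2) : man2_arr M M :=
  @Man2Arr M M (cmap_id M) (fun V _ a => a).

Definition man2_comp (M N P : man2) (nu : man2_arr N P) (mu : man2_arr M N) :
    man2_arr M P :=
  @Man2Arr M P (cmap_comp nu mu)
    (fun V h a => pull mu (cfunP nu h) (pull nu h a)).

Definition TwoMan : precat :=
  @Precat man2 man2_arr man2_mor man2_id man2_comp.

End Manifolds.

(* Main.v *)
(* Both categories are fully faithfully and essentially surjectively related to a third one, of "frames".
   An object is a manifold M with ranks r1, r2 and a family of local frames, that is of elements
   (a, b, w) with a, b invertible and w = (w_j) skew, given relatively to a set-theoretic reference
   frame at each point and such that the changes of frame are smooth.  A morphism is a smooth map f with,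
   at each x, a triple (a, b, w) which is smooth in local frames.
   On one side, a metric double vector bundle E has local Lagrangian coordinates, in which the pairing is
   the canonical one; a morphism w : F^*_P -> E^*_Q reads (q, u, v) |-> (q a, u b + w(q, v), v a'), and
   the isotropy of its dual relation says exactly that a' = a and that w is skew in (q, v).
   On the other side, (a, b, w) is the substitution xi_j |-> sum a_ij xi_i,
   eta_j |-> sum b_ij eta_i + sum (w_j)_il xi_i xi_l of free generators of degrees 1 and 2, the general
   form of a morphism of graded algebras in local coordinates.  Sections of the structure sheaf are
   functions of a point of M and of a superpoint in the reference frame. *)

From HB Require Import structures.
From mathcomp Require Import all_boot all_order all_algebra.
From mathcomp Require Import all_classical all_reals all_analysis.
Require Import Defs.
From mathcomp Require Import reals.

Set Implicit Arguments.
Unset Strict Implicit.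
Unset Printing Implicit Defensive.

Import Order.TTheory GRing.Theory Num.Theory.
Import numFieldNormedType.Exports.

Local Open Scope classical_set_scope.
Local Open Scope ring_scope.

(** * Smooth functions and manifolds *)

(** The axioms of a double vector bundle provide charts of [D -> A] and of [D -> B] separately;
    charts adapted to both structures have to be produced. A chart of [D -> B] near the zeros of [B]
    yields a core coordinate that is linear over [B] only. Its derivative at [0] along the scaling
    of [D -> A] is linear over both structures and keeps its values on the core, and this suffices.
    Frames are chosen at every point without any coherence, and smoothness is required only of
    composites in which the choices cancel; a morphism is then plain pointwise data. On the side of
    functions no quotient algebra is formed: polynomials in odd and even generators are evaluated at
    points with values in one fixed operator algebra, so that substitution is an action on points
    and pull-back is precomposition. The factor 1/2 enters twice: a symmetric term of the metric is
    divided evenly between its two arguments, and a coefficient of [xi_i xi_l] between the entries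
    [(i, l)] and [(l, i)], which makes the skew matrix unique. *)

Section Calculus.
Variable R : realType.

Section Cont.
Variables (T : topologicalType) (x : T).
Implicit Types f g : T -> R.

Lemma contD f g : {for x, continuous f} -> {for x, continuous g} ->
  {for x, continuous (fun x => f x + g x)}.
Proof. by move=> cf cg; apply: (@cvgD _ _ _ (nbhs x)). Qed.

Lemma contM f g : {for x, continuous f} -> {for x, continuous g} ->
  {for x, continuous (fun x => f x * g x)}.
Proof. by move=> cf cg; apply: (@cvgM _ _ (nbhs x)). Qed.

Lemma contV f : f x != 0 -> {for x, continuous f} -> {for x, continuous (fun x => (f x)^-1)}.
Proof. by move=> f0 cf; apply: (@cvgV _ _ (nbhs x)). Qed.

Lemma cont_sumZ (V : normedModType R) (I : Type) (r : seq I) (P : pred I) (f : I -> T -> R) (v : I -> V) :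
  (forall i, {for x, continuous (f i)}) ->
  {for x, continuous (fun x => \sum_(i <- r | P i) f i x *: v i)}.
Proof.
move=> H; elim: r => [|i r IH].
  rewrite (_ : (fun _ => _) = fun=> 0); first exact: cst_continuous.
  by apply/funext => y; rewrite big_nil.
case Pi : (P i); last first.
  by rewrite (_ : (fun _ => _) = fun x => \sum_(i <- r | P i) f i x *: v i) //;
    apply/funext => y; rewrite big_cons Pi.
rewrite (_ : (fun _ => _) = fun y => f i y *: v i + \sum_(i <- r | P i) f i y *: v i);
  last by apply/funext => y; rewrite big_cons Pi.
by apply: (@cvgD _ _ _ (nbhs x)) => //; apply: (@cvgZr_tmp _ _ _ (nbhs x)); exact: H.
Qed.

Lemma cont_row m (f : 'I_m -> T -> R) : (forall i, {for x, continuous (f i)}) ->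
  {for x, continuous (fun x => \row_i f i x)}.
Proof.
move=> H; rewrite (_ : (fun _ => _) = fun x => \sum_i f i x *: (delta_mx 0 i : 'rV[R]_m)).
  exact: cont_sumZ.
apply/funext => y; rewrite [LHS]row_sum_delta.
by apply: eq_bigr => j _; rewrite mxE.
Qed.

End Cont.

Lemma derivable_line n (f : 'rV[R]_n -> R) (y v : 'rV[R]_n) (t : R) :
  derivable f (t *: v + y) v ->
  is_derive t 1 (fun s : R => f (s *: v + y)) ('D_v f (t *: v + y)).
Proof.
have E (h : R) : (f (h *: v + (t *: v + y)) - f (t *: v + y)) =
    ((fun s => f (s *: v + y)) (h *: 1 + t) - (fun s => f (s *: v + y)) t).
  by rewrite /= addrA -scalerDl scaler1.
move=> H; apply: DeriveDef.
  rewrite /derivable; move: H; rewrite /derivable.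
  by under eq_fun do rewrite /= E.
by rewrite /derive; under eq_fun do rewrite /= -E.
Qed.

(** The mean value theorem on the segment from [y] to [b *: v + y]. Both signs of [b] are covered
    because [b] will be a coordinate of an arbitrary increment. *)
Lemma line_MVT n (f : 'rV[R]_n -> R) (y v : 'rV[R]_n) (b : R) :
  (forall t, `|t| <= `|b| -> derivable f (t *: v + y) v) ->
  exists2 c, `|c| <= `|b| & f (b *: v + y) - f y = b * 'D_v f (c *: v + y).
Proof.
move=> H.
have D (t : R) : `|t| <= `|b| ->
    is_derive t 1 (fun s : R => f (s *: v + y)) ('D_v f (t *: v + y)).
  by move=> tb; apply: derivable_line; apply: H.
have C (t : R) : `|t| <= `|b| -> {for t, continuous (fun s : R => f (s *: v + y))}.
  move=> tb; apply: differentiable_continuous; apply/derivable1_diffP.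
  by apply: ex_derive; apply: D.
have [b0|b0] := leP 0 b.
  have [//|t||c] := @MVT_segment _ (fun s : R => f (s *: v + y))
     (fun t => 'D_v f (t *: v + y)) 0 b _.
  - rewrite in_itv /= => /andP[t0 tb]; apply: D.
    by rewrite ger0_norm ?ger0_norm// ltW.
  - apply: continuous_in_subspaceT => t; rewrite inE /= in_itv /= => /andP[t0 tb].
    by apply: C; rewrite ger0_norm ?ger0_norm.
  rewrite in_itv /= => /andP[c0 cb]; rewrite scale0r add0r subr0 => ->.
  by exists c; rewrite ?(mulrC b)// !ger0_norm.
have [|t||c] := @MVT_segment _ (fun s : R => f (s *: v + y))
     (fun t => 'D_v f (t *: v + y)) b 0 _.
- exact: ltW.
- rewrite in_itv /= => /andP[t0 tb]; apply: D.
  by rewrite ltr0_norm// ltr0_norm// lerN2 ltW.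
- apply: continuous_in_subspaceT => t; rewrite inE /= in_itv /= => /andP[t0 tb].
  by apply: C; rewrite ler0_norm ?ltr0_norm// lerN2.
rewrite in_itv /= => /andP[c0 cb]; rewrite scale0r add0r sub0r => E.
exists c; first by rewrite ler0_norm ?ltr0_norm// lerN2.
by rewrite -opprB E mulrN opprK mulrC.
Qed.

Lemma sum_linear n (a : 'I_n -> R) :
  linear (fun v : 'rV[R]_n => \sum_i v 0 i * a i : R).
Proof.
move=> k u v; rewrite scaler_sumr -big_split; apply: eq_bigr => i _ /=.
by rewrite !mxE mulrDl -mulrA.
Qed.

Lemma coord_norm n (h : 'rV[R]_n) j : `|h 0 j| <= `|h|.
Proof.
rewrite [leRHS]/Num.Def.normr /= mx_normrE.
by apply: (le_bigmax _ (fun ij => `|h ij.1 ij.2|) (0, j)).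
Qed.

(** The increment is telescoped through the points that share their first [k] coordinates with [h].
    The mean value theorem turns each step into a partial derivative taken near [x], which
    continuity compares with the one at [x]. *)
Lemma C1_differentiable n (f : 'rV[R]_n -> R) (x : 'rV[R]_n) :
  (forall i, \forall y \near x, derivable f y (delta_mx 0 i)) ->
  (forall i, {for x, continuous (fun y => 'D_(delta_mx 0 i) f y)}) ->
  differentiable f x.
Proof.
move=> Hd Hc.
pose a (i : 'I_n) := 'D_(delta_mx 0 i) f x.
pose F := fun v : 'rV[R]_n => \sum_i v 0 i * a i : R.
pose dF : {linear 'rV[R]_n -> R} :=
  HB.pack F (GRing.isLinear.Build R 'rV[R]_n R *:%R F (sum_linear a)).
have cF : continuous dF.
  by move=> v; apply: (@cont_sumZ _ _ R^o) => i; exact: coord_continuous.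
have key : f \o shift x = cst (f x) + dF +o_ (0 : 'rV[R]_n) id.
  apply/eqaddoP => e e0.
  (* The tolerance is shared among [n] steps; the divisor [n + 1] also covers [n = 0]. *)
  have n0 : 0 < n%:R + 1 :> R by rewrite ltr_wpDl.
  have e1 : 0 < e / (n%:R + 1) by rewrite divr_gt0.
  have : \forall y \near x, forall i, derivable f y (delta_mx 0 i) /\
     `|a i - 'D_(delta_mx 0 i) f y| < e / (n%:R + 1).
    apply: (@filter_forall _ _ _ (nbhs x)) => i; apply: filterI; first exact: Hd.
    by have /cvgrPdist_lt := Hc i; apply.
  move=> /nbhs_ballP [d /= d0 hd].
  near=> h.
  have hh : `|h| < d.
    by near: h; apply/nbhs_ballP; exists d => // z; rewrite -ball_normE /ball_ /= sub0r normrN.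
  pose hk (k : nat) : 'rV[R]_n := \row_j (if (j < k)%N then h 0 j else 0).
  have hkS (k : 'I_n) : hk k.+1 = h 0 k *: delta_mx 0 k + hk k.
    apply/rowP => j; rewrite !mxE ltnS leq_eqVlt eqxx /=.
    have [->|jk] := eqVneq j k; first by rewrite eqxx ltnn mulr1 addr0.
    by rewrite (negbTE (_ : val j != val k)) // mulr0 add0r.
  (* Between two consecutive points every coordinate stays bounded by that of [h], so the whole
     segment remains in the ball. *)
  have hb (k : 'I_n) t : `|t| <= `|h 0 k| -> ball x d (t *: delta_mx 0 k + (hk k + x)).
    move=> tb; rewrite -ball_normE /ball_ /= addrA opprD addrCA subrr addr0 normrN.
    apply: le_lt_trans hh; rewrite /Num.Def.normr /= mx_normrE.
    apply: bigmax_le => [|[i j] _ /=]; first exact: (normr_ge0 h).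
    rewrite !mxE ord1 eqxx /=.
    apply: (@le_trans _ _ `|h 0 j|); last exact: coord_norm.
    have [->|jk] := eqVneq j k; first by rewrite ltnn mulr1 addr0.
    by rewrite mulr0 add0r; case: ifP => // _; rewrite normr0.
  have step (k : 'I_n) : `|f (hk k.+1 + x) - f (hk k + x) - h 0 k * a k| <=
      e / (n%:R + 1) * `|h|.
    have [t tb|c cb E] := @line_MVT n f (hk k + x) (delta_mx 0 k) (h 0 k).
      by have [] := hd _ (hb _ _ tb) k.
    have -> : hk k.+1 + x = h 0 k *: delta_mx 0 k + (hk k + x) by rewrite hkS addrA.
    rewrite E -mulrBr normrM mulrC.
    apply: ler_pM => //.
      by rewrite distrC; apply: ltW; have [_] := hd _ (hb _ _ cb) k.
    exact: coord_norm.
  have tele : f (h + x) - f x = \sum_(k < n) (f (hk k.+1 + x) - f (hk k + x)).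
    rewrite -(big_mkord xpredT (fun k => f (hk k.+1 + x) - f (hk k + x))).
    rewrite telescope_sumr//; congr (f (_ + x) - _).
      by apply/rowP => j; rewrite mxE ltn_ord.
    by congr f; rewrite (_ : hk 0%N = 0) ?add0r//; apply/rowP => j; rewrite !mxE ltn0.
  rewrite /= !fctE /= opprD addrA tele /F -sumrB.
  apply: (le_trans (ler_norm_sum _ _ _)).
  apply: (@le_trans _ _ (\sum_(k < n) (e / (n%:R + 1) * `|h|))).
    by apply: ler_sum => k _; exact: step.
  rewrite -mulr_suml (_ : \sum_(i < n) (e / (n%:R + 1)) = n%:R * (e / (n%:R + 1))); last by rewrite sumr_const card_ord mulr_natl.
  rewrite ler_wpM2r// mulrCA ger_pMr//.
  by rewrite ler_pdivrMr// mul1r lerDl.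
apply/diff_locallyP; rewrite (diff_unique cF key); split => //.
Unshelve. all: by end_near. Qed.

Lemma diffE_partial n (f : 'rV[R]_n -> R) (x v : 'rV[R]_n) : differentiable f x ->
  'D_v f x = \sum_i v 0 i * 'D_(delta_mx 0 i) f x.
Proof.
move=> df; rewrite deriveE// {1}(row_sum_delta v) linear_sum; apply: eq_bigr => i _.
by rewrite linearZ deriveE.
Qed.

Lemma rowE_sum n m (f : 'I_m -> 'rV[R]_n -> R) :
  (fun x => \row_j f j x) = \sum_j (fun x => f j x *: (delta_mx 0 j : 'rV[R]_m)).
Proof.
apply/funext => x; rewrite fct_sumE [LHS]row_sum_delta.
by apply: eq_bigr => j _; rewrite mxE.
Qed.

Lemma differentiable_row n m (f : 'I_m -> 'rV[R]_n -> R) x :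
  (forall j, differentiable (f j) x) -> differentiable (fun x => \row_j f j x) x.
Proof.
move=> H; rewrite rowE_sum; apply: differentiable_sum => j.
exact: differentiableZl.
Qed.

Lemma chain_rule n m (g : 'rV[R]_m -> R) (f : 'I_m -> 'rV[R]_n -> R) x v :
  (forall j, differentiable (f j) x) -> differentiable g (\row_j f j x) ->
  derivable (fun x => g (\row_j f j x)) x v /\
  'D_v (fun x => g (\row_j f j x)) x =
    \sum_j 'D_v (f j) x * 'D_(delta_mx 0 j) g (\row_j f j x).
Proof.
move=> df dg; have dF := differentiable_row df.
have dgF : differentiable (g \o (fun x => \row_j f j x)) x by exact: differentiable_comp.
split; first exact: diff_derivable.
rewrite (_ : (fun _ => _) = g \o (fun x => \row_j f j x))// deriveE// diff_comp//=.
rewrite -(deriveE v dF) derive_mx; last exact: diff_derivable.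
rewrite -(deriveE _ dg) diffE_partial//; apply: eq_bigr => j _; rewrite mxE; congr (_ * _).
by congr ('D_v _ x); apply/funext => y; rewrite mxE.
Qed.

Implicit Types (n m k : nat).

Lemma Ck_sub n k (U V : set 'rV[R]_n) f : V `<=` U -> Ck k U f -> Ck k V f.
Proof.
move=> VU; elim: k f => [|k IH] f /= [cf df]; split=> //; try by move=> x /VU; exact: cf.
move=> i; have [d1 d2] := df i; split; first by move=> x /VU; exact: d1.
exact: IH.
Qed.

Lemma Ck_cont n k (U : set 'rV[R]_n) f : Ck k U f -> forall x, U x -> {for x, continuous f}.
Proof. by case: k => [|k] /= []. Qed.

Lemma Ck_le n k (U : set 'rV[R]_n) f : Ck k.+1 U f -> Ck k U f.
Proof.
elim: k f => [|k IH] f /= [cf df]; split=> // i; have [d1 d2] := df i; split=> //.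
exact: IH.
Qed.

(** The clauses of [Ck] are statements about globally defined functions at the points of the set, so
    they can be collected from arbitrary sets [V]. *)
Lemma Ck_loc n k (U : set 'rV[R]_n) f :
  (forall x, U x -> exists V, V x /\ Ck k V f) -> Ck k U f.
Proof.
elim: k f => [|k IH] f H /=; split=> //; try by move=> x /H [V [Vx [c _]]]; exact: c.
move=> i; split; first by move=> x /H [V [Vx [_ /(_ i) [d _]]]]; exact: d.
by apply: IH => x /H [V [Vx [_ /(_ i) [_ d]]]]; exists V.
Qed.

(** On an open set, equality of functions is equality near each point, and continuity and
    derivatives depend on nothing more. *)
Lemma Ck_eq n k (U : set 'rV[R]_n) f g : open U -> (forall x, U x -> f x = g x) ->
  Ck k U f -> Ck k U g.
Proof.
move=> oU; have E (h l : 'rV[R]_n -> R) x : (forall x, U x -> h x = l x) -> U x ->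
    \forall y \near x, h y = l y.
  by move=> hl Ux; apply: filterS hl _; exact: open_nbhs_nbhs.
have C (h l : 'rV[R]_n -> R) x : (forall x, U x -> h x = l x) -> U x ->
    {for x, continuous h} -> {for x, continuous l}.
  move=> hl Ux ch; rewrite /prop_for /continuous_at -(hl x Ux).
  by apply: cvg_trans ch; apply: (@near_eq_cvg _ _ (nbhs x)); exact: E hl Ux.
elim: k f g => [|k IH] f g fg [cf df].
  by split=> // x Ux; apply: (C f g x fg Ux); exact: cf.
split=> [x Ux|i]; first by apply: (C f g x fg Ux); exact: cf.
have [d1 d2] := df i; split=> [x Ux|].
  by apply: (near_eq_derivable (E _ _ _ fg Ux)); exact: d1.
by apply: IH d2 => x Ux; apply: near_eq_derive; exact: E fg Ux.
Qed.

Lemma Ck_cst n k (U : set 'rV[R]_n) (a : R) : Ck k U (fun=> a).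
Proof.
elim: k a => [|k IH] a; first by split=> // x _; exact: cst_continuous.
split; first by move=> x _; exact: cst_continuous.
move=> i; split=> [x _|]; first exact: derivable_cst.
by under eq_fun do rewrite derive_cst; exact: IH.
Qed.

Lemma Ck_coord n k (U : set 'rV[R]_n) (j : 'I_n) : Ck k U (fun x => x 0 j).
Proof.
have dif (x : 'rV[R]_n) : differentiable (fun x : 'rV[R]_n => x 0 j : R) x.
  exact: differentiable_coord.
case: k => [|k]; first by split=> // x _; exact: coord_continuous.
split; first by move=> x _; exact: coord_continuous.
move=> i; split=> [x _|]; first exact: diff_derivable.
have -> : (fun x => 'D_(delta_mx 0 i) (fun x : 'rV[R]_n => x 0 j : R) x) =
    fun=> (delta_mx 0 i : 'rV[R]_n) 0 j.
  apply/funext => x.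
  have := @derive_mx R 'rV[R]_n 1 n id x (delta_mx 0 i) (@derivable_id _ _ _ _).
  rewrite (@derive_id R 'rV[R]_n) => E.
  by rewrite [in RHS]E mxE.
exact: Ck_cst.
Qed.

Lemma CkD n k (U : set 'rV[R]_n) f g : open U -> Ck k U f -> Ck k U g ->
  Ck k U (fun x => f x + g x).
Proof.
move=> oU; elim: k f g => [|k IH] f g [cf df] [cg dg].
  by split=> // x Ux; apply: contD; [exact: cf|exact: cg].
split; first by move=> x Ux; apply: contD; [exact: cf|exact: cg].
move=> i; have [f1 f2] := df i; have [g1 g2] := dg i; split=> [x Ux|].
  by apply: derivableD; [exact: f1|exact: g1].
apply: Ck_eq oU _ (IH _ _ f2 g2) => x Ux /=.
by rewrite -deriveD//; [exact: f1|exact: g1].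
Qed.

Lemma CkM n k (U : set 'rV[R]_n) f g : open U -> Ck k U f -> Ck k U g ->
  Ck k U (fun x => f x * g x).
Proof.
move=> oU; elim: k f g => [|k IH] f g hf hg.
  by split=> // x Ux; apply: contM; [exact: (Ck_cont hf)|exact: (Ck_cont hg)].
have hf' := Ck_le hf; have hg' := Ck_le hg.
case: hf hg => cf df [cg dg].
split; first by move=> x Ux; apply: contM; [exact: cf|exact: cg].
move=> i; have [f1 f2] := df i; have [g1 g2] := dg i; split=> [x Ux|].
  by apply: derivableM; [exact: f1|exact: g1].
apply: (Ck_eq (f := fun x => f x * 'D_(delta_mx 0 i) g x + g x * 'D_(delta_mx 0 i) f x)) => //.
  by move=> x Ux /=; rewrite deriveM//; [exact: f1|exact: g1].
by apply: CkD => //; apply: IH.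
Qed.

Lemma Ck_sum n k (U : set 'rV[R]_n) (I : Type) (r : seq I) (P : pred I) f : open U ->
  (forall i, P i -> Ck k U (f i)) -> Ck k U (fun x => \sum_(i <- r | P i) f i x).
Proof.
move=> oU H; elim: r => [|i r IH].
  by under eq_fun do rewrite big_nil; exact: Ck_cst.
under eq_fun do rewrite big_cons; case Pi : (P i) => //.
by apply: CkD => //; exact: H.
Qed.

Lemma Ck_diff n k (U : set 'rV[R]_n) f x : open U -> Ck k.+1 U f -> U x ->
  differentiable f x.
Proof.
move=> oU [_ df] Ux; apply: C1_differentiable => i.
  have [d _] := df i; have := @open_nbhs_nbhs _ x U (conj oU Ux).
  by apply: filterS => y Uy; exact: d.
by have [_ d] := df i; exact: (Ck_cont d).
Qed.

(** Induction on [k]: by the chain rule a partial derivative of the composite is a sum of products,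
    one factor of which is again a composite, with a partial derivative of [g]. *)
Lemma Ck_comp n m k (U : set 'rV[R]_n) (V : set 'rV[R]_m) g (f : 'I_m -> 'rV[R]_n -> R) :
  open U -> open V -> (forall x, U x -> V (\row_j f j x)) ->
  Ck k V g -> (forall j, Ck k U (f j)) -> Ck k U (fun x => g (\row_j f j x)).
Proof.
move=> oU oV UV; elim: k g f UV => [|k IH] g f UV hg hf.
  split=> // x Ux; apply: (@continuous_comp _ _ _ (fun x => \row_j f j x) g).
    by apply: cont_row => j; exact: (Ck_cont (hf j)).
  by apply: Ck_cont hg _ _; exact: UV.
split=> [x Ux|i].
  apply: (@continuous_comp _ _ _ (fun x => \row_j f j x) g).
    by apply: cont_row => j; exact: (Ck_cont (hf j)).
  by apply: Ck_cont hg _ _; exact: UV.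
have df x : U x -> forall j, differentiable (f j) x by move=> Ux j; apply: Ck_diff (hf j) _.
have dg x : U x -> differentiable g (\row_j f j x).
  by move=> Ux; apply: Ck_diff hg _ => //; exact: UV.
split=> [x Ux|]; first by have [] := chain_rule (delta_mx 0 i) (df x Ux) (dg x Ux).
apply: (Ck_eq (f := fun x => \sum_j 'D_(delta_mx 0 i) (f j) x *
    (fun x => 'D_(delta_mx 0 j) g (\row_j f j x)) x)) => //.
  by move=> x Ux; have [_ ->] := chain_rule (delta_mx 0 i) (df x Ux) (dg x Ux).
apply: Ck_sum => // j _; apply: CkM => //; first by have [_ /(_ i) []] := hf j.
apply: (IH (fun y => 'D_(delta_mx 0 j) g y) f) => //; last by move=> l; exact: Ck_le.
by have [_ /(_ j) []] := hg.
Qed.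

Lemma CkV n k (U : set 'rV[R]_n) f : open U -> (forall x, U x -> f x != 0) ->
  Ck k U f -> Ck k U (fun x => (f x)^-1).
Proof.
move=> oU f0; elim: k => [|k IH] hf.
  by split=> // x Ux; apply: contV; [exact: f0|exact: (Ck_cont hf)].
have hf' := Ck_le hf; case: hf => cf df.
split; first by move=> x Ux; apply: contV; [exact: f0|exact: cf].
move=> i; have [f1 f2] := df i; split=> [x Ux|].
  by apply: derivableV; [exact: f0|exact: f1].
apply: (Ck_eq (f := fun x => (-1) * (((f x)^-1 * (f x)^-1) * 'D_(delta_mx 0 i) f x))) => //.
  move=> x Ux /=; rewrite deriveV ?f0//; last exact: f1.
  by rewrite mulN1r scaleNr expr2 invfM.
by apply: CkM => //; [exact: Ck_cst|apply: CkM => //; apply: CkM => //; exact: IH].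
Qed.

End Calculus.

Arguments atlas {R} _ _.
Arguments crd {R T} _ _.
Arguments dom {R T} _ _.

(** * Germs of smooth functions on Euclidean spaces *)

Section SmoothGerms.
Variable R : realType.
Implicit Types n m k : nat.

(** Smoothness as a property of the germ at [x]. Since the clauses of [Cinfty] are pointwise, the
    open [U] is what makes this a statement about a neighbourhood. *)
Definition sm n (f : 'rV[R]_n -> R) (x : 'rV[R]_n) : Prop :=
  exists U, [/\ open U, U x & Cinfty U f].

Definition smv n m (F : 'rV[R]_n -> 'rV[R]_m) (x : 'rV[R]_n) : Prop :=
  forall j, sm (fun y => F y 0 j) x.

Lemma nbhs_open n (x : 'rV[R]_n) A : nbhs x A -> exists U, [/\ open U, U x & U `<=` A].
Proof.
move=> xA; exists (interior A); split; [exact: open_interior|exact: xA|].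
exact: interior_subset.
Qed.

Lemma sm_near n (f : 'rV[R]_n -> R) x : sm f x -> \forall y \near x, sm f y.
Proof.
move=> [U [oU Ux hU]]; have /filterS := @open_nbhs_nbhs _ x U (conj oU Ux); apply.
by move=> y Uy; exists U.
Qed.

Lemma smP n (U : set 'rV[R]_n) f : open U -> Cinfty U f <-> forall x, U x -> sm f x.
Proof.
move=> oU; split=> [h x Ux|h k]; first by exists U.
by apply: Ck_loc => x /h [V [_ Vx hV]]; exists V.
Qed.

Lemma Cinfty_sm n (U : set 'rV[R]_n) f x : open U -> Cinfty U f -> U x -> sm f x.
Proof. by move=> oU h Ux; exists U. Qed.

Lemma sm_Cinfty n (U : set 'rV[R]_n) f : open U -> (forall x, U x -> sm f x) -> Cinfty U f.
Proof. by move=> oU /(smP _ oU). Qed.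

Lemma sm_cont n (f : 'rV[R]_n -> R) x : sm f x -> {for x, continuous f}.
Proof. by move=> [U [_ Ux /(_ 0%N) hU]]; exact: Ck_cont hU x Ux. Qed.

Lemma sm_eq n (f g : 'rV[R]_n -> R) x : (\forall y \near x, f y = g y) -> sm f x -> sm g x.
Proof.
move=> /nbhs_open [V [oV Vx VA]] [U [oU Ux hU]]; exists (U `&` V).
split=> // [|k]; first exact: openI.
apply: (Ck_eq (f := f)); first exact: openI.
  by move=> y [_ /VA].
by apply: Ck_sub (hU k) => y [].
Qed.

Lemma sm_ext n (f g : 'rV[R]_n -> R) x : (forall y, f y = g y) -> sm f x -> sm g x.
Proof. by move=> /funext ->. Qed.

Lemma sm_cst n (a : R) x : sm (fun _ : 'rV[R]_n => a) x.
Proof. by exists setT; split=> // [|k]; [exact: openT|exact: Ck_cst]. Qed.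

Lemma sm_coord n (j : 'I_n) x : sm (fun y : 'rV[R]_n => y 0 j) x.
Proof. by exists setT; split=> // [|k]; [exact: openT|exact: Ck_coord]. Qed.

Lemma smv_id n x : smv (@id 'rV[R]_n) x.
Proof. by move=> j; exact: sm_coord. Qed.

Lemma sm2 n (f g h : 'rV[R]_n -> R) x :
  (forall U k, open U -> Ck k U f -> Ck k U g -> Ck k U h) -> sm f x -> sm g x -> sm h x.
Proof.
move=> H [U [oU Ux hU]] [V [oV Vx hV]]; exists (U `&` V); split=> // [|k].
  exact: openI.
by apply: H; [exact: openI|apply: Ck_sub (hU k) => y []|apply: Ck_sub (hV k) => y []].
Qed.

Lemma smD n (f g : 'rV[R]_n -> R) x : sm f x -> sm g x -> sm (fun y => f y + g y) x.
Proof. by apply: sm2 => U k; exact: CkD. Qed.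

Lemma smM n (f g : 'rV[R]_n -> R) x : sm f x -> sm g x -> sm (fun y => f y * g y) x.
Proof. by apply: sm2 => U k; exact: CkM. Qed.

Lemma smV n (f : 'rV[R]_n -> R) x : f x != 0 -> sm f x -> sm (fun y => (f y)^-1) x.
Proof.
move=> f0 hf; have cf := sm_cont hf; have /nbhs_open [V [oV Vx V0]] : \forall y \near x, f y != 0.
  by apply: (cf [set z : R | z != 0]); apply: open_nbhs_nbhs; split=> //; exact: open_neq.
case: hf => U [oU Ux hU]; exists (U `&` V); split=> // [|k]; first exact: openI.
by apply: CkV => [|y [_ /V0]//|]; [exact: openI|apply: Ck_sub (hU k) => y []].
Qed.

Lemma smv_cont n m (F : 'rV[R]_n -> 'rV[R]_m) x : smv F x -> {for x, continuous F}.
Proof.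
move=> hF; rewrite (_ : F = fun y => \row_j F y 0 j); last first.
  by apply/funext => y; apply/rowP => j; rewrite mxE.
by apply: cont_row => j; exact: sm_cont.
Qed.

Lemma sm_comp n m (g : 'rV[R]_m -> R) (F : 'rV[R]_n -> 'rV[R]_m) x :
  sm g (F x) -> smv F x -> sm (fun y => g (F y)) x.
Proof.
move=> [V [oV VF hV]] hF.
have /nbhs_open [U [oU Ux UA]] : \forall y \near x, V (F y) /\ forall j, sm (fun y => F y 0 j) y.
  apply: filterI; first by apply: (smv_cont hF); exact: open_nbhs_nbhs.
  by apply: (@filter_forall _ _ _ (nbhs x)) => j; exact: sm_near.
exists U; split=> // k.
rewrite (_ : (fun _ => _) = fun y => g (\row_j (fun j y => F y 0 j) j y)); last first.
  by apply/funext => y; congr g; apply/rowP => j; rewrite mxE.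
apply: (Ck_comp oU oV _ (hV k)) => [y Uy|j].
  by rewrite (_ : \row_j _ = F y); [have [] := UA _ Uy|apply/rowP => j; rewrite mxE].
by apply: sm_Cinfty => // y Uy; have [_] := UA _ Uy; apply.
Qed.

Lemma smv_comp n m p (G : 'rV[R]_m -> 'rV[R]_p) (F : 'rV[R]_n -> 'rV[R]_m) x :
  smv G (F x) -> smv F x -> smv (fun y => G (F y)) x.
Proof. by move=> hG hF j; apply: (sm_comp (hG j)). Qed.

Lemma sm_partial n (f : 'rV[R]_n -> R) x i : sm f x -> sm (fun y => 'D_(delta_mx 0 i) f y) x.
Proof. by move=> [U [oU Ux hU]]; exists U; split=> // k; have [_ /(_ i) []] := hU k.+1. Qed.

Lemma sm_diff n (f : 'rV[R]_n -> R) x : sm f x -> differentiable f x.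
Proof. by move=> [U [oU Ux hU]]; exact: Ck_diff (hU 1%N) _. Qed.

End SmoothGerms.

(** * Neighbourhoods, smooth functions and maps on spaces with an atlas *)

Section SmoothSpaces.
Variable R : realType.

(** The part of the manifold axioms on which calculus in charts rests. Cores and dual bundles are
    shown to satisfy exactly this much. *)
Definition pman (X : space R) : Prop :=
  (forall x : X, exists2 c, atlas X c & dom c x) /\ (forall c, atlas X c -> mchart c).

(** The neighbourhood filter of the topology defined by [opn]; a [space] carries no
    [topologicalType] structure. *)
Definition nearx (X : space R) (x : X) (A : set X) : Prop :=
  exists U, [/\ opn U, U x & U `<=` A].

Lemma manifold_pman n (X : space R) : is_manifold n X -> pman X.
Proof. by case=> h1 h2 _ _; split=> // c /h2 []. Qed.

Lemma mchart_inj (X : space R) (c : chart R X) x y : mchart c -> dom c x -> dom c y ->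
  crd c x = crd c y -> x = y.
Proof. by move=> [h _] cx cy; apply: h; exact/mem_set. Qed.

Section Space.
Variables (X : space R) (hX : pman X).
Implicit Types (c d e : chart R X) (x y : X) (U V A B : set X).

Lemma opnI U V : opn U -> opn V -> opn (U `&` V).
Proof.
move=> oU oV c hc; have [_ /(_ c hc) mc] := hX.
rewrite (_ : _ @` _ = (crd c @` (U `&` dom c)) `&` (crd c @` (V `&` dom c))).
  by apply: openI; [exact: oU|exact: oV].
apply/seteqP; split=> [_ [x [[Ux Vx] cx] <-]|v [[x [Ux cx] <-] [y [Vy cy] xy]]].
  by split; exists x.
by exists x => //; split=> //; split=> //; rewrite (mchart_inj mc cx cy).
Qed.

Lemma opnT : opn (setT : set X).
Proof.
move=> c hc; have [_ /(_ c hc) [_ /(_ c hc)]] := hX.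
by rewrite /compat setIid setTI => -[[]].
Qed.

Lemma opn_bigcup (I : Type) (D : set I) (F : I -> set X) :
  (forall i, D i -> opn (F i)) -> opn (\bigcup_(i in D) F i).
Proof.
move=> H c hc; rewrite (_ : _ @` _ = \bigcup_(i in D) (crd c @` (F i `&` dom c))).
  by apply: bigcup_open => i Di; exact: H.
apply/seteqP; split=> [_ [x [[i Di Fx] cx] <-]|v [i Di [x [Fx cx] <-]]].
  by exists i => //; exists x.
by exists x => //; split=> //; exists i.
Qed.

Lemma nearx_sub x A B : A `<=` B -> nearx x A -> nearx x B.
Proof. by move=> AB [U [oU Ux UA]]; exists U; split=> // y /UA /AB. Qed.

Lemma nearxI x A B : nearx x A -> nearx x B -> nearx x (A `&` B).
Proof.
move=> [U [oU Ux UA]] [V [oV Vx VB]]; exists (U `&` V); split=> //; first exact: opnI.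
by move=> y [/UA ? /VB ?].
Qed.

Lemma nearx2 x A B C : nearx x A -> nearx x B -> (forall y, A y -> B y -> C y) -> nearx x C.
Proof. by move=> hA hB h; apply: nearx_sub (nearxI hA hB) => y []; exact: h. Qed.

Lemma nearx_self x A : nearx x A -> A x.
Proof. by move=> [U [_ Ux]]; apply. Qed.

Lemma nearx_near x A : nearx x A -> nearx x (fun y => nearx y A).
Proof. by move=> [U [oU Ux UA]]; exists U; split=> // y Uy; exists U. Qed.

Lemma nearx_open U x : opn U -> U x -> nearx x U.
Proof. by exists U; split. Qed.

Lemma nearxT x : nearx x setT.
Proof. by exists setT; split=> //; exact: opnT. Qed.

Lemma nearx_true x A : (forall y, A y) -> nearx x A.
Proof. by move=> h; apply: nearx_sub (nearxT x) => y. Qed.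

Lemma nearx_all (I : finType) x (A : I -> set X) :
  (forall i, nearx x (A i)) -> nearx x (fun y => forall i, A i y).
Proof.
move=> H; suff: nearx x (fun y => forall i, i \in enum I -> A i y).
  by apply: nearx_sub => y hy i; apply: hy; rewrite mem_enum.
elim: (enum I) => [|i r IH]; first by apply: nearx_true.
apply: nearx2 (H i) IH _ => y Ai hr j; rewrite inE => /predU1P [->//|]; exact: hr.
Qed.

Lemma opnP U : opn U <-> forall x, U x -> nearx x U.
Proof.
split=> [oU x Ux|H]; first exact: nearx_open.
rewrite (_ : U = \bigcup_(V in [set V | opn V /\ V `<=` U]) V).
  by apply: opn_bigcup => V [].
apply/seteqP; split=> [x /H [V [oV Vx VU]]|x [V [_ VU] /VU]//]; by exists V.
Qed.

(** [mchart] compares a chart with those of the atlas only. Two charts of the maximal atlas are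
    compared through an atlas chart around [x], and [O] is where both transitions can be
    composed. *)
Lemma mchart_trans c d x : mchart c -> mchart d -> dom c x -> dom d x ->
  exists tau O, [/\ open O, O (crd c x),
    (forall v, O v -> exists2 y, dom c y & crd c y = v),
    (forall v, O v -> smv tau v) &
    forall y, dom c y -> O (crd c y) -> dom d y /\ crd d y = tau (crd c y)].
Proof.
move=> mc md cx dx; have [/(_ x) [e ae ex] hm] := hX.
have me := hm _ ae.
have [[oO1 [t1 [s1 E1]]] _] := mc.2 _ ae.
have [_ [oO2 [t2 [s2 E2]]]] := md.2 _ ae.
have sm1 v : (crd c @` (dom c `&` dom e)) v -> smv t1 v.
  by move=> hv j; exact: Cinfty_sm oO1 (s1 j) hv.
have sm2 v : (crd e @` (dom e `&` dom d)) v -> smv t2 v.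
  by move=> hv j; exact: Cinfty_sm oO2 (s2 j) hv.
have c1 : (crd c @` (dom c `&` dom e)) (crd c x) by exists x.
have /nbhs_open [ O [oO Ox OA]] : \forall v \near crd c x,
    (crd c @` (dom c `&` dom e)) v /\ (crd e @` (dom e `&` dom d)) (t1 v).
  apply: filterI; first exact: open_nbhs_nbhs.
  apply: (smv_cont (sm1 _ c1)); rewrite -E1//; apply: open_nbhs_nbhs; split=> //.
  by exists x.
have key y : dom c y -> O (crd c y) -> dom d y /\ crd d y = t2 (t1 (crd c y)).
  move=> cy /OA [[z [cz ez] zy] [w [ew dw] wE]].
  have ? := mchart_inj mc cz cy zy; subst z.
  have ? : w = y by apply: (mchart_inj me) => //; rewrite wE -E1.
  by subst w; rewrite -E1//; split=> //; exact: E2.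
exists (fun v => t2 (t1 v)), O; split=> //.
- by move=> v /OA [[y [cy _] <-] _]; exists y.
- by move=> v /OA [h1 h2]; apply: smv_comp; [exact: sm2|exact: sm1].
Qed.

Lemma mchart_opn c (O : set 'rV[R]_(cdim c)) : mchart c -> open O ->
  opn [set y | dom c y /\ O (crd c y)].
Proof.
move=> mc oO d ad; have [_ /(_ d ad) md] := hX.
have [_ [oI [tau [s E]]]] := mc.2 _ ad.
rewrite openE => v [x [[cx Ox] dx] <-].
have I1 : (crd d @` (dom d `&` dom c)) (crd d x) by exists x.
have smt : smv tau (crd d x) by move=> j; exact: Cinfty_sm oI (s j) I1.
have : \forall w \near crd d x, (crd d @` (dom d `&` dom c)) w /\ O (tau w).
  apply: filterI; first exact: open_nbhs_nbhs.
  by apply: (smv_cont smt); rewrite -E//; exact: open_nbhs_nbhs.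
apply: filterS => w [[y [dy cy] <-]]; rewrite -E// => Oy; by exists y.
Qed.

Lemma mchart_dom c : mchart c -> opn (dom c).
Proof.
move=> mc; have := @mchart_opn c setT mc openT; congr opn.
by apply/seteqP; split=> y // [].
Qed.

(** [opn] is tested in the charts of the atlas; this transfers neighbourhoods to open sets in the
    image of any chart of the maximal atlas, which is how all local arguments proceed. *)
Lemma nearx_chart c x A : mchart c -> dom c x -> nearx x A <->
  exists O, [/\ open O, O (crd c x), (forall v, O v -> exists2 y, dom c y & crd c y = v) &
     forall y, dom c y -> O (crd c y) -> A y].
Proof.
move=> mc cx; split=> [[U [oU Ux UA]]|[ O [oO Ox _ OA]]]; last first.
  by exists [set y | dom c y /\ O (crd c y)]; split=> // [|y []//]; [exact: mchart_opn|exact: OA].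
have [/(_ x) [e ae ex] hm] := hX; have me := hm _ ae.
have [tau [ O [oO Ox Osurj Osm OE]]] := mchart_trans mc me cx ex.
have /nbhs_open [ O' [oO' O'x O'A]] : \forall v \near crd c x,
    O v /\ (crd e @` (U `&` dom e)) (tau v).
  apply: filterI; first exact: open_nbhs_nbhs.
  apply: (smv_cont (Osm _ Ox)); have [_ <-] := OE _ cx Ox.
  by apply: open_nbhs_nbhs; split; [exact: oU|exists x].
exists O'; split=> //; first by move=> v /O'A [/Osurj].
move=> y cy /O'A [Oy [z [Uz ez]]]; have [ey <-] := OE _ cy Oy => zy.
by apply: UA; rewrite -(mchart_inj me ez ey zy).
Qed.

Lemma mchart_nearx c x : mchart c -> dom c x -> nearx x (dom c).
Proof. by move=> mc cx; apply: nearx_open => //; exact: mchart_dom. Qed.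

Lemma mchart_image c U : mchart c -> opn U -> open (crd c @` (U `&` dom c)).
Proof.
move=> mc oU; rewrite openE => _ [x [Ux cx] <-].
have /(nearx_chart _ mc cx) [ O [oO Ox Os OA]] : nearx x (U `&` dom c).
  by apply: nearx_open => //; apply: opnI => //; exact: mchart_dom.
have /filterS := @open_nbhs_nbhs _ _ O (conj oO Ox); apply => v /[dup] Ov /Os [y cy vE].
by exists y => //; apply: OA => //; rewrite vE.
Qed.

(** The expression of [f] in a chart. For an injective chart at most one value qualifies; outside
    the image the expression is [0]. *)
Definition chread c (f : X -> R) (v : 'rV[R]_(cdim c)) : R :=
  xget 0 [set r | exists2 y, dom c y & crd c y = v /\ r = f y].

Lemma chreadE c f y : mchart c -> dom c y -> chread f (crd c y) = f y.
Proof.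
move=> mc cy; rewrite /chread; case: xgetP => [r _ [z cz [zy ->]]|/(_ (f y)) []]; last by exists y.
by rewrite (mchart_inj mc cz cy).
Qed.

(** One chart around [x] is asked for; by [smx_chart] any other chart of the maximal atlas gives the
    same notion. *)
Definition smx (f : X -> R) x : Prop :=
  exists c, [/\ mchart c, dom c x & sm (@chread c f) (crd c x)].

Lemma smx_chart c f x : mchart c -> dom c x -> smx f x <-> sm (@chread c f) (crd c x).
Proof.
move=> mc cx; split=> [[d [md dx hs]]|]; last by exists c.
have [tau [ O [oO Ox Os Osm OE]]] := mchart_trans mc md cx dx.
apply: (@sm_eq _ _ (fun v => @chread d f (tau v))).
  have /filterS := @open_nbhs_nbhs _ _ O (conj oO Ox); apply => v /[dup] Ov /Os [y cy vE].
  by subst v; have [dy <-] := OE _ cy Ov; rewrite !chreadE.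
by apply: sm_comp; [have [_ <-] := OE _ cx Ox|exact: Osm].
Qed.

Lemma smxI c f x g : mchart c -> dom c x -> sm g (crd c x) ->
  nearx x (fun y => f y = g (crd c y)) -> smx f x.
Proof.
move=> mc cx hg /(nearx_chart _ mc cx) [ O [oO Ox Os OE]]; apply/(smx_chart _ mc cx).
apply: (sm_eq _ hg).
have /filterS := @open_nbhs_nbhs _ _ O (conj oO Ox); apply => v /[dup] Ov /Os [y cy vE].
by subst v; rewrite chreadE// OE.
Qed.

Lemma smx_read c f x : mchart c -> dom c x -> smx f x -> exists2 g, sm g (crd c x) &
  forall y, dom c y -> f y = g (crd c y).
Proof.
move=> mc cx /(smx_chart _ mc cx) h; exists (@chread c f) => // y cy.
by rewrite chreadE.
Qed.

Lemma pman_chart x : exists2 c, mchart c & dom c x.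
Proof. by have [/(_ x) [c ac cx] hm] := hX; exists c => //; exact: hm. Qed.

Lemma smx_near f x : smx f x -> nearx x (smx f).
Proof.
move=> /[dup] [[c [mc cx _]]] /(smx_chart _ mc cx) /sm_near /nbhs_open [ O [oO Ox OA]].
exists [set y | dom c y /\ O (crd c y)]; split=> //; first exact: mchart_opn.
by move=> y [cy /OA h]; apply/(smx_chart _ mc cy).
Qed.

Lemma smx_eq f g x : nearx x (fun y => f y = g y) -> smx f x -> smx g x.
Proof.
move=> fg [c [mc cx hs]]; apply: (smxI mc cx hs).
apply: nearx2 fg (mchart_nearx mc cx) _ => y E cy.
by rewrite chreadE.
Qed.

Lemma smx_ext f g x : (forall y, f y = g y) -> smx f x -> smx g x.
Proof. by move=> fg; apply: smx_eq; exact: nearx_true. Qed.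

Lemma smx_crd c x j : mchart c -> dom c x -> smx (fun y => crd c y 0 j) x.
Proof. by move=> mc cx; apply: (smxI mc cx (sm_coord j _)); exact: nearx_true. Qed.

Lemma smx_comp m (g : 'rV[R]_m -> R) (F : X -> 'rV[R]_m) x :
  sm g (F x) -> (forall j, smx (fun y => F y 0 j) x) -> smx (fun y => g (F y)) x.
Proof.
move=> hg hF; have [c mc cx] := pman_chart x.
pose G v := \row_j @chread c (fun y => F y 0 j) v.
have GE y : dom c y -> G (crd c y) = F y.
  by move=> cy; apply/rowP => j; rewrite mxE chreadE.
apply: (@smxI c _ x (fun v => g (G v))) => //; last first.
  by apply: nearx_sub (mchart_nearx mc cx) => y cy; rewrite GE.
apply: sm_comp; first by rewrite GE.
move=> j; apply: (@sm_ext _ _ (@chread c (fun y => F y 0 j))) => [v|]; first by rewrite mxE.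
exact/smx_chart.
Qed.

Lemma smx_open m (F : X -> 'rV[R]_m) x (O : set 'rV[R]_m) : open O -> O (F x) ->
  (forall j, smx (fun y => F y 0 j) x) -> nearx x (fun y => O (F y)).
Proof.
move=> oO Ox hF; have [c mc cx] := pman_chart x.
pose G v := \row_j @chread c (fun y => F y 0 j) v.
have GE y : dom c y -> G (crd c y) = F y.
  by move=> cy; apply/rowP => j; rewrite mxE chreadE.
have sG : smv G (crd c x).
  move=> j; apply: (@sm_ext _ _ (@chread c (fun y => F y 0 j))) => [v|]; first by rewrite mxE.
  exact/smx_chart.
have /nbhs_open [V [oV Vx VA]] : \forall v \near crd c x, O (G v).
  by apply: (smv_cont sG); rewrite GE//; exact: open_nbhs_nbhs.
exists [set y | dom c y /\ V (crd c y)]; split=> //; first exact: mchart_opn.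
by move=> y [cy /VA]; rewrite GE.
Qed.

Lemma smx_cst (a : R) x : smx (fun=> a) x.
Proof.
have [c mc cx] := pman_chart x; apply: (smxI mc cx (sm_cst a _)); exact: nearx_true.
Qed.

Lemma smx_op2 (h : R -> R -> R) f g x :
  (forall n (f g : 'rV[R]_n -> R) v, sm f v -> sm g v -> sm (fun w => h (f w) (g w)) v) ->
  smx f x -> smx g x -> smx (fun y => h (f y) (g y)) x.
Proof.
move=> H hf hg; have [c mc cx] := pman_chart x.
apply: (smxI mc cx (H _ _ _ _ ((smx_chart _ mc cx).1 hf) ((smx_chart _ mc cx).1 hg))).
by apply: nearx_sub (mchart_nearx mc cx) => y cy; rewrite !chreadE.
Qed.

Lemma smxD f g x : smx f x -> smx g x -> smx (fun y => f y + g y) x.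
Proof. by apply: (@smx_op2 +%R) => *; exact: smD. Qed.

Lemma smxM f g x : smx f x -> smx g x -> smx (fun y => f y * g y) x.
Proof. by apply: (@smx_op2 *%R) => *; exact: smM. Qed.

Lemma smxN f x : smx f x -> smx (fun y => - f y) x.
Proof.
move=> h; apply: (smx_ext _ (smxM (smx_cst (-1) x) h)) => y; exact: mulN1r.
Qed.

Lemma smxB f g x : smx f x -> smx g x -> smx (fun y => f y - g y) x.
Proof. by move=> hf hg; apply: smxD => //; exact: smxN. Qed.

Lemma smxV f x : f x != 0 -> smx f x -> smx (fun y => (f y)^-1) x.
Proof.
move=> f0 h; have [c mc cx] := pman_chart x.
have f0' : @chread c f (crd c x) != 0 by rewrite chreadE.
apply: (smxI mc cx (smV f0' ((smx_chart _ mc cx).1 h))).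
by apply: nearx_sub (mchart_nearx mc cx) => y cy; rewrite !chreadE.
Qed.

Lemma smx_sum (I : Type) (r : seq I) (P : pred I) (f : I -> X -> R) x :
  (forall i, P i -> smx (f i) x) -> smx (fun y => \sum_(i <- r | P i) f i y) x.
Proof.
move=> H; elim: r => [|i r IH].
  by apply: (smx_ext _ (smx_cst 0 x)) => y; rewrite big_nil.
case Pi : (P i); last by apply: (smx_ext _ IH) => y; rewrite big_cons Pi.
by apply: (smx_ext _ (smxD (H i Pi) IH)) => y; rewrite big_cons Pi.
Qed.

Lemma smx_prod (I : Type) (r : seq I) (P : pred I) (f : I -> X -> R) x :
  (forall i, P i -> smx (f i) x) -> smx (fun y => \prod_(i <- r | P i) f i y) x.
Proof.
move=> H; elim: r => [|i r IH].
  by apply: (smx_ext _ (smx_cst 1 x)) => y; rewrite big_nil.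
case Pi : (P i); last by apply: (smx_ext _ IH) => y; rewrite big_cons Pi.
by apply: (smx_ext _ (smxM (H i Pi) IH)) => y; rewrite big_cons Pi.
Qed.

Lemma smooth_onP U f : opn U -> smooth_on U f <-> forall x, U x -> smx f x.
Proof.
move=> oU; split=> [H x Ux|H c ac].
  have [/(_ x) [c ac cx] hm] := hX; have mc := hm _ ac; have [g sg gE] := H c ac.
  have sg' : sm g (crd c x).
    by apply: Cinfty_sm (oU _ ac) sg _; exists x.
  apply: (smxI mc cx sg'); apply: nearx2 (nearx_open oU Ux) (mchart_nearx mc cx) _.
  by move=> y; exact: gE.
have [_ hm] := hX; have mc := hm _ ac; exists (@chread c f); last first.
  by move=> x Ux cx; rewrite chreadE.
apply: sm_Cinfty => [|_ [x [Ux cx] <-]]; first exact: oU.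
by apply/smx_chart => //; exact: H.
Qed.

(** This takes the place of the inverse function theorem: the third hypothesis supplies a smooth
    local inverse [phi], read in a known chart [e], and at the same time shows that the image of
    [crd c] contains the open set [O]. *)
Lemma mchartI c : {in dom c &, injective (crd c)} ->
  (forall x, dom c x -> nearx x (dom c) /\ forall j, smx (fun y => crd c y 0 j) x) ->
  (forall x, dom c x -> exists e phi O, [/\ mchart e, dom e x, open O, O (crd c x) &
     smv phi (crd c x) /\ forall v, O v -> exists y, [/\ dom c y, crd c y = v, dom e y & crd e y = phi v]]) ->
  mchart c.
Proof.
move=> inj hs hi; split=> // d ad; have [_ /(_ _ ad) md] := hX.
have inj' x y : dom c x -> dom c y -> crd c x = crd c y -> x = y.
  by move=> cx cy; apply: inj; exact/mem_set.
have opc : opn (dom c) by apply/opnP => x /hs [].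
pose rd j v := xget 0 [set r | exists y, [/\ dom c y, crd c y = v & r = crd d y 0 j]].
have rdE j y : dom c y -> rd j (crd c y) = crd d y 0 j.
  move=> cy; rewrite /rd; case: xgetP => [r _ [z [cz zy ->]]|/(_ (crd d y 0 j)) []]; last by exists y.
  by rewrite (inj' _ _ cz cy).
have loc x : dom c x -> dom d x -> exists e phi O, [/\ open O, O (crd c x), smv phi (crd c x) &
    exists tau, smv tau (phi (crd c x)) /\
    forall v, O v -> exists y, [/\ dom c y, crd c y = v, dom d y & crd d y = tau (phi v : 'rV_(cdim (e : chart R X)))]].
  move=> cx dx; have [e [phi [ O [me ex oO Ox [sphi OE]]]]] := hi x cx.
  have [tau [ O' [oO' O'x _ Osm O'E]]] := mchart_trans me md ex dx.
  have pE : phi (crd c x) = crd e x.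
    by have [y [cy yE ey <-]] := OE _ Ox; rewrite (inj' _ _ cy cx).
  have /nbhs_open [W [oW Wx WA]] : \forall v \near crd c x, O v /\ O' (phi v).
    apply: filterI; first exact: open_nbhs_nbhs.
    by apply: (smv_cont sphi); rewrite pE; exact: open_nbhs_nbhs.
  exists e, phi, W; split=> //; exists tau; split; first by rewrite pE; exact: Osm.
  move=> v /WA [/OE [y [cy yE ey ye]] O'v]; rewrite -ye in O'v *.
  by have [dy dE] := O'E _ ey O'v; exists y.
have op1 : open (crd c @` (dom c `&` dom d)).
  rewrite openE => _ [x [cx dx] <-].
  have [e [phi [ O [oO Ox sphi [tau [st OE]]]]]] := loc x cx dx.
  have /filterS := @open_nbhs_nbhs _ _ O (conj oO Ox); apply => v /OE [y [cy yE dy _]].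
  by exists y.
split; split=> //.
- exists (fun v => \row_j rd j v); split; last first.
    by move=> x cx dx; apply/rowP => j; rewrite mxE rdE.
  move=> j; apply: sm_Cinfty => // _ [x [cx dx] <-].
  have [e [phi [ O [oO Ox sphi [tau [st OE]]]]]] := loc x cx dx.
  apply: (@sm_eq _ _ (fun v => tau (phi v) 0 j)).
    have /filterS := @open_nbhs_nbhs _ _ O (conj oO Ox); apply => v /OE [y [cy yE dy <-]].
    by rewrite mxE -yE rdE.
  exact: smv_comp.
- by rewrite setIC; exact: mchart_image.
- exists (fun v => \row_j @chread d (fun y => crd c y 0 j) v); split; last first.
    by move=> x dx cx; apply/rowP => j; rewrite mxE chreadE.
  move=> j; apply: sm_Cinfty => [|_ [x [dx cx] <-]]; first by rewrite setIC; exact: mchart_image.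
  apply: (@sm_ext _ _ (@chread d (fun y => crd c y 0 j))) => [v|]; first by rewrite mxE.
  by apply/smx_chart => //; have [] := hs _ cx.
Qed.

Lemma mchart_reparam c m (phi : 'rV[R]_(cdim c) -> 'rV[R]_m) psi : mchart c ->
  (forall v, smv phi v) -> (forall v, smv psi v) -> cancel phi psi -> cancel psi phi ->
  mchart (Chart (dom c) (fun x => phi (crd c x))).
Proof.
move=> mc sp sq K K'; apply: mchartI => /=.
- by move=> x y /set_mem cx /set_mem cy /(can_inj K); exact: mchart_inj.
- move=> x cx; split=> [|j]; first exact: mchart_nearx.
  by apply: (smx_comp (g := fun v => phi v 0 j)) => [|l]; [exact: sp|exact: smx_crd].
- move=> x cx; have [ O [oO Ox Os _]] := (nearx_chart (dom c) mc cx).1 (mchart_nearx mc cx).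
  have /nbhs_open [W [oW Wx WA]] : \forall v \near phi (crd c x), O (psi v).
    by apply: (smv_cont (sq _)); rewrite K; exact: open_nbhs_nbhs.
  exists c, psi, W; split=> //; split=> // v /WA /Os [y cy yE].
  by exists y; rewrite yE.
Qed.

Lemma mchart_restr c U : mchart c -> opn U -> mchart (Chart (dom c `&` U) (crd c)).
Proof.
move=> mc oU; apply: mchartI => /=.
- by move=> x y /set_mem [cx _] /set_mem [cy _]; exact: mchart_inj.
- move=> x [cx Ux]; split=> [|j]; last exact: smx_crd.
  by apply: nearxI; [exact: mchart_nearx|exact: nearx_open].
- move=> x [cx Ux]; have := nearxI (mchart_nearx mc cx) (nearx_open oU Ux).
  move=> /(nearx_chart _ mc cx) [ O [oO Ox Os OA]].
  exists c, id, O; split=> //; split; first exact: smv_id.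
  by move=> v /[dup] Ov /Os [y cy yE]; exists y; split=> //; apply: OA => //; rewrite yE.
Qed.

End Space.

Section Maps.
Variables (X Y : space R) (hX : pman X) (hY : pman Y).

Lemma smooth_map_smx (F : X -> Y) f x : smooth_map F -> smx f (F x) -> smx (fun y => f (F y)) x.
Proof.
move=> [cF sF] hf; have [/(_ (F x)) [d ad dx] hm] := hY; have md := hm _ ad.
have oF : opn (F @^-1` dom d) by apply: cF; apply: mchart_dom.
apply: (smx_eq hX (f := fun y => @chread _ d f (crd d (F y)))).
  by apply: nearx_sub (nearx_open oF dx) => y dy; rewrite chreadE.
apply: smx_comp => //; first exact/(smx_chart hY).
by move=> j; have /(smooth_onP hX _ oF) := sF d ad j; apply.
Qed.

Lemma smooth_map_near (F : X -> Y) x A : smooth_map F -> nearx (F x) A -> nearx x (F @^-1` A).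
Proof.
by move=> [cF _] [U [oU Ux UA]]; exists (F @^-1` U); split=> // [|y /UA//]; exact: cF.
Qed.

Lemma smooth_mapI (F : X -> Y) :
  (forall x, exists d, [/\ mchart d, dom d (F x), nearx x (F @^-1` dom d) &
     forall j, smx (fun y => crd d (F y) 0 j) x]) -> smooth_map F.
Proof.
move=> H; have near x A : nearx (F x) A -> nearx x (F @^-1` A).
  have [d [md dx nF sF]] := H x.
  move=> /(nearx_chart hY _ md dx) [ O [oO Ox _ OA]].
  apply: (nearx2 hX nF (smx_open hX oO Ox sF)) => y dy Oy; exact: OA.
have cF : cont_map F.
  by move=> V oV; apply/opnP => x Vx; apply: near; exact: nearx_open.
split=> // d ad j; have [_ /(_ _ ad) md] := hY.
have od : opn (F @^-1` dom d) by apply: cF; exact: mchart_dom.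
apply/(smooth_onP hX _ od) => x dx.
have [e [me ex nF sF]] := H x.
have [g sg gE] := smx_read hY me ex (smx_crd hY j md dx).
apply: (smx_eq hX (f := fun y => g (crd e (F y)))); last exact: smx_comp.
by apply: nearx_sub nF => y ey; rewrite gE.
Qed.

Lemma smooth_map_crd (F : X -> Y) d x j : smooth_map F -> mchart d -> dom d (F x) ->
  smx (fun y => crd d (F y) 0 j) x.
Proof.
by move=> sF md dx; apply: (smooth_map_smx (f := fun z => crd d z 0 j)) => //; exact: smx_crd.
Qed.

End Maps.

Lemma smooth_map_id (X : space R) : pman X -> smooth_map (@id X).
Proof.
move=> hX; apply: smooth_mapI => // x; have [c mc cx] := pman_chart hX x.
by exists c; split=> // [|j]; [exact: mchart_nearx|exact: smx_crd].
Qed.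

Lemma smooth_map_comp (X Y Z : space R) (G : Y -> Z) (F : X -> Y) :
  pman X -> pman Y -> pman Z -> smooth_map G -> smooth_map F -> smooth_map (G \o F).
Proof.
move=> hX hY hZ sG sF; apply: smooth_mapI => // x.
have [d md dx] := pman_chart hZ (G (F x)); exists d; split=> //.
  apply: (smooth_map_near (A := G @^-1` dom d) sF).
  by apply: smooth_map_near => //; exact: mchart_nearx.
move=> j; apply: (smooth_map_smx hX hY (f := fun y => crd d (G y) 0 j) sF).
exact: (smooth_map_crd hY hZ).
Qed.

End SmoothSpaces.

(** * Smooth matrix-valued functions *)

Section SmoothMatrices.
Variables (R : realType) (X : space R) (hX : pman X).
Implicit Types (x : X).

Definition smm m n (F : X -> 'M[R]_(m, n)) x := forall i j, smx (fun y => F y i j) x.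

Lemma smm_eq m n (F G : X -> 'M[R]_(m, n)) x : nearx x (fun y => F y = G y) -> smm F x -> smm G x.
Proof. by move=> E h i j; apply: smx_eq (h i j) => //; apply: nearx_sub E => y ->. Qed.

Lemma smm_ext m n (F G : X -> 'M[R]_(m, n)) x : (forall y, F y = G y) -> smm F x -> smm G x.
Proof. by move=> /funext ->. Qed.

Lemma smm_cst m n (A : 'M[R]_(m, n)) x : smm (fun=> A) x.
Proof. by move=> i j; exact: smx_cst. Qed.

Lemma smm_rV n (F : X -> 'rV[R]_n) x : smm F x <-> forall j, smx (fun y => F y 0 j) x.
Proof. by split=> [h j|h i j]; [exact: h|rewrite ord1; exact: h]. Qed.

Lemma smm_mul m n p (F : X -> 'M[R]_(m, n)) (G : X -> 'M[R]_(n, p)) x :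
  smm F x -> smm G x -> smm (fun y => F y *m G y) x.
Proof.
move=> hF hG i j; apply: (smx_ext hX (f := fun y => \sum_l F y i l * G y l j)).
  by move=> y; rewrite mxE.
by apply: smx_sum => // l _; apply: smxM.
Qed.

Lemma smmD m n (F G : X -> 'M[R]_(m, n)) x : smm F x -> smm G x -> smm (fun y => F y + G y) x.
Proof.
move=> hF hG i j; apply: (smx_ext hX (f := fun y => F y i j + G y i j)).
  by move=> y; rewrite mxE.
exact: smxD.
Qed.

Lemma smmZ m n (f : X -> R) (F : X -> 'M[R]_(m, n)) x :
  smx f x -> smm F x -> smm (fun y => f y *: F y) x.
Proof.
move=> hF hG i j; apply: (smx_ext hX (f := fun y => f y * F y i j)).
  by move=> y; rewrite mxE.
exact: smxM.
Qed.

Lemma smm_sum m n (I : Type) (r : seq I) (P : pred I) (F : I -> X -> 'M[R]_(m, n)) x :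
  (forall i, P i -> smm (F i) x) -> smm (fun y => \sum_(i <- r | P i) F i y) x.
Proof.
move=> H i j; apply: (smx_ext hX (f := fun y => \sum_(l <- r | P l) F l y i j)).
  by move=> y; rewrite summxE.
by apply: smx_sum => // l Pl; apply: H.
Qed.

Lemma smmB m n (F G : X -> 'M[R]_(m, n)) x : smm F x -> smm G x -> smm (fun y => F y - G y) x.
Proof.
move=> hF hG i j; apply: (smx_ext hX (f := fun y => F y i j - G y i j)).
  by move=> y; rewrite !mxE.
exact: smxB.
Qed.

Lemma smm_tr m n (F : X -> 'M[R]_(m, n)) x : smm F x -> smm (fun y => (F y)^T) x.
Proof. by move=> h i j; apply: smx_ext (h j i) => // y; rewrite mxE. Qed.

Lemma smm_row_mx m n p (F : X -> 'M[R]_(m, n)) (G : X -> 'M[R]_(m, p)) x :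
  smm F x -> smm G x -> smm (fun y => row_mx (F y) (G y)) x.
Proof.
move=> hF hG i j; case: (split_ordP j) => l ->.
  by apply: smx_ext (hF i l) => // y; rewrite row_mxEl.
by apply: smx_ext (hG i l) => // y; rewrite row_mxEr.
Qed.

Lemma smm_rowl m n p (F : X -> 'M[R]_(m, n)) (G : X -> 'M[R]_(m, p)) x :
  smm (fun y => row_mx (F y) (G y)) x -> smm F x.
Proof. by move=> h i j; apply: smx_ext (h i (lshift p j)) => // y; rewrite row_mxEl. Qed.

Lemma smm_rowr m n p (F : X -> 'M[R]_(m, n)) (G : X -> 'M[R]_(m, p)) x :
  smm (fun y => row_mx (F y) (G y)) x -> smm G x.
Proof. by move=> h i j; apply: smx_ext (h i (rshift n j)) => // y; rewrite row_mxEr. Qed.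

Lemma smx_neq0 (f : X -> R) x : smx f x -> f x != 0 -> nearx x (fun y => f y != 0).
Proof.
move=> hf f0.
have oV : open [set v : 'rV[R]_1 | v 0 0 != 0].
  apply: (@open_comp _ _ (fun v : 'rV[R]_1 => v 0 0) [set z | z != 0]).
    by move=> v _; exact: coord_continuous.
  exact: open_neq.
have := smx_open hX (F := fun y => \row__ f y) oV.
move=> /(_ x); rewrite /= !mxE => /(_ f0) H; apply: nearx_sub (H _) => [y|j].
  by rewrite /= !mxE.
by apply: smx_ext hf => // y; rewrite mxE.
Qed.

Lemma smx_det n (F : X -> 'M[R]_n) x : smm F x -> smx (fun y => \det (F y)) x.
Proof.
move=> h; apply: smx_sum => // s _; apply: smxM => //; first exact: smx_cst.
by apply: smx_prod => // i _; exact: h.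
Qed.

(** Cramer's rule: the determinant stays nonzero nearby, and the inverse is the adjugate divided by
    it. *)
Lemma smm_inv n (F : X -> 'M[R]_n) x : F x \in unitmx -> smm F x ->
  nearx x (fun y => F y \in unitmx) /\ smm (fun y => invmx (F y)) x.
Proof.
rewrite unitmxE unitfE => u h; have hd := smx_det h.
have nd := smx_neq0 hd u; split; first by apply: nearx_sub nd => y; rewrite unitmxE unitfE.
apply: (@smm_eq _ _ (fun y => (\det (F y))^-1 *: \adj (F y))).
  by apply: nearx_sub nd => y d0; rewrite /invmx unitmxE unitfE d0.
apply: smmZ; first exact: smxV.
move=> i j; apply: (smx_ext hX (f := fun y => cofactor (F y) j i)); first by move=> y; rewrite mxE.
apply: smxM => //; first exact: smx_cst.
apply: smx_det => k l; apply: smx_ext (h (lift j k) (lift i l)) => // y.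
by rewrite !mxE.
Qed.

Lemma smm_smv n m (G : 'rV[R]_n -> 'rV[R]_m) (F : X -> 'rV[R]_n) x :
  smv G (F x) -> smm F x -> smm (fun y => G (F y)) x.
Proof.
move=> hG /smm_rV hF; apply/smm_rV => j.
exact: (smx_comp hX (g := fun v => G v 0 j)).
Qed.

End SmoothMatrices.

Section SmoothAt.
Variable R : realType.

(** Smoothness of a map at one point. The third clause together with the smoothness of the
    coordinates includes continuity there. Unlike [smooth_map], which speaks of all points at once,
    it applies to locally defined frames; [smatP] relates the two. *)
Definition smat (X Y : space R) (s : X -> Y) (x : X) : Prop :=
  exists d, [/\ mchart d, dom d (s x), nearx x (fun y => dom d (s y)) & smm (fun y => crd d (s y)) x].

Section Two.
Variables (X Y : space R) (hX : pman X) (hY : pman Y).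
Implicit Types (s : X -> Y).

Lemma smat_smx s f x : smat s x -> smx f (s x) -> smx (fun y => f (s y)) x.
Proof.
move=> [d [md dx nd /smm_rV hs]] hf.
have [g sg gE] := smx_read hY md dx hf.
apply: (smx_eq hX (f := fun y => g (crd d (s y)))); last exact: smx_comp.
by apply: nearx_sub nd => y dy; rewrite gE.
Qed.

Lemma smat_smm m n s (F : Y -> 'M[R]_(m, n)) x : smat s x -> smm F (s x) -> smm (fun y => F (s y)) x.
Proof. by move=> h hF i j; apply: (smat_smx (f := fun y => F y i j)). Qed.

Lemma smat_near s x A : smat s x -> nearx (s x) A -> nearx x (fun y => A (s y)).
Proof.
move=> [d [md dx nd /smm_rV hs]] /(nearx_chart hY _ md dx) [W [oW Wx _ WA]].
by apply: (nearx2 hX nd (smx_open hX oW Wx hs)) => y dy Wy; exact: WA.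
Qed.

Lemma smm_crd c (x : X) : mchart c -> dom c x -> smm (crd c) x.
Proof. by move=> mc cx; apply/smm_rV => j; exact: smx_crd. Qed.

Lemma smat_crd s d x : smat s x -> mchart d -> dom d (s x) ->
  nearx x (fun y => dom d (s y)) /\ smm (fun y => crd d (s y)) x.
Proof.
move=> hs md dx; split; first by apply: smat_near => //; exact: mchart_nearx.
apply: smat_smm => //; apply/smm_rV => j; exact: smx_crd.
Qed.

Lemma smatP s : smooth_map s <-> forall x, smat s x.
Proof.
split=> [sF x|H]; last first.
  apply: smooth_mapI => // x; have [d [md dx nd /smm_rV hs]] := H x.
  by exists d.
have [d md dx] := pman_chart hY (s x); exists d; split=> //.
  by apply: smooth_map_near => //; exact: mchart_nearx.
by apply/smm_rV => j; exact: smooth_map_crd.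
Qed.

Lemma smooth_smat s x : smooth_map s -> smat s x.
Proof. by move=> /smatP; apply. Qed.

Lemma smat_eq s s' x : nearx x (fun y => s y = s' y) -> smat s x -> smat s' x.
Proof.
move=> E [d [md dx nd hs]]; exists d; split=> //.
- by rewrite -(nearx_self E).
- by apply: (nearx2 hX E nd) => y <-.
- by apply: smm_eq hs => //; apply: nearx_sub E => y ->.
Qed.

End Two.

Lemma smat_id (X : space R) (hX : pman X) x : smat (@id X) x.
Proof. by move: x; apply/(smatP hX hX); exact: smooth_map_id. Qed.

Lemma smat_comp (X Y Z : space R) (hX : pman X) (hY : pman Y) (hZ : pman Z)
  (g : Y -> Z) (f : X -> Y) x : smat f x -> smat g (f x) -> smat (fun y => g (f y)) x.
Proof.
move=> hf [d [md dx nd hs]]; exists d; split=> //.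
  by apply: (smat_near hX hY (A := fun y => dom d (g y))).
by apply: (smat_smm hX hY (F := fun y => crd d (g y))).
Qed.

End SmoothAt.

Lemma sig_ext (T : Type) (P : T -> Prop) (x y : {x | P x}) : sval x = sval y -> x = y.
Proof. by case: x y => [x px] [y py] /= e; subst y; congr exist; exact: Prop_irrelevance. Qed.

Definition pickd (T : Type) (d : T) (P : set T) : T :=
  if pselect (exists x, P x) is left h then sval (cid h) else d.

Lemma pickdP (T : Type) (d : T) (P : set T) : (exists x, P x) -> P (pickd d P).
Proof. by rewrite /pickd; case: pselect => // h _; exact: svalP (cid h). Qed.

(** * Building atlases; embedded submanifolds *)

Section PmanBuild.
Variable R : realType.

(** A transition germ [phi] at each common point is enough: the same clause that makes it a
    transition also shows that the overlap has an open image. *)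
Lemma pmanI (X : space R) :
  (forall x : X, exists2 c, atlas X c & dom c x) ->
  (forall c x y, atlas X c -> dom c x -> dom c y -> crd c x = crd c y -> x = y) ->
  (forall c d x, atlas X c -> atlas X d -> dom c x -> dom d x -> exists phi,
     smv phi (crd c x) /\ \forall v \near crd c x,
       exists y, [/\ dom c y, dom d y, crd c y = v & crd d y = phi v]) ->
  pman X.
Proof.
move=> cov inj loc; split=> // c ac.
suff H c1 d : atlas X c1 -> atlas X d -> compat c1 d.
  split; last by move=> d ad; split; exact: H.
  by move=> x y /set_mem cx /set_mem cy; exact: inj.
move=> {c ac}ac ad; pose c := c1.
have op : open (crd c @` (dom c `&` dom d)).
  rewrite openE => _ [x [cx dx] <-].
  have [phi [_]] := loc _ _ _ ac ad cx dx.
  by apply: filterS => v [y [cy dy yE _]]; exists y.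
split=> //.
pose rd j v := xget 0 [set r | exists y, [/\ dom c y, crd c y = v & r = crd d y 0 j]].
have rdE j y : dom c y -> rd j (crd c y) = crd d y 0 j.
  move=> cy; rewrite /rd; case: xgetP => [r _ [z [cz zy ->]]|/(_ (crd d y 0 j)) []]; last by exists y.
  by rewrite (inj _ _ _ ac cz cy).
exists (fun v => \row_j rd j v); split; last first.
  by move=> x cx dx; apply/rowP => j; rewrite mxE rdE.
move=> j; apply: sm_Cinfty => // _ [x [cx dx] <-].
have [phi [sphi nphi]] := loc _ _ _ ac ad cx dx.
apply: (sm_eq _ (sphi j)); apply: filterS nphi => v [y [cy dy yE <-]].
by rewrite mxE -yE rdE.
Qed.

Lemma smv_lsub n m x : smv (@lsubmx R 1 n m) x.
Proof. by move=> j; apply: (sm_ext _ (sm_coord (lshift m j) x)) => v; rewrite mxE. Qed.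

Lemma smv_rsub n m x : smv (@rsubmx R 1 n m) x.
Proof. by move=> j; apply: (sm_ext _ (sm_coord (rshift n j) x)) => v; rewrite mxE. Qed.

Lemma smv_row n m p (F : 'rV[R]_p -> 'rV[R]_n) (G : 'rV[R]_p -> 'rV[R]_m) x :
  smv F x -> smv G x -> smv (fun v => row_mx (F v) (G v)) x.
Proof.
move=> hF hG j; case: (split_ordP j) => l ->.
  by apply: sm_ext (hF l) => v; rewrite row_mxEl.
by apply: sm_ext (hG l) => v; rewrite row_mxEr.
Qed.

Lemma smv_cst n m (w : 'rV[R]_m) (x : 'rV[R]_n) : smv (fun=> w) x.
Proof. by move=> j; exact: sm_cst. Qed.

Lemma sm_sum n (I : Type) (r : seq I) (P : pred I) (f : I -> 'rV[R]_n -> R) x :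
  (forall i, P i -> sm (f i) x) -> sm (fun y => \sum_(i <- r | P i) f i y) x.
Proof.
move=> H; elim: r => [|i r IH].
  by apply: (sm_ext _ (sm_cst 0 x)) => y; rewrite big_nil.
case Pi : (P i); last by apply: (sm_ext _ IH) => y; rewrite big_cons Pi.
by apply: (sm_ext _ (smD (H i Pi) IH)) => y; rewrite big_cons Pi.
Qed.

(** A transition between slice charts is [u |-> (u, 0)], followed by the ambient transition and the
    projection to the first block. The point with coordinates [(u, 0)] lies in [S] because that is
    how a slice chart describes [S]. *)
Lemma pman_sub (X : space R) (S : set X) : pman X ->
  (forall x : {x | S x}, exists2 c, slice_chart c & dom c x) -> pman (subspace S).
Proof.
move=> hX cov; apply: pmanI => //.
- move=> c x y [k l U f mc Sf] /= Ux Uy E; apply: sig_ext; apply: (mchart_inj mc) => //=.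
  rewrite -(hsubmxK (f (sval x))) -(hsubmxK (f (sval y))) E.
  by rewrite (Sf _ Ux).1 ?(Sf _ Uy).1 //; exact: svalP.
- move=> c d x [k l U f mc Sf] [k' l' U' f' mc' Sf'] /= Ux Ux'.
  have [tau [W [oW Wx Ws Wsm WE]]] := mchart_trans hX mc mc' Ux Ux'.
  have fx : row_mx (lsubmx (f (sval x))) 0 = f (sval x).
    by rewrite -[RHS]hsubmxK (Sf _ Ux).1 //; exact: svalP.
  have sr (u : 'rV[R]_k) : smv (fun u : 'rV[R]_k => row_mx u (0 : 'rV[R]_l)) u.
    by apply: smv_row; [exact: smv_id|exact: smv_cst].
  exists (fun u => lsubmx (tau (row_mx u 0))); split.
    apply: (smv_comp (G := @lsubmx _ _ _ _)); first exact: smv_lsub.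
    by apply: smv_comp; [apply: Wsm; rewrite fx|exact: sr].
  have : \forall u \near lsubmx (f (sval x)), W (row_mx u 0).
    by apply: (smv_cont (sr _)); rewrite fx; exact: open_nbhs_nbhs.
  apply: filterS => u /[dup] Wu /Ws [y Uy yE].
  have Sy : S y by apply/(Sf _ Uy); rewrite /= in yE; rewrite yE row_mxKr.
  have [dy E] := WE _ Uy (eq_ind_r W Wu yE); rewrite /= in yE E dy.
  by exists (exist _ y Sy); split=> //=; rewrite ?E yE ?row_mxKl.
Qed.

End PmanBuild.

Section Dot.
Variable R : realType.

Definition dot n (u w : 'rV[R]_n) : R := \sum_j u 0 j * w 0 j.

Lemma dotC n (u w : 'rV[R]_n) : dot u w = dot w u.
Proof. by apply: eq_bigr => j _; rewrite mulrC. Qed.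

Lemma dotDl n (u u' w : 'rV[R]_n) : dot (u + u') w = dot u w + dot u' w.
Proof. by rewrite /dot -big_split; apply: eq_bigr => j _; rewrite mxE mulrDl. Qed.

Lemma dotZl n t (u w : 'rV[R]_n) : dot (t *: u) w = t * dot u w.
Proof. by rewrite /dot mulr_sumr; apply: eq_bigr => j _; rewrite mxE mulrA. Qed.

Lemma dotDr n (u w w' : 'rV[R]_n) : dot u (w + w') = dot u w + dot u w'.
Proof. by rewrite dotC dotDl !(dotC u). Qed.

Lemma dotZr n t (u w : 'rV[R]_n) : dot u (t *: w) = t * dot u w.
Proof. by rewrite dotC dotZl dotC. Qed.

Lemma dot0l n (u : 'rV[R]_n) : dot 0 u = 0.
Proof. by rewrite -(scale0r 0) dotZl mul0r. Qed.

Lemma dot0r n (u : 'rV[R]_n) : dot u 0 = 0.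
Proof. by rewrite dotC dot0l. Qed.

Lemma dot_delta n (u : 'rV[R]_n) j : dot u (delta_mx 0 j) = u 0 j.
Proof.
rewrite /dot (bigD1 j)//= big1 ?mxE ?eqxx ?mulr1 ?addr0// => i /negbTE ij.
by rewrite mxE ij andbF mulr0.
Qed.

Lemma dot_row n m (u u' : 'rV[R]_n) (w w' : 'rV[R]_m) :
  dot (row_mx u w) (row_mx u' w') = dot u u' + dot w w'.
Proof.
rewrite /dot big_split_ord /=; congr (_ + _); apply: eq_bigr => j _.
  by rewrite !row_mxEl.
by rewrite !row_mxEr.
Qed.

Lemma dotE n (u w : 'rV[R]_n) : dot u w = (u *m w^T) 0 0.
Proof. by rewrite mxE; apply: eq_bigr => j _; rewrite mxE. Qed.

Lemma dot_mul n m (u : 'rV[R]_n) (w : 'rV[R]_m) (A : 'M[R]_(m, n)) :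
  dot u (w *m A) = dot (u *m A^T) w.
Proof. by rewrite !dotE trmx_mul mulmxA. Qed.

Lemma dot_inj n (u u' : 'rV[R]_n) : (forall w, dot u w = dot u' w) -> u = u'.
Proof. by move=> h; apply/rowP => j; rewrite -!dot_delta. Qed.

Lemma rV_lin n (f : 'rV[R]_n -> R) : (forall u w, f (u + w) = f u + f w) ->
  (forall t u, f (t *: u) = t * f u) -> forall w, f w = dot (\row_j f (delta_mx 0 j)) w.
Proof.
move=> fD fZ w; rewrite {1}(row_sum_delta w) /dot.
rewrite (big_morph f fD (_ : f 0 = 0)); last by rewrite -(scale0r 0) fZ mul0r.
by apply: eq_bigr => j _; rewrite fZ mxE mulrC.
Qed.

Lemma smx_dot (X : space R) (hX : pman X) n (F G : X -> 'rV[R]_n) x :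
  smm F x -> smm G x -> smx (fun y => dot (F y) (G y)) x.
Proof. by move=> hF hG; apply: smx_sum => // j _; apply: smxM. Qed.

End Dot.

(** The two axioms that keep operations in the fibres. With a covering by [vb_chart] they are what
    is established for cores and for dual bundles, so that bundles, cores and duals can be treated
    alike. *)
Record vblaw (R : realType) (M E : Type) (v : vb_ops R M E) : Prop := VbLaw {
  vl_add : forall e e', vproj v e = vproj v e' -> vproj v (vadd v e e') = vproj v e;
  vl_scale : forall t e, vproj v (vscale v t e) = vproj v e }.

Definition vbcov (R : realType) (M E : space R) (v : vb_ops R M E) : Prop :=
  forall m, exists c r (xi : E -> 'rV[R]_r), dom c m /\ vb_chart v c xi.

(** * Vector bundles and their duals *)

Section VectorBundles.
Variables (R : realType) (M E : space R) (hM : pman M) (hE : pman E) (v : vb_ops R M E).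

Lemma vbundle_law r : is_vbundle r v -> vblaw v.
Proof. by case. Qed.

Definition vmk r (xi : E -> 'rV[R]_r) m w : E :=
  pickd (vzero v m) [set e | vproj v e = m /\ xi e = w].

Section Chart.
Variables (hv : vblaw v) (c : chart R M) (r : nat) (xi : E -> 'rV[R]_r) (hc : vb_chart v c xi).

Lemma vmkP m w : dom c m -> vproj v (vmk xi m w) = m /\ xi (vmk xi m w) = w.
Proof.
case: hc => _ _ _ /(_ m w) h _ /h [e e1 e2].
by apply: (@pickdP E (vzero v m) [set e | vproj v e = m /\ xi e = w]); exists e.
Qed.

Lemma vmk_proj m w : dom c m -> vproj v (vmk xi m w) = m.
Proof. by move=> /(vmkP w) []. Qed.

Lemma vmk_xi m w : dom c m -> xi (vmk xi m w) = w.
Proof. by move=> /(vmkP w) []. Qed.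

Lemma vb_mchart : mchart c. Proof. by case: hc. Qed.

Lemma vb_mcharte : @mchart R E (Chart (fun e => dom c (vproj v e))
                       (fun e => row_mx (crd c (vproj v e)) (xi e))).
Proof. by case: hc. Qed.

Lemma vb_xiD e e' : dom c (vproj v e) -> vproj v e = vproj v e' ->
  xi (vadd v e e') = xi e + xi e'.
Proof. by case: hc => _ h *; exact: h. Qed.

Lemma vb_xiZ t e : dom c (vproj v e) -> xi (vscale v t e) = t *: xi e.
Proof. by case: hc => _ _ h *; exact: h. Qed.

Lemma vb_inj e e' : dom c (vproj v e) -> vproj v e = vproj v e' -> xi e = xi e' -> e = e'.
Proof.
move=> ce pe xe; apply: (mchart_inj vb_mcharte) => //=; first by rewrite -pe.
by rewrite pe xe.
Qed.

Lemma vmk_eta e m w : dom c m -> vproj v e = m -> xi e = w -> vmk xi m w = e.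
Proof. by move=> cm pe xe; apply: vb_inj; rewrite ?vmk_proj ?vmk_xi. Qed.

Lemma vmkD m w w' : dom c m -> vadd v (vmk xi m w) (vmk xi m w') = vmk xi m (w + w').
Proof.
move=> cm; have E1 : vproj v (vmk xi m w) = vproj v (vmk xi m w') by rewrite !vmk_proj.
apply/esym/vmk_eta => //; first by rewrite (vl_add hv) ?vmk_proj.
by rewrite vb_xiD ?vmk_xi// vmk_proj.
Qed.

Lemma vmkZ m t w : dom c m -> vscale v t (vmk xi m w) = vmk xi m (t *: w).
Proof.
move=> cm; apply/esym/vmk_eta => //; first by rewrite (vl_scale hv) vmk_proj.
by rewrite vb_xiZ ?vmk_xi// vmk_proj.
Qed.

Lemma vb_proj_smat e : dom c (vproj v e) -> smat (vproj v) e.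
Proof.
move=> ce; exists c; split=> //; first exact: vb_mchart.
  by have := mchart_nearx hE vb_mcharte ce.
apply: (smm_rowl hE (G := xi)); exact: (smm_crd hE vb_mcharte ce).
Qed.

Lemma vb_xi_smm e : dom c (vproj v e) -> smm xi e.
Proof.
move=> ce; apply: (smm_rowr hE (F := fun e => crd c (vproj v e))).
exact: (smm_crd hE vb_mcharte ce).
Qed.

Lemma vb_smatI (X : space R) (hX : pman X) (s : X -> E) x :
  smat (fun y => vproj v (s y)) x -> dom c (vproj v (s x)) -> smm (fun y => xi (s y)) x ->
  smat s x.
Proof.
move=> h cx hw; have [h1 h2] := smat_crd hX hM h vb_mchart cx.
exists (Chart (fun e => dom c (vproj v e)) (fun e => row_mx (crd c (vproj v e)) (xi e))).
by split=> //; [exact: vb_mcharte|apply: smm_row_mx].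
Qed.

Lemma vmk_smat (X : space R) (hX : pman X) (g : X -> M) (W : X -> 'rV[R]_r) x :
  smat g x -> dom c (g x) -> smm W x -> smat (fun y => vmk xi (g y) (W y)) x.
Proof.
move=> hg cx hW; have [n1 _] := smat_crd hX hM hg vb_mchart cx.
apply: vb_smatI => //; last 1 first.
- by apply: (smm_eq hX _ hW); apply: nearx_sub n1 => y cy; rewrite vmk_xi.
- by apply: (smat_eq hX _ hg); apply: nearx_sub n1 => y cy; rewrite vmk_proj.
- by rewrite vmk_proj.
Qed.

(** The local inverse required by [mchartI] keeps the base coordinates and multiplies the fibre
    coordinates by [L'], read in the base chart. *)
Lemma vb_chart_change r' (xi' : E -> 'rV[R]_r') (L : M -> 'M[R]_(r, r')) (L' : M -> 'M[R]_(r', r)) :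
  (forall m, dom c m -> [/\ smm L m, smm L' m, L m *m L' m = 1%:M & L' m *m L m = 1%:M]) ->
  (forall e, dom c (vproj v e) -> xi' e = xi e *m L (vproj v e)) -> vb_chart v c xi'.
Proof.
move=> hL hxi; split.
- exact: vb_mchart.
- move=> e e' ce pe; rewrite !hxi -?pe ?(vl_add hv)// vb_xiD// mulmxDl //.
- by move=> t e ce; rewrite !hxi ?(vl_scale hv)// vb_xiZ// scalemxAl.
- move=> m w cm; exists (vmk xi m (w *m L' m)); first by rewrite vmk_proj.
  by rewrite hxi vmk_proj// vmk_xi// -mulmxA; have [_ _ _ ->] := hL _ cm; rewrite mulmx1.
have hx0 e : dom c (vproj v e) -> xi e = xi' e *m L' (vproj v e).
  by move=> ce; rewrite hxi// -mulmxA; have [_ _ -> _] := hL _ ce; rewrite mulmx1.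
apply: mchartI => //=.
- move=> e e' /set_mem /= ce /set_mem /= ce' /eq_row_mx [h1 h2].
  have pe := mchart_inj vb_mchart ce ce' h1.
  by apply: vb_inj => //; rewrite !hx0// h2 pe.
- move=> e ce; have ne := mchart_nearx hE vb_mcharte ce; split=> // j.
  have sp := vb_proj_smat ce; have [_ hc'] := smat_crd hE hM sp vb_mchart ce.
  apply: (smm_row_mx hE hc' (G := xi')).
  have [sL _ _ _] := hL _ ce.
  have h := smm_mul hE (vb_xi_smm ce) (smat_smm hE hM sp sL).
  by apply: smm_eq h => //; apply: nearx_sub ne => y cy; rewrite hxi.
- move=> e ce; have mcc := vb_mchart.
  have [W [oW Wx Ws _]] := (nearx_chart hM (dom c) mcc ce).1 (mchart_nearx hM mcc ce).
  pose ch := Chart (fun e => dom c (vproj v e)) (fun e => row_mx (crd c (vproj v e)) (xi e)).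
  pose Lr (u : 'rV[R]_(cdim c)) : 'M[R]_(r', r) := \matrix_(i, j) chread (fun m => L' m i j) u.
  pose phi (u : 'rV[R]_(cdim c + r')) : 'rV[R]_(cdim c + r) :=
    row_mx (lsubmx u) (rsubmx u *m Lr (lsubmx u)).
  pose W' := [set u : 'rV[R]_(cdim c + r') | W (lsubmx u)].
  exists ch, phi, W'; split=> //; first exact: vb_mcharte.
  + apply: (@open_comp _ _ (@lsubmx R 1 (cdim c) r') W) => // u _.
    by apply: smv_cont; exact: smv_lsub.
  + by rewrite /W' /= row_mxKl.
  split.
    apply: smv_row; first exact: smv_lsub.
    move=> j; apply: (@sm_ext _ _ (fun u : 'rV[R]_(cdim c + r') =>
        \sum_i (rsubmx u) 0 i * chread (fun m => L' m i j) (lsubmx u))).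
      by move=> u; rewrite mxE; apply: eq_bigr => i _; rewrite [Lr _ _ _]mxE.
    apply: sm_sum => i _; apply: smM; first exact: smv_rsub.
    apply: (sm_comp (g := chread (fun m => L' m i j)) (F := @lsubmx R 1 (cdim c) r')); last exact: smv_lsub.
    rewrite row_mxKl; apply/(smx_chart hM) => //; have [_ sL' _ _] := hL _ ce; exact: sL'.
  move=> u Wu; have [m cm mE] := Ws _ Wu.
  have LE : Lr (lsubmx u) = L' m by apply/matrixP => i j; rewrite mxE -mE chreadE.
  exists (vmk xi m (rsubmx u *m L' m)); rewrite /= !vmk_proj//; split=> //.
    rewrite mE hxi ?vmk_proj// vmk_xi// -mulmxA; have [_ _ _ ->] := hL _ cm.
    by rewrite mulmx1 hsubmxK.
  by rewrite vmk_xi// /phi LE mE.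
Qed.

End Chart.

Section Dual.
Variables (hv : vblaw v) (hcov : vbcov v).

Lemma lform_eq (P P' : lform v) : base P = base P' ->
  (forall e, vproj v e = base P -> ev P e = ev P' e) -> P = P'.
Proof.
move=> bE eE; apply: sig_ext; rewrite (surjective_pairing (sval P)) (surjective_pairing (sval P')).
congr (_, _) => //; apply/funext => e; have [h|h] := pselect (vproj v e = base P); first exact: eE.
have [/(_ e h) -> _ _] := svalP P; have [/(_ e)] := svalP P'; rewrite -[(sval P').1]bE.
by move=> /(_ h).
Qed.

Lemma base_mkform m phi : base (mkform v m phi) = m.
Proof. by rewrite /base /mkform /clip; case: pselect. Qed.

Definition linform m (phi : E -> R) :=
  (forall e e', vproj v e = m -> vproj v e' = m -> phi (vadd v e e') = phi e + phi e') /\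
  (forall t e, vproj v e = m -> phi (vscale v t e) = t * phi e).

Lemma ev_mkform m phi e : linform m phi -> vproj v e = m -> ev (mkform v m phi) e = phi e.
Proof.
move=> [lD lZ] pe; rewrite /ev /mkform /clip; case: pselect => [h|[]] /=; first by rewrite asboolT.
split=> [e0 h|e0 e1 h0 h1|t e0 h] /=; first by rewrite asboolF.
  by rewrite !asboolT ?(vl_add hv) ?h0 ?h1 ?lD//.
by rewrite !asboolT ?(vl_scale hv)// lZ.
Qed.

Lemma evD (P : lform v) e e' : vproj v e = base P -> vproj v e' = base P ->
  ev P (vadd v e e') = ev P e + ev P e'.
Proof. by case: (svalP P) => _ h _; exact: h. Qed.

Lemma evZ (P : lform v) t e : vproj v e = base P -> ev P (vscale v t e) = t * ev P e.
Proof. by case: (svalP P) => _ _ h; exact: h. Qed.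

Definition dzeta r (xi : E -> 'rV[R]_r) (P : lform v) : 'rV[R]_r :=
  \row_j ev P (vmk xi (base P) (delta_mx 0 j)).

Lemma dzetaE c r (xi : E -> 'rV[R]_r) P e : vb_chart v c xi -> dom c (base P) ->
  vproj v e = base P -> ev P e = dot (dzeta xi P) (xi e).
Proof.
move=> hc cP pe; pose f w := ev P (vmk xi (base P) w).
have -> : ev P e = f (xi e) by rewrite /f (vmk_eta hc cP pe).
apply: (rV_lin (f := f)) => [u w|t u]; rewrite /f.
  by rewrite -(vmkD hv hc)// evD ?(vmk_proj hc).
by rewrite -(vmkZ hv hc)// evZ ?(vmk_proj hc).
Qed.

Lemma dzeta_uniq c r (xi : E -> 'rV[R]_r) P z : vb_chart v c xi -> dom c (base P) ->
  (forall e, vproj v e = base P -> ev P e = dot z (xi e)) -> dzeta xi P = z.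
Proof.
by move=> hc cP h; apply/rowP => j; rewrite mxE h ?(vmk_proj hc)// (vmk_xi hc)// dot_delta.
Qed.

Lemma linform_dot c r (xi : E -> 'rV[R]_r) m z : vb_chart v c xi -> dom c m ->
  linform m (fun e => dot z (xi e)).
Proof.
move=> hc cm; split=> [e e' pe pe'|t e pe].
  by rewrite (vb_xiD hc) ?dotDr ?pe.
by rewrite (vb_xiZ hc) ?dotZr ?pe.
Qed.

Definition fmk r (xi : E -> 'rV[R]_r) m (z : 'rV[R]_r) : lform v :=
  mkform v m (fun e => dot z (xi e)).

Lemma ev_fmk c r (xi : E -> 'rV[R]_r) m z e : vb_chart v c xi -> dom c m -> vproj v e = m ->
  ev (fmk xi m z) e = dot z (xi e).
Proof. by move=> hc cm pe; apply: ev_mkform => //; exact: linform_dot hc cm. Qed.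

Lemma dzeta_fmk c r (xi : E -> 'rV[R]_r) m z : vb_chart v c xi -> dom c m ->
  dzeta xi (fmk xi m z) = z.
Proof.
by move=> hc cm; apply: (dzeta_uniq hc); rewrite base_mkform// => e pe; rewrite (ev_fmk _ hc).
Qed.

(** Two dual charts over the same point differ by a matrix: [A m] has as entries the
    [xi]-coordinates of the frame of [xi'], so that [zeta' = zeta *m A m]. It is smooth because the
    frame of [xi'] is. *)
Lemma pman_dual : pman (dual_space v).
Proof.
apply: pmanI.
- move=> P; have [c [r [xi [cm hc]]]] := hcov (base P).
  eexists; first by apply: (DualChart hc) => Q e cQ pe; exact: (dzetaE hc cQ pe).
  by [].
- move=> _ P Q [c r xi zeta hc hz] /= cP cQ /eq_row_mx [h1 h2].
  have bE := mchart_inj (vb_mchart hc) cP cQ h1.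
  by apply: lform_eq => // e pe; rewrite !hz ?h2// -bE.
move=> _ _ P [c r xi zeta hc hz] [d r' xi' zeta' hd hz'] /= cP dP.
have [tau [W [oW Wx Ws Wsm WE]]] := mchart_trans hM (vb_mchart hc) (vb_mchart hd) cP dP.
pose A m : 'M[R]_(r, r') := \matrix_(i, j) xi (vmk xi' m (delta_mx 0 j)) 0 i.
have sA : smm A (base P).
  have h j : smm (fun m => xi (vmk xi' m (delta_mx 0 j))) (base P).
    apply: (smat_smm hM hE (F := xi)); last by apply: (vb_xi_smm hc); rewrite (vmk_proj hd).
    by apply: (vmk_smat hd hM (g := id)) => //; [exact: smat_id|exact: smm_cst].
  by move=> i j; apply: (smx_ext hM _ (h j 0 i)) => m; rewrite mxE.
pose Ar (u : 'rV[R]_(cdim c)) : 'M[R]_(r, r') := \matrix_(i, j) chread (fun m => A m i j) u.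
exists (fun u => row_mx (tau (lsubmx u)) (rsubmx u *m Ar (lsubmx u))); split.
  apply: smv_row.
    by apply: smv_comp; [rewrite row_mxKl; exact: Wsm|exact: smv_lsub].
  move=> j; apply: (@sm_ext _ _ (fun u : 'rV[R]_(cdim c + r) =>
      \sum_i (rsubmx u) 0 i * chread (fun m => A m i j) (lsubmx u))).
    by move=> u; rewrite mxE; apply: eq_bigr => i _; rewrite [Ar _ _ _]mxE.
  apply: sm_sum => i _; apply: smM; first exact: smv_rsub.
  apply: (sm_comp (g := chread (fun m => A m i j)) (F := @lsubmx R 1 (cdim c) r)); last exact: smv_lsub.
  by rewrite row_mxKl; apply/(smx_chart hM) => //; exact: vb_mchart hc.
have : \forall u \near row_mx (crd c (base P)) (zeta P), W (@lsubmx R 1 (cdim c) r u).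
  by apply: (smv_cont (@smv_lsub _ _ _ _)); rewrite row_mxKl; exact: open_nbhs_nbhs.
apply: filterS => u Wu; have [m cm mE] := Ws _ Wu.
have [dm dE] := WE _ cm (eq_ind_r W Wu mE).
exists (fmk xi m (rsubmx u)); rewrite base_mkform; split=> //.
  have -> : zeta (fmk xi m (rsubmx u)) = rsubmx u; last by rewrite mE hsubmxK.
  rewrite -(dzeta_fmk (rsubmx u) hc cm); apply/esym/(dzeta_uniq hc); rewrite base_mkform// => e pe.
  by rewrite hz ?base_mkform ?(dzeta_fmk _ hc).
rewrite dE mE; congr row_mx.
have LE : Ar (lsubmx u) = A m by apply/matrixP => i j; rewrite mxE -mE chreadE//; exact: vb_mchart hc.
apply: dot_inj => w; rewrite LE.
have := hz' (fmk xi m (rsubmx u)) (vmk xi' m w); rewrite base_mkform (vmk_proj hd)// (vmk_xi hd)//.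
rewrite -/(dot _ _) => <- //; rewrite (ev_fmk _ hc) ?(vmk_proj hd)//.
rewrite -[A m]trmxK -dot_mul; congr dot; apply/rowP => i.
pose f w := xi (vmk xi' m w) 0 i.
have fD a b : f (a + b) = f a + f b.
  by rewrite /f -(vmkD hv hd)// (vb_xiD hc) ?(vmk_proj hd)// mxE.
have fZ t a : f (t *: a) = t * f a.
  by rewrite /f -(vmkZ hv hd)// (vb_xiZ hc) ?(vmk_proj hd)// mxE.
rewrite -/(f w) (rV_lin fD fZ) mxE dotC; apply: eq_bigr => j _.
by rewrite !mxE.
Qed.

Lemma dual_law : vblaw (dual_ops v).
Proof. by split=> *; rewrite /= base_mkform. Qed.

Lemma dual_vb_chart c r (xi : E -> 'rV[R]_r) : vb_chart v c xi ->
  vb_chart (dual_ops v) c (dzeta xi).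
Proof.
move=> hc; have := pman_dual => -[_ hm]; split=> /=.
- exact: vb_mchart hc.
- move=> P P' cP pP; apply: (dzeta_uniq hc); rewrite base_mkform// => e pe.
  rewrite ev_mkform//; first by rewrite dotDl (dzetaE hc cP pe) (dzetaE (P := P') hc) -?pP.
  split=> [e1 e2 h1 h2|t e1 h1]; first by rewrite !evD ?h1 ?h2 -?pP// addrACA.
  by rewrite !evZ ?h1 -?pP// mulrDr.
- move=> t P cP; apply: (dzeta_uniq hc); rewrite base_mkform// => e pe.
  rewrite ev_mkform//; first by rewrite dotZl (dzetaE hc cP pe).
  split=> [e1 e2 h1 h2|t1 e1 h1]; first by rewrite evD ?h1 ?h2// mulrDr.
  by rewrite evZ ?h1// mulrCA.
- by move=> m z cm; exists (fmk xi m z); [exact: base_mkform|exact: dzeta_fmk hc cm].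
- by apply: hm; apply: (DualChart hc) => P e cP pe; exact: dzetaE hc cP pe.
Qed.

End Dual.
End VectorBundles.

Section Permute.
Variables (R : realType) (X : space R) (hX : pman X).

Lemma mchart_ext (U : set X) n (f g : X -> 'rV[R]_n) : (forall x, f x = g x) ->
  mchart (Chart U f) -> mchart (Chart U g).
Proof. by move=> /funext ->. Qed.

(** Exchanging the middle blocks turns a chart suited to [D -> A] into one suited to [D -> B]. *)
Lemma mchart_swap (U : set X) n a b e (p : X -> 'rV[R]_n) (fa : X -> 'rV[R]_a) (fb : X -> 'rV[R]_b)
    (fe : X -> 'rV[R]_e) :
  mchart (Chart U (fun x => row_mx (row_mx (p x) (fa x)) (row_mx (fb x) (fe x)))) ->
  mchart (Chart U (fun x => row_mx (row_mx (p x) (fb x)) (row_mx (fa x) (fe x)))).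
Proof.
move=> mc.
have sr a' b' (v : 'rV[R]_((n + a') + (b' + e))) : smv (fun v : 'rV[R]_((n + a') + (b' + e)) =>
    row_mx (row_mx (lsubmx (lsubmx v)) (lsubmx (rsubmx v)))
           (row_mx (rsubmx (lsubmx v)) (rsubmx (rsubmx v)))) v.
  apply: smv_row; apply: smv_row;
    by apply: smv_comp; (exact: smv_lsub || exact: smv_rsub).
apply: (mchart_ext _ (mchart_reparam hX mc (sr _ _) (sr _ _) _ _)) => [x|v|v] /=.
all: by rewrite !(row_mxKl, row_mxKr, hsubmxK).
Qed.

Lemma mchart_rot (U : set X) n a b e (p : X -> 'rV[R]_n) (fa : X -> 'rV[R]_a) (fb : X -> 'rV[R]_b)
    (fe : X -> 'rV[R]_e) :
  mchart (Chart U (fun x => row_mx (row_mx (p x) (fa x)) (row_mx (fb x) (fe x)))) ->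
  mchart (Chart U (fun x => row_mx (row_mx (p x) (fe x)) (row_mx (fa x) (fb x)))).
Proof.
move=> mc; apply: mchart_swap.
have s1 (v : 'rV[R]_((n + a) + (b + e))) : smv (fun v : 'rV[R]_((n + a) + (b + e)) =>
    row_mx (lsubmx v) (row_mx (rsubmx (rsubmx v)) (lsubmx (rsubmx v)))) v.
  apply: smv_row; first exact: smv_lsub.
  by apply: smv_row; apply: smv_comp; (exact: smv_lsub || exact: smv_rsub).
have s2 (v : 'rV[R]_((n + a) + (e + b))) : smv (fun v : 'rV[R]_((n + a) + (e + b)) =>
    row_mx (lsubmx v) (row_mx (rsubmx (rsubmx v)) (lsubmx (rsubmx v)))) v.
  apply: smv_row; first exact: smv_lsub.
  by apply: smv_row; apply: smv_comp; (exact: smv_lsub || exact: smv_rsub).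
apply: (mchart_ext _ (mchart_reparam hX mc s1 s2 _ _)) => [x|v|v] /=.
all: by rewrite !(row_mxKl, row_mxKr, hsubmxK).
Qed.

End Permute.

(** * Decomposed coordinates on double vector bundles *)

Section DoubleCoordinates.
Variable R : realType.

(** The fragment of the axioms that is established for [dualA D] as well. The compatibility of the
    two structures is then read off decomposed coordinates. *)
Record dlaw (X : dvb_data R) : Prop := Dlaw {
  dl_M : pman (dvM X); dl_A : pman (dvA X); dl_B : pman (dvB X); dl_D : pman X;
  dl_vA : vblaw (opA X); dl_vB : vblaw (opB X);
  dl_vDA : vblaw (opDA X); dl_vDB : vblaw (opDB X);
  dl_sq : forall d : X, vproj (opA X) (vproj (opDA X) d) = vproj (opB X) (vproj (opDB X) d) }.

Lemma dlaw_flip (X : dvb_data R) : dlaw X -> dlaw (flip_data X).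
Proof. by case=> *; split. Qed.

Lemma dvb_dlaw (D : dvb R) : dlaw D.
Proof.
case: (dvbP D) => -[a hA] [b hB] [e hDA] [f hDB] sq *.
have [n1 m1] := vb_base hA; have [n2 m2] := vb_total hA; have [n3 m3] := vb_total hB.
have [n4 m4] := vb_total hDA.
by split=> //; [exact: manifold_pman m1|exact: manifold_pman m2|exact: manifold_pman m3|
  exact: manifold_pman m4|exact: vbundle_law hA|exact: vbundle_law hB|exact: vbundle_law hDA|
  exact: vbundle_law hDB].
Qed.

Section Dco.
Variable X : dvb_data R.
Notation qA := (vproj (opA X)).
Notation qB := (vproj (opB X)).
Notation pA := (vproj (opDA X)).
Notation pB := (vproj (opDB X)).

Definition chA (c : chart R (dvM X)) k (al : dvA X -> 'rV[R]_k) : chart R (dvA X) :=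
  Chart (fun a => dom c (qA a)) (fun a => row_mx (crd c (qA a)) (al a)).
Definition chB (c : chart R (dvM X)) k (be : dvB X -> 'rV[R]_k) : chart R (dvB X) :=
  Chart (fun a => dom c (qB a)) (fun a => row_mx (crd c (qB a)) (be a)).

(* Coordinates in which the double vector bundle is the product of its sides and its core. *)
Record dco (c : chart R (dvM X)) ka kb kc (al : dvA X -> 'rV[R]_ka) (be : dvB X -> 'rV[R]_kb)
    (de : X -> 'rV[R]_kc) : Prop := Dco {
  dco_A : vb_chart (opA X) c al;
  dco_B : vb_chart (opB X) c be;
  dco_DA : vb_chart (opDA X) (chA c al) (fun d => row_mx (be (pB d)) (de d));
  dco_DB : vb_chart (opDB X) (chB c be) (fun d => row_mx (al (pA d)) (de d)) }.

Definition dcov : Prop := forall m, exists c ka kb kc (al : dvA X -> 'rV[R]_ka)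
  (be : dvB X -> 'rV[R]_kb) (de : X -> 'rV[R]_kc), dom c m /\ dco c al be de.

Definition dmk ka kb kc (al : dvA X -> 'rV[R]_ka) (be : dvB X -> 'rV[R]_kb)
    (de : X -> 'rV[R]_kc) m u v w : X :=
  vmk (opDA X) (fun d => row_mx (be (pB d)) (de d)) (vmk (opA X) al m u) (row_mx v w).

Hypothesis L : dlaw X.

Section One.
Variables (c : chart R (dvM X)) (ka kb kc : nat) (al : dvA X -> 'rV[R]_ka)
  (be : dvB X -> 'rV[R]_kb) (de : X -> 'rV[R]_kc).

Section Given.
Hypothesis hc : dco c al be de.

Lemma dco_addA d d' : dom c (qA (pA d)) -> pA d = pA d' ->
  be (pB (vadd (opDA X) d d')) = be (pB d) + be (pB d') /\
  de (vadd (opDA X) d d') = de d + de d'.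
Proof.
by move=> cd pd; have := vb_xiD (dco_DA hc) cd pd; rewrite add_row_mx => /eq_row_mx.
Qed.

Lemma dco_addB d d' : dom c (qA (pA d)) -> pB d = pB d' ->
  al (pA (vadd (opDB X) d d')) = al (pA d) + al (pA d') /\
  de (vadd (opDB X) d d') = de d + de d'.
Proof.
move=> cd pd; rewrite (dl_sq L) in cd.
by have := vb_xiD (dco_DB hc) cd pd; rewrite add_row_mx => /eq_row_mx.
Qed.

Lemma dco_scaleA t d : dom c (qA (pA d)) ->
  be (pB (vscale (opDA X) t d)) = t *: be (pB d) /\ de (vscale (opDA X) t d) = t *: de d.
Proof.
by move=> cd; have := vb_xiZ (dco_DA hc) t cd; rewrite scale_row_mx => /eq_row_mx.
Qed.

Lemma dco_scaleB t d : dom c (qA (pA d)) ->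
  al (pA (vscale (opDB X) t d)) = t *: al (pA d) /\ de (vscale (opDB X) t d) = t *: de d.
Proof.
move=> cd; rewrite (dl_sq L) in cd.
by have := vb_xiZ (dco_DB hc) t cd; rewrite scale_row_mx => /eq_row_mx.
Qed.

Lemma qA_addB d d' : pB d = pB d' -> qA (pA (vadd (opDB X) d d')) = qA (pA d).
Proof. by move=> pd; rewrite !(dl_sq L) (vl_add (dl_vDB L)). Qed.

Lemma qA_scaleB t d : qA (pA (vscale (opDB X) t d)) = qA (pA d).
Proof. by rewrite !(dl_sq L) (vl_scale (dl_vDB L)). Qed.

Lemma dco_inj d d' : dom c (qA (pA d)) -> qA (pA d) = qA (pA d') -> al (pA d) = al (pA d') ->
  be (pB d) = be (pB d') -> de d = de d' -> d = d'.
Proof.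
move=> cd qd ad bd dd; apply: (vb_inj (dco_DA hc)) => //.
  exact: (vb_inj (dco_A hc)).
by rewrite bd dd.
Qed.

Lemma dmk_pA m u v w : dom c m -> pA (dmk al be de m u v w) = vmk (opA X) al m u.
Proof. by move=> cm; rewrite (vmk_proj (dco_DA hc))//= (vmk_proj (dco_A hc)). Qed.

Lemma dmkP m u v w : dom c m -> let d := dmk al be de m u v w in
  [/\ qA (pA d) = m, al (pA d) = u, be (pB d) = v & de d = w].
Proof.
move=> cm d; rewrite (dmk_pA u v w cm) (vmk_proj (dco_A hc))// (vmk_xi (dco_A hc))//.
have /eq_row_mx [-> ->] : row_mx (be (pB d)) (de d) = row_mx v w; last by [].
by rewrite (vmk_xi (dco_DA hc))//= (vmk_proj (dco_A hc)).
Qed.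

Lemma dmk_eta d m : dom c m -> qA (pA d) = m -> dmk al be de m (al (pA d)) (be (pB d)) (de d) = d.
Proof.
move=> cm qd; have [h1 h2 h3 h4] := dmkP (al (pA d)) (be (pB d)) (de d) cm.
by apply: dco_inj; rewrite ?h1.
Qed.

Lemma dmk_pB m u v w : dom c m -> pB (dmk al be de m u v w) = vmk (opB X) be m v.
Proof.
move=> cm; have [h1 h2 h3 h4] := dmkP u v w cm.
by apply/esym/(vmk_eta (dco_B hc)) => //; rewrite -(dl_sq L).
Qed.

Lemma dmk_addA m u v w v' w' : dom c m ->
  vadd (opDA X) (dmk al be de m u v w) (dmk al be de m u v' w') = dmk al be de m u (v + v') (w + w').
Proof.
move=> cm; rewrite /dmk (vmkD (dl_vDA L) (dco_DA hc)) ?add_row_mx//=.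
by rewrite (vmk_proj (dco_A hc)).
Qed.

Lemma dmk_scaleA m t u v w : dom c m ->
  vscale (opDA X) t (dmk al be de m u v w) = dmk al be de m u (t *: v) (t *: w).
Proof.
move=> cm; rewrite /dmk (vmkZ (dl_vDA L) (dco_DA hc)) ?scale_row_mx//=.
by rewrite (vmk_proj (dco_A hc)).
Qed.

Lemma dmk_addB m u v w u' w' : dom c m ->
  vadd (opDB X) (dmk al be de m u v w) (dmk al be de m u' v w') = dmk al be de m (u + u') v (w + w').
Proof.
move=> cm; have [h1 h2 h3 h4] := dmkP u v w cm; have [h1' h2' h3' h4'] := dmkP u' v w' cm.
have [k1 k2 k3 k4] := dmkP (u + u') v (w + w') cm.
have pE : pB (dmk al be de m u v w) = pB (dmk al be de m u' v w') by rewrite !dmk_pB.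
have cd : dom c (qA (pA (dmk al be de m u v w))) by rewrite h1.
have [aE dE] := dco_addB cd pE.
apply: dco_inj; rewrite ?(qA_addB pE) ?h1 ?k1// ?aE ?dE ?h2 ?h2' ?h4 ?h4'//.
by rewrite (vl_add (dl_vDB L))// h3.
Qed.

Lemma dmk_scaleB m t u v w : dom c m ->
  vscale (opDB X) t (dmk al be de m u v w) = dmk al be de m (t *: u) v (t *: w).
Proof.
move=> cm; have [h1 h2 h3 h4] := dmkP u v w cm.
have [k1 k2 k3 k4] := dmkP (t *: u) v (t *: w) cm.
have cd : dom c (qA (pA (dmk al be de m u v w))) by rewrite h1.
have [aE dE] := dco_scaleB t cd.
by apply: dco_inj; rewrite ?qA_scaleB ?h1 ?k1// ?aE ?dE ?h2 ?h4// (vl_scale (dl_vDB L)) h3.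
Qed.

Lemma dco_qsmat d : dom c (qA (pA d)) -> smat (fun d => qA (pA d)) d.
Proof.
move=> cd; apply: (smat_comp (dl_D L) (dl_A L) (dl_M L)).
  exact: (vb_proj_smat (dl_D L) (dco_DA hc)).
exact: (vb_proj_smat (dl_A L) (dco_A hc)).
Qed.

Lemma dco_de_smm d : dom c (qA (pA d)) -> smm de d.
Proof.
move=> cd; apply: (smm_rowr (dl_D L) (F := fun d => be (pB d))).
exact: (vb_xi_smm (dl_D L) (dco_DA hc)).
Qed.

Lemma dco_be_smm d : dom c (qA (pA d)) -> smm (fun d => be (pB d)) d.
Proof.
move=> cd; apply: (smm_rowl (dl_D L) (G := de)).
exact: (vb_xi_smm (dl_D L) (dco_DA hc)).
Qed.

Lemma dco_al_smm d : dom c (qA (pA d)) -> smm (fun d => al (pA d)) d.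
Proof.
move=> cd; apply: (smm_rowl (dl_D L) (G := de)).
by apply: (vb_xi_smm (dl_D L) (dco_DB hc)); rewrite /= -(dl_sq L).
Qed.

Lemma dmk_smat (Y : space R) (hY : pman Y) (g : Y -> dvM X) (U : Y -> 'rV[R]_ka)
    (V : Y -> 'rV[R]_kb) (W : Y -> 'rV[R]_kc) y :
  smat g y -> dom c (g y) -> smm U y -> smm V y -> smm W y ->
  smat (fun y => dmk al be de (g y) (U y) (V y) (W y)) y.
Proof.
move=> hg cy hU hV hW; apply: (vmk_smat (dl_A L) (dco_DA hc) hY).
- exact: (vmk_smat (dl_M L) (dco_A hc) hY).
- by rewrite /= (vmk_proj (dco_A hc)).
- exact: smm_row_mx.
Qed.

Lemma dco_smatI (Y : space R) (hY : pman Y) (s : Y -> X) y :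
  smat (fun y => qA (pA (s y))) y -> dom c (qA (pA (s y))) -> smm (fun y => al (pA (s y))) y ->
  smm (fun y => be (pB (s y))) y -> smm (fun y => de (s y)) y -> smat s y.
Proof.
move=> hg cy h1 h2 h3; apply: (vb_smatI (dl_A L) (dco_DA hc) hY) => //.
- exact: (vb_smatI (dl_M L) (dco_A hc) hY).
- exact: smm_row_mx.
Qed.

End Given.

(** The chart of [D -> B] is the chart of [D -> A] with the blocks [al] and [be] exchanged, so over
    [B] only linearity in the fibres has to be supplied. *)
Lemma dco_build : vb_chart (opA X) c al -> vb_chart (opB X) c be ->
  vb_chart (opDA X) (chA c al) (fun d => row_mx (be (pB d)) (de d)) ->
  (forall d d', dom c (qB (pB d)) -> pB d = pB d' ->
    al (pA (vadd (opDB X) d d')) = al (pA d) + al (pA d') /\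
    de (vadd (opDB X) d d') = de d + de d') ->
  (forall t d, dom c (qB (pB d)) ->
    al (pA (vscale (opDB X) t d)) = t *: al (pA d) /\ de (vscale (opDB X) t d) = t *: de d) ->
  dco c al be de.
Proof.
move=> hA hB hDA hD hS; split=> //; split.
- exact: (vb_mcharte hB).
- by move=> e e' ce pe; rewrite add_row_mx; have [-> ->] := hD e e' ce pe.
- by move=> t e ce; rewrite scale_row_mx; have [-> ->] := hS t e ce.
- move=> b w /= cb; pose a := vmk (opA X) al (qB b) (lsubmx w).
  have qa : qA a = qB b by rewrite (vmk_proj hA).
  have [|pd xd] := vmkP hDA (m := a) (row_mx (be b) (rsubmx w)); first by rewrite /= qa.
  move/eq_row_mx: xd => [bd dd].
  exists (vmk (opDA X) (fun d => row_mx (be (pB d)) (de d)) a (row_mx (be b) (rsubmx w))).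
    by apply: (vb_inj hB); rewrite -?(dl_sq L) ?pd ?qa.
  by rewrite pd dd (vmk_xi hA)// hsubmxK.
have := mchart_swap (dl_D L) (vb_mcharte hDA).
rewrite (_ : (fun e : X => dom (chA c al) (pA e)) = (fun e => dom (chB c be) (pB e))); last first.
  by apply/funext => e; rewrite /= (dl_sq L).
by apply: mchart_ext => e; rewrite (dl_sq L).
Qed.

End One.

End Dco.

Lemma dco_flip (X : dvb_data R) (c : chart R (dvM X)) ka kb kc (al : dvA X -> 'rV[R]_ka)
  (be : dvB X -> 'rV[R]_kb) (de : X -> 'rV[R]_kc) :
  dco c al be de -> @dco (flip_data X) c kb ka kc be al de.
Proof. by case=> *; split. Qed.

(** * Morphisms of double vector bundles in decomposed coordinates *)

Section Morphisms.
Variables (X Y : dvb_data R) (LX : dlaw X) (LY : dlaw Y).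
Variables (F : X -> Y) (fA : dvA X -> dvA Y) (fB : dvB X -> dvB Y) (fM : dvM X -> dvM Y).

Section Form.
Variables (c : chart R (dvM X)) (ka kb kc : nat) (al : dvA X -> 'rV[R]_ka)
  (be : dvB X -> 'rV[R]_kb) (de : X -> 'rV[R]_kc).
Variables (c' : chart R (dvM Y)) (ka' kb' kc' : nat) (al' : dvA Y -> 'rV[R]_ka')
  (be' : dvB Y -> 'rV[R]_kb') (de' : Y -> 'rV[R]_kc').

(** The general shape of a morphism over [x]: linear on the two sides and on the core, plus a
    bilinear term [W] that measures how far the morphism is from respecting the chosen
    splittings. *)
Definition dform (x : dvM X) (a : 'M[R]_(ka, ka')) (b : 'M[R]_(kb, kb')) (k : 'M[R]_(kc, kc'))
    (W : 'I_kc' -> 'M[R]_(ka, kb)) : Prop :=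
  [/\ forall e, vproj (opA X) e = x -> al' (fA e) = al e *m a,
      forall e, vproj (opB X) e = x -> be' (fB e) = be e *m b &
      forall d, vproj (opA X) (vproj (opDA X) d) = x -> forall j, de' (F d) 0 j =
        (de d *m k) 0 j + dot (al (vproj (opDA X) d) *m W j) (be (vproj (opDB X) d))].

Hypotheses (hc : dco c al be de) (hc' : dco c' al' be' de').

(** The matrix entries are values of [F] on elements whose coordinates are basis vectors or zero;
    these elements depend smoothly on the point, hence so do the entries. *)
Lemma dmor_coord m : dvb_mor F fA fB fM -> dom c m -> dom c' (fM m) ->
  exists a b k W, [/\ smm a m, smm b m, smm k m, forall j, smm (W j) m &
    nearx m (fun x => [/\ dom c x, dom c' (fM x) & dform x (a x) (b x) (k x) (W ^~ x)])].
Proof.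
move=> [FA FB fAM fBM] cm c'm.
have sM : smat fM m by apply: (smooth_smat (dl_M LX) (dl_M LY)); exact: vbm_smooth_base fAM.
have pF d : vproj (opDA Y) (F d) = fA (vproj (opDA X) d) := vbm_proj FA d.
have pF' d : vproj (opDB Y) (F d) = fB (vproj (opDB X) d) := vbm_proj FB d.
have qF e : vproj (opA Y) (fA e) = fM (vproj (opA X) e) := vbm_proj fAM e.
have qF' e : vproj (opB Y) (fB e) = fM (vproj (opB X) e) := vbm_proj fBM e.
pose va x u := vmk (opA X) al x u; pose vb x u := vmk (opB X) be x u.
pose vd x u v w := dmk al be de x u v w.
pose a x : 'M[R]_(ka, ka') := \matrix_(i, j) al' (fA (va x (delta_mx 0 i))) 0 j.
pose b x : 'M[R]_(kb, kb') := \matrix_(i, j) be' (fB (vb x (delta_mx 0 i))) 0 j.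
pose k x : 'M[R]_(kc, kc') := \matrix_(i, j) de' (F (vd x 0 0 (delta_mx 0 i))) 0 j.
pose W j x : 'M[R]_(ka, kb) := \matrix_(i, l) de' (F (vd x (delta_mx 0 i) (delta_mx 0 l) 0)) 0 j.
have sid := smat_id (dl_M LX) m.
have sva u : smat (fun x => va x u) m.
  by apply: (vmk_smat (dl_M LX) (dco_A hc) (dl_M LX) (g := id)) => //; exact: (smm_cst (dl_M LX)).
have svb u : smat (fun x => vb x u) m.
  by apply: (vmk_smat (dl_M LX) (dco_B hc) (dl_M LX) (g := id)) => //; exact: (smm_cst (dl_M LX)).
have svd u v w : smat (fun x => vd x u v w) m.
  by apply: (dmk_smat LX hc (dl_M LX) (g := id)) => //; exact: (smm_cst (dl_M LX)).
have sfA u : smm (fun x => al' (fA (va x u))) m.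
  have s1 : smat (fun x => fA (va x u)) m.
    apply: (smat_comp (dl_M LX) (dl_A LX) (dl_A LY) (sva u)).
    by apply: (smooth_smat (dl_A LX) (dl_A LY)); exact: vbm_smooth fAM.
  apply: (smat_smm (dl_M LX) (dl_A LY) (F := al') s1).
  by apply: (vb_xi_smm (dl_A LY) (dco_A hc')); rewrite qF (vmk_proj (dco_A hc)).
have sfB u : smm (fun x => be' (fB (vb x u))) m.
  have s1 : smat (fun x => fB (vb x u)) m.
    apply: (smat_comp (dl_M LX) (dl_B LX) (dl_B LY) (svb u)).
    by apply: (smooth_smat (dl_B LX) (dl_B LY)); exact: vbm_smooth fBM.
  apply: (smat_smm (dl_M LX) (dl_B LY) (F := be') s1).
  by apply: (vb_xi_smm (dl_B LY) (dco_B hc')); rewrite qF' (vmk_proj (dco_B hc)).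
have sF u v w : smm (fun x => de' (F (vd x u v w))) m.
  have s1 : smat (fun x => F (vd x u v w)) m.
    apply: (smat_comp (dl_M LX) (dl_D LX) (dl_D LY) (svd u v w)).
    by apply: (smooth_smat (dl_D LX) (dl_D LY)); exact: vbm_smooth FA.
  apply: (smat_smm (dl_M LX) (dl_D LY) (F := de') s1).
  by apply: (dco_de_smm LY hc'); rewrite pF qF (dmk_pA hc)// (vmk_proj (dco_A hc)).
exists a, b, k, W; split.
- by move=> i j; apply: (smx_ext (dl_M LX) _ (sfA (delta_mx 0 i) 0 j)) => x; rewrite mxE.
- by move=> i j; apply: (smx_ext (dl_M LX) _ (sfB (delta_mx 0 i) 0 j)) => x; rewrite mxE.
- by move=> i j; apply: (smx_ext (dl_M LX) _ (sF 0 0 (delta_mx 0 i) 0 j)) => x; rewrite mxE.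
- move=> j i l; apply: (smx_ext (dl_M LX) _ (sF (delta_mx 0 i) (delta_mx 0 l) 0 0 j)) => x.
  by rewrite mxE.
have n1 := mchart_nearx (dl_M LX) (vb_mchart (dco_A hc)) cm.
have n2 := smat_near (dl_M LX) (dl_M LY) sM (mchart_nearx (dl_M LY) (vb_mchart (dco_A hc')) c'm).
apply: (nearx2 (dl_M LX) n1 n2) => x cx c'x; split=> //; split.
- move=> e qe; apply/rowP => j; pose f u := al' (fA (va x u)) 0 j.
  have fD u w : f (u + w) = f u + f w.
    rewrite /f /va -(vmkD (dl_vA LX) (dco_A hc))// (vbm_add fAM) ?(vmk_proj (dco_A hc))//.
    by rewrite (vb_xiD (dco_A hc')) ?mxE// !qF !(vmk_proj (dco_A hc)).
  have fZ t u : f (t *: u) = t * f u.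
    rewrite /f /va -(vmkZ (dl_vA LX) (dco_A hc))// (vbm_scale fAM).
    by rewrite (vb_xiZ (dco_A hc')) ?mxE// !qF !(vmk_proj (dco_A hc)).
  have -> : al' (fA e) 0 j = f (al e) by rewrite /f /va (vmk_eta (dco_A hc) cx qe).
  by rewrite (rV_lin fD fZ) mxE dotC; apply: eq_bigr => i _; rewrite !mxE.
- move=> e qe; apply/rowP => j; pose f u := be' (fB (vb x u)) 0 j.
  have fD u w : f (u + w) = f u + f w.
    rewrite /f /vb -(vmkD (dl_vB LX) (dco_B hc))// (vbm_add fBM) ?(vmk_proj (dco_B hc))//.
    by rewrite (vb_xiD (dco_B hc')) ?mxE// !qF' !(vmk_proj (dco_B hc)).
  have fZ t u : f (t *: u) = t * f u.
    rewrite /f /vb -(vmkZ (dl_vB LX) (dco_B hc))// (vbm_scale fBM).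
    by rewrite (vb_xiZ (dco_B hc')) ?mxE// !qF' !(vmk_proj (dco_B hc)).
  have -> : be' (fB e) 0 j = f (be e) by rewrite /f /vb (vmk_eta (dco_B hc) cx qe).
  by rewrite (rV_lin fD fZ) mxE dotC; apply: eq_bigr => i _; rewrite !mxE.
move=> d qd j; pose g u v w := de' (F (vd x u v w)) 0 j.
have cF u v w : dom c' (vproj (opA Y) (vproj (opDA Y) (F (vd x u v w)))).
  by rewrite pF qF (dmk_pA hc)// (vmk_proj (dco_A hc)).
have gDA u v w v' w' : g u (v + v') (w + w') = g u v w + g u v' w'.
  rewrite /g /vd -(dmk_addA LX hc)// (vbm_add FA) ?(dmk_pA hc)//.
  by have [|_ ->] := dco_addA hc' (cF u v w) (d' := F (vd x u v' w')); rewrite ?pF ?(dmk_pA hc) ?mxE.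
have gZA t u v w : g u (t *: v) (t *: w) = t * g u v w.
  rewrite /g /vd -(dmk_scaleA LX hc)// (vbm_scale FA).
  by have [_ ->] := dco_scaleA hc' t (cF u v w); rewrite mxE.
have gDB u v w u' w' : g (u + u') v (w + w') = g u v w + g u' v w'.
  rewrite /g /vd -(dmk_addB LX hc)// (vbm_add FB) ?(dmk_pB LX hc)//.
  by have [|_ ->] := dco_addB LY hc' (cF u v w) (d' := F (vd x u' v w')); rewrite ?pF' ?(dmk_pB LX hc) ?mxE.
have gZB t u v w : g (t *: u) v (t *: w) = t * g u v w.
  rewrite /g /vd -(dmk_scaleB LX hc)// (vbm_scale FB).
  by have [_ ->] := dco_scaleB LY hc' t (cF u v w); rewrite mxE.
have -> : de' (F d) 0 j = g (al (vproj (opDA X) d)) (be (vproj (opDB X) d)) (de d).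
  by rewrite /g /vd (dmk_eta hc cx qd).
set u := al _; set v := be _; set w := de _.
have g0 u0 : g u0 0 0 = 0 by have := gZA 0 u0 0 0; rewrite !scale0r mul0r.
(* Additivity over [A] splits [(v, w)] as [(v, 0) + (0, w)]; additivity over [B] then splits
   [(u, w)] as [(u, 0) + (0, w)], and [g u 0 0] is [0]. *)
have -> : g u v w = g 0 0 w + g u v 0.
  rewrite -{1}(addr0 v) -{1}(add0r w) gDA addrC; congr (_ + _).
  by rewrite -{1}(addr0 u) -{1}(add0r w) gDB g0 add0r.
congr (_ + _).
  rewrite (rV_lin (f := g 0 0)).
  - by rewrite mxE dotC; apply: eq_bigr => i _; rewrite !mxE.
  - by move=> w1 w2; have := gDA 0 0 w1 0 w2; rewrite addr0.
  - by move=> t w1; have := gZA t 0 0 w1; rewrite scaler0.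
rewrite (rV_lin (f := fun v => g u v 0)).
- apply: eq_bigr => l _; congr (_ * _); rewrite !mxE.
  rewrite (rV_lin (f := fun u => g u (delta_mx 0 l) 0)).
  + by rewrite dotC; apply: eq_bigr => i _; rewrite !mxE.
  + by move=> w1 w2; have := gDB w1 (delta_mx 0 l) 0 w2 0; rewrite addr0.
  + by move=> t w1; have := gZB t w1 (delta_mx 0 l) 0; rewrite scaler0.
- by move=> w1 w2; have := gDA u w1 0 w2 0; rewrite addr0.
- by move=> t w1; have := gZA t u w1 0; rewrite scaler0.
Qed.

End Form.

(** Every clause of [dvb_mor] is local over the base. Equalities are checked on coordinates, where
    [dform] turns them into linear algebra, and smoothness comes from that of the matrices. *)
Lemma dmor_of_coord :
  (forall e, vproj (opA Y) (fA e) = fM (vproj (opA X) e)) ->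
  (forall e, vproj (opB Y) (fB e) = fM (vproj (opB X) e)) ->
  (forall d, vproj (opDA Y) (F d) = fA (vproj (opDA X) d)) ->
  (forall d, vproj (opDB Y) (F d) = fB (vproj (opDB X) d)) ->
  (forall m, smat fM m) ->
  (forall m, exists c ka kb kc (al : dvA X -> 'rV[R]_ka) (be : dvB X -> 'rV[R]_kb) (de : X -> 'rV[R]_kc)
      c' ka' kb' kc' (al' : dvA Y -> 'rV[R]_ka') (be' : dvB Y -> 'rV[R]_kb') (de' : Y -> 'rV[R]_kc')
      a b k W,
    [/\ dco c al be de, dco c' al' be' de', dom c m, dom c' (fM m) &
    [/\ smm a m, smm b m, smm k m, forall j, smm (W j) m &
      nearx m (fun x => dform al be de al' be' de' x (a x) (b x) (k x) (W ^~ x))]]) ->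
  dvb_mor F fA fB fM.
Proof.
move=> qF qF' pF pF' sM H.
have sM' : smooth_map fM by apply/(smatP (dl_M LX) (dl_M LY)).
have fAM : vb_mor (opA X) (opA Y) fA fM.
  split=> //.
  - apply/(smatP (dl_A LX) (dl_A LY)) => e.
    have [c [ka [kb [kc [al [be [de [c' [ka' [kb' [kc' [al' [be' [de' [a [b [k [W
      [hc hc' cm c'm [sa _ _ _ nf]]]]]]]]]]]]]]]]]]]] := H (vproj (opA X) e).
    have sq := vb_proj_smat (dl_A LX) (dco_A hc) cm.
    apply: (vb_smatI (dl_M LY) (dco_A hc') (dl_A LX)); last 1 first.
    + have h := smm_mul (dl_A LX) (vb_xi_smm (dl_A LX) (dco_A hc) cm) (smat_smm (dl_A LX) (dl_M LX) sq sa).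
      apply: (smm_eq (dl_A LX) _ h); apply: nearx_sub (smat_near (dl_A LX) (dl_M LX) sq nf) => y [h1 _ _].
      by rewrite h1.
    + apply: (smat_eq (dl_A LX) (s := fun e => fM (vproj (opA X) e))).
        by apply: (nearx_true (dl_A LX)) => y; rewrite qF.
      exact: (smat_comp (dl_A LX) (dl_M LX) (dl_M LY)).
    + by rewrite qF.
  - move=> e e' ee'.
    have [c [ka [kb [kc [al [be [de [c' [ka' [kb' [kc' [al' [be' [de' [a [b [k [W
      [hc hc' cm c'm [_ _ _ _ nf]]]]]]]]]]]]]]]]]]]] := H (vproj (opA X) e).
    have [h1 _ _] := nearx_self nf.
    have E1 : vproj (opA Y) (fA e) = vproj (opA Y) (fA e') by rewrite !qF ee'.
    have E2 := vl_add (dl_vA LX) ee'.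
    apply: (vb_inj (dco_A hc')); first by rewrite qF E2.
      by rewrite qF E2 (vl_add (dl_vA LY))// qF.
    by rewrite (vb_xiD (dco_A hc') _ E1) ?qF// !h1 ?E2 -?ee'// (vb_xiD (dco_A hc) cm ee') mulmxDl.
  - move=> t e.
    have [c [ka [kb [kc [al [be [de [c' [ka' [kb' [kc' [al' [be' [de' [a [b [k [W
      [hc hc' cm c'm [_ _ _ _ nf]]]]]]]]]]]]]]]]]]]] := H (vproj (opA X) e).
    have [h1 _ _] := nearx_self nf.
    have E2 := vl_scale (dl_vA LX) t e.
    apply: (vb_inj (dco_A hc')); first by rewrite qF E2.
      by rewrite qF E2 (vl_scale (dl_vA LY))// qF.
    by rewrite (vb_xiZ (dco_A hc')) ?qF// !h1 ?E2// (vb_xiZ (dco_A hc))// scalemxAl.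
have fBM : vb_mor (opB X) (opB Y) fB fM.
  split=> //.
  - apply/(smatP (dl_B LX) (dl_B LY)) => e.
    have [c [ka [kb [kc [al [be [de [c' [ka' [kb' [kc' [al' [be' [de' [a [b [k [W
      [hc hc' cm c'm [_ sb _ _ nf]]]]]]]]]]]]]]]]]]]] := H (vproj (opB X) e).
    have sq := vb_proj_smat (dl_B LX) (dco_B hc) cm.
    apply: (vb_smatI (dl_M LY) (dco_B hc') (dl_B LX)); last 1 first.
    + have h := smm_mul (dl_B LX) (vb_xi_smm (dl_B LX) (dco_B hc) cm) (smat_smm (dl_B LX) (dl_M LX) sq sb).
      apply: (smm_eq (dl_B LX) _ h); apply: nearx_sub (smat_near (dl_B LX) (dl_M LX) sq nf) => y [_ h1 _].
      by rewrite h1.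
    + apply: (smat_eq (dl_B LX) (s := fun e => fM (vproj (opB X) e))).
        by apply: (nearx_true (dl_B LX)) => y; rewrite qF'.
      exact: (smat_comp (dl_B LX) (dl_M LX) (dl_M LY)).
    + by rewrite qF'.
  - move=> e e' ee'.
    have [c [ka [kb [kc [al [be [de [c' [ka' [kb' [kc' [al' [be' [de' [a [b [k [W
      [hc hc' cm c'm [_ _ _ _ nf]]]]]]]]]]]]]]]]]]]] := H (vproj (opB X) e).
    have [_ h1 _] := nearx_self nf.
    have E1 : vproj (opB Y) (fB e) = vproj (opB Y) (fB e') by rewrite !qF' ee'.
    have E2 := vl_add (dl_vB LX) ee'.
    apply: (vb_inj (dco_B hc')); first by rewrite qF' E2.
      by rewrite qF' E2 (vl_add (dl_vB LY))// qF'.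
    by rewrite (vb_xiD (dco_B hc') _ E1) ?qF'// !h1 ?E2 -?ee'// (vb_xiD (dco_B hc) cm ee') mulmxDl.
  - move=> t e.
    have [c [ka [kb [kc [al [be [de [c' [ka' [kb' [kc' [al' [be' [de' [a [b [k [W
      [hc hc' cm c'm [_ _ _ _ nf]]]]]]]]]]]]]]]]]]]] := H (vproj (opB X) e).
    have [_ h1 _] := nearx_self nf.
    have E2 := vl_scale (dl_vB LX) t e.
    apply: (vb_inj (dco_B hc')); first by rewrite qF' E2.
      by rewrite qF' E2 (vl_scale (dl_vB LY))// qF'.
    by rewrite (vb_xiZ (dco_B hc')) ?qF'// !h1 ?E2// (vb_xiZ (dco_B hc))// scalemxAl.
have sF : smooth_map F.
  apply/(smatP (dl_D LX) (dl_D LY)) => e.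
  have [c [ka [kb [kc [al [be [de [c' [ka' [kb' [kc' [al' [be' [de' [a [b [k [W
    [hc hc' cm c'm [sa sb sk sW nf]]]]]]]]]]]]]]]]]]]] := H (vproj (opA X) (vproj (opDA X) e)).
  have sq := dco_qsmat LX hc cm.
  have nq := smat_near (dl_D LX) (dl_M LX) sq nf.
  have ha := dco_al_smm LX hc cm; have hb := dco_be_smm LX hc cm.
  apply: (dco_smatI LY hc' (dl_D LX)).
  + apply: (smat_eq (dl_D LX) (s := fun e => fM (vproj (opA X) (vproj (opDA X) e)))).
      by apply: (nearx_true (dl_D LX)) => y; rewrite pF qF.
    exact: (smat_comp (dl_D LX) (dl_M LX) (dl_M LY)).
  + by rewrite pF qF.
  + have h := smm_mul (dl_D LX) ha (smat_smm (dl_D LX) (dl_M LX) sq sa).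
    by apply: (smm_eq (dl_D LX) _ h); apply: nearx_sub nq => y [h1 _ _]; rewrite pF h1.
  + have h := smm_mul (dl_D LX) hb (smat_smm (dl_D LX) (dl_M LX) sq sb).
    by apply: (smm_eq (dl_D LX) _ h); apply: nearx_sub nq => y [_ h1 _]; rewrite pF' h1// -(dl_sq LX).
  + have h1 := smm_mul (dl_D LX) (dco_de_smm LX hc cm) (smat_smm (dl_D LX) (dl_M LX) sq sk).
    apply/smm_rV => j.
    have h2 := smm_mul (dl_D LX) ha (smat_smm (dl_D LX) (dl_M LX) sq (sW j)).
    have h3 := smxD (dl_D LX) (h1 0 j) (smx_dot (dl_D LX) h2 hb).
    by apply: (smx_eq (dl_D LX) _ h3); apply: nearx_sub nq => y [_ _ h]; rewrite h.
split=> //; split=> //; try by [exact: vbm_smooth fAM|exact: vbm_smooth fBM].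
- move=> e e' ee'.
  have [c [ka [kb [kc [al [be [de [c' [ka' [kb' [kc' [al' [be' [de' [a [b [k [W
    [hc hc' cm c'm [_ _ _ _ nf]]]]]]]]]]]]]]]]]]]] := H (vproj (opA X) (vproj (opDA X) e)).
  have [h1 h2 h3] := nearx_self nf.
  have E1 : vproj (opDA Y) (F e) = vproj (opDA Y) (F e') by rewrite !pF ee'.
  have E2 := vl_add (dl_vDA LX) ee'; have cF : dom c' (vproj (opA Y) (vproj (opDA Y) (F e))) by rewrite pF qF.
  have [Db Dd] := dco_addA hc cm ee'; have [Fb Fd] := dco_addA hc' cF E1.
  have E3 := vl_add (dl_vDA LY) E1.
  apply: (dco_inj hc'); rewrite ?E3 ?pF ?E2 ?qF// ?pF' ?Fb ?Fd.
    rewrite !pF' !h2 -?(dl_sq LX) ?E2// ?Db ?mulmxDl// -ee' //.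
  apply/rowP => j; rewrite mxE !h3 ?E2 -?ee'// Db Dd dotDr mulmxDl [in LHS]mxE.
  by rewrite addrACA.
- move=> t e.
  have [c [ka [kb [kc [al [be [de [c' [ka' [kb' [kc' [al' [be' [de' [a [b [k [W
    [hc hc' cm c'm [_ _ _ _ nf]]]]]]]]]]]]]]]]]]]] := H (vproj (opA X) (vproj (opDA X) e)).
  have [h1 h2 h3] := nearx_self nf.
  have E2 := vl_scale (dl_vDA LX) t e; have cF : dom c' (vproj (opA Y) (vproj (opDA Y) (F e))) by rewrite pF qF.
  have [Db Dd] := dco_scaleA hc t cm; have [Fb Fd] := dco_scaleA hc' t cF.
  have E3 := vl_scale (dl_vDA LY) t (F e).
  apply: (dco_inj hc'); rewrite ?E3 ?pF ?E2 ?qF// ?pF' ?Fb ?Fd.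
    by rewrite !pF' !h2 -?(dl_sq LX) ?E2// Db scalemxAl.
  apply/rowP => j; rewrite mxE !h3 ?E2// Db Dd dotZr -scalemxAl [in LHS]mxE.
  by rewrite mulrDr.
- move=> e e' ee'.
  have [c [ka [kb [kc [al [be [de [c' [ka' [kb' [kc' [al' [be' [de' [a [b [k [W
    [hc hc' cm c'm [_ _ _ _ nf]]]]]]]]]]]]]]]]]]]] := H (vproj (opA X) (vproj (opDA X) e)).
  have [h1 h2 h3] := nearx_self nf.
  have E1 : vproj (opDB Y) (F e) = vproj (opDB Y) (F e') by rewrite !pF' ee'.
  have E2 := vl_add (dl_vDB LX) ee'; have cF : dom c' (vproj (opA Y) (vproj (opDA Y) (F e))) by rewrite pF qF.
  have [Db Dd] := dco_addB LX hc cm ee'; have [Fb Fd] := dco_addB LY hc' cF E1.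
  have Q := qA_addB LX ee'; have Q' := qA_addB LY E1.
  have Qe : vproj (opA X) (vproj (opDA X) e') = vproj (opA X) (vproj (opDA X) e).
    by rewrite !(dl_sq LX) ee'.
  apply: (dco_inj hc').
  + by rewrite pF qF Q.
  + by rewrite Q' !pF !qF Q.
  + by rewrite Fb !pF !h1// Db mulmxDl.
  + by rewrite (vl_add (dl_vDB LY))// !pF' E2.
  apply/rowP => j; rewrite Fd [RHS]mxE !h3// Db Dd E2 -ee' !mulmxDl dotDl [in LHS]mxE.
  by rewrite addrACA.
- move=> t e.
  have [c [ka [kb [kc [al [be [de [c' [ka' [kb' [kc' [al' [be' [de' [a [b [k [W
    [hc hc' cm c'm [_ _ _ _ nf]]]]]]]]]]]]]]]]]]]] := H (vproj (opA X) (vproj (opDA X) e)).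
  have [h1 h2 h3] := nearx_self nf.
  have E2 := vl_scale (dl_vDB LX) t e; have cF : dom c' (vproj (opA Y) (vproj (opDA Y) (F e))) by rewrite pF qF.
  have [Db Dd] := dco_scaleB LX hc t cm; have [Fb Fd] := dco_scaleB LY hc' t cF.
  have Q := qA_scaleB LX t e; have Q' := qA_scaleB LY t (F e).
  apply: (dco_inj hc').
  + by rewrite pF qF Q.
  + by rewrite Q' !pF !qF Q.
  + by rewrite Fb !pF !h1// Db scalemxAl.
  + by rewrite (vl_scale (dl_vDB LY))// !pF' E2.
  apply/rowP => j; rewrite Fd [RHS]mxE !h3// Db Dd E2 -!scalemxAl dotZl [in LHS]mxE.
  by rewrite mulrDr.
Qed.

End Morphisms.
End DoubleCoordinates.

Definition zlaw (R : realType) (M E : Type) (v : vb_ops R M E) : Prop :=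
  (forall m, vproj v (vzero v m) = m) /\ (forall e, vscale v 0 e = vzero v (vproj v e)).

Lemma vbundle_zlaw (R : realType) (M E : space R) (v : vb_ops R M E) r : is_vbundle r v -> zlaw v.
Proof. by case. Qed.

Lemma xi_vzero (R : realType) (M E : space R) (v : vb_ops R M E) c r (xi : E -> 'rV[R]_r) m :
  vb_chart v c xi -> zlaw v -> dom c m -> xi (vzero v m) = 0.
Proof.
move=> hc [z1 z2] cm; rewrite -[in LHS](z1 m) -z2 (vb_xiZ hc) ?z1//.
exact: scale0r.
Qed.

Lemma vb_zero_eq (R : realType) (M E : space R) (v : vb_ops R M E) c r (xi : E -> 'rV[R]_r) e m :
  vb_chart v c xi -> zlaw v -> dom c m -> vproj v e = m -> xi e = 0 -> e = vzero v m.
Proof.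
move=> hc hz cm pe xe; have [z1 z2] := hz.
by apply: (vb_inj hc); rewrite ?pe ?z1// xe (xi_vzero hc).
Qed.

Lemma clipE (T : Type) (P : T -> Prop) (d : {x | P x}) x : P x -> sval (clip d x) = x.
Proof. by rewrite /clip; case: pselect. Qed.

(** * The core and the dual over A in decomposed coordinates *)

Section Dual.
Variables (R : realType) (D : dvb R).
Let L := dvb_dlaw D.
Notation qA := (vproj (opA D)).
Notation qB := (vproj (opB D)).
Notation pA := (vproj (opDA D)).
Notation pB := (vproj (opDB D)).

Lemma dvb_zlaw : [/\ zlaw (opA D), zlaw (opB D), zlaw (opDA D) & zlaw (opDB D)].
Proof.
case: (dvbP D) => -[a hA] [b hB] [e hDA] [f hDB] *.
by split; [exact: vbundle_zlaw hA|exact: vbundle_zlaw hB|exact: vbundle_zlaw hDA|exact: vbundle_zlaw hDB].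
Qed.

Section Coordinates.
Variables (c : chart R (dvM D)) (ka kb kc : nat) (al : dvA D -> 'rV[R]_ka)
  (be : dvB D -> 'rV[R]_kb) (de : D -> 'rV[R]_kc) (hc : dco c al be de).

Lemma dco_zeroA a : dom c (qA a) -> let d := vzero (opDA D) a in
  [/\ pA d = a, be (pB d) = 0 & de d = 0].
Proof.
move=> ca d; have [_ _ zDA _] := dvb_zlaw; split; first exact: zDA.1.
  have : row_mx (be (pB d)) (de d) = row_mx 0 0.
    by rewrite row_mx0; apply: (xi_vzero (dco_DA hc)).
  by move=> /eq_row_mx [].
have : row_mx (be (pB d)) (de d) = row_mx 0 0.
  by rewrite row_mx0; apply: (xi_vzero (dco_DA hc)).
by move=> /eq_row_mx [].
Qed.

Lemma dco_zeroB b : dom c (qB b) -> let d := vzero (opDB D) b in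
  [/\ pB d = b, al (pA d) = 0 & de d = 0].
Proof.
move=> cb d; have [_ _ _ zDB] := dvb_zlaw; split; first exact: zDB.1.
  have : row_mx (al (pA d)) (de d) = row_mx 0 0.
    by rewrite row_mx0; apply: (xi_vzero (dco_DB hc)).
  by move=> /eq_row_mx [].
have : row_mx (al (pA d)) (de d) = row_mx 0 0.
  by rewrite row_mx0; apply: (xi_vzero (dco_DB hc)).
by move=> /eq_row_mx [].
Qed.

Lemma dco_is_core d : dom c (qA (pA d)) -> is_core d <-> al (pA d) = 0 /\ be (pB d) = 0.
Proof.
move=> cd; have [zA zB _ _] := dvb_zlaw; split=> [[-> ->]|[ad bd]].
  by rewrite zA.1 (xi_vzero (dco_A hc) zA)// (xi_vzero (dco_B hc) zB).
split; first exact: (vb_zero_eq (dco_A hc)).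
by apply: (vb_zero_eq (dco_B hc)); rewrite -?(dl_sq L).
Qed.

Definition core_slice (d : D) : 'rV[R]_((cdim c + kc) + (ka + kb)) :=
  row_mx (row_mx (crd c (qA (pA d))) (de d)) (row_mx (al (pA d)) (be (pB d))).

(** The blocks are reordered so that the core is the vanishing locus of the last one, [(al, be)], as
    a slice chart demands. *)
Lemma core_slice_chart : @slice_chart R D (@is_core R D)
  (Chart (fun x : core D => dom c (qA (pA (sval x)))) (fun x => lsubmx (core_slice (sval x)))).
Proof.
apply: (SliceChart (U := fun d => dom c (qA (pA d)))).
  exact: (mchart_rot (dl_D L) (vb_mcharte (dco_DA hc))).
move=> d cd; rewrite row_mxKr (dco_is_core cd) -[0 in X in _ <-> X]row_mx0.
by split=> [[-> ->]//|/eq_row_mx].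
Qed.

Definition core_xi : core D -> 'rV[R]_kc := fun k => de (sval k).

End Coordinates.

Hypothesis hcov : dcov D.

Lemma pman_core : pman (core D).
Proof.
apply: pman_sub; first exact: dl_D L.
move=> x; have [c [ka [kb [kc [al [be [de [cm hc]]]]]]]] := hcov (qA (pA (sval x))).
by eexists; first exact: (core_slice_chart hc).
Qed.

Lemma core_law : vblaw (core_ops D).
Proof.
have vD := dl_vDA L; have vA := dl_vA L; have [zA _ _ _] := dvb_zlaw.
split=> [k k' /= kk|t k /=].
  rewrite /clip; case: pselect => //= _; rewrite (vl_add vD)//.
  by rewrite (svalP k).1 (svalP k').1 kk.
by rewrite /clip; case: pselect => //= _; rewrite (vl_scale vD).
Qed.

Section CoreCoordinates.
Variables (c : chart R (dvM D)) (ka kb kc : nat) (al : dvA D -> 'rV[R]_ka)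
  (be : dvB D -> 'rV[R]_kb) (de : D -> 'rV[R]_kc) (hc : dco c al be de).

Lemma core_al (k : core D) : dom c (vproj (core_ops D) k) ->
  al (pA (sval k)) = 0 /\ be (pB (sval k)) = 0.
Proof. by move=> ck; apply/(dco_is_core hc) => //; exact: svalP. Qed.

Lemma core_pA (k : core D) : pA (sval k) = vzero (opA D) (vproj (core_ops D) k).
Proof. exact: (svalP k).1. Qed.

Lemma core_mk m w : dom c m -> is_core (dmk al be de m 0 0 w).
Proof. by move=> cm; have [h1 h2 h3 h4] := dmkP hc 0 0 w cm; apply/(dco_is_core hc); rewrite ?h1. Qed.

Lemma core_vb_chart : vb_chart (core_ops D) c (core_xi de).
Proof.
have [_ hm] := pman_core; split.
- exact: vb_mchart (dco_A hc).
- move=> k k' ck kk; rewrite /core_xi.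
  have ck' : dom c (vproj (core_ops D) k') by rewrite -kk.
  have pk : pA (sval k) = pA (sval k') by rewrite !core_pA kk.
  have [a1 b1] := core_al ck; have [a2 b2] := core_al ck'.
  have [h1 h2] := dco_addA hc ck pk.
  have pE := vl_add (dl_vDA L) pk.
  rewrite [sval (vadd _ _ _)]clipE//; apply/(dco_is_core hc); first by rewrite pE.
  by rewrite pE h1 a1 b1 b2 addr0.
- move=> t k ck; rewrite /core_xi; have [a1 b1] := core_al ck.
  have [h1 h2] := dco_scaleA hc t ck; have pE := vl_scale (dl_vDA L) t (sval k).
  rewrite [sval (vscale _ _ _)]clipE//; apply/(dco_is_core hc); first by rewrite pE.
  by rewrite pE h1 a1 b1 scaler0.
- move=> m w cm; exists (exist _ _ (core_mk w cm)); have [h1 h2 h3 h4] := dmkP hc 0 0 w cm.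
    exact: h1.
  exact: h4.
- apply: (mchart_ext _ (hm _ (core_slice_chart hc))) => k.
  by rewrite row_mxKl.
Qed.

End CoreCoordinates.

Lemma core_cov : vbcov (core_ops D).
Proof.
move=> m; have [c [ka [kb [kc [al [be [de [cm hc]]]]]]]] := hcov m.
by exists c, kc, (core_xi de); split=> //; exact: core_vb_chart hc.
Qed.

Lemma DA_cov : vbcov (opDA D).
Proof.
move=> a; have [c [ka [kb [kc [al [be [de [cm hc]]]]]]]] := hcov (qA a).
by eexists _, _, _; split; last exact: (dco_DA hc).
Qed.

Lemma pman_core_dual : pman (core_dual D).
Proof. exact: (pman_dual (dl_M L) pman_core core_law core_cov). Qed.

Lemma pman_DA_dual : pman (dual_space (opDA D)).
Proof. exact: (pman_dual (dl_A L) (dl_D L) (dl_vDA L) DA_cov). Qed.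

Section DualCoordinates.
Variables (c : chart R (dvM D)) (ka kb kc : nat) (al : dvA D -> 'rV[R]_ka)
  (be : dvB D -> 'rV[R]_kb) (de : D -> 'rV[R]_kc) (hc : dco c al be de).

Definition xiDA (d : D) : 'rV[R]_(kb + kc) := row_mx (be (pB d)) (de d).
(** The components of a form along [be] and along [de]: [bs] is the coordinate on the core [B^*] of
    the dual, [gm] the one on its side [C^*]. *)
Definition bs (P : lform (opDA D)) : 'rV[R]_kb := lsubmx (dzeta xiDA P).
Definition gm (P : lform (opDA D)) : 'rV[R]_kc := rsubmx (dzeta xiDA P).

Lemma evE P d : dom c (qA (base P)) -> pA d = base P ->
  ev P d = dot (bs P) (be (pB d)) + dot (gm P) (de d).
Proof.
move=> cP pd; rewrite (dzetaE (dl_vDA L) (dco_DA hc) cP pd) /bs /gm.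
by rewrite -[dzeta _ _]hsubmxK dot_row hsubmxK.
Qed.

Lemma ev_coords P u w : dom c (qA (base P)) ->
  (forall d, pA d = base P -> ev P d = dot u (be (pB d)) + dot w (de d)) -> bs P = u /\ gm P = w.
Proof.
move=> cP h; have -> : bs P = u /\ gm P = w <-> dzeta xiDA P = row_mx u w.
  rewrite /bs /gm; split=> [[<- <-]|->]; first by rewrite hsubmxK.
  by rewrite row_mxKl row_mxKr.
by apply: (dzeta_uniq (dco_DA hc)) => // d pd; rewrite h// dot_row.
Qed.

Lemma form_coord_inj (P P' : lform (opDA D)) : dom c (qA (base P)) -> base P = base P' ->
  bs P = bs P' -> gm P = gm P' -> P = P'.
Proof. by move=> cP bE h1 h2; apply: lform_eq => // d pd; rewrite !evE ?h1 ?h2 -?bE. Qed.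

Lemma base_dA_proj (P : lform (opDA D)) : base (dA_proj P) = qA (base P).
Proof. exact: base_mkform. Qed.

(** The element [0_a +_B c] on which [P] is evaluated has vanishing [be] and the [de] of [c], so
    only the component [gm] contributes. *)
Lemma dA_proj_gm (P : lform (opDA D)) : dom c (qA (base P)) ->
  dzeta (core_xi de) (dA_proj P) = gm P.
Proof.
move=> cP; have hcc := core_vb_chart hc.
apply: (dzeta_uniq hcc); rewrite base_dA_proj// => k pk.
have ck : dom c (vproj (core_ops D) k) by rewrite pk.
have [a1 b1] := core_al hc ck; have [z1 z2 z3] := dco_zeroA hc cP.
set f := fun k : core D => ev P (vadd (opDB D) (vzero (opDA D) (base P)) (sval k)).
have fE k' : vproj (core_ops D) k' = qA (base P) -> f k' = dot (gm P) (core_xi de k').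
  move=> pk'; have ck' : dom c (vproj (core_ops D) k') by rewrite pk'.
  have [a2 b2] := core_al hc ck'.
  have cz : dom c (qA (pA (vzero (opDA D) (base P)))) by rewrite z1.
  have pz : pB (vzero (opDA D) (base P)) = pB (sval k').
    apply: (vb_inj (dco_B hc)); rewrite -?(dl_sq L) ?z1// ?z2 ?b2//.
  have [h1 h2] := dco_addB L hc cz pz.
  have pE : pA (vadd (opDB D) (vzero (opDA D) (base P)) (sval k')) = base P.
    apply: (vb_inj (dco_A hc)); rewrite ?(qA_addB L pz) ?z1//.
    by rewrite h1 z1 a2 addr0.
  rewrite /f evE// h2 z3 add0r (vl_add (dl_vDB L))// z2 dot0r add0r //.
rewrite [ev _ _]ev_mkform//; [exact: fE|exact: core_law|].
split=> [e e' h h'|t e h].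
  rewrite -/(f _) -/(f e) -/(f e') !fE ?(vl_add core_law) ?h ?h'//.
  by rewrite (vb_xiD hcc) ?h ?h'// dotDr.
by rewrite -/(f _) -/(f e) !fE ?(vl_scale core_law) ?h// (vb_xiZ hcc) ?h// dotZr.
Qed.

Lemma dA_zero_coords k : dom c (base k) -> base (dA_zero k) = vzero (opA D) (base k) /\
  (bs (dA_zero k) = 0 /\ gm (dA_zero k) = dzeta (core_xi de) k).
Proof.
move=> ck; have bE : base (dA_zero k) = vzero (opA D) (base k) by exact: base_mkform.
have [zA _ _ _] := dvb_zlaw; have hcc := core_vb_chart hc.
split=> //; apply: ev_coords; first by rewrite bE zA.1.
set f := fun d => ev k (clip (core_zero (base k)) (vadd (opDA D) d
          (vscale (opDA D) (-1) (vzero (opDB D) (pB d))))).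
have fE d : pA d = vzero (opA D) (base k) -> f d = dot (dzeta (core_xi de) k) (de d).
  move=> pd; have qd : qA (pA d) = base k by rewrite pd zA.1.
  have cb : dom c (qB (pB d)) by rewrite -(dl_sq L) qd.
  have [z1 z2 z3] := dco_zeroB hc cb; set z := vzero _ _ in z1 z2 z3 *.
  have qz : qA (pA z) = base k by rewrite (dl_sq L) z1 -(dl_sq L).
  have pz : pA z = pA d.
    apply: (vb_inj (dco_A hc)); rewrite ?qz ?qd// z2 pd.
    by rewrite (xi_vzero (dco_A hc)).
  have cz : dom c (qA (pA z)) by rewrite qz.
  have [s1 s2] := dco_scaleA hc (-1) cz.
  have pz' : pA d = pA (vscale (opDA D) (-1) z) by rewrite (vl_scale (dl_vDA L)).
  have cd : dom c (qA (pA d)) by rewrite qd.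
  have [h1 h2] := dco_addA hc cd pz'.
  have pE := vl_add (dl_vDA L) pz'.
  have kc' : is_core (vadd (opDA D) d (vscale (opDA D) (-1) z)).
    apply/(dco_is_core hc); rewrite pE// h1 s1 z1 scaleN1r subrr; split=> //.
    by rewrite pd (xi_vzero (dco_A hc)).
  rewrite /f (dzetaE core_law hcc)//=; last by rewrite clipE// pE.
  by rewrite /core_xi clipE// h2 s2 z3 scaler0 addr0.
move=> d pd; rewrite bE in pd; rewrite [ev _ _]ev_mkform//; last 2 first.
- exact: dl_vDA L.
- split=> [e e' h h'|t e h].
    rewrite -/(f _) -/(f e) -/(f e') !fE// ?(vl_add (dl_vDA L)) ?h ?h'//.
    have ee' : pA e = pA e' by rewrite h h'.
    have ce : dom c (qA (pA e)) by rewrite h zA.1.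
    have [_ ->] := dco_addA hc ce ee'.
    by rewrite dotDr.
  rewrite -/(f _) -/(f e) !fE ?(vl_scale (dl_vDA L)) ?h//.
  have ce : dom c (qA (pA e)) by rewrite h zA.1.
  have [_ ->] := dco_scaleA hc t ce.
  by rewrite dotZr.
by rewrite -/(f d) fE// dot0l add0r.
Qed.

Lemma dA_add_coords (P P' : lform (opDA D)) : dom c (qA (base P)) -> dA_proj P = dA_proj P' ->
  base (dA_add P P') = vadd (opA D) (base P) (base P') /\
  (bs (dA_add P P') = bs P + bs P' /\ gm (dA_add P P') = gm P).
Proof.
move=> cP PP; have bE : base (dA_add P P') = vadd (opA D) (base P) (base P') by exact: base_mkform.
have qE : qA (base P) = qA (base P') by rewrite -!base_dA_proj PP.
have cP' : dom c (qA (base P')) by rewrite -qE.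
have gE : gm P = gm P' by rewrite -!dA_proj_gm// PP.
have qs : qA (vadd (opA D) (base P) (base P')) = qA (base P) by rewrite (vl_add (dl_vA L)).
split=> //; apply: ev_coords; first by rewrite bE qs.
pose f := fun x : D => xget 0 [set s | exists d d' : D,
       [/\ pA d = base P, pA d' = base P', pB d = pB d',
           x = vadd (opDB D) d d' & s = ev P d + ev P' d']].
have fE x : pA x = vadd (opA D) (base P) (base P') ->
    f x = dot (bs P + bs P') (be (pB x)) + dot (gm P) (de x).
  move=> px; rewrite /f; case: xgetP => [s _ [d [d' [pd pd' pb -> ->]]]|].
    have cd : dom c (qA (pA d)) by rewrite pd.
    have [h1 h2] := dco_addB L hc cd pb.
    rewrite !evE// h2 (vl_add (dl_vDB L))// -pb -gE dotDl dotDr.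
    by rewrite addrACA.
  set q := qA (base P) in cP qE *.
  (* A decomposition of [x] exists: [d] receives the whole core coordinate and [d'] none. The first
     branch has shown that every decomposition gives the same value, because [gm P = gm P']. *)
  pose d := dmk al be de q (al (base P)) (be (pB x)) (de x).
  pose d' := dmk al be de q (al (base P')) (be (pB x)) 0.
  have pd : pA d = base P by rewrite (dmk_pA hc)//; apply: (vmk_eta (dco_A hc)).
  have pd' : pA d' = base P' by rewrite (dmk_pA hc)//; apply: (vmk_eta (dco_A hc)).
  have pb : pB d = pB d' by rewrite !(dmk_pB L hc).
  move=> /(_ (ev P d + ev P' d')) []; exists d, d'; split=> //.
  rewrite /d /d' (dmk_addB L hc)// addr0 -(vb_xiD (dco_A hc))// -px (dmk_eta hc)//.
  by rewrite px qs.
move=> d pd; rewrite bE in pd; rewrite [ev _ _]ev_mkform//; last 2 first.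
- exact: dl_vDA L.
- split=> [e e' h h'|t e h].
    rewrite -/(f _) -/(f e) -/(f e') !fE// ?(vl_add (dl_vDA L)) ?h ?h'//.
    have ee' : pA e = pA e' by rewrite h h'.
    have ce : dom c (qA (pA e)) by rewrite h qs.
    have [-> ->] := dco_addA hc ce ee'.
    by rewrite !dotDr addrACA.
  rewrite -/(f _) -/(f e) !fE ?(vl_scale (dl_vDA L)) ?h//.
  have ce : dom c (qA (pA e)) by rewrite h qs.
  have [-> ->] := dco_scaleA hc t ce.
  by rewrite !dotZr mulrDr.
by rewrite -/(f d) fE.
Qed.

Lemma dA_scale_coords t (P : lform (opDA D)) : dom c (qA (base P)) ->
  base (dA_scale t P) = vscale (opA D) t (base P) /\
  (bs (dA_scale t P) = t *: bs P /\ gm (dA_scale t P) = gm P).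
Proof.
move=> cP; rewrite /dA_scale; have [zA _ _ _] := dvb_zlaw; case: eqVneq => [->|t0].
  have [|h1 [h2 h3]] := @dA_zero_coords (dA_proj P); rewrite ?base_dA_proj//.
  by rewrite h1 h2 h3 base_dA_proj zA.2 scale0r dA_proj_gm.
set f := fun d => t * ev P (vscale (opDB D) t^-1 d).
have qs : qA (vscale (opA D) t (base P)) = qA (base P) by rewrite (vl_scale (dl_vA L)).
have fE x : pA x = vscale (opA D) t (base P) ->
    f x = dot (t *: bs P) (be (pB x)) + dot (gm P) (de x).
  move=> px; have cx : dom c (qA (pA x)) by rewrite px qs.
  have [h1 h2] := dco_scaleB L hc t^-1 cx.
  have pE : pA (vscale (opDB D) t^-1 x) = base P.
    apply: (vb_inj (dco_A hc)); rewrite ?(qA_scaleB L) ?px ?qs//.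
    by rewrite h1 px (vb_xiZ (dco_A hc))// scalerA mulVf// scale1r.
  rewrite /f evE// h2 (vl_scale (dl_vDB L)) dotZr dotZl mulrDr; congr (_ + _).
  by rewrite mulrA mulfV// mul1r.
split; first exact: base_mkform.
apply: ev_coords; rewrite base_mkform ?qs// => d pd; rewrite [ev _ _]ev_mkform//; last 2 first.
- exact: dl_vDA L.
- split=> [e e' h h'|s e h].
    rewrite -/(f _) -/(f e) -/(f e') !fE// ?(vl_add (dl_vDA L)) ?h ?h'//.
    have ee' : pA e = pA e' by rewrite h h'.
    have ce : dom c (qA (pA e)) by rewrite h qs.
    have [-> ->] := dco_addA hc ce ee'.
    by rewrite !dotDr addrACA.
  rewrite -/(f _) -/(f e) !fE ?(vl_scale (dl_vDA L)) ?h//.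
  have ce : dom c (qA (pA e)) by rewrite h qs.
  have [-> ->] := dco_scaleA hc s ce.
  by rewrite !dotZr mulrDr.
by rewrite -/(f d) fE.
Qed.

Lemma dco_dual_pre : [/\ vb_chart (opA (dualA D)) c al,
  vb_chart (opB (dualA D)) c (dzeta (core_xi de)) &
  vb_chart (opDA (dualA D)) (@chA _ (dualA D) c ka al)
    (fun P => row_mx (dzeta (core_xi de) (dA_proj P)) (bs P))].
Proof.
have hcc := core_vb_chart hc.
have h2 : vb_chart (dual_ops (core_ops D)) c (dzeta (core_xi de)).
  exact: (dual_vb_chart (dl_M L) pman_core core_law core_cov hcc).
have h3 : vb_chart (dual_ops (opDA D)) (chA c al) (dzeta xiDA).
  exact: (dual_vb_chart (dl_A L) (dl_D L) (dl_vDA L) DA_cov (dco_DA hc)).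
split=> //; first exact: dco_A hc.
(* [dzeta xiDA] lists the components as [(bs, gm)], whereas in the dual the side coordinate [gm]
   precedes the core coordinate [bs]: the change of coordinates is the exchange of blocks. *)
pose Lm : 'M[R]_(kb + kc, kc + kb) := block_mx 0 1%:M 1%:M 0.
pose Lm' : 'M[R]_(kc + kb, kb + kc) := block_mx 0 1%:M 1%:M 0.
have LE n m (u : 'rV[R]_n) (w : 'rV[R]_m) : row_mx u w *m block_mx 0 1%:M 1%:M 0 = row_mx w u.
  by rewrite mul_row_block !mulmx0 !mulmx1 addr0 add0r.
have L1 n m : (block_mx 0 1%:M 1%:M 0 : 'M[R]_(n + m, m + n)) *m block_mx 0 1%:M 1%:M 0 = 1%:M.
  by rewrite mulmx_block !mulmx0 !mul0mx !mulmx1 !add0r addr0 -scalar_mx_block.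
change (vb_chart (dual_ops (opDA D)) (@chA _ D c ka al)
  (fun P => row_mx (dzeta (core_xi de) (dA_proj P)) (bs P))).
apply: (vb_chart_change (dl_A L) pman_DA_dual (@dual_law _ _ _ (opDA D)) h3
  (L := fun=> Lm) (L' := fun=> Lm')).
- by move=> a ca; split; rewrite ?L1//; exact: (smm_cst (dl_A L)).
- move=> P cP; rewrite dA_proj_gm// -[dzeta xiDA P]hsubmxK LE //.
Qed.

End DualCoordinates.

Lemma dlaw_dual : dlaw (dualA D).
Proof.
split.
- exact: dl_M L.
- exact: dl_A L.
- exact: pman_core_dual.
- exact: pman_DA_dual.
- exact: dl_vA L.
- exact: dual_law.
- exact: dual_law.
- split=> [P P' PP|t P].
    have [c [ka [kb [kc [al [be [de [cm hc]]]]]]]] := hcov (qA (base P)).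
    have [h1 [h2 h3]] := dA_add_coords hc cm PP.
    have q1 : qA (base (dA_add P P')) = qA (base P).
      by rewrite h1 (vl_add (dl_vA L))//; rewrite -!base_dA_proj; congr base.
    have [c1 c2] : dom c (base (dA_proj (dA_add P P'))) /\ dom c (base (dA_proj P)).
      by rewrite !base_dA_proj q1.
    have hz := @dual_vb_chart _ _ _ (dl_M L) pman_core _ core_law core_cov _ _ _ (core_vb_chart hc).
    apply: (vb_inj hz) => //=; first by rewrite !base_dA_proj.
    by rewrite !(dA_proj_gm hc)// q1.
  have [c [ka [kb [kc [al [be [de [cm hc]]]]]]]] := hcov (qA (base P)).
  have [h1 [h2 h3]] := dA_scale_coords hc t cm.
  have q1 : qA (base (dA_scale t P)) = qA (base P) by rewrite h1 (vl_scale (dl_vA L)).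
  have hz := @dual_vb_chart _ _ _ (dl_M L) pman_core _ core_law core_cov _ _ _ (core_vb_chart hc).
  have c1 : dom c (base (dA_proj (dA_scale t P))) by rewrite !base_dA_proj q1.
  apply: (vb_inj hz) => //=; first by rewrite !base_dA_proj.
  by rewrite !(dA_proj_gm hc)// q1.
- by move=> P; rewrite /= base_dA_proj.
Qed.

Lemma dco_dual (c : chart R (dvM D)) ka kb kc (al : dvA D -> 'rV[R]_ka)
    (be : dvB D -> 'rV[R]_kb) (de : D -> 'rV[R]_kc) : dco c al be de ->
  @dco _ (dualA D) c ka kc kb al (dzeta (core_xi de)) (bs be de).
Proof.
move=> hc; have [h1 h2 h3] := dco_dual_pre hc.
apply: (dco_build dlaw_dual) => //.
- move=> P P' /= cP PP; rewrite base_dA_proj in cP.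
  have [e1 [e2 e3]] := dA_add_coords hc cP PP; rewrite [base _]e1 e2.
  rewrite (vb_xiD (dco_A hc))//; by rewrite -!base_dA_proj; congr base.
- move=> t P /= cP; rewrite base_dA_proj in cP.
  have [e1 [e2 e3]] := dA_scale_coords hc t cP; rewrite [base _]e1 e2.
  by rewrite (vb_xiZ (dco_A hc)).
Qed.

End Dual.

Section BundleTools.
Variables (R : realType) (M E : space R) (hM : pman M) (hE : pman E) (v : vb_ops R M E) (hv : vblaw v).

Lemma vb_chart_glue (c : chart R M) r (xi : E -> 'rV[R]_r) : mchart c ->
  (forall m, dom c m -> exists2 d, dom d m & vb_chart v d xi) -> vb_chart v c xi.
Proof.
move=> mc H; split=> //.
- by move=> e e' /H [d dm hd] ee; exact: (vb_xiD hd).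
- by move=> t e /H [d dm hd]; exact: (vb_xiZ hd).
- move=> m w /H [d dm hd]; exists (vmk v xi m w); first exact: (vmk_proj hd).
  exact: (vmk_xi hd).
apply: mchartI => //=.
- move=> e e' /set_mem /= ce /set_mem /= ce' /eq_row_mx [h1 h2].
  have pe := mchart_inj mc ce ce' h1.
  by have [d de hd] := H _ ce; exact: (vb_inj hd).
- move=> e ce; have [d de hd] := H _ ce; have sp := vb_proj_smat hE hd de.
  have [n1 s1] := smat_crd hE hM sp mc ce; split=> // j.
  exact: (smm_row_mx hE s1 (vb_xi_smm hE hd de)).
- move=> e ce; have [d de hd] := H _ ce.
  have [tau [W [oW Wx Ws Wsm WE]]] := mchart_trans hM mc (vb_mchart hd) ce de.
  pose phi (u : 'rV[R]_(cdim c + r)) : 'rV[R]_(cdim d + r) := row_mx (tau (lsubmx u)) (rsubmx u).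
  exists (Chart (fun e => dom d (vproj v e)) (fun e => row_mx (crd d (vproj v e)) (xi e))), phi, [set u : 'rV[R]_(cdim c + r) | W (lsubmx u)]; split.
  + exact: (vb_mcharte hd).
  + by [].
  + apply: (@open_comp _ _ (@lsubmx R 1 (cdim c) r) W) => // u _.
    by apply: smv_cont; exact: smv_lsub.
  + by rewrite /= row_mxKl.
  split.
    apply: smv_row; last exact: smv_rsub.
    by apply: smv_comp; [rewrite row_mxKl; exact: Wsm|exact: smv_lsub].
  move=> u Wu; have [m cm mE] := Ws _ Wu.
  have [dm dE] := WE _ cm (eq_ind_r W Wu mE).
  exists (vmk v xi m (rsubmx u)); rewrite /= (vmk_proj hd)//; split=> //.
    by rewrite (vmk_xi hd)// mE hsubmxK.
  by rewrite (vmk_xi hd)// dE mE.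
Qed.

Lemma vb_chart_sub (c c' : chart R M) r (xi : E -> 'rV[R]_r) : vb_chart v c xi -> mchart c' ->
  dom c' `<=` dom c -> vb_chart v c' xi.
Proof. by move=> hc mc' sub; apply: vb_chart_glue => // m /sub cm; exists c. Qed.

Lemma vb_fiber_lin (c : chart R M) r (xi : E -> 'rV[R]_r) m n (f : E -> 'rV[R]_n) :
  vb_chart v c xi -> dom c m ->
  (forall e e', vproj v e = m -> vproj v e' = m -> f (vadd v e e') = f e + f e') ->
  (forall t e, vproj v e = m -> f (vscale v t e) = t *: f e) ->
  forall e, vproj v e = m -> f e = xi e *m \matrix_(i, j) f (vmk v xi m (delta_mx 0 i)) 0 j.
Proof.
move=> hc cm fD fZ e pe; apply/rowP => j; pose g w := f (vmk v xi m w) 0 j.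
have -> : f e 0 j = g (xi e) by rewrite /g (vmk_eta hc cm pe).
rewrite (rV_lin (f := g)).
- by rewrite mxE dotC; apply: eq_bigr => i _; rewrite !mxE.
- by move=> u w; rewrite /g -(vmkD hv hc)// fD ?(vmk_proj hc)// mxE.
- by move=> t u; rewrite /g -(vmkZ hv hc)// fZ ?(vmk_proj hc)// mxE.
Qed.

End BundleTools.

Section LineDerivatives.
Variable R : realType.
Implicit Types f g : R -> R.

Lemma is_derive_add f g a b : is_derive (0 : R) 1 f a -> is_derive (0 : R) 1 g b ->
  'D_1 (fun t => f t + g t) (0 : R) = a + b.
Proof. by move=> [d1 <-] [d2 <-]; rewrite -deriveD. Qed.

Lemma is_derive_mul f s a : is_derive (0 : R) 1 f a -> 'D_1 (fun t => s * f t) (0 : R) = s * a.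
Proof. by move=> [d1 <-]; rewrite -[RHS]/(s *: _) -deriveZ. Qed.

Lemma derive_near f g : (\forall t \near (0 : R), f t = g t) ->
  'D_1 f (0 : R) = 'D_1 g (0 : R).
Proof. exact: near_eq_derive. Qed.

End LineDerivatives.

(** * Local splittings of double vector bundles *)

Section Splitting.
Variables (R : realType) (D : dvb R).
Let L := dvb_dlaw D.
Notation qA := (vproj (opA D)).
Notation qB := (vproj (opB D)).
Notation pA := (vproj (opDA D)).
Notation pB := (vproj (opDB D)).

(** A zero is [0] times itself, and the scalar [0] can be moved through the other structure; the
    identities about zeros below rest on the same device. *)
Lemma pB_zeroA a : pB (vzero (opDA D) a) = vzero (opB D) (qA a).
Proof.
have [_ zB zDA _] := dvb_zlaw D; have h := dvbP D.
rewrite -[in LHS](zDA.1 a) -zDA.2 (dv_proj_scale h) zB.2 -(dl_sq L).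
by rewrite zDA.1.
Qed.

Lemma pA_zeroB b : pA (vzero (opDB D) b) = vzero (opA D) (qB b).
Proof.
have [zA _ _ zDB] := dvb_zlaw D; have h := dvbP D.
rewrite -[in LHS](zDB.1 b) -zDB.2 (dv_scale_proj h) zA.2 (dl_sq L).
by rewrite zDB.1.
Qed.

Lemma zeroA_add a a' : qA a = qA a' ->
  vzero (opDA D) (vadd (opA D) a a') = vadd (opDB D) (vzero (opDA D) a) (vzero (opDA D) a').
Proof.
move=> qa; have [_ _ zDA _] := dvb_zlaw D; have h := dvbP D.
have pE : pB (vzero (opDA D) a) = pB (vzero (opDA D) a') by rewrite !pB_zeroA qa.
have := dv_add_scale h 0 pE; rewrite !zDA.2 !zDA.1 => <-.
by rewrite (dv_add_proj h)// !zDA.1.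
Qed.

Lemma zeroA_scale t a : vzero (opDA D) (vscale (opA D) t a) = vscale (opDB D) t (vzero (opDA D) a).
Proof.
have [_ _ zDA _] := dvb_zlaw D; have h := dvbP D.
have := dv_scale_scale h t 0 (vzero (opDA D) a); rewrite !zDA.2 !zDA.1 => ->.
by rewrite (dv_scale_proj h) zDA.1.
Qed.

Lemma zeroB_eq x : vzero (opDB D) (vzero (opB D) x) = vzero (opDA D) (vzero (opA D) x).
Proof.
have [zA _ zDA zDB] := dvb_zlaw D.
have E : vscale (opA D) 0 (vzero (opA D) x) = vzero (opA D) x by rewrite zA.2 zA.1.
by rewrite -[in RHS]E zeroA_scale zDB.2 pB_zeroA zA.1.
Qed.

Variables (c : chart R (dvM D)) (ka kb : nat) (al : dvA D -> 'rV[R]_ka) (be : dvB D -> 'rV[R]_kb).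
Hypotheses (hal : vb_chart (opA D) c al) (hbe : vb_chart (opB D) c be).
Variables (cB : chart R (dvB D)) (k : nat) (xi : D -> 'rV[R]_k).
Hypothesis hxi : vb_chart (opDB D) cB xi.
Let oB := vzero (opB D).
Let oA := vzero (opA D).

(** [xi] trivializes [D -> B] over [cB] only, which is arranged around the zero of [B] over one
    point; the splitting is built over the points whose zero still lies there. *)
Definition zdom x := dom c x /\ dom cB (oB x).

Lemma oB_smat x : dom c x -> smat oB x.
Proof.
move=> cx; have [_ zB _ _] := dvb_zlaw D.
apply: (smat_eq (dl_M L) (s := fun x => vmk (opB D) be x 0)).
  apply: (nearx_sub _ (mchart_nearx (dl_M L) (vb_mchart hbe) cx)) => y cy.
  by apply: (vmk_eta hbe); rewrite ?zB.1 ?(xi_vzero hbe).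
apply: (vmk_smat (dl_M L) hbe (dl_M L) (g := id)) => //; first exact: (smat_id (dl_M L)).
exact: (smm_cst (dl_M L)).
Qed.

Lemma zdom_near x : zdom x -> nearx x zdom.
Proof.
move=> [cx bx]; apply: nearxI; first exact: dl_M L.
  exact: (mchart_nearx (dl_M L) (vb_mchart hal) cx).
apply: (smat_near (dl_M L) (dl_B L) (oB_smat cx)).
exact: (mchart_nearx (dl_B L) (vb_mchart hxi) bx).
Qed.

Lemma oA_smat : forall a, smat (vzero (opDA D)) a.
Proof.
move=> a; case: (dvbP D) => _ _ [r hDA] _ *.
have [d [z [da hd]]] := vb_triv hDA a; have [z1 z2] := vbundle_zlaw hDA.
apply: (smat_eq (dl_A L) (s := fun a => vmk (opDA D) z a 0)).
  apply: (nearx_sub _ (mchart_nearx (dl_A L) (vb_mchart hd) da)) => y dy.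
  by apply: (vmk_eta hd); rewrite ?z1 ?(xi_vzero hd).
apply: (vmk_smat (dl_A L) hd (dl_A L) (g := id)) => //; first exact: (smat_id (dl_A L)).
exact: (smm_cst (dl_A L)).
Qed.

(** Over the zero of [B] at [x] the fibre of [D] is the direct sum of [A_x] and the core. [Smx] is
    the projection to [A_x] and [Tmx] the zero section of [D -> A], in coordinates acting on row
    vectors; hence [TS], and the kernel of [Smx x] is the core. *)
Definition Smx x : 'M[R]_(k, ka) := \matrix_(i, j) al (pA (vmk (opDB D) xi (oB x) (delta_mx 0 i))) 0 j.
Definition Tmx x : 'M[R]_(ka, k) :=
  \matrix_(i, j) xi (vzero (opDA D) (vmk (opA D) al x (delta_mx 0 i))) 0 j.

Lemma qAB d x : pB d = oB x -> qA (pA d) = x.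
Proof. by have [_ zB _ _] := dvb_zlaw D; rewrite (dl_sq L) => ->; exact: zB.1. Qed.

Lemma SmxE d x : zdom x -> pB d = oB x -> al (pA d) = xi d *m Smx x.
Proof.
move=> [cx bx]; have h := dvbP D; move: d.
apply: (vb_fiber_lin (dl_vDB L) (f := fun d => al (pA d)) hxi bx) => [e e' pe pe'|t e pe].
  by rewrite (dv_add_proj h) ?pe ?pe'// (vb_xiD hal) ?(qAB pe) ?(qAB pe').
by rewrite (dv_scale_proj h) (vb_xiZ hal) ?(qAB pe).
Qed.

Lemma TmxE a x : zdom x -> qA a = x -> xi (vzero (opDA D) a) = al a *m Tmx x.
Proof.
move=> [cx bx]; move: a.
apply: (vb_fiber_lin (dl_vA L) (f := fun a => xi (vzero (opDA D) a)) hal cx) => [e e' pe pe'|t e pe].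
  by rewrite zeroA_add ?pe ?pe'// (vb_xiD hxi) ?pB_zeroA ?pe ?pe'.
by rewrite zeroA_scale (vb_xiZ hxi) ?pB_zeroA ?pe.
Qed.

Lemma TS x : zdom x -> Tmx x *m Smx x = 1%:M.
Proof.
move=> zx; have [cx bx] := zx; have [_ _ zDA _] := dvb_zlaw D.
apply/row_matrixP => i; rewrite row_mul row1.
pose a := vmk (opA D) al x (delta_mx 0 i).
have qa : qA a = x by rewrite (vmk_proj hal).
have aa : al a = delta_mx 0 i by rewrite (vmk_xi hal).
rewrite rowE -[X in X *m Tmx x]aa -(TmxE zx qa) -(SmxE zx) ?pB_zeroA ?qa// zDA.1 aa //.
Qed.

Lemma Smx_smm x : zdom x -> smm Smx x.
Proof.
move=> [cx bx] i j.
have s1 : smat (fun x => vmk (opDB D) xi (oB x) (delta_mx 0 i)) x.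
  by apply: (vmk_smat (dl_B L) hxi (dl_M L) (oB_smat cx)) => //; exact: (smm_cst (dl_M L)).
have s2 : smat pA (vmk (opDB D) xi (oB x) (delta_mx 0 i)).
  case: (dvbP D) => _ _ [r hDA] _ *.
  have [d [z [da hd]]] := vb_triv hDA (pA (vmk (opDB D) xi (oB x) (delta_mx 0 i))).
  exact: (vb_proj_smat (dl_D L) hd).
have s3 := smat_comp (dl_M L) (dl_D L) (dl_A L) s1 s2.
have s4 : smm al (pA (vmk (opDB D) xi (oB x) (delta_mx 0 i))).
  by apply: (vb_xi_smm (dl_A L) hal); rewrite (qAB (x := x))// (vmk_proj hxi).
by apply: (smx_ext (dl_M L) _ (smat_smm (dl_M L) (dl_A L) s3 s4 0 j)) => y; rewrite mxE.
Qed.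

Lemma Tmx_smm x : zdom x -> smm Tmx x.
Proof.
move=> [cx bx] i j.
have s1 : smat (fun x => vmk (opA D) al x (delta_mx 0 i)) x.
  apply: (vmk_smat (dl_M L) hal (dl_M L) (g := id)) => //; first exact: (smat_id (dl_M L)).
  exact: (smm_cst (dl_M L)).
have s3 := smat_comp (dl_M L) (dl_A L) (dl_D L) s1 (oA_smat _).
have s4 : smm xi (vzero (opDA D) (vmk (opA D) al x (delta_mx 0 i))).
  by apply: (vb_xi_smm (dl_D L) hxi); rewrite pB_zeroA (vmk_proj hal).
by apply: (smx_ext (dl_M L) _ (smat_smm (dl_M L) (dl_D L) s3 s4 0 j)) => y; rewrite mxE.
Qed.

Variables (m : dvM D).
Hypothesis zm : zdom m.

(** The projector onto the core over [x], along the zeros of [D -> A]. *)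
Definition Pmx x : 'M[R]_k := 1%:M - Smx x *m Tmx x.

Lemma Pmx_idem x : zdom x -> Pmx x *m Pmx x = Pmx x.
Proof.
move=> zx; rewrite {2}/Pmx mulmxBr mulmx1 /Pmx mulmxBl mul1mx.
by rewrite -mulmxA [Tmx x *m _]mulmxA TS// mul1mx subrr subr0.
Qed.

Definition kc := \rank (Pmx m).
Definition K0 : 'M[R]_(kc, k) := row_base (Pmx m).

Lemma N0_ex : {N : 'M[R]_(k, kc) | K0 *m N = 1%:M}.
Proof. by apply: cid; apply/row_freeP; exact: row_base_free. Qed.
Definition N0 := sval N0_ex.

(** The rows of [K0] are a basis of the core over [m], with [N0] reading coordinates in it; [Pmx x]
    moves this basis into the core over [x]. [Gmx] is [1] at [m], hence invertible nearby, and there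
    [Nmx x] reads coordinates in the moved basis. *)
Definition Gmx x : 'M[R]_kc := K0 *m Pmx x *m N0.
Definition Nmx x : 'M[R]_(k, kc) := N0 *m invmx (Gmx x).

Lemma Gm : Gmx m = 1%:M.
Proof.
have /submxP [Z KE] : (K0 <= Pmx m)%MS by rewrite /K0 eq_row_base.
rewrite /Gmx; have -> : K0 *m Pmx m = K0 by rewrite KE -mulmxA Pmx_idem.
exact: svalP N0_ex.
Qed.

Definition good x := zdom x /\ Gmx x \in unitmx.

Lemma good_m : good m.
Proof. by split=> //; rewrite Gm unitmx1. Qed.

Lemma Gmx_smm x : zdom x -> smm Gmx x.
Proof.
move=> zx; have hM := dl_M L; apply: (smm_mul hM); last exact: (smm_cst hM).
apply: (smm_mul hM); first exact: (smm_cst hM).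
apply: (smmB hM); first exact: (smm_cst hM).
by apply: (smm_mul hM); [exact: Smx_smm|exact: Tmx_smm].
Qed.

Lemma good_near x : good x -> nearx x good.
Proof.
move=> [zx u]; apply: (nearxI (dl_M L)); first exact: zdom_near.
by have [] := smm_inv (dl_M L) u (Gmx_smm zx).
Qed.

Lemma Nmx_smm x : good x -> smm Nmx x.
Proof.
move=> [zx u]; apply: (smm_mul (dl_M L)); first exact: (smm_cst (dl_M L)).
by have [] := smm_inv (dl_M L) u (Gmx_smm zx).
Qed.

Lemma PN x : good x -> K0 *m Pmx x *m Nmx x = 1%:M.
Proof. by move=> [zx u]; rewrite /Nmx mulmxA mulmxV. Qed.

Lemma PS x : zdom x -> Pmx x *m Smx x = 0.
Proof. by move=> zx; rewrite /Pmx mulmxBl mul1mx -mulmxA TS// mulmx1 subrr. Qed.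

(* [kc] is the rank of the core, since the kernel of [Smx x] has constant rank [k - ka]. *)
Lemma ker_Smx x (u : 'rV[R]_k) : good x -> u *m Smx x = 0 -> u *m Nmx x = 0 -> u = 0.
Proof.
move=> gx uS uN; have [zx _] := gx.
have rkS y : zdom y -> \rank (kermx (Smx y)) = (k - ka)%N.
  move=> zy; rewrite mxrank_ker; congr (_ - _)%N; apply/eqP; rewrite eqn_leq rank_leq_col /=.
  by have := mxrankM_maxr (Tmx y) (Smx y); rewrite TS// mxrank1.
have kcE : kc = (k - ka)%N.
  rewrite -(rkS m zm) /kc; apply/eqP; rewrite eqn_leq; apply/andP; split; apply: mxrankS.
    by apply/sub_kermxP; exact: PS.
  apply/submxP; exists (kermx (Smx m)); rewrite /Pmx mulmxBr mulmx1 mulmxA mulmx_ker mul0mx subr0 //.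
have sub : (K0 *m Pmx x <= kermx (Smx x))%MS by apply/sub_kermxP; rewrite -mulmxA PS// mulmx0.
have rk : \rank (K0 *m Pmx x) = kc.
  apply/eqP; rewrite eqn_leq rank_leq_row /=.
  by have := mxrankM_maxl (K0 *m Pmx x) (Nmx x); rewrite PN// mxrank1.
have : (kermx (Smx x) <= K0 *m Pmx x)%MS.
  by have [_ <-] := mxrank_leqif_sup sub; rewrite rk rkS// kcE.
have /submx_trans h : (u <= kermx (Smx x))%MS by apply/sub_kermxP.
move=> /h /submxP [w uE]; move: uN; rewrite uE -mulmxA PN// mulmx1 => ->.
by rewrite mul0mx.
Qed.

(** A core coordinate for [d]: from [xi d] the contribution that the zero of [D -> A] at [pA d]
    would have over the zero of [B] is subtracted, and the rest is read by [Nmx]. *)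
Definition th (d : D) : 'rV[R]_kc :=
  (xi d - al (pA d) *m Tmx (qA (pA d))) *m Nmx (qA (pA d)).

Lemma thD d d' : dom cB (pB d) -> dom c (qA (pA d)) -> pB d = pB d' ->
  th (vadd (opDB D) d d') = th d + th d'.
Proof.
move=> bd cd dd; have h := dvbP D.
have qd : qA (pA d) = qA (pA d') by rewrite !(dl_sq L) dd.
rewrite /th (vb_xiD hxi)// (dv_add_proj h)// (vl_add (dl_vA L))// (vb_xiD hal)// -qd.
by rewrite [(_ + _) *m Tmx _]mulmxDl opprD addrACA mulmxDl.
Qed.

Lemma thZ t d : dom cB (pB d) -> dom c (qA (pA d)) ->
  th (vscale (opDB D) t d) = t *: th d.
Proof.
move=> bd cd; have h := dvbP D.
rewrite /th (vb_xiZ hxi)// (dv_scale_proj h) (vl_scale (dl_vA L)) (vb_xiZ hal)//.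
by rewrite -scalemxAl -scalerBr scalemxAl.
Qed.

Lemma pA_smat d : smat pA d.
Proof.
case: (dvbP D) => _ _ [r hDA] _ *; have [d' [z [da hd]]] := vb_triv hDA (pA d).
exact: (vb_proj_smat (dl_D L) hd).
Qed.

Lemma pB_smat d : smat pB d.
Proof.
case: (dvbP D) => _ _ _ [r hDB] *; have [d' [z [da hd]]] := vb_triv hDB (pB d).
exact: (vb_proj_smat (dl_D L) hd).
Qed.

Lemma th_smm d : dom cB (pB d) -> good (qA (pA d)) -> smm th d.
Proof.
move=> bd gd; have [[cx bx] _] := gd; have hD := dl_D L.
have sq := smat_comp hD (dl_A L) (dl_M L) (pA_smat d) (vb_proj_smat (dl_A L) hal cx).
apply: (smm_mul hD); last exact: (smat_smm hD (dl_M L) sq (Nmx_smm gd)).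
apply: (smmB hD); first exact: (vb_xi_smm hD hxi).
apply: (smm_mul hD).
  exact: (smat_smm hD (dl_A L) (pA_smat d) (vb_xi_smm (dl_A L) hal cx)).
by apply: (smat_smm hD (dl_M L) sq); apply: Tmx_smm; case: gd.
Qed.

(* [th] is linear along the fibres of [D -> B] only; its derivative along those of [D -> A] at the zero
   section is linear for both structures. *)
Definition thl (d : D) : 'rV[R]_kc :=
  \row_j 'D_1 (fun t : R => th (vscale (opDA D) t d) 0 j) (0 : R).

(** In the chart of [D] defined by [z], scaling is a straight line through the coordinates of the
    zero vector, near which [th] is smooth. The derivative along this line is linear in [z d], with
    the partial derivatives in the fibre directions as matrix [H]. *)
Lemma thl_chart (cA : chart R (dvA D)) r (z : D -> 'rV[R]_r) a0 :
  vb_chart (opDA D) cA z -> dom cA a0 -> good (qA a0) ->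
  exists H : dvA D -> 'M[R]_(r, kc), smm H a0 /\ nearx a0 (fun a => dom cA a /\
    forall d, pA d = a -> forall j,
      is_derive (0 : R) 1 (fun t : R => th (vscale (opDA D) t d) 0 j) ((z d *m H a) 0 j)).
Proof.
move=> hz ca ga; have [_ _ zDA _] := dvb_zlaw D; have [[cx bx] _] := ga.
have mc := vb_mcharte hz; set cD := Chart _ _ in mc.
have cz0 : dom cD (vzero (opDA D) a0) by rewrite /= zDA.1.
pose g j := @chread _ _ cD (fun d => th d 0 j).
pose n := cdim cA.
pose lf (a : dvA D) : 'rV[R]_(n + r) := row_mx (crd cA a) 0.
have lf0 : crd cD (vzero (opDA D) a0) = lf a0 by rewrite /= zDA.1 (xi_vzero hz).
have sg j : sm (g j) (lf a0).
  rewrite -lf0; apply/(smx_chart (dl_D L)) => //.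
  by apply: th_smm; rewrite ?zDA.1// pB_zeroA.
have slf : smm lf a0.
  apply: (smm_row_mx (dl_A L)); last exact: (smm_cst (dl_A L)).
  exact: (smm_crd (dl_A L) (vb_mchart hz)).
pose H a : 'M[R]_(r, kc) := \matrix_(i, j) 'D_(delta_mx 0 (rshift n i)) (g j) (lf a).
exists H; split.
  move=> i j; apply: (smx_ext (dl_A L) (f := fun a => 'D_(delta_mx 0 (rshift n i)) (g j) (lf a))).
    by move=> a; rewrite mxE.
  apply: (smx_comp (dl_A L) (g := fun v => 'D_(delta_mx 0 (rshift n i)) (g j) v)).
    exact: sm_partial.
  by move=> l; exact: slf.
have /nbhs_open [W [oW Wx WA]] : \forall v \near lf a0, forall j, sm (g j) v.
  by apply: (@filter_forall _ _ _ (nbhs (lf a0))) => j; exact: sm_near.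
have n1 := smx_open (dl_A L) oW Wx (fun j => slf 0 j).
apply: (nearx2 (dl_A L) n1 (mchart_nearx (dl_A L) (vb_mchart hz) ca)) => a Wa ca'; split=> // d pd j.
have dg : differentiable (g j) (lf a) by apply: sm_diff; exact: WA.
pose w : 'rV[R]_(n + r) := row_mx 0 (z d).
have E t : th (vscale (opDA D) t d) 0 j = g j (t *: w + lf a).
  have pE : pA (vscale (opDA D) t d) = a by rewrite (vl_scale (dl_vDA L)).
  have cE : crd cD (vscale (opDA D) t d) = t *: w + lf a.
    by rewrite /= pE (vb_xiZ hz) ?pd// scale_row_mx add_row_mx scaler0 add0r addr0.
  by rewrite -cE /g chreadE//= pE.
have -> : (fun t : R => th (vscale (opDA D) t d) 0 j) = (fun t => g j (t *: w + lf a)).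
  exact/funext.
have := @derivable_line _ _ (g j) (lf a) w 0; rewrite scale0r add0r => h.
have -> : (z d *m H a) 0 j = 'D_w (g j) (lf a); last by apply: h; exact: diff_derivable.
rewrite diffE_partial// big_split_ord /= big1 ?add0r; last first.
  by move=> i _; rewrite row_mxEl mxE mul0r.
by rewrite mxE; apply: eq_bigr => i _; rewrite row_mxEr mxE.
Qed.

Lemma thl_derive d j : good (qA (pA d)) ->
  is_derive (0 : R) 1 (fun t : R => th (vscale (opDA D) t d) 0 j) (thl d 0 j).
Proof.
move=> gd; case: (dvbP D) => _ _ [r hDA] _ *; have [cA [z [da hd]]] := vb_triv hDA (pA d).
have [H [_ /nearx_self [_ h]]] := thl_chart hd da gd.
have [hd1 hd2] := h d erefl j.
by rewrite /thl mxE; exact: DeriveDef.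
Qed.

Lemma thl_lin (cA : chart R (dvA D)) r (z : D -> 'rV[R]_r) a0 :
  vb_chart (opDA D) cA z -> dom cA a0 -> good (qA a0) ->
  exists H : dvA D -> 'M[R]_(r, kc), smm H a0 /\ nearx a0 (fun a => dom cA a /\
    forall d, pA d = a -> thl d = z d *m H a).
Proof.
move=> hz ca ga; have [H [sH nH]] := thl_chart hz ca ga; exists H; split=> //.
apply: nearx_sub nH => a [ca' h]; split=> // d pd; apply/rowP => j.
by have [_ <-] := h d pd j; rewrite mxE.
Qed.

(** [b] itself may lie far outside [cB], but [t b] enters it for small [t]. This is why
    differentiating at [t = 0] produces a coordinate on all of [D] over the good points, and not
    only near the zeros of [B]. *)
Lemma scale_near b : dom c (qB b) -> dom cB (oB (qB b)) ->
  \forall t \near (0 : R), dom cB (vscale (opB D) t b).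
Proof.
move=> cb zb; have [_ zB _ _] := dvb_zlaw D; have mb := vb_mcharte hbe.
have cz : dom (Chart (fun e => dom c (qB e)) (fun e => row_mx (crd c (qB e)) (be e))) (oB (qB b)).
  by rewrite /= zB.1.
have nb := mchart_nearx (dl_B L) (vb_mchart hxi) zb.
have [W [oW Wx Ws WA]] := (nearx_chart (dl_B L) _ mb cz).1 nb.
pose l (t : R) : 'rV[R]_(cdim c + kb) := t *: row_mx 0 (be b) + row_mx (crd c (qB b)) 0.
have l0 : l 0 = row_mx (crd c (qB (oB (qB b)))) (be (oB (qB b))).
  by rewrite /l scale0r add0r zB.1 (xi_vzero hbe).
have cl : {for 0, continuous l}.
  by apply: (@cvgD _ _ _ (nbhs (0 : R))); [apply: (@cvgZr_tmp _ _ _ (nbhs (0 : R))); exact: cvg_id|exact: cvg_cst].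
have : \forall t \near (0 : R), W (l t).
  by apply: cl; rewrite l0; exact: open_nbhs_nbhs.
apply: filterS => t; rewrite /l scale_row_mx add_row_mx scaler0 add0r addr0 => Wt.
by apply: WA => /=; rewrite (vl_scale (dl_vB L))// (vb_xiZ hbe).
Qed.

Lemma thlE d j : thl d 0 j = 'D_1 (fun t : R => th (vscale (opDA D) t d) 0 j) (0 : R).
Proof. by rewrite mxE. Qed.

(** By the interchange law [t (d +_B d') = t d +_B t d']; for small [t] these elements lie over
    [cB], where [th] is additive, and the identity is differentiated at [0]. *)
Lemma thlD d d' : good (qA (pA d)) -> pB d = pB d' ->
  thl (vadd (opDB D) d d') = thl d + thl d'.
Proof.
move=> gd dd; have h := dvbP D; have [[cd zd] _] := gd.
have qd : qA (pA d') = qA (pA d) by rewrite !(dl_sq L) dd.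
have gd' : good (qA (pA d')) by rewrite qd.
apply/rowP => j; rewrite [RHS]mxE [LHS]thlE.
apply: etrans (is_derive_add (thl_derive j gd) (thl_derive j gd')).
apply: derive_near; rewrite (dl_sq L) in cd zd.
apply: filterS (scale_near cd zd) => t bt.
rewrite (dv_add_scale h)// thD.
- by rewrite [LHS]mxE.
- by rewrite (dv_proj_scale h).
- by rewrite (vl_scale (dl_vDA L)) (dl_sq L).
- by rewrite !(dv_proj_scale h) dd.
Qed.

Lemma thlZ s d : good (qA (pA d)) -> thl (vscale (opDB D) s d) = s *: thl d.
Proof.
move=> gd; have h := dvbP D; have [[cd zd] _] := gd.
apply/rowP => j; rewrite [RHS]mxE [LHS]thlE.
apply: etrans (is_derive_mul s (thl_derive j gd)).
apply: derive_near; rewrite (dl_sq L) in cd zd.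
apply: filterS (scale_near cd zd) => t bt.
rewrite -(dv_scale_scale h) thZ.
- by rewrite [LHS]mxE.
- by rewrite (dv_proj_scale h).
- by rewrite (vl_scale (dl_vDA L)) (dl_sq L).
Qed.

Lemma add_zeroA d : vadd (opDA D) d (vzero (opDA D) (pA d)) = d.
Proof.
case: (dvbP D) => _ _ [r hDA] _ *; have [cA [z [da hd]]] := vb_triv hDA (pA d).
have [z1 z2] := vbundle_zlaw hDA; have vl := vbundle_law hDA.
have pd : pA d = pA (vzero (opDA D) (pA d)) by rewrite z1.
apply: (vb_inj hd); rewrite ?(vl_add vl)// (vb_xiD hd)// (xi_vzero hd)// addr0 //.
Qed.

Lemma add_zeroA' d : vadd (opDA D) (vzero (opDA D) (pA d)) d = d.
Proof.
case: (dvbP D) => _ _ [r hDA] _ *; have [cA [z [da hd]]] := vb_triv hDA (pA d).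
have [z1 z2] := vbundle_zlaw hDA; have vl := vbundle_law hDA.
have pd : pA (vzero (opDA D) (pA d)) = pA d by rewrite z1.
by apply: (vb_inj hd); rewrite ?(vl_add vl)// ?z1// (vb_xiD hd) ?z1// (xi_vzero hd)// add0r.
Qed.

Lemma add_zeroB d : vadd (opDB D) d (vzero (opDB D) (pB d)) = d.
Proof.
case: (dvbP D) => _ _ _ [r hDA] *; have [cA [z [da hd]]] := vb_triv hDA (pB d).
have [z1 z2] := vbundle_zlaw hDA; have vl := vbundle_law hDA.
have pd : pB d = pB (vzero (opDB D) (pB d)) by rewrite z1.
apply: (vb_inj hd); rewrite ?(vl_add vl)// (vb_xiD hd)// (xi_vzero hd)// addr0 //.
Qed.

Lemma add_zeroB' d : vadd (opDB D) (vzero (opDB D) (pB d)) d = d.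
Proof.
case: (dvbP D) => _ _ _ [r hDA] *; have [cA [z [da hd]]] := vb_triv hDA (pB d).
have [z1 z2] := vbundle_zlaw hDA; have vl := vbundle_law hDA.
have pd : pB (vzero (opDB D) (pB d)) = pB d by rewrite z1.
by apply: (vb_inj hd); rewrite ?(vl_add vl)// ?z1// (vb_xiD hd) ?z1// (xi_vzero hd)// add0r.
Qed.

(** The Eckmann-Hilton argument: the interchange law is applied to [d, o, o, d'], with [o] the
    common zero of both structures. *)
Lemma core_addE d d' x : pA d = oA x -> pA d' = oA x -> pB d = oB x -> pB d' = oB x ->
  vadd (opDA D) d d' = vadd (opDB D) d d'.
Proof.
move=> a1 a2 b1 b2; have h := dvbP D; pose o := vzero (opDA D) (oA x).
have [zA zB zDA zDB] := dvb_zlaw D.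
have oE : o = vzero (opDB D) (oB x) := esym (zeroB_eq x).
have pAo : pA o = oA x by rewrite /o zDA.1.
have pBo : pB o = oB x by rewrite oE zDB.1.
have := @dv_add_add _ _ h d o o d'; rewrite a1 a2 b1 b2 pAo pBo => /(_ erefl erefl erefl erefl).
have -> : vadd (opDB D) d o = d by rewrite oE -b1 add_zeroB.
have -> : vadd (opDB D) o d' = d' by rewrite oE -b2 add_zeroB'.
have -> : vadd (opDA D) d o = d by rewrite /o -a1 add_zeroA.
by have -> : vadd (opDA D) o d' = d' by rewrite /o -a2 add_zeroA'.
Qed.

Lemma scaleDA s t d : vscale (opDA D) (s + t) d = vadd (opDA D) (vscale (opDA D) s d) (vscale (opDA D) t d).
Proof.
case: (dvbP D) => _ _ [r hDA] _ *; have [cA [z [da hd]]] := vb_triv hDA (pA d).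
have vl := vbundle_law hDA.
apply: (vb_inj hd); rewrite ?(vl_add vl) ?(vl_scale vl)// (vb_xiD hd) ?(vl_scale vl)//.
by rewrite !(vb_xiZ hd)// scalerDl.
Qed.

(* On the core [t |-> th (t d)] is additive and differentiable at [0], hence linear. *)
Lemma thl_core d x : good x -> pA d = oA x -> pB d = oB x -> thl d = th d.
Proof.
move=> gx ad bd; have h := dvbP D; have [[cx zx] _] := gx; have [zA zB _ _] := dvb_zlaw D.
have gd : good (qA (pA d)) by rewrite ad zA.1.
apply/rowP => j; pose f t := th (vscale (opDA D) t d) 0 j.
have pA' t : pA (vscale (opDA D) t d) = oA x by rewrite (vl_scale (dl_vDA L)).
have pB' t : pB (vscale (opDA D) t d) = oB x.
  rewrite (dv_proj_scale h) bd; apply: (vb_inj hbe); rewrite ?(vl_scale (dl_vB L)) ?zB.1//.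
  by rewrite (vb_xiZ hbe) ?zB.1// (xi_vzero hbe)// scaler0.
have fD s t : f (s + t) = f s + f t.
  rewrite /f scaleDA (core_addE (pA' _) (pA' _) (pB' _) (pB' _)) thD ?mxE ?pB' ?pA'//.
  by rewrite zA.1.
have f0 : f 0 = 0 by have := fD 0 0; rewrite addr0 => /eqP; rewrite -subr_eq0 opprD addNKr oppr_eq0 => /eqP.
have fn n t : f (n%:R * t) = n%:R * f t.
  elim: n => [|n IH]; first by rewrite !mul0r.
  by rewrite -addn1 natrD !mulrDl !mul1r fD IH.
have f1 : f 1 = th d 0 j.
  rewrite /f; congr (th _ 0 j).
  case: (dvbP D) => _ _ [r hDA] _ *; have [cA [z [da hd]]] := vb_triv hDA (pA d).
  by apply: (vb_inj hd); rewrite ?(vl_scale (vbundle_law hDA))// (vb_xiZ hd)// scale1r.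
have [D1 E1] := thl_derive j gd; rewrite -/f in D1 E1.
have /cvgrPdist_lt cv : h^-1 *: (f (h *: 1 + 0) - f 0) @[h --> 0^'] --> 'D_1 f (0 : R) by exact: D1.
rewrite -f1 -E1; apply/eqP; rewrite -subr_eq0 -normr_le0; apply/ler_addgt0Pl => e e0.
rewrite addr0; apply: ltW; have := cv _ e0; rewrite /dnbhs /within /= => /nbhs_ballP [r /= r0 hr].
(* The difference quotient is sampled at [1/(n+1)], where additivity makes it exactly [f 1]. *)
have [n] := @ltr_add_invr R 0 r r0; rewrite add0r => nr.
have n0 : (n.+1%:R : R) != 0 by rewrite pnatr_eq0.
have := hr n.+1%:R^-1; rewrite -ball_normE /ball_ /= sub0r normrN gtr0_norm ?invr_gt0// => /(_ nr).
rewrite invr_eq0 => /(_ n0); rewrite invrK f0 subr0 addr0.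
by rewrite -[_ *: 1]/(_ * 1) mulr1 -[_ *: f _]/(_ * _) -fn mulfV.
Qed.

Lemma core_ex x w : good x -> exists d, [/\ pA d = oA x, pB d = oB x & th d = w].
Proof.
move=> gx; have [zx _] := gx; have [cx bx] := zx; have [zA zB _ _] := dvb_zlaw D.
pose u := w *m (K0 *m Pmx x); pose d := vmk (opDB D) xi (oB x) u.
have bd : pB d = oB x by rewrite (vmk_proj hxi).
have xd : xi d = u by rewrite (vmk_xi hxi).
have qd := qAB bd.
have ad : al (pA d) = 0 by rewrite (SmxE zx bd) xd /u -!mulmxA PS// !mulmx0.
exists d; split=> //; first exact: (vb_zero_eq hal zA).
by rewrite /th qd ad mul0mx subr0 xd /u -mulmxA PN// mulmx1.
Qed.

Lemma core_inj x d : good x -> pA d = oA x -> pB d = oB x -> th d = 0 -> d = vzero (opDA D) (oA x).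
Proof.
move=> gx ad bd; have [zx _] := gx; have [cx bx] := zx; have [zA zB _ zDB] := dvb_zlaw D.
have a0 : al (pA d) = 0 by rewrite ad (xi_vzero hal).
rewrite /th a0 mul0mx subr0 (qAB bd) => xN.
rewrite /oA -zeroB_eq; apply: (vb_zero_eq hxi zDB) => //.
by apply: (ker_Smx gx) => //; rewrite -(SmxE zx bd).
Qed.

Lemma thl_zeroA a : good (qA a) -> thl (vzero (opDA D) a) = 0.
Proof.
move=> ga; case: (dvbP D) => _ _ [r hDA] _ *; have [cA [z [da hd]]] := vb_triv hDA a.
have [z1 z2] := vbundle_zlaw hDA.
have [H [_ /nearx_self [_ h]]] := thl_lin hd da ga.
by rewrite (h _ (z1 _)) (xi_vzero hd)// mul0mx.
Qed.

(** Subtracting over [B] the zero of [D -> A] at [pA d] lands in the core, where [thl] agrees with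
    [th], which is injective there. *)
Lemma thl_inj d : good (qA (pA d)) -> be (pB d) = 0 -> thl d = 0 -> d = vzero (opDA D) (pA d).
Proof.
move=> gd bd td; have h := dvbP D; have [[cx zx] _] := gd; have [zA zB zDA zDB] := dvb_zlaw D.
set x := qA (pA d) in gd cx zx *.
have bd' : pB d = oB x by apply: (vb_zero_eq hbe zB); rewrite -?(dl_sq L).
pose o := vzero (opDA D) (pA d); pose e := vadd (opDB D) d (vscale (opDB D) (-1) o).
have po : pB o = oB x by rewrite pB_zeroA.
have so : pB (vscale (opDB D) (-1) o) = oB x by rewrite (vl_scale (dl_vDB L)).
have dso : pB d = pB (vscale (opDB D) (-1) o) by rewrite so.
have qso : qA (vscale (opA D) (-1) (pA d)) = x by rewrite (vl_scale (dl_vA L)).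
have pe : pA e = oA x.
  rewrite (dv_add_proj h)// (dv_scale_proj h) zDA.1.
  have qE : qA (pA d) = qA (vscale (opA D) (-1) (pA d)) by rewrite qso.
  apply: (vb_zero_eq hal zA) => //; first by rewrite (vl_add (dl_vA L)).
  by rewrite (vb_xiD hal)// (vb_xiZ hal)// scaleN1r subrr.
have pe' : pB e = oB x by rewrite (vl_add (dl_vDB L)).
have go : good (qA (pA o)) by rewrite zDA.1.
have te : thl e = 0 by rewrite thlD// thlZ// thl_zeroA// td scaler0 addr0.
rewrite (thl_core gd pe pe') in te.
have e0 := core_inj gd pe pe' te.
apply: (vb_inj hxi); rewrite ?bd' ?po//.
have : xi e = 0 by rewrite e0 /oA -zeroB_eq (xi_vzero hxi).
by rewrite (vb_xiD hxi) ?bd'// (vb_xiZ hxi) ?po// scaleN1r => /eqP; rewrite subr_eq0 => /eqP.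
Qed.

Lemma thl_zeroB b : good (qB b) -> thl (vzero (opDB D) b) = 0.
Proof.
move=> gb; have [_ _ _ zDB] := dvb_zlaw D.
have go : good (qA (pA (vzero (opDB D) b))) by rewrite (dl_sq L) zDB.1.
by rewrite -[in LHS](zDB.1 b) -zDB.2 thlZ// scale0r.
Qed.

Lemma be_lin (cA : chart R (dvA D)) r (z : D -> 'rV[R]_r) a0 :
  vb_chart (opDA D) cA z -> dom cA a0 -> dom c (qA a0) ->
  exists H : dvA D -> 'M[R]_(r, kb), smm H a0 /\ nearx a0 (fun a => dom cA a /\
    forall d, pA d = a -> be (pB d) = z d *m H a).
Proof.
move=> hz ca cx; have h := dvbP D.
exists (fun a => \matrix_(i, j) be (pB (vmk (opDA D) z a (delta_mx 0 i))) 0 j); split.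
  move=> i j.
  have s1 : smat (fun a => vmk (opDA D) z a (delta_mx 0 i)) a0.
    apply: (vmk_smat (dl_A L) hz (dl_A L) (g := id)) => //; first exact: (smat_id (dl_A L)).
    exact: (smm_cst (dl_A L)).
  have s2 := smat_comp (dl_A L) (dl_D L) (dl_B L) s1 (pB_smat _).
  have s3 : smm be (pB (vmk (opDA D) z a0 (delta_mx 0 i))).
    by apply: (vb_xi_smm (dl_B L) hbe); rewrite -(dl_sq L) (vmk_proj hz).
  by apply: (smx_ext (dl_A L) _ (smat_smm (dl_A L) (dl_B L) s2 s3 0 j)) => y; rewrite mxE.
have n2 := smat_near (dl_A L) (dl_M L) (vb_proj_smat (dl_A L) hal cx)
  (mchart_nearx (dl_M L) (vb_mchart hal) cx).
apply: (nearx2 (dl_A L) (mchart_nearx (dl_A L) (vb_mchart hz) ca) n2) => a ca' cx'; split=> //.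
apply: (vb_fiber_lin (dl_vDA L) (f := fun d => be (pB d)) hz ca') => [e e' pe pe'|t e pe].
  by rewrite (dv_proj_add h) ?pe ?pe'// (vb_xiD hbe) -?(dl_sq L) ?pe ?pe'.
by rewrite (dv_proj_scale h) (vb_xiZ hbe) -?(dl_sq L) ?pe.
Qed.

Lemma lin_both (cA : chart R (dvA D)) r (z : D -> 'rV[R]_r) a0 :
  vb_chart (opDA D) cA z -> dom cA a0 -> good (qA a0) ->
  exists H : dvA D -> 'M[R]_(r, kb + kc), [/\ smm H a0, row_free (H a0) & nearx a0 (fun a => dom cA a /\
    forall d, pA d = a -> row_mx (be (pB d)) (thl d) = z d *m H a)].
Proof.
move=> hz ca ga; have [[cx _] _] := ga.
have [H1 [s1 n1]] := be_lin hz ca cx; have [H2 [s2 n2]] := thl_lin hz ca ga.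
exists (fun a => row_mx (H1 a) (H2 a)); split.
- exact: (smm_row_mx (dl_A L)).
- apply/inj_row_free => u; rewrite mul_mx_row -[0 in X in X -> _]row_mx0 => /eq_row_mx [h1 h2].
  have [_ e1] := nearx_self n1; have [_ e2] := nearx_self n2.
  pose d := vmk (opDA D) z a0 u; have pd : pA d = a0 by rewrite (vmk_proj hz).
  have zd : z d = u by rewrite (vmk_xi hz).
  have d0 : d = vzero (opDA D) (pA d).
    by apply: thl_inj; rewrite ?pd ?e1 ?e2 ?zd.
  by have [_ _ zDA _] := dvb_zlaw D; rewrite -zd d0 (xi_vzero hz) ?pd.
- by apply: (nearx2 (dl_A L) n1 n2) => a [? h1] [_ h2]; split=> // d pd; rewrite h1// h2// mul_mx_row.
Qed.

(** At the zero of [A] over [m], the matrix of [(be, thl)] is injective by [lin_both]. It is also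
    surjective: the sum over [A] of a zero of [D -> B] and a core element takes any prescribed
    value. *)
Lemma rank_DA r (z : D -> 'rV[R]_r) (cA : chart R (dvA D)) :
  vb_chart (opDA D) cA z -> dom cA (oA m) -> r = (kb + kc)%N.
Proof.
move=> hz ca; have [zA zB zDA zDB] := dvb_zlaw D; have h := dvbP D.
have gm := good_m; have [[cm bm] _] := gm.
have [|H [_ free nH]] := lin_both hz ca; first by rewrite zA.1.
have [_ hH] := nearx_self nH.
have full : row_full (H (oA m)).
  rewrite -sub1mx; apply/row_subP => i; apply/submxP; set w := row i _.
  have [d [ad bd td]] := core_ex (rsubmx w) gm.
  pose b := vmk (opB D) be m (lsubmx w); have qb : qB b = m by rewrite (vmk_proj hbe).
  pose e := vadd (opDA D) (vzero (opDB D) b) d.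
  have po : pA (vzero (opDB D) b) = oA m by rewrite pA_zeroB qb.
  have pod : pA (vzero (opDB D) b) = pA d by rewrite po.
  exists (z e); rewrite (vb_xiD hz) ?po// mulmxDl -!hH// zDB.1 bd (vmk_xi hbe)// (xi_vzero hbe)//.
  rewrite (thl_core gm ad bd) td thl_zeroB ?qb// add_row_mx addr0 add0r hsubmxK //.
by move: free full; rewrite /row_free /row_full => /eqP -> /eqP.
Qed.

End Splitting.

Lemma smm_near (R : realType) (X : space R) (hX : pman X) m n (F : X -> 'M[R]_(m, n)) x :
  smm F x -> nearx x (smm F).
Proof.
move=> h; apply: (nearx_all hX) => i; apply: (nearx_all hX) => j.
exact: (smx_near hX (h i j)).
Qed.

Section Decomposition.
Variables (R : realType) (D : dvb R).
Let L := dvb_dlaw D.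

(** Around each point of [A] a chart of [D -> A] is changed by the invertible matrices [H], so that
    its fibre coordinates become [(be, thl)]; linearity over [B] is already known for [thl]. *)
Theorem dvb_decomposable : exists ka kb, forall m, exists c kc (al : dvA D -> 'rV[R]_ka)
  (be : dvB D -> 'rV[R]_kb) (de : D -> 'rV[R]_kc), dom c m /\ dco c al be de.
Proof.
case: (dvbP D) => -[ka hA] [kb hB] [r hDA] [k hDB] *; exists ka, kb => m.
have [c0 [al [cm0 hal0]]] := vb_triv hA m; have [c1 [be [cm1 hbe1]]] := vb_triv hB m.
have [cB [xi [bm hxi]]] := vb_triv hDB (vzero (opB D) m).
have [cA0 [z0 [am hz0]]] := vb_triv hDA (vzero (opA D) m).
have mc : mchart (Chart (dom c0 `&` dom c1) (crd c0)).
  apply: (mchart_restr (dl_M L) (vb_mchart hal0)); exact: (mchart_dom (dl_M L) (vb_mchart hbe1)).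
have hal := vb_chart_sub (dl_M L) (dl_A L) hal0 mc (fun x h => h.1).
have hbe := vb_chart_sub (dl_M L) (dl_B L) hbe1 mc (fun x h => h.2).
set c := Chart _ _ in mc hal hbe.
have zm : zdom c cB m by split.
have rE := rank_DA hal hbe hxi zm hz0 am.
pose G := good c al cB xi m.
have og : opn G by apply/opnP => x; exact: (good_near hal hbe hxi).
have mc' := mchart_restr (dl_M L) mc og; set c' := Chart _ _ in mc'.
have hal' := vb_chart_sub (dl_M L) (dl_A L) hal mc' (fun x h => h.1).
have hbe' := vb_chart_sub (dl_M L) (dl_B L) hbe mc' (fun x h => h.1).
exists c', (kc al xi m), al, be, (thl al xi m).
split; first by split=> //; exact: (good_m hal hxi zm).
apply: (dco_build L hal' hbe').
- apply: (vb_chart_glue (dl_A L) (dl_D L)); first exact: (vb_mcharte hal').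
  move=> a [ca ga]; have [cA [z [da hz]]] := vb_triv hDA a.
  (* The rank of [D -> A] is one number for the whole bundle, computed at the zero over [m] by
     [rank_DA]; substituting it makes the matrices [H] square. *)
  clear hz0; subst r.
  have [H [sH free nH]] := lin_both hal hbe hxi zm hz da ga.
  have u : H a \in unitmx by rewrite -row_free_unit.
  have [nu si] := smm_inv (dl_A L) u sH.
  have [V [oV Va VP]] := nearxI (dl_A L) (nearxI (dl_A L) nH nu)
    (nearxI (dl_A L) (smm_near (dl_A L) sH) (smm_near (dl_A L) si)).
  have mcA := mchart_restr (dl_A L) (vb_mchart hz) oV.
  have hz' := vb_chart_sub (dl_A L) (dl_D L) hz mcA (fun x h => h.1).
  exists (Chart (dom cA `&` V) (crd cA)); first by split.
  apply: (vb_chart_change (dl_A L) (dl_D L) (dl_vDA L) hz' (L := H) (L' := fun a => invmx (H a))).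
    by move=> y [_ /VP [[_ uy] [s1 s2]]]; split=> //; [exact: mulmxV|exact: mulVmx].
  by move=> e [_ /VP [[[_ h] _] _]]; exact: h.
- move=> d d' [cd gd] dd; split.
    by rewrite (dv_add_proj (dvbP D) dd) (vb_xiD hal)// !(dl_sq L) -?dd.
  by rewrite (thlD hal hbe hxi)// (dl_sq L).
- move=> t d [cd gd]; split.
    by rewrite (dv_scale_proj (dvbP D)) (vb_xiZ hal)// (dl_sq L).
  by rewrite (thlZ hal hbe hxi)// (dl_sq L).
Qed.

Lemma dvb_dcov : dcov D.
Proof.
have [ka [kb H]] := dvb_decomposable => m.
by have [c [kc [al [be [de h]]]]] := H m; exists c, ka, kb, kc, al, be, de.
Qed.

End Decomposition.

Section Restriction.
Variables (R : realType) (X : dvb_data R) (L : dlaw X).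

Lemma dco_restr (c : chart R (dvM X)) ka kb kc (al : dvA X -> 'rV[R]_ka)
    (be : dvB X -> 'rV[R]_kb) (de : X -> 'rV[R]_kc) U : dco c al be de -> opn U ->
  dco (Chart (dom c `&` U) (crd c)) al be de.
Proof.
move=> hc oU; have mc' := mchart_restr (dl_M L) (vb_mchart (dco_A hc)) oU.
have hA := vb_chart_sub (dl_M L) (dl_A L) (dco_A hc) mc' (fun x h => h.1).
have hB := vb_chart_sub (dl_M L) (dl_B L) (dco_B hc) mc' (fun x h => h.1).
split=> //.
- exact: (vb_chart_sub (dl_A L) (dl_D L) (dco_DA hc) (vb_mcharte hA) (fun x h => h.1)).
- exact: (vb_chart_sub (dl_B L) (dl_D L) (dco_DB hc) (vb_mcharte hB) (fun x h => h.1)).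
Qed.

(** In the fibres of [D -> A] the new coordinates [(be, th)] are obtained from [(be, de)] by a block
    triangular matrix. Its off-diagonal block [Om] carries the bilinear term, with [al] frozen. *)
Lemma dco_core (c : chart R (dvM X)) ka kb kc (al : dvA X -> 'rV[R]_ka)
    (be : dvB X -> 'rV[R]_kb) (de : X -> 'rV[R]_kc) kc' (th : X -> 'rV[R]_kc')
    (k : dvM X -> 'M[R]_(kc, kc')) (k' : dvM X -> 'M[R]_(kc', kc)) (W : 'I_kc' -> dvM X -> 'M[R]_(ka, kb)) :
  dco c al be de ->
  (forall x, dom c x -> [/\ smm k x, smm k' x, forall j, smm (W j) x, k x *m k' x = 1%:M & k' x *m k x = 1%:M]) ->
  (forall d j, dom c (vproj (opA X) (vproj (opDA X) d)) -> th d 0 j =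
     (de d *m k (vproj (opA X) (vproj (opDA X) d))) 0 j +
     dot (al (vproj (opDA X) d) *m W j (vproj (opA X) (vproj (opDA X) d))) (be (vproj (opDB X) d))) ->
  dco c al be th.
Proof.
move=> hc hk hth; have hA := dco_A hc.
pose q := vproj (opA X).
pose Om a : 'M[R]_(kb, kc') := \matrix_(l, j) (al a *m W j (q a)) 0 l.
have OmE a b : b *m Om a = \row_j dot (al a *m W j (q a)) b.
  by apply/rowP => j; rewrite !mxE dotC; apply: eq_bigr => l _; rewrite mxE.
apply: (dco_build L) (dco_A hc) (dco_B hc) _ _ _.
- apply: (vb_chart_change (dl_A L) (dl_D L) (dl_vDA L) (dco_DA hc)
    (L := fun a => block_mx 1%:M (Om a) 0 (k (q a)))
    (L' := fun a => block_mx 1%:M (- Om a *m k' (q a)) 0 (k' (q a)))).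
  + move=> a ca; have [sk sk' sW k1 k2] := hk _ ca.
    have sq := vb_proj_smat (dl_A L) hA ca; have hAp := dl_A L.
    have sO : smm Om a.
      move=> l j; apply: (smx_ext hAp _ (smm_mul hAp (vb_xi_smm hAp hA ca) (smat_smm hAp (dl_M L) sq (sW j)) 0 l)).
      by move=> y; rewrite [RHS]mxE.
    have sb n1 n2 n3 n4 (F1 : dvA X -> 'M[R]_(n1, n3)) (F2 : dvA X -> 'M[R]_(n1, n4))
        (F3 : dvA X -> 'M[R]_(n2, n3)) (F4 : dvA X -> 'M[R]_(n2, n4)) :
        smm F1 a -> smm F2 a -> smm F3 a -> smm F4 a ->
        smm (fun a => block_mx (F1 a) (F2 a) (F3 a) (F4 a)) a.
      move=> s1 s2 s3 s4; apply: (smm_ext (F := fun a => (row_mx (row_mx (F1 a) (F2 a))^T (row_mx (F3 a) (F4 a))^T)^T)).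
        by move=> y; rewrite tr_row_mx !trmxK.
      by apply: smm_tr => //; apply: smm_row_mx => //; apply: smm_tr => //; apply: smm_row_mx.
    have s1 := smat_smm hAp (dl_M L) sq sk; have s1' := smat_smm hAp (dl_M L) sq sk'.
    split.
    * by apply: sb => //; exact: (smm_cst hAp).
    * apply: sb => //; try exact: (smm_cst hAp).
      apply: (smm_mul hAp) => //; apply: (smm_ext (F := fun y => 0 - Om y)).
        by move=> y; rewrite sub0r.
      by apply: (smmB hAp) => //; exact: (smm_cst hAp).
    * rewrite mulmx_block !mulmx0 !mul0mx !mulmx1 !mul1mx !addr0 ?add0r k1 mulNmx addNr.
      by rewrite -scalar_mx_block.
    * rewrite mulmx_block !mulmx0 !mul0mx !mulmx1 !mul1mx !addr0 ?add0r k2 -mulmxA k2 mulmx1 subrr.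
      by rewrite -scalar_mx_block.
  + move=> d cd; rewrite mul_row_block !mulmx0 mulmx1 addr0; congr row_mx.
    rewrite OmE; apply/rowP => j; rewrite hth// [RHS]mxE [X in _ = X + _]mxE.
    by rewrite addrC.
- move=> d d' cd dd; rewrite -(dl_sq L) in cd; have [h1 h2] := dco_addB L hc cd dd.
  have qd : vproj (opA X) (vproj (opDA X) d') = vproj (opA X) (vproj (opDA X) d).
    by rewrite !(dl_sq L) dd.
  split=> //; apply/rowP => j; rewrite [RHS]mxE !hth ?(qA_addB L dd) ?qd//.
  rewrite h1 h2 !mulmxDl dotDl (vl_add (dl_vDB L))// -dd [X in X + _ = _]mxE.
  by rewrite addrACA.
- move=> t d cd; rewrite -(dl_sq L) in cd; have [h1 h2] := dco_scaleB L hc t cd.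
  split=> //; apply/rowP => j; rewrite [RHS]mxE !hth ?(qA_scaleB L)//.
  rewrite h1 h2 -!scalemxAl dotZl (vl_scale (dl_vDB L)) [X in X + _ = _]mxE.
  by rewrite mulrDr.
Qed.

End Restriction.

(** * Lagrangian coordinates on metric double vector bundles *)

Section Lagrangian.
Variables (R : realType) (E : mdvb R).
Let L := dvb_dlaw E.
Let LF := dlaw_flip L : dlaw (flip E).
Notation qA := (vproj (opA E)).
Notation qB := (vproj (opB E)).
Notation pA := (vproj (opDA E)).
Notation pB := (vproj (opDB E)).
Notation g := (@pairing R E).

(* Local coordinates whose frame is Lagrangian: the pairing is the canonical one. *)
Record lagr (c : chart R (dvM E)) r1 r2 (al : dvA E -> 'rV[R]_r1) (be : dvB E -> 'rV[R]_r2)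
    (th : E -> 'rV[R]_r1) : Prop := Lagr {
  lg_dco : dco c al be th;
  lg_pair : forall e e', dom c (qA (pA e)) -> pB e = pB e' ->
    g e e' = dot (th e) (al (pA e')) + dot (th e') (al (pA e)) }.

Lemma ev_metric e e' : pB e' = pB e -> ev (metric_map g e) e' = g e e'.
Proof.
move=> ee; apply: ev_mkform => //; first exact: dl_vDB L.
have m := mdvbP E; split=> [e1 e2 h1 h2|t e1 h1]; first by rewrite (met_add m).
by rewrite (met_scale m).
Qed.

(** The isomorphism to the dual, written as in [dform], shows the pairing as two terms linear in a
    core coordinate and one term in the side coordinates alone. The core coordinate is modified so
    that the last term disappears, as when completing a square. *)
Lemma lagr_exists : exists r1 r2, forall m, exists c (al : dvA E -> 'rV[R]_r1)
  (be : dvB E -> 'rV[R]_r2) (th : E -> 'rV[R]_r1), dom c m /\ lagr c al be th.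
Proof.
have [ka [kb H]] := dvb_decomposable E; exists ka, kb => m.
have [c [kc [al [be [de [cm hc]]]]]] := H m.
have hcov : dcov (flip E) := @dvb_dcov R (flip E).
have LD := dlaw_dual hcov.
have [[fA [fB [fM hf]]] [G [[gA [gB [gM hg]]] FG GF]]] := met_iso (mdvbP E).
set F := metric_map g in hf FG GF.
have hcF := dco_flip hc; have hcD := dco_dual hcov hcF.
have bF e : base (F e) = pB e by exact: base_mkform.
have [zA zB zDA zDB] := dvb_zlaw E.
have fAE b : fA b = b.
  have [h _ _ _] := hf; have := vbm_proj h (vzero (opDB E) b).
  by rewrite [vproj (opDA (dualA (flip E))) _]bF [vproj (opDA (flip E)) _]zDB.1 => <-.
have fME x : fM x = x.
  have [_ _ h _] := hf; have /= := vbm_proj h (vzero (opB E) x).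
  by rewrite fAE zB.1.
have gAE b : gA b = b.
  have [h _ _ _] := hg; have /= := vbm_proj h (zero_form (opDB E) b).
  by rewrite -[base _]/b => <-; rewrite -bF GF.
have gME x : gM x = x.
  have [_ _ h _] := hg; have /= := vbm_proj h (vzero (opB E) x).
  by rewrite gAE zB.1.
have [|a [b [k [W [sa sb sk sW nf]]]]] := dmor_coord LF LD hcF hcD hf cm; first by rewrite fME.
have [|a' [b' [k' [W' [sa' sb' sk' sW' nf']]]]] := dmor_coord LD LF hcD hcF hg cm; first by rewrite gME.
have hM := dl_M L.
have n1 : nearx m (fun x => [/\ smm k x, smm k' x & forall j, smm (W j) x]).
  apply: (nearx2 hM (nearxI hM (smm_near hM sk) (smm_near hM sk')) (nearx_all hM (fun j => smm_near hM (sW j)))).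
  by move=> y [? ?] ?.
have [V [oV Vm VP]] := nearxI hM n1 (nearxI hM nf nf').
have hcV := dco_restr L hc oV; set c' := Chart _ _ in hcV.
have pF e : dom c (qA (pA e)) -> gm (D := flip E) al de (F e) = dzeta (core_xi (D := flip E) de) (dA_proj (F e)).
  by move=> ce; rewrite (dA_proj_gm hcov hcF)// bF -(dl_sq L).
have gE e e' x : V x -> dom c x -> qA (pA e) = x -> pB e = pB e' ->
    g e e' = dot (de e *m k x) (al (pA e')) + \sum_j dot (be (pB e) *m W j x) (al (pA e)) * al (pA e') 0 j
      + dot (al (pA e) *m b x) (de e').
  move=> Vx cx qe ee; have [_ [[_ _ [h1 h2 h3]] _]] := VP _ Vx.
  rewrite -ev_metric// -/(F e) (evE (D := flip E) hcF) ?bF//; last by rewrite /= -(dl_sq L) qe.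
  congr (_ + _).
    rewrite /dot -big_split; apply: eq_bigr => j _ /=.
    by rewrite -mulrDl -h3//= -(dl_sq L).
  have hfp := let: And4 _ h _ _ := hf in vbm_proj h e.
  by rewrite pF ?qe// -[dA_proj _]/(vproj (opDB (dualA (flip E))) (F e)) hfp h2.
(* Elements with only a core coordinate kill the bilinear terms; on them [F] and its inverse [G]
   show that their core matrices are mutually inverse. *)
have kk' x : V x -> dom c x -> k x *m k' x = 1%:M /\ k' x *m k x = 1%:M.
  move=> Vx cx; have [_ [[_ _ [h1 h2 h3]] [_ _ [h1' h2' h3']]]] := VP _ Vx.
  split; apply/row_matrixP => i; rewrite row_mul row1 rowE.
    pose e := dmk (X := E) al be de x 0 0 (delta_mx 0 i).
    have [e1 e2 e3 e4] := dmkP hc 0 0 (delta_mx 0 i) cx; rewrite -/e in e1 e2 e3 e4.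
    have qe : qB (pB e) = x by rewrite -(dl_sq L).
    have bE : bs (D := flip E) al de (F e) = delta_mx 0 i *m k x.
      by apply/rowP => j; rewrite h3//= e3 mul0mx dot0l addr0 e4.
    apply/rowP => j; have := h3' (F e) _ j; rewrite FG e4 -mulmxA bE => ->; last by rewrite /= bF.
    by rewrite /= bF e3 mul0mx dot0l addr0 mulmxA.
  have [e1 e2 e3 e4] := dmkP hcD 0 0 (delta_mx 0 i) cx.
  set P := dmk _ _ _ _ _ _ _ in e1 e2 e3 e4.
  have dG : de (G P) = delta_mx 0 i *m k' x.
    by apply/rowP => j; rewrite h3'// e2 mul0mx dot0l addr0 e4.
  have pG : pB (G P) = base P by rewrite -bF GF.
  apply/rowP => j; have := h3 (G P) _ j; rewrite GF e4 dG => ->; last by rewrite /= pG.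
  by rewrite [vproj (opDA (flip E)) (G P)]pG [be _]e2 mul0mx dot0l addr0.
(* The side term is symmetric in the two [A] coordinates ([Wsym]), so half of it is absorbed by each
   argument. The transpose undoes the exchange of sides in [flip E]. *)
pose W2 j x : 'M[R]_(ka, kb) := 2^-1 *: (W j x)^T.
pose th e : 'rV[R]_ka := \row_j ((de e *m k (qA (pA e))) 0 j + dot (al (pA e) *m W2 j (qA (pA e))) (be (pB e))).
have hth : dco c' al be th.
  apply: (dco_core L hcV (k := k) (k' := k') (W := W2)) => [x [cx Vx]|e j _]; last by rewrite mxE.
  have [[s1 s2 s3] _] := VP _ Vx; have [e1 e2] := kk' _ Vx cx.
  split=> // j; apply: (smmZ hM); first exact: (smx_cst hM).
  exact: (smm_tr hM).
exists c', al, be, th; split; first by split.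
split=> // e e' [ce Ve] ee; set x := qA (pA e) in ce Ve.
have qe' : qA (pA e') = x by rewrite /x !(dl_sq L) ee.
(* Symmetry of the pairing between an element with only an [A] coordinate and one with only a core
   coordinate: [b] is the transpose of [k]. *)
have bk u w : dot (u *m b x) w = dot (w *m k x) u.
  pose e1 := dmk (X := E) al be de x u 0 0; pose e2 := dmk (X := E) al be de x 0 0 w.
  have [a1 a2 a3 a4] := dmkP hc u 0 0 ce; have [b1 b2 b3 b4] := dmkP hc 0 0 w ce.
  have bb : pB e1 = pB e2 by rewrite !(dmk_pB L hc).
  have := met_sym (mdvbP E) bb; rewrite (gE _ _ x)// (gE e2 e1 x)//.
  rewrite a2 a3 a4 b2 b3 b4 !mul0mx ?dot0l ?dot0r !big1 ?addr0 ?add0r// => j _.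
    by rewrite mul0mx dot0l mul0r.
  by rewrite mul0mx dot0l mul0r.
have Wsym v (u u' : 'rV[R]_ka) : \sum_j dot (v *m W j x) u * u' 0 j = \sum_j dot (v *m W j x) u' * u 0 j.
  pose e1 := dmk (X := E) al be de x u v 0; pose e2 := dmk (X := E) al be de x u' v 0.
  have [a1 a2 a3 a4] := dmkP hc u v 0 ce; have [b1 b2 b3 b4] := dmkP hc u' v 0 ce.
  have bb : pB e1 = pB e2 by rewrite !(dmk_pB L hc).
  have := met_sym (mdvbP E) bb; rewrite (gE _ _ x)// (gE e2 e1 x)//.
  by rewrite a2 a3 a4 b2 b3 b4 !mul0mx ?dot0l ?dot0r ?addr0 ?add0r.
have thE e0 u : qA (pA e0) = x -> dot (th e0) u = dot (de e0 *m k x) u +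
    2^-1 * \sum_j dot (be (pB e0) *m W j x) (al (pA e0)) * u 0 j.
  move=> q0; rewrite {1}/dot mulr_sumr -big_split; apply: eq_bigr => j _ /=.
  rewrite mxE q0 mulrDl; congr (_ + _); rewrite mulrA; congr (_ * _).
  by rewrite /W2 -scalemxAr dotZl; congr (_ * _); rewrite [RHS]dotC dot_mul.
rewrite (gE e e' x)// !thE// bk -ee (Wsym _ (al (pA e')) (al (pA e))).
set A := dot _ _; set B := \sum_j _; set C := dot _ _.
have hB : B = 2^-1 * B + 2^-1 * B.
  by rewrite -mulrDl -mulr2n -[2^-1 *+ 2]mulr_natl mulfV ?mul1r// pnatr_eq0.
rewrite {1}hB; move: (2^-1 * B) => B'; rewrite -!addrA; congr (_ + (_ + _)).
exact: addrC.
Qed.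

End Lagrangian.

(** * Morphisms in Lagrangian coordinates *)

Section ModelMorphisms.
Variable R : realType.

(* [(a, b, w)] stands for [(q, u, v) |-> (q a, u b + w(q, v), v a)] on the dual side, and for the
   pull-back of generators [xi_j |-> sum_i a_ij xi_i],
   [eta_j |-> sum_i b_ij eta_i + sum_(i, l) (w_j)_il xi_i xi_l] on the side of functions. *)
Record Lm (s1 s2 r1 r2 : nat) := MkLm {
  la : 'M[R]_(s1, r1); lb : 'M[R]_(s2, r2); lw : 'I_r2 -> 'M[R]_s1 }.

Definition lskew s1 s2 r1 r2 (h : Lm s1 s2 r1 r2) := forall j, (lw h j)^T = - lw h j.

Definition lid r1 r2 : Lm r1 r2 r1 r2 := MkLm 1%:M 1%:M (fun=> 0).

(** [g] after [h]. As vectors are rows, the matrices multiply in the opposite order; the quadratic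
    part of [g] is transported by [la h] on both sides, and that of [h] is combined linearly by
    [lb g]. *)
Definition lcomp s1 s2 r1 r2 t1 t2 (g : Lm r1 r2 t1 t2) (h : Lm s1 s2 r1 r2) : Lm s1 s2 t1 t2 :=
  MkLm (la h *m la g) (lb h *m lb g)
    (fun k => \sum_j lb g j k *: lw h j + la h *m lw g k *m (la h)^T).

Lemma Lm_eq s1 s2 r1 r2 (g h : Lm s1 s2 r1 r2) : la g = la h -> lb g = lb h ->
  (forall j, lw g j = lw h j) -> g = h.
Proof.
case: g => a b w; case: h => a' b' w' /= -> -> ww; congr MkLm; exact/funext.
Qed.

Lemma lskew_id r1 r2 : lskew (lid r1 r2).
Proof. by move=> j /=; rewrite trmx0 oppr0. Qed.

Lemma lskew_comp s1 s2 r1 r2 t1 t2 (g : Lm r1 r2 t1 t2) (h : Lm s1 s2 r1 r2) :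
  lskew g -> lskew h -> lskew (lcomp g h).
Proof.
move=> sg sh k /=; rewrite raddfD /= opprD -sumrN; congr (_ + _).
  rewrite raddf_sum; apply: eq_bigr => j _.
  by transitivity (lb g j k *: (lw h j)^T); [apply/matrixP => a b; rewrite !mxE|rewrite sh scalerN].
by rewrite !trmx_mul trmxK sg mulNmx mulmxN mulmxA.
Qed.

Lemma lcomp_idl s1 s2 r1 r2 (h : Lm s1 s2 r1 r2) : lcomp (lid r1 r2) h = h.
Proof.
apply: Lm_eq => /=; rewrite ?mulmx1// => k.
rewrite mulmx0 mul0mx addr0 (bigD1 k)//= big1 ?addr0 => [|j jk]; first by rewrite mxE eqxx scale1r.
by rewrite mxE (negbTE jk) scale0r.
Qed.

Lemma lcomp_idr s1 s2 r1 r2 (h : Lm s1 s2 r1 r2) : lcomp h (lid s1 s2) = h.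
Proof.
apply: Lm_eq => /=; rewrite ?mul1mx// => k.
by rewrite big1 ?add0r ?mul1mx ?trmx1 ?mulmx1// => j _; rewrite scaler0.
Qed.

Lemma lcompA s1 s2 r1 r2 t1 t2 u1 u2 (f : Lm t1 t2 u1 u2) (g : Lm r1 r2 t1 t2) (h : Lm s1 s2 r1 r2) :
  lcomp f (lcomp g h) = lcomp (lcomp f g) h.
Proof.
apply: Lm_eq => /=; rewrite ?mulmxA// => k.
under eq_bigr => j _ do rewrite scalerDr scaler_sumr.
rewrite big_split /= mulmxDr mulmxDl addrA; congr (_ + _ + _); last by rewrite trmx_mul !mulmxA.
  rewrite exchange_big; apply: eq_bigr => i _ /=; rewrite mxE scaler_suml.
  by apply: eq_bigr => j _; rewrite scalerA mulrC.
rewrite mulmx_sumr mulmx_suml; apply: eq_bigr => j _.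
by rewrite -scalemxAr -scalemxAl.
Qed.

Definition lsm (X : space R) s1 s2 r1 r2 (h : X -> Lm s1 s2 r1 r2) x : Prop :=
  [/\ smm (fun y => la (h y)) x, smm (fun y => lb (h y)) x & forall j, smm (fun y => lw (h y) j) x].

Section Smooth.
Variables (X : space R) (hX : pman X).

Lemma lsm_cst s1 s2 r1 r2 (h : Lm s1 s2 r1 r2) (x : X) : lsm (fun=> h) x.
Proof. by split=> [||j]; exact: smm_cst. Qed.

Lemma lsm_eq s1 s2 r1 r2 (g h : X -> Lm s1 s2 r1 r2) x : nearx x (fun y => g y = h y) -> lsm g x -> lsm h x.
Proof.
by move=> e [h1 h2 h3]; split=> [||j]; [apply: smm_eq h1|apply: smm_eq h2|apply: smm_eq (h3 j)] => //;
  apply: nearx_sub e => y ->.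
Qed.

Lemma lsm_comp s1 s2 r1 r2 t1 t2 (g : X -> Lm r1 r2 t1 t2) (h : X -> Lm s1 s2 r1 r2) x :
  lsm g x -> lsm h x -> lsm (fun y => lcomp (g y) (h y)) x.
Proof.
move=> [g1 g2 g3] [h1 h2 h3]; split=> [||k] /=; try exact: smm_mul.
apply: smmD => //.
  by apply: smm_sum => // j _; apply: smmZ => //; exact: g2.
by apply: smm_mul => //; [apply: smm_mul|apply: smm_tr].
Qed.

Lemma lsm_smat (Y : space R) (hY : pman Y) s1 s2 r1 r2 (f : X -> Y) (h : Y -> Lm s1 s2 r1 r2) x :
  smat f x -> lsm h (f x) -> lsm (fun y => h (f y)) x.
Proof.
move=> sf [h1 h2 h3]; split=> [||k]; first exact: (smat_smm hX hY (F := fun y => la (h y))).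
  exact: (smat_smm hX hY (F := fun y => lb (h y))).
exact: (smat_smm hX hY (F := fun y => lw (h y) k)).
Qed.

End Smooth.
End ModelMorphisms.

Section Representation.
Variable R : realType.

Record lco (E : mdvb R) r1 r2 := Lco {
  lc : chart R (dvM E); lal : dvA E -> 'rV[R]_r1; lbe : dvB E -> 'rV[R]_r2; lth : E -> 'rV[R]_r1;
  lcP : lagr lc lal lbe lth }.

Section One.
Variables (E : mdvb R) (r1 r2 : nat) (C : lco E r1 r2).
Implicit Types X : dualA E.
Notation qA := (vproj (opA E)).

Definition Xal X : 'rV[R]_r1 := lal C (base X).
Definition Xga X : 'rV[R]_r1 := gm (D := E) (lbe C) (lth C) X.
Definition Xbe X : 'rV[R]_r2 := bs (D := E) (lbe C) (lth C) X.
Definition Xq X : dvM E := qA (base X).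

Let hc : dco (lc C) (lal C) (lbe C) (lth C) := lg_dco (lcP C).
Let hcov : dcov E := @dvb_dcov R E.

Lemma dcoX : @dco _ (dualA E) (lc C) r1 r1 r2 (lal C) (dzeta (core_xi (D := E) (lth C))) Xbe.
Proof. exact: dco_dual hc. Qed.

Lemma Xga_core X : dom (lc C) (Xq X) -> dzeta (core_xi (D := E) (lth C)) (dA_proj X) = Xga X.
Proof. exact: (dA_proj_gm hcov hc). Qed.

Lemma X_inj X Y : dom (lc C) (Xq X) -> Xq X = Xq Y -> Xal X = Xal Y -> Xga X = Xga Y ->
  Xbe X = Xbe Y -> X = Y.
Proof.
move=> cX qE aE gE bE; apply: (form_coord_inj (D := E) hc) => //.
exact: (vb_inj (dco_A hc)).
Qed.

Definition Xmk x u v w : dualA E :=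
  dmk (X := dualA E) (lal C) (dzeta (core_xi (D := E) (lth C))) Xbe x u v w.

Lemma XmkP x u v w : dom (lc C) x -> let X := Xmk x u v w in
  [/\ Xq X = x, Xal X = u, Xga X = v & Xbe X = w].
Proof.
move=> cx X; have [h1 h2 h3 h4] := dmkP dcoX u v w cx.
by split=> //; rewrite -Xga_core; [exact: h3|rewrite /Xq [qA _]h1].
Qed.

Lemma ev_X X e : dom (lc C) (Xq X) -> vproj (opDA E) e = base X ->
  ev X e = dot (Xbe X) (lbe C (vproj (opDB E) e)) + dot (Xga X) (lth C e).
Proof. exact: (evE (D := E) hc). Qed.

End One.

Section Rep.
Variables (F E : mdvb R) (s1 s2 r1 r2 : nat).
Implicit Types (w : dualA F -> dualA E) (C : lco F s1 s2) (h : Lm R s1 s2 r1 r2).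

(* [w] has matrix [h] over [x] in the coordinates [C], [C'], and maps the fibre over [x] to that over [y]. *)
Definition rep w C (C' : lco E r1 r2) x y h := forall X, Xq X = x ->
  [/\ Xq (w X) = y, Xal C' (w X) = Xal C X *m la h, Xga C' (w X) = Xga C X *m la h &
      forall j, Xbe C' (w X) 0 j = (Xbe C X *m lb h) 0 j + dot (Xal C X *m lw h j) (Xga C X)].

Lemma rep_uniq w C (C' : lco E r1 r2) x y h (h' : Lm R s1 s2 r1 r2) : dom (lc C) x -> rep w C C' x y h -> rep w C C' x y h' -> h = h'.
Proof.
move=> cx H H'; apply: Lm_eq => [||j].
- apply/row_matrixP => i; rewrite !rowE; have [h1 h2 h3 h4] := XmkP (C := C) (delta_mx 0 i) 0 0 cx.
  by have [_ a _ _] := H _ h1; have [_ a' _ _] := H' _ h1; rewrite h2 in a a'; rewrite -a a'.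
- apply/row_matrixP => i; rewrite !rowE; have [h1 h2 h3 h4] := XmkP (C := C) 0 0 (delta_mx 0 i) cx.
  have [_ _ _ a] := H _ h1; have [_ _ _ a'] := H' _ h1; apply/rowP => k.
  by have := a k; rewrite a' h2 h4 !mul0mx !dot0l !addr0.
- apply/matrixP => i l; have [h1 h2 h3 h4] := XmkP (C := C) (delta_mx 0 i) (delta_mx 0 l) 0 cx.
  have [_ _ _ a] := H _ h1; have [_ _ _ a'] := H' _ h1.
  have := a j; rewrite a' h2 h3 h4 !mul0mx mxE !add0r !dot_delta -!rowE !mxE => ->.
  by [].
Qed.

Lemma rep_ext w (w' : dualA F -> dualA E) C (C' : lco E r1 r2) x y h : dom (lc C') y -> rep w C C' x y h -> rep w' C C' x y h ->
  forall X, Xq X = x -> w X = w' X.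
Proof.
move=> cy H H' X qX; have [q1 a1 g1 b1] := H _ qX; have [q2 a2 g2 b2] := H' _ qX.
apply: (X_inj (C := C')); rewrite ?q1 ?q2// ?a1 ?a2// ?g1 ?g2//.
by apply/rowP => j; rewrite b1 b2.
Qed.

End Rep.

Lemma rep_id (E : mdvb R) r1 r2 (C : lco E r1 r2) x : rep id C C x x (lid R r1 r2).
Proof. by move=> X qX; split=> //= [||j]; rewrite ?mulmx1// mulmx0 dot0l addr0. Qed.

Lemma rep_comp (F E G : mdvb R) s1 s2 r1 r2 t1 t2 (C : lco F s1 s2) (C' : lco E r1 r2) (C'' : lco G t1 t2)
    (w : dualA F -> dualA E) (w' : dualA E -> dualA G) x y z h g :
  rep w C C' x y h -> rep w' C' C'' y z g -> rep (w' \o w) C C'' x z (lcomp g h).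
Proof.
move=> H H' X qX; have [q1 a1 g1 b1] := H _ qX; have [q2 a2 g2 b2] := H' _ q1.
split=> //= [||k]; [by rewrite a2 a1 mulmxA|by rewrite g2 g1 mulmxA|].
rewrite b2 a1 g1.
have -> : Xbe C' (w X) = Xbe C X *m lb h + \row_j dot (Xal C X *m lw h j) (Xga C X).
  by apply/rowP => j; rewrite b1 !mxE.
rewrite mulmxDl mulmxA [in LHS]mxE -addrA; congr (_ + _).
rewrite mulmxDr dotDl; congr (_ + _).
  rewrite mxE mulmx_sumr (big_morph (fun A => dot A (Xga C X)) (id1 := 0) (op1 := +%R)) ?dot0l//; last first.
    by move=> *; exact: dotDl.
  by apply: eq_bigr => j _; rewrite mxE -scalemxAr dotZl mulrC.
by rewrite dot_mul !mulmxA.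
Qed.

Section Morphism.
Variables (F E : mdvb R).
Let LF := dvb_dlaw F.
Let LE := dvb_dlaw E.
Let LXF : dlaw (dualA F) := dlaw_dual (@dvb_dcov R F).
Let LXE : dlaw (dualA E) := dlaw_dual (@dvb_dcov R E).

Section Rank.
Variables (s1 s2 r1 r2 : nat).

(** [dmor_coord] leaves four unrelated families [a], [b], [k], [W]; isotropy is then tested on pairs
    of elements of the dual relation written out in coordinates. *)
Lemma mor_rep (w : dualA F -> dualA E) : mdvb_mor w -> exists w0 : dvM F -> dvM E,
  [/\ forall x, smat w0 x, forall X, Xq (w X) = w0 (Xq X) &
  forall (C : lco F s1 s2) (C' : lco E r1 r2) x, dom (lc C) x -> dom (lc C') (w0 x) ->
    exists h, lsm h x /\ nearx x (fun y => [/\ dom (lc C) y, dom (lc C') (w0 y),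
      rep w C C' y (w0 y) (h y) & lskew (h y)])].
Proof.
move=> [wP [wC [w0 [hw iso]]]]; exists w0.
have [hDA hDB hA hB] := hw; split.
- by move=> x; apply: (smooth_smat (dl_M LXF) (dl_M LXE)); exact: vbm_smooth_base hA.
- by move=> X; rewrite /Xq [base (w X)](vbm_proj hDA X); exact: vbm_proj hA (base X).
move=> C C' x cx cx'; have hc := lg_dco (lcP C); have hc' := lg_dco (lcP C').
have [a [b [k [W [sa sb sk sW nf]]]]] := dmor_coord LXF LXE (dcoX C) (dcoX C') hw cx cx'.
have bP X : base (w X) = wP (base X) := vbm_proj hDA X.
have cPr X : dA_proj (w X) = wC (dA_proj X) := vbm_proj hDB X.
exists (fun y => MkLm (a y) (k y) (W ^~ y)); split; first by split.
apply: nearx_sub nf => y [cy cy' [h1 h2 h3]].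
have q0 X : Xq X = y -> Xq (w X) = w0 y.
  by move=> <-; rewrite /Xq bP; exact: vbm_proj hA (base X).
have wal X : Xq X = y -> Xal C' (w X) = Xal C X *m a y.
  by move=> qX; rewrite /Xal bP h1.
have wga X : Xq X = y -> Xga C' (w X) = Xga C X *m b y.
  move=> qX; rewrite -Xga_core ?q0// -Xga_core ?qX//= -h2 ?cPr//.
  by rewrite /= base_dA_proj.
have wbe X : Xq X = y -> forall j, Xbe C' (w X) 0 j =
    (Xbe C X *m k y) 0 j + dot (Xal C X *m W j y) (Xga C X).
  by move=> qX j; rewrite h3//= -/(Xal C X) [dzeta _ _]Xga_core ?qX.
(* the element [w_p^* e] in coordinates *)
pose e' u v t := dmk (X := E) (lal C') (lbe C') (lth C') (w0 y) (u *m a y) v t.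
pose f' u v t := dmk (X := F) (lal C) (lbe C) (lth C) y u (v *m (k y)^T)
   ((\sum_j v 0 j *: (u *m W j y)) + t *m (b y)^T).
have rel u v t : dual_rel w wP (f' u v t, e' u v t).
  have [f1 f2 f3 f4] := dmkP hc u (v *m (k y)^T) ((\sum_j v 0 j *: (u *m W j y)) + t *m (b y)^T) cy.
  have [e1 e2 e3 e4] := dmkP hc' (u *m a y) v t cy'.
  exists (vproj (opDA F) (f' u v t)); split=> //=.
    have q1 : vproj (opA E) (wP (vproj (opDA F) (f' u v t))) = w0 y by rewrite (vbm_proj hA) f1.
    apply: (vb_inj (dco_A hc')); rewrite ?e1 ?q1//.
    by rewrite e2 h1// f2.
  move=> X bX; have qX : Xq X = y by rewrite /Xq bX.
  rewrite (ev_X (C := C)) ?qX// (ev_X (C := C')) ?q0//; last first.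
    have q1 : vproj (opA E) (base (w X)) = w0 y by rewrite -[LHS]/(Xq (w X)) q0.
    apply: (vb_inj (dco_A hc')); rewrite ?e1 ?q1//.
    by rewrite e2 -[RHS]/(Xal C' (w X)) wal// /Xal bX f2.
  rewrite [lbe C _]f3 [lth C _]f4 [lbe C' _]e3 [lth C' _]e4 wga//.
  have -> : Xbe C' (w X) = Xbe C X *m k y + \row_j dot (Xal C X *m W j y) (Xga C X).
    by apply/rowP => j; rewrite wbe// !mxE.
  have -> : Xal C X = u by rewrite /Xal bX f2.
  rewrite dotDl dotDr -!addrA; congr (_ + _).
    by rewrite dot_mul trmxK.
  congr (_ + _); last by rewrite dot_mul trmxK.
  rewrite dotC (big_morph (fun A => dot A (Xga C X)) (id1 := 0) (op1 := +%R)) ?dot0l//; last first.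
    by move=> *; exact: dotDl.
  by apply: eq_bigr => j _; rewrite dotZl mxE mulrC.
(* The two related pairs are built from the same [v], so they lie over the same points of both sides
   [B] and isotropy applies, with [u], [t], [u'], [t'] free. *)
have isoE (v : 'rV[R]_r2) u t u' t' :
    dot (\sum_j v 0 j *: (u *m W j y)) u' + dot (t *m (b y)^T) u' +
    (dot (\sum_j v 0 j *: (u' *m W j y)) u + dot (t' *m (b y)^T) u) =
    dot t (u' *m a y) + dot t' (u *m a y).
  have [f1 f2 f3 f4] := dmkP hc u (v *m (k y)^T) ((\sum_j v 0 j *: (u *m W j y)) + t *m (b y)^T) cy.
  have [e1 e2 e3 e4] := dmkP hc' (u *m a y) v t cy'.
  have [f1' f2' f3' f4'] := dmkP hc u' (v *m (k y)^T) ((\sum_j v 0 j *: (u' *m W j y)) + t' *m (b y)^T) cy.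
  have [e1' e2' e3' e4'] := dmkP hc' (u' *m a y) v t' cy'.
  have := iso _ _ (rel u v t) (rel u' v t').
  rewrite /= !(dmk_pB LF hc)// !(dmk_pB LE hc')// => /(_ erefl erefl).
  rewrite (lg_pair (lcP C)) ?f1// ?(dmk_pB LF hc)// (lg_pair (lcP C')) ?e1// ?(dmk_pB LE hc')//.
  rewrite f2 f4 f2' f4' e2 e4 e2' e4' addrC => /eqP; rewrite subr_eq0 => /eqP ->.
  by rewrite !dotDl.
(* Setting [v = 0] removes [W]; one core coordinate against one [A] coordinate remains. *)
have ba : b y = a y.
  apply/trmx_inj/row_matrixP => i; rewrite !rowE; apply: dot_inj => u.
  have := isoE 0 0 (delta_mx 0 i) u 0; rewrite !mul0mx !dot0l !addr0.
  rewrite dot0r addr0 big1 ?dot0l ?add0r => [e|j _]; last by rewrite mxE scale0r.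
  by rewrite e dot_mul.
(* With vanishing core coordinates the right-hand side of [isoE] is [0], and basis vectors isolate
   the entries of [W j]. *)
have Wskew j : (W j y)^T = - W j y.
  apply/matrixP => i l; rewrite !mxE.
  have D (u : 'rV[R]_s1) : \sum_l (delta_mx 0 j : 'rV[R]_r2) 0 l *: (u *m W l y) = u *m W j y.
    rewrite (bigD1 j)//= big1 ?addr0 => [|l' /negbTE lj]; first by rewrite mxE !eqxx scale1r.
    by rewrite mxE lj andbF scale0r.
  have := isoE (delta_mx 0 j) (delta_mx 0 i) 0 (delta_mx 0 l) 0.
  rewrite !D !mul0mx !dot0l !addr0 !dot_delta -!rowE !mxE => /eqP.
  by rewrite addrC addr_eq0 => /eqP.
split=> //= X qX; split=> //=; [exact: q0|exact: wal|by rewrite wga ?ba|exact: wbe].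
Qed.

End Rank.

(** The maps induced on the sides are not given; they are recovered by applying [w] to the zeros of
    the two structures of the dual. *)
Lemma mor_of_rep (w : dualA F -> dualA E) (w0 : dvM F -> dvM E) : (forall x, smat w0 x) ->
  (forall x, exists s1 s2 r1 r2 (C : lco F s1 s2) (C' : lco E r1 r2) h,
    [/\ dom (lc C) x, dom (lc C') (w0 x), lsm h x &
      nearx x (fun y => [/\ dom (lc C) y, dom (lc C') (w0 y), rep w C C' y (w0 y) (h y) & lskew (h y)])]) ->
  mdvb_mor w.
Proof.
move=> s0 H.
pose wP p := base (w (zero_form (opDA F) p)).
pose wC k := dA_proj (w (dA_zero k)).
have qw X : Xq (w X) = w0 (Xq X).
  have [s1 [s2 [r1 [r2 [C [C' [h [cx cx' _ /nearx_self [_ _ hr _]]]]]]]]] := H (Xq X).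
  by have [] := hr X erefl.
have bw X : base (w X) = wP (base X).
  have [s1 [s2 [r1 [r2 [C [C' [h [cx cx' _ /nearx_self [_ _ hr _]]]]]]]]] := H (Xq X).
  have hc' := lg_dco (lcP C').
  have [q1 a1 _ _] := hr X erefl; have [q2 a2 _ _] := hr (zero_form (opDA F) (base X)) erefl.
  apply: (vb_inj (dco_A hc')); rewrite -?[vproj _ (base _)]/(Xq _) ?q1//.
  by rewrite [LHS]a1 [RHS]a2.
have hcovF := @dvb_dcov R F.
have pw X : dA_proj (w X) = wC (dA_proj X).
  have [s1 [s2 [r1 [r2 [C [C' [h [cx cx' _ /nearx_self [_ _ hr _]]]]]]]]] := H (Xq X).
  have hc := lg_dco (lcP C); have hX' := dcoX C'.
  have cp : dom (lc C) (base (dA_proj X)) by rewrite base_dA_proj.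
  have [z1 [z2 z3]] := dA_zero_coords hcovF hc cp.
  have [zA _ _ _] := dvb_zlaw F.
  have qz : Xq (dA_zero (dA_proj X)) = Xq X by rewrite /Xq z1 zA.1 base_dA_proj.
  have [q1 _ g1 _] := hr X erefl; have [q2 _ g2 _] := hr _ qz.
  apply: (vb_inj (dco_B hX')).
  - by rewrite /= base_dA_proj [vproj _ _]q1.
  - by rewrite /= !base_dA_proj [LHS]q1 [RHS]q2.
  - rewrite !Xga_core ?q1 ?q2// g1 g2; congr (_ *m _).
    by rewrite [RHS]z3 Xga_core.
exists wP, wC, w0; split.
  apply: (dmor_of_coord LXF LXE) => //.
  - move=> p; have [s1 [s2 [r1 [r2 [C [C' [h [cx cx' _ /nearx_self [_ _ hr _]]]]]]]]] := H (vproj (opA F) p).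
    by have [] := hr (zero_form (opDA F) p) erefl.
  - move=> k /=; rewrite /wC base_dA_proj -[LHS]/(Xq _) qw; congr w0.
    have [c [ka [kb [kc [al [be [de [ck hc]]]]]]]] := hcovF (base k).
    have [z1 _] := dA_zero_coords hcovF hc ck; have [zA _ _ _] := dvb_zlaw F.
    by rewrite /Xq z1 zA.1.
  - move=> x; have [s1 [s2 [r1 [r2 [C [C' [h [cx cx' [h1 h2 h3] nh]]]]]]]] := H x.
    exists (lc C), s1, s1, s2, (lal C), (dzeta (core_xi (D := F) (lth C))), (Xbe C),
      (lc C'), r1, r1, r2, (lal C'), (dzeta (core_xi (D := E) (lth C'))), (Xbe C'),
      (fun y => la (h y)), (fun y => la (h y)), (fun y => lb (h y)), (fun j y => lw (h y) j).
    split=> //; try exact: dcoX.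
    split=> //; apply: nearx_sub nh => y [cy cy' hr _]; split.
    + by move=> p qp; have [] := hr (zero_form (opDA F) p) qp.
    + move=> k qk /=; have hc := lg_dco (lcP C).
      have ck : dom (lc C) (base k) by rewrite [base k]qk.
      have [z1 [z2 z3]] := dA_zero_coords hcovF hc ck; have [zA _ _ _] := dvb_zlaw F.
      have qz : Xq (dA_zero k) = y by rewrite /Xq z1 zA.1.
      by have [q1 _ g1 _] := hr _ qz; rewrite /wC Xga_core ?q1// g1 [Xga _ _]z3.
    + move=> X qX j; have [_ _ _ b1] := hr X qX.
      by rewrite b1 /= Xga_core//; rewrite [Xq X]qX.
move=> [f e] [f' e'] [p [pe pf ef]] [p' [pe' pf' ef']] /= bf be.
have [s1 [s2 [r1 [r2 [C [C' [h [cx cx' _ /nearx_self [_ _ hr hs]]]]]]]]] := H (vproj (opA F) p).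
set x := vproj (opA F) p in cx cx' hr hs.
rewrite /= in pe pf ef pe' pf' ef'.
have qp' : vproj (opA F) p' = x by rewrite -pf' (dl_sq LF) -bf -(dl_sq LF) pf.
have hc := lg_dco (lcP C); have hc' := lg_dco (lcP C').
have coord p1 f1 e1 : vproj (opA F) p1 = x -> vproj (opDA F) f1 = p1 -> vproj (opDA E) e1 = wP p1 ->
    (forall X : dualA F, base X = p1 -> ev X f1 = ev (w X) e1) ->
    lal C' (vproj (opDA E) e1) = lal C p1 *m la (h x) /\
    lth C f1 = (\sum_j lbe C' (vproj (opDB E) e1) 0 j *: (lal C p1 *m lw (h x) j)) + lth C' e1 *m (la (h x))^T.
  move=> qp pf1 pe1 ev1; split.
    by rewrite pe1; have [] := hr (zero_form (opDA F) p1) qp.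
  (* A form over [p1] with arbitrary [Xga] and zero [Xbe] reads off the core coordinate of [f1]. *)
  apply: dot_inj => v; rewrite dotC; pose X := Xmk C x (lal C p1) v 0.
  have [q1 a1 g1 b1] := XmkP (C := C) (lal C p1) v 0 cx; rewrite -/X in q1 a1 g1 b1.
  have bX : base X = p1 by apply: (vb_inj (dco_A hc)); rewrite ?[vproj _ (base X)]q1// qp.
  have [qw1 aw gw bw1] := hr X q1.
  have := ev1 X bX; rewrite (ev_X (C := C)) ?q1 ?pf1// (ev_X (C := C')) ?qw1// ?pe1 ?bw ?bX//.
  rewrite b1 g1 gw g1 dot0l add0r => ->.
  rewrite dotDl addrC -{1}(trmxK (la (h x))) -dot_mul dotC [in RHS]addrC; congr (_ + _).
  rewrite (big_morph (fun A => dot A v) (id1 := 0) (op1 := +%R)) ?dot0l//; last first.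
    by move=> *; exact: dotDl.
  apply: eq_bigr => j _; rewrite bw1 a1 g1 b1 mul0mx [in LHS]mxE add0r dotZl.
  by rewrite mulrC.
have [a1 t1] := coord p f e erefl pf pe ef; have [a2 t2] := coord p' f' e' qp' pf' pe' ef'.
have cf : dom (lc C) (vproj (opA F) (vproj (opDA F) f)) by rewrite pf.
have ce : dom (lc C') (vproj (opA E) (vproj (opDA E) e)).
  rewrite pe; have [q1 _ _ _] := hr (zero_form (opDA F) p) erefl.
  by rewrite -[vproj _ _]/(Xq _) q1.
rewrite (lg_pair (lcP C) cf bf) (lg_pair (lcP C') ce be) a1 a2 t1 t2 pf pf' -be !dotDl.
set u := lal C p; set u' := lal C p'; set v := lbe _ _.
(* The two points share their coordinate [v] on the side [B], so skewness makes the quadratic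
   contributions cancel; the linear ones cancel because [la] acts alike on [Xal] and on [Xga]. *)
have sk : dot (\sum_j v 0 j *: (u *m lw (h x) j)) u' = - dot (\sum_j v 0 j *: (u' *m lw (h x) j)) u.
  rewrite !(big_morph (fun A => dot A _) (id1 := 0) (op1 := +%R)) ?dot0l//; try by move=> *; exact: dotDl.
  rewrite -sumrN; apply: eq_bigr => j _; rewrite !dotZl -mulrN; congr (_ * _).
  by rewrite [in RHS]dotC dot_mul hs mulmxN -[- (_ *m _)]scaleN1r dotZl mulN1r opprK.
rewrite sk !dot_mul [in X in - X]addrACA [X in - (X + _)]addrC.
by rewrite subrr add0r addNr.
Qed.

End Morphism.
End Representation.

(** * The category of frames *)

Section FrameCategory.
Variable R : realType.

(* Each point carries an unnamed reference frame; [kS i x] is the change of frame from it to the local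
   frame [i], so that only the composites [kS j x] after [kS' i x] are required to be smooth. *)
Record kobj := Kobj {
  km :> space R; kr1 : nat; kr2 : nat; kI : Type;
  kU : kI -> set km; kS : kI -> km -> Lm R kr1 kr2 kr1 kr2; kS' : kI -> km -> Lm R kr1 kr2 kr1 kr2;
  kM : exists n, is_manifold n km;
  kUo : forall i, opn (kU i);
  kUc : forall x, exists i, kU i x;
  kSS' : forall i x, kU i x -> lcomp (kS i x) (kS' i x) = lid _ _ _;
  kS'S : forall i x, kU i x -> lcomp (kS' i x) (kS i x) = lid _ _ _;
  kSsk : forall i x, kU i x -> lskew (kS i x);
  kS'sk : forall i x, kU i x -> lskew (kS' i x);
  kSsm : forall i j x, kU i x -> kU j x -> lsm (fun y => lcomp (kS j y) (kS' i y)) x }.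

Definition karr (N M : kobj) : Type :=
  ((km N -> km M) * (km N -> Lm R (kr1 N) (kr2 N) (kr1 M) (kr2 M)))%type.

(** [w.2] compares reference frames, which may vary discontinuously with the point; smoothness makes
    sense for this composite between local frames. *)
Definition kloc (N M : kobj) (w : karr N M) i j y :=
  lcomp (kS j (w.1 y)) (lcomp (w.2 y) (kS' (k := N) i y)).

Definition khom (N M : kobj) (w : karr N M) : Prop :=
  [/\ forall x, smat w.1 x, forall x, lskew (w.2 x) &
      forall i j x, kU i x -> kU j (w.1 x) -> lsm (kloc w i j) x].

Definition kid (N : kobj) : karr N N := (id, fun=> lid _ _ _).

Definition kcomp (P N M : kobj) (g : karr N M) (f : karr P N) : karr P M :=
  (fun x => g.1 (f.1 x), fun x => lcomp (g.2 (f.1 x)) (f.2 x)).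

Definition Kpre : precat := @Precat kobj karr khom kid kcomp.

Lemma kpman (N : kobj) : pman N.
Proof. by have [n h] := kM N; exact: manifold_pman h. Qed.

Lemma kU_near (N : kobj) (i : kI N) x : kU i x -> nearx x (kU i).
Proof. by move=> ux; apply: nearx_open => //; exact: kUo. Qed.

Lemma kloc_comp (P N M : kobj) (g : karr N M) (f : karr P N) i j l y : kU j (f.1 y) ->
  kloc (kcomp g f) i l y = lcomp (kloc g j l (f.1 y)) (kloc f i j y).
Proof.
move=> uy; rewrite /kloc /= -!lcompA; congr lcomp; congr lcomp.
by rewrite [RHS]lcompA kS'S// lcomp_idl.
Qed.

(** Other local frames change the local matrix by the smooth transitions [kSsm] on either side, so
    one pair of frames around each point suffices. *)
Lemma khomI (N M : kobj) (w : karr N M) : (forall x, smat w.1 x) -> (forall x, lskew (w.2 x)) ->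
  (forall x, exists i j, [/\ kU i x, kU j (w.1 x) & lsm (kloc w i j) x]) -> khom w.
Proof.
move=> s0 sk H; split=> // i j x ux uy; have hN := kpman N; have hM := kpman M.
have [a [b [ua ub hs]]] := H x.
pose g x := lcomp (lcomp (kS j (w.1 x)) (kS' b (w.1 x))) (lcomp (kloc w a b x) (lcomp (kS a x) (kS' i x))).
apply: (@lsm_eq _ _ hN _ _ _ _ g); last first.
  apply: lsm_comp => //; first by apply: (lsm_smat hN hM (h := fun y => lcomp (kS j y) (kS' b y))) => //; exact: kSsm.
  by apply: lsm_comp => //; exact: kSsm.
have n1 := kU_near ua; have n2 := smat_near hN hM (s0 x) (kU_near ub).
apply: (nearx2 hN n1 n2) => y uay uby; rewrite /g /kloc -!lcompA; congr lcomp.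
rewrite [in LHS]lcompA kS'S// lcomp_idl; congr lcomp.
by rewrite lcompA kS'S// lcomp_idl.
Qed.

Lemma Kcat : is_category Kpre.
Proof.
split=> /=.
- move=> N; split=> //=; first exact: (smat_id (kpman N)).
    by move=> x; exact: lskew_id.
  move=> i j x ux uy; apply: lsm_eq (kSsm ux uy); first exact: kpman.
  by apply: (nearx_true (kpman N)) => y; rewrite /kloc /= lcomp_idl.
- move=> P N M g f [g1 g2 g3] [f1 f2 f3].
  have hP := kpman P; have hN := kpman N; have hM := kpman M.
  split=> /=.
  + by move=> x; exact: (smat_comp hP hN hM).
  + by move=> x; exact: lskew_comp.
  + move=> i l x ux uz; have [j uy] := kUc (f.1 x).
    apply: (@lsm_eq _ _ hP _ _ _ _ (fun y => lcomp (kloc g j l (f.1 y)) (kloc f i j y))).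
      apply: nearx_sub (smat_near hP hN (f1 x) (kU_near uy)) => y uy'.
      by apply: esym; exact: kloc_comp.
    apply: lsm_comp => //; last exact: f3.
    by apply: (lsm_smat hP hN (h := kloc g j l)) => //; exact: g3.
- by move=> N M [f h]; rewrite /kcomp /=; congr pair; apply/funext => x; rewrite lcomp_idl.
- by move=> N M [f h]; rewrite /kcomp /=; congr pair; apply/funext => x; rewrite lcomp_idr.
- by move=> P Q N M h g f; rewrite /kcomp /=; congr pair; apply/funext => x; rewrite lcompA.
Qed.

End FrameCategory.

(** * The functor from metric double vector bundles to frames *)

Section MdvbFrames.
Variable R : realType.

Lemma rk_subproof (E : mdvb R) : {r : nat * nat | forall m, exists C : lco E r.1 r.2, dom (lc C) m}.
Proof.
apply: cid; have [r1 [r2 H]] := lagr_exists E; exists (r1, r2) => m.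
by have [c [al [be [th [cm h]]]]] := H m; exists (Lco h).
Qed.

Definition rk1 E := (sval (rk_subproof E)).1.
Definition rk2 E := (sval (rk_subproof E)).2.
(** One system of Lagrangian coordinates is chosen around each point, with no coherence between the
    choices. At [m] itself it serves as the reference frame of [Kof E]; on its whole domain it is
    the local frame with index [m]. *)
Definition Cx E m : lco E (rk1 E) (rk2 E) := sval (cid (svalP (rk_subproof E) m)).

Lemma CxP E m : dom (lc (Cx (E := E) m)) m.
Proof. exact: svalP (cid (svalP (rk_subproof E) m)). Qed.

Lemma dvM_pman (E : mdvb R) : pman (dvM E).
Proof. exact: dl_M (dvb_dlaw E). Qed.

(** The base map read off on zero forms, so that it is a function of [w] alone and needs no choice
    from [mdvb_mor]. *)
Definition wbase (F E : mdvb R) (w : dualA F -> dualA E) x : dvM E :=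
  Xq (w (zero_form (opDA F) (vzero (opA F) x))).

Definition repm (F E : mdvb R) (w : dualA F -> dualA E) s1 s2 r1 r2 (C : lco F s1 s2) (C' : lco E r1 r2) x y :=
  pickd (MkLm 0 0 (fun=> 0)) (rep w C C' x y).

Lemma repmE (F E : mdvb R) (w : dualA F -> dualA E) s1 s2 r1 r2 (C : lco F s1 s2) (C' : lco E r1 r2) x y h :
  dom (lc C) x -> rep w C C' x y h -> repm w C C' x y = h.
Proof.
move=> cx hr; apply: (rep_uniq cx _ hr).
exact: (@pickdP _ _ (rep w C C' x y) (ex_intro _ h hr)).
Qed.

Lemma Xq_zero (F : mdvb R) x : Xq (zero_form (opDA F) (vzero (opA F) x) : dualA F) = x.
Proof. by have [zA _ _ _] := dvb_zlaw F; rewrite /Xq /base /= zA.1. Qed.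

Section Mor.
Variables (F E : mdvb R) (w : dualA F -> dualA E) (hw : mdvb_mor w).

Lemma mor_rep_base : (forall x, smat (wbase w) x) /\
  forall (C : lco F (rk1 F) (rk2 F)) (C' : lco E (rk1 E) (rk2 E)) x,
    dom (lc C) x -> dom (lc C') (wbase w x) -> exists h, lsm h x /\
    nearx x (fun y => [/\ dom (lc C) y, dom (lc C') (wbase w y), rep w C C' y (wbase w y) (h y) & lskew (h y)]).
Proof.
have [w0 [h1 _ h2]] := mor_rep (rk1 F) (rk2 F) (rk1 E) (rk2 E) hw.
suff -> : wbase w = w0 by [].
apply/funext => x; have [h [_ /nearx_self [_ _ hr _]]] := h2 _ _ x (CxP x) (CxP (w0 x)).
by have [] := hr _ (Xq_zero x).
Qed.

Lemma mor_repm (C : lco F (rk1 F) (rk2 F)) (C' : lco E (rk1 E) (rk2 E)) x : dom (lc C) x -> dom (lc C') (wbase w x) ->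
  rep w C C' x (wbase w x) (repm w C C' x (wbase w x)) /\ lskew (repm w C C' x (wbase w x)).
Proof.
move=> cx cx'; have [h [_ /nearx_self [_ _ hr hs]]] := mor_rep_base.2 C C' x cx cx'.
by rewrite (repmE cx hr).
Qed.

End Mor.

Lemma mdvb_mor_id (E : mdvb R) : mdvb_mor (id : dualA E -> dualA E).
Proof.
apply: (@mor_of_rep _ _ _ _ id); first exact: (smat_id (dvM_pman E)).
move=> x; exists (rk1 E), (rk2 E), (rk1 E), (rk2 E), (Cx x), (Cx x), (fun=> lid _ _ _).
split; try exact: CxP; first exact: (lsm_cst (dvM_pman E)).
apply: nearx_sub (_ : nearx x (dom (lc (Cx x)))) => [y cy|].
  by split=> //; [exact: rep_id|exact: lskew_id].
by apply: mchart_nearx; [exact: (dvM_pman E)|exact: (vb_mchart (dco_A (lg_dco (lcP _))))|exact: CxP].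
Qed.

Lemma wbase_rep (F E : mdvb R) (w : dualA F -> dualA E) s1 s2 r1 r2 (C : lco F s1 s2) (C' : lco E r1 r2) x y h :
  rep w C C' x y h -> wbase w x = y.
Proof. by move=> hr; have [] := hr _ (Xq_zero x). Qed.

Lemma wbase_comp (F E G : mdvb R) (w : dualA F -> dualA E) (w' : dualA E -> dualA G) x :
  mdvb_mor w -> mdvb_mor w' -> wbase (w' \o w) x = wbase w' (wbase w x).
Proof.
move=> hw hw'; have [r1 _] := mor_repm hw (CxP x) (CxP (wbase w x)).
have [r2 _] := mor_repm hw' (CxP (wbase w x)) (CxP (wbase w' (wbase w x))).
exact: wbase_rep (rep_comp r1 r2).
Qed.

Lemma mdvb_mor_comp (F E G : mdvb R) (w : dualA F -> dualA E) (w' : dualA E -> dualA G) :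
  mdvb_mor w' -> mdvb_mor w -> mdvb_mor (w' \o w).
Proof.
move=> hw' hw; have [hF hE hG] := And3 (dvM_pman F) (dvM_pman E) (dvM_pman G).
have [s1 n1] := mor_rep_base hw; have [s2 n2] := mor_rep_base hw'.
apply: (@mor_of_rep _ _ _ _ (fun x => wbase w' (wbase w x))).
  by move=> x; exact: (smat_comp hF hE hG).
move=> x; have [h [sh nh]] := n1 (Cx x) (Cx (wbase w x)) x (CxP _) (CxP _).
have [g [sg ng]] := n2 (Cx (wbase w x)) (Cx (wbase w' (wbase w x))) (wbase w x) (CxP _) (CxP _).
exists (rk1 F), (rk2 F), (rk1 G), (rk2 G), (Cx x), (Cx (wbase w' (wbase w x))),
  (fun y => lcomp (g (wbase w y)) (h y)); split; try exact: CxP.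
  by apply: lsm_comp => //; exact: (lsm_smat hF hE (h := g)).
apply: (nearx2 hF nh (smat_near hF hE (s1 x) ng)) => y [c1 c2 r1 k1] [c3 c4 r2 k2]; split=> //.
  exact: rep_comp r1 r2.
exact: lskew_comp.
Qed.

Lemma MDVB_category : is_category (MDVB R).
Proof. by split=> //=; [exact: mdvb_mor_id|move=> F E G g f; exact: mdvb_mor_comp]. Qed.

Let Iid (E : mdvb R) := mdvb_mor_id E.

Lemma wbase_id (E : mdvb R) x : wbase (id : dualA E -> dualA E) x = x.
Proof. exact: Xq_zero. Qed.

(** Changes of coordinates are the matrices of the identity morphism; their smoothness, skewness and
    cocycle rule are therefore instances of the results on morphisms. *)
Definition Krep (E : mdvb R) (C C' : lco E (rk1 E) (rk2 E)) x := repm id C C' x x.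

Lemma KrepP (E : mdvb R) C C' x : dom (lc C) x -> dom (lc C') x ->
  rep (id : dualA E -> dualA E) C C' x x (Krep C C' x) /\ lskew (Krep C C' x).
Proof.
move=> cx cx'; have := @mor_repm _ _ _ (Iid E) C C' x; rewrite wbase_id.
exact.
Qed.

Lemma Krep_comp (E : mdvb R) (C C' C'' : lco E (rk1 E) (rk2 E)) x :
  dom (lc C) x -> dom (lc C') x -> dom (lc C'') x -> lcomp (Krep C' C'' x) (Krep C C' x) = Krep C C'' x.
Proof.
move=> c c' c''; have [r1 _] := KrepP c c'; have [r2 _] := KrepP c' c''.
by apply/esym/(repmE c); exact: (rep_comp r1 r2).
Qed.

Lemma Krep_id (E : mdvb R) (C : lco E (rk1 E) (rk2 E)) x : dom (lc C) x -> Krep C C x = lid _ _ _.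
Proof. by move=> c; apply: (repmE c); exact: rep_id. Qed.

Lemma Kof_subproof (E : mdvb R) : exists n, is_manifold n (dvM E).
Proof. by case: (dvbP E) => -[rA hA] _ _ _ _ _ _ _ _ _ _ _; by case: hA. Qed.

Definition KofU (E : mdvb R) (m : dvM E) : set (dvM E) := dom (lc (Cx m)).

Lemma lc_mchart (E : mdvb R) r1 r2 (C : lco E r1 r2) : mchart (lc C).
Proof. exact: (vb_mchart (dco_A (lg_dco (lcP C)))). Qed.

Lemma Kof_smooth (E : mdvb R) (i j x : dvM E) : KofU i x -> KofU j x ->
  lsm (fun y => lcomp (Krep (Cx y) (Cx j) y) (Krep (Cx i) (Cx y) y)) x.
Proof.
move=> ui uj; have := (mor_rep_base (Iid E)).2 (Cx i) (Cx j) x ui; rewrite wbase_id => /(_ uj).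
move=> [h [sh nh]]; apply: lsm_eq sh; first exact: dvM_pman.
apply: nearx_sub nh => y []; rewrite wbase_id => c1 c2 hr hs.
by rewrite Krep_comp//; [apply/esym/(repmE c1)|exact: CxP].
Qed.

Definition Kof (E : mdvb R) : kobj R.
Proof.
refine (@Kobj _ (dvM E) (rk1 E) (rk2 E) (dvM E) (@KofU E) (fun m x => Krep (Cx x) (Cx m) x)
  (fun m x => Krep (Cx m) (Cx x) x) (Kof_subproof E) _ _ _ _ _ _ (@Kof_smooth E)).
- by move=> i; apply: mchart_dom; [exact: dvM_pman|exact: lc_mchart].
- by move=> x; exists x; exact: CxP.
- by move=> i x ux; rewrite Krep_comp ?Krep_id//; exact: CxP.
- by move=> i x ux; rewrite Krep_comp ?Krep_id//; exact: CxP.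
- by move=> i x ux; have [] := KrepP (CxP x) ux.
- by move=> i x ux; have [] := KrepP ux (CxP x).
Defined.

Definition Kmap (F E : mdvb R) (w : dualA F -> dualA E) : karr (Kof F) (Kof E) :=
  (wbase w, fun x => repm w (Cx x) (Cx (wbase w x)) x (wbase w x)).

Lemma Kmap_khom (F E : mdvb R) (w : dualA F -> dualA E) : mdvb_mor w -> khom (Kmap w).
Proof.
move=> hw; have [s0 H] := mor_rep_base hw; split=> //=.
  by move=> x; have [] := mor_repm hw (CxP x) (CxP (wbase w x)).
move=> i j x ui uj; have [h [sh nh]] := H (Cx i) (Cx j) x ui uj.
apply: lsm_eq sh; first exact: dvM_pman.
apply: nearx_sub nh => y [c1 c2 hr hs]; rewrite /kloc /=.
have [r1 _] := KrepP c1 (CxP y); have [r2 _] := KrepP (CxP (wbase w y)) c2.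
have [r3 _] := mor_repm hw (CxP y) (CxP (wbase w y)).
exact: (rep_uniq c1 hr (rep_comp (rep_comp r1 r3) r2)).
Qed.

Lemma Kmap_id (E : mdvb R) : Kmap (id : dualA E -> dualA E) = kid (Kof E).
Proof.
rewrite /Kmap /kid; congr pair; apply/funext => x; rewrite wbase_id//.
by rewrite (@repmE _ _ _ _ _ _ _ _ _ _ _ _ (CxP x) (@rep_id _ _ _ _ _ x)).
Qed.

Lemma Kmap_comp (F E G : mdvb R) (w : dualA F -> dualA E) (w' : dualA E -> dualA G) :
  mdvb_mor w -> mdvb_mor w' -> Kmap (w' \o w) = kcomp (Kmap w') (Kmap w).
Proof.
move=> hw hw'; rewrite /Kmap /kcomp /=; congr pair; apply/funext => x; rewrite wbase_comp//.
have [r1 _] := mor_repm hw (CxP x) (CxP (wbase w x)).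
have [r2 _] := mor_repm hw' (CxP (wbase w x)) (CxP (wbase w' (wbase w x))).
by rewrite (repmE (CxP x) (rep_comp r1 r2)).
Qed.

Lemma Kmap_inj (F E : mdvb R) (w w' : dualA F -> dualA E) : mdvb_mor w -> mdvb_mor w' ->
  Kmap w = Kmap w' -> w = w'.
Proof.
move=> hw hw' [e1 e2]; apply/funext => X.
have [r1 _] := mor_repm hw (CxP (Xq X)) (CxP (wbase w (Xq X))).
have [r2 _] := mor_repm hw' (CxP (Xq X)) (CxP (wbase w' (Xq X))).
have := congr1 (fun f => f (Xq X)) e2; rewrite /= => e; rewrite e e1 in r1.
by apply: (rep_ext _ r1 r2) => //; exact: CxP.
Qed.

(** [w] is written down on each fibre separately, in the coordinates chosen at the point and at its
    image. Seen from the coordinates chosen at one fixed point, its matrix is [kloc], which is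
    smooth by assumption. *)
Lemma Kmap_surj (F E : mdvb R) (u : karr (Kof F) (Kof E)) : khom u ->
  exists2 w : dualA F -> dualA E, mdvb_mor w & Kmap w = u.
Proof.
move=> [u1 u2 u3]; pose f : dvM F -> dvM E := u.1.
have hF := dvM_pman F; have hE := dvM_pman E.
pose w (X : dualA F) : dualA E := let x := Xq X in let h := u.2 x in
  Xmk (Cx (f x)) (f x) (Xal (Cx x) X *m la h) (Xga (Cx x) X *m la h)
   (\row_j ((Xbe (Cx x) X *m lb h) 0 j + dot (Xal (Cx x) X *m lw h j) (Xga (Cx x) X))).
have wr x : rep w (Cx x) (Cx (f x)) x (f x) (u.2 x).
  move=> X qX; rewrite /w qX.
  have [h1 h2 h3 h4] := XmkP (C := Cx (f x)) (Xal (Cx x) X *m la (u.2 x)) (Xga (Cx x) X *m la (u.2 x))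
    (\row_j ((Xbe (Cx x) X *m lb (u.2 x)) 0 j + dot (Xal (Cx x) X *m lw (u.2 x) j) (Xga (Cx x) X))) (CxP (f x)).
  by split=> // j; rewrite h4 mxE.
have hw : mdvb_mor w.
  apply: (@mor_of_rep _ _ _ _ f) => // x.
  exists (rk1 F), (rk2 F), (rk1 E), (rk2 E), (Cx x), (Cx (f x)), (kloc u x (f x)).
  split; try exact: CxP; first by apply: u3; exact: CxP.
  have n1 : nearx x (dom (lc (Cx x))) by apply: mchart_nearx => //; [exact: lc_mchart|exact: CxP].
  have n2 : nearx (f x) (dom (lc (Cx (f x)))) by apply: mchart_nearx => //; [exact: lc_mchart|exact: CxP].
  apply: (nearx2 hF n1 (smat_near hF hE (u1 x) n2)) => y cy cy'.
  have [r1 k1] := KrepP cy (CxP y); have [r2 k2] := KrepP (CxP (f y)) cy'.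
  split=> //; first exact: (rep_comp (rep_comp r1 (wr y)) r2).
  by rewrite /kloc; apply: lskew_comp => //; apply: lskew_comp.
exists w => //; rewrite /Kmap [u]surjective_pairing; congr pair; apply/funext => x.
  exact: wbase_rep (wr x).
by rewrite (wbase_rep (wr x)) (repmE (CxP x) (wr x)).
Qed.

End MdvbFrames.

(** * Metric double vector bundles from frames *)

Section Boxes.
Variables (R : realType) (r : nat).

Lemma coord_open (a d : R) j : open [set y : 'rV[R]_r | `|a - y 0 j| < d].
Proof.
rewrite openE => v bv.
have hs : sm (fun y : 'rV[R]_r => a + -1 * y 0 j) v.
  by apply: smD; [exact: sm_cst|apply: smM; [exact: sm_cst|exact: sm_coord]].
have h : {for v, continuous (fun y : 'rV[R]_r => `|a - y 0 j|)}.
  apply: continuous_comp; last exact: norm_continuous.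
  rewrite (_ : (fun y : 'rV[R]_r => a - y 0 j) = (fun y => a + -1 * y 0 j)); first exact: sm_cont.
  by apply/funext => y; rewrite mulN1r.
exact: (cvgr_lt _ h _ bv).
Qed.

(** Balls of the sup norm with rational centre and radius [1/(m+1)]: a countable base, for the
    second countability of total spaces. *)
Definition box (q : 'rV[rat]_r) (m : nat) : set 'rV[R]_r :=
  [set v | forall j, `|ratr (q 0 j) - v 0 j| < m.+1%:R^-1].

Lemma box_open q m : open (box q m).
Proof.
rewrite openE => v bv; apply: (@filter_forall _ _ _ (nbhs v)) => j.
by apply: open_nbhs_nbhs; split; [exact: coord_open|exact: bv].
Qed.

Lemma box_basis (O : set 'rV[R]_r) v : open O -> O v -> exists q m, box q m v /\ box q m `<=` O.
Proof.
move=> oO Ov; have /nbhs_ballP [e /= e0 he] : nbhs v O by exact: open_nbhs_nbhs.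
have e20 : 0 < e / 2 by rewrite divr_gt0.
have [m hm] : exists m : nat, m.+1%:R^-1 < e / 2.
  by exists (Num.truncn (e / 2)^-1); rewrite invf_plt ?posrE ?ltr0Sn// truncnS_gt.
have m0 : 0 < m.+1%:R^-1 :> R by rewrite invr_gt0 ltr0Sn.
have H j : exists q : rat, `|ratr q - v 0 j| < m.+1%:R^-1.
  have lt : v 0 j - m.+1%:R^-1 < v 0 j + m.+1%:R^-1 by rewrite ltrBlDr -addrA ltrDl addr_gt0.
  have [q] := rat_in_itvoo lt; rewrite in_itv /= => /andP[q1 q2]; exists q.
  by rewrite ltr_distl q1 q2.
have [q hq] := choice H.
exists (\row_j q j), m; split=> [j|y hy]; first by rewrite mxE.
apply: he; split=> // i j; rewrite ord1 -ball_normE /=.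
have -> : v 0 j - y 0 j = (ratr (q j) - y 0 j) - (ratr (q j) - v 0 j) by rewrite opprB [RHS]addrC addrA subrK.
rewrite (le_lt_trans (ler_normB _ _))// (splitr e) ltrD//; last exact: lt_trans (hq j) hm.
by apply: lt_trans hm; have := hy j; rewrite mxE.
Qed.

End Boxes.

Section Product.
Variables (R : realType) (M : space R) (hM : pman M) (r : nat).

Inductive prod_chart : chart R (M * 'rV[R]_r) -> Prop :=
| ProdChart c : atlas M c ->
    prod_chart (Chart (fun e => dom c e.1) (fun e => row_mx (crd c e.1) e.2)).

Definition prod_space : space R := Space prod_chart.

Definition prod_ch c : chart R prod_space := Chart (fun e => dom c e.1) (fun e => row_mx (crd c e.1) e.2).

Lemma prod_pman : pman prod_space.
Proof.
have [cov hm] := hM; apply: pmanI.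
- move=> [x v]; have [c ac cx] := cov x; eexists; [exact: (ProdChart ac)|exact: cx].
- by move=> _ [x v] [y w] [c ac] /= cx cy /eq_row_mx [h ->]; rewrite (mchart_inj (hm c ac) cx cy h).
move=> _ _ [x v] [c ac] [d ad] /= cx dx; have mc := hm c ac; have md := hm d ad.
have [tau [ O [oO Ox Os Osm OE]]] := mchart_trans hM mc md cx dx.
exists (fun u => row_mx (tau (lsubmx u)) (rsubmx u)); split.
  apply: smv_row; last exact: smv_rsub.
  by apply: smv_comp; [rewrite row_mxKl; exact: Osm|exact: smv_lsub].
have : \forall u \near row_mx (crd c x) v, O (@lsubmx R 1 (cdim c) r u).
  by apply: (smv_cont (@smv_lsub _ _ _ _)); rewrite row_mxKl; exact: open_nbhs_nbhs.
apply: filterS => u Ou; have [y cy yE] := Os _ Ou; rewrite -yE in Ou.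
have [dy dE] := OE _ cy Ou; exists (y, rsubmx u); split=> //=; first by rewrite yE hsubmxK.
by rewrite dE yE.
Qed.

Lemma prod_mchart c : atlas M c -> mchart (prod_ch c).
Proof. by move=> ac; apply: prod_pman.2; exact: ProdChart. Qed.

Lemma smx_fst f x (v : 'rV[R]_r) : smx f x -> smx (X := prod_space) (fun e => f e.1) (x, v).
Proof.
have [cov hm] := hM; have [c ac cx] := cov x => hf.
have [g sg gE] := smx_read hM (hm c ac) cx hf.
apply: (@smxI R prod_space prod_pman (prod_ch c) _ (x, v) (fun u => g (lsubmx u)) (prod_mchart ac)) => //=.
  by apply: sm_comp; [rewrite row_mxKl; exact: sg|exact: smv_lsub].
have n := mchart_nearx prod_pman (prod_mchart ac) (x := (x, v)) cx.
by apply: nearx_sub n => -[y w] /= cy; rewrite row_mxKl gE.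
Qed.

Lemma smx_snd j x (v : 'rV[R]_r) : smx (X := prod_space) (fun e => e.2 0 j) (x, v).
Proof.
have [cov hm] := hM; have [c ac cx] := cov x.
have := @smx_crd R prod_space prod_pman (prod_ch c) (x, v) (rshift (cdim c) j) (prod_mchart ac) cx.
by apply: smx_ext => [|[y w]]; [exact: prod_pman|rewrite /= row_mxEr].
Qed.

End Product.

(** * Manifold structure on a product with twisted fibre coordinates *)

Section Twisted.
Variables (R : realType) (M : space R) (n : nat) (mM : is_manifold n M) (F : Type) (r : nat).
Variables (I : Type) (U : I -> set M) (t : I -> M -> F -> 'rV[R]_r) (t' : I -> M -> 'rV[R]_r -> F).
Let hM : pman M := manifold_pman mM.
Hypotheses (oU : forall i, opn (U i)) (cU : forall x, exists i, U i x).
Hypotheses (tK : forall i x, U i x -> cancel (t i x) (t' i x)) (t'K : forall i x, U i x -> cancel (t' i x) (t i x)).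
Hypothesis tS : forall i j x v l, U i x -> U j x ->
  smx (X := prod_space M r) (fun e => t j e.1 (t' i e.1 e.2) 0 l) (x, v).

(* [F] is a bare set: the charts of [M * F] come from the fibre coordinates [t i] *)
Definition tw_ch (c : chart R M) i : chart R (M * F) :=
  Chart (fun e => dom c e.1 /\ U i e.1) (fun e => row_mx (crd c e.1) (t i e.1 e.2)).

Inductive tw_chart : chart R (M * F) -> Prop := TwChart c i : atlas M c -> tw_chart (tw_ch c i).

Definition tw_space : space R := Space tw_chart.

Lemma tw_pman : pman tw_space.
Proof.
have [cov hm] := hM; apply: pmanI.
- move=> [x f]; have [c ac cx] := cov x; have [i ui] := cU x; exists (tw_ch c i) => //; exact: TwChart.
- move=> _ [x f] [y g] [c i ac] /= [cx ux] [cy uy] /eq_row_mx [h1 h2].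
  have xy := mchart_inj (hm c ac) cx cy h1; subst y.
  by rewrite -(tK ux f) -(tK ux g) h2.
move=> _ _ [x f] [c i ac] [d j ad] /= [cx ui] [dx uj]; have mc := hm c ac; have md := hm d ad.
have [tau [ O [oO Ox Os Osm OE]]] := mchart_trans hM mc md cx dx.
have [ O' [oO' O'x _ O'E]] := (nearx_chart hM (U i `&` U j) mc cx).1 (nearx_open (opnI hM (@oU i) (@oU j)) (conj ui uj)).
have H l : exists g : 'rV[R]_(cdim c + r) -> R, sm g (row_mx (crd c x) (t i x f)) /\
    forall e, dom c e.1 -> t j e.1 (t' i e.1 e.2) 0 l = g (row_mx (crd c e.1) e.2).
  have [g sg gE] := smx_read (prod_pman hM r) (prod_mchart hM r ac) (x := (x, t i x f)) cx (tS _ l ui uj).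
  by exists g; split.
have [g hg] := choice H.
exists (fun u => row_mx (tau (lsubmx u)) (\row_l g l u)); split.
  apply: smv_row; last by move=> l; apply: (sm_ext _ (hg l).1) => u; rewrite mxE.
  by apply: smv_comp; [rewrite row_mxKl; exact: Osm|exact: smv_lsub].
have : \forall u \near row_mx (crd c x) (t i x f), (O `&` O') (@lsubmx R 1 (cdim c) r u).
  apply: (smv_cont (@smv_lsub _ _ _ _)); rewrite row_mxKl.
  by apply: filterI; exact: open_nbhs_nbhs.
apply: filterS => u [Ou O'u]; have [y cy yE] := Os _ Ou; rewrite -yE in Ou O'u.
have [dy dE] := OE _ cy Ou; have [uyi uyj] := O'E _ cy O'u.
exists (y, t' i y (rsubmx u)); split=> //=; first by rewrite t'K// yE hsubmxK.
rewrite dE yE; congr row_mx; apply/rowP => l; rewrite mxE.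
by have [_ /(_ (y, rsubmx u) cy) /= ->] := hg l; rewrite yE hsubmxK.
Qed.

Lemma tw_mchart c i : atlas M c -> @mchart R tw_space (tw_ch c i).
Proof. by move=> ac; apply: tw_pman.2; exact: TwChart. Qed.

Lemma tw_near x f A : nearx x A -> nearx (X := tw_space) (x, f) (fun e => A e.1).
Proof.
move=> nA; have [cov hm] := hM; have [c ac cx] := cov x; have [i ui] := cU x.
have [ O [oO Ox _ OE]] := (nearx_chart hM A (hm c ac) cx).1 nA.
have nx := mchart_nearx tw_pman (tw_mchart i ac) (x := (x, f)) (conj cx ui).
have no : nearx (X := tw_space) (x, f) (fun e => O (@lsubmx R 1 (cdim c) r (crd (tw_ch c i) e))).
  have := smx_open tw_pman (F := fun e : tw_space => @lsubmx R 1 (cdim c) r (crd (tw_ch c i) e)) (x := (x, f)) oO.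
  apply; first by rewrite /= row_mxKl.
  move=> j; apply: (smx_ext tw_pman _ (@smx_crd R tw_space tw_pman (tw_ch c i) (x, f) (lshift r j) (tw_mchart i ac) (conj cx ui))).
  by move=> e; rewrite [RHS]mxE.
by apply: (nearx2 tw_pman nx no) => -[y g] /= [cy uy]; rewrite row_mxKl => /(OE _ cy).
Qed.

Lemma tw_near_fiber i x f O : U i x -> open O -> O (t i x f) ->
  nearx (X := tw_space) (x, f) (fun e => O (t i e.1 e.2)).
Proof.
move=> ui oO Ox; have [cov hm] := hM; have [c ac cx] := cov x.
apply: (smx_open tw_pman (F := fun e : tw_space => t i e.1 e.2)) => // j.
apply: (smx_ext tw_pman _ (@smx_crd R tw_space tw_pman (tw_ch c i) (x, f) (rshift (cdim c) j) (tw_mchart i ac) (conj cx ui))).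
by move=> e; rewrite /= row_mxEr.
Qed.

Lemma tw_hausdorff (e e' : tw_space) : e <> e' -> exists V W : set tw_space,
  [/\ opn V, opn W, V e, W e' & V `&` W = set0].
Proof.
move=> ne; suff [A [B [[V [ oV Vx VA]] [W [ oW Wx WB]] AB]]] : exists A B,
    [/\ nearx e A, nearx e' B & A `&` B = set0].
  exists V, W; split=> //; apply/seteqP; split=> // z [/VA Az /WB Bz].
  by rewrite -AB; split.
case: e e' ne => x f [y g] ne; have [xy|nxy] := pselect (x = y); last first.
  have [V [W [ oV oW Vx Wy VW]]] := mfd_hausdorff mM nxy.
  exists (fun e => V e.1), (fun e => W e.1); split; [exact: tw_near (nearx_open oV Vx)|exact: tw_near (nearx_open oW Wy)|].
  by apply/seteqP; split=> // z [Vz Wz]; have : (V `&` W) z.1 by []; rewrite VW.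
subst y; have [i ui] := cU x.
have fg : t i x f != t i x g.
  by apply/eqP => h; apply: ne; rewrite -(tK ui f) -(tK ui g) h.
have [ O [ O' [oO oO' Of O'g OO']]] : exists O O' : set 'rV[R]_r, [/\ open O, open O', O (t i x f), O' (t i x g) &
    O `&` O' = set0].
  move: fg => /eqP /rowP /existsNP [j /eqP fj]; set a := t i x f in fj *; set b := t i x g in fj *.
  pose d := `|a 0 j - b 0 j| / 2; have d0 : 0 < d by rewrite divr_gt0// normr_gt0 subr_eq0.
  exists [set v | `|a 0 j - v 0 j| < d], [set v | `|b 0 j - v 0 j| < d]; split=> //=; try exact: coord_open; rewrite ?subrr ?normr0//.
  apply/seteqP; split=> // v [/= h1 h2]; suff : `|a 0 j - b 0 j| < `|a 0 j - b 0 j| by rewrite ltxx.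
  have {1}-> : a 0 j - b 0 j = (a 0 j - v 0 j) - (b 0 j - v 0 j) by rewrite opprB addrA subrK.
  by rewrite (le_lt_trans (ler_normB _ _))// [ltRHS]splitr ltrD.
exists (fun e => O (t i e.1 e.2)), (fun e => O' (t i e.1 e.2)); split; try exact: tw_near_fiber.
by apply/seteqP; split=> // z [Vz Wz]; have : (O `&` O') (t i z.1 z.2) by []; rewrite OO'.
Qed.

Lemma tw_second_countable : exists B : nat -> set tw_space, (forall i, opn (B i)) /\
  forall (V : set tw_space) e, opn V -> V e -> exists i, B i e /\ B i `<=` V.
Proof.
have [B [oB bB]] := mfd_second_countable mM.
(* The index set [I] may be uncountable; one index is retained for each basic open set of the base
   that fits into some [U i]. *)
pose io n0 : option I := if pselect (exists i, B n0 `<=` U i) is left h then Some (sval (cid h)) else None.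
have ioP n0 i : B n0 `<=` U i -> exists i0, io n0 = Some i0 /\ B n0 `<=` U i0.
  move=> h; rewrite /io; case: pselect => [h0|[]]; last by exists i.
  by exists (sval (cid h0)); split=> //; exact: svalP (cid h0).
have ioP' n0 i0 : io n0 = Some i0 -> B n0 `<=` U i0.
  by rewrite /io; case: pselect => // h [<-]; exact: svalP (cid h).
(* Two basic sets of the base are needed: the first fixes the fibre coordinates through [io], the
   second shrinks the base. A smaller basic set alone could be assigned other fibre coordinates. *)
pose W (k : (nat * nat) * ('rV[rat]_r * nat)) : set tw_space := [set e | B k.1.1 e.1 /\ B k.1.2 e.1 /\
   if io k.1.1 is Some i0 then box k.2.1 k.2.2 (t i0 e.1 e.2) else False].
have oW k : opn (W k).
  apply: (opnP (W k)).2 => -[x f] [b1 [b2]] /=; case E : (io k.1.1) => [i0|//] bx.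
  have ui : U i0 x by exact: ioP' E _ b1.
  have n1 := tw_near f (nearx_open (oB k.1.1) b1).
  have n2 := tw_near f (nearx_open (oB k.1.2) b2).
  have n3 := tw_near_fiber (f := f) ui (@box_open _ _ _ _) bx.
  apply: (nearx2 tw_pman (nearxI tw_pman n1 n2) n3) => -[y g] [h1 h2] h3.
  by rewrite /W /= E.
exists (fun m => if unpickle m is Some k then W k else set0); split.
  by move=> m; case: unpickle => [k|]; [exact: oW|by apply: (opnP set0).2].
move=> V [x f] oV Ve; have [i ui] := cU x.
have [n0 [b0 s0]] := bB (U i) x (@oU i) ui; have [i0 [E s1]] := ioP n0 i s0.
have [cov hm] := hM; have [c ac cx] := cov x; have ui0 := s1 _ b0.
have [ O [oO Ox _ OE]] := (nearx_chart tw_pman V (tw_mchart i0 ac) (x := (x, f)) (conj cx ui0)).1 (nearx_open oV Ve).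
have /nbhs_ballP [e /= e0 he] : nbhs (row_mx (crd c x) (t i0 x f)) O by exact: open_nbhs_nbhs.
have n1 : nearx x (fun y => dom c y /\ ball (crd c x) e (crd c y)).
  have nx := mchart_nearx hM (hm c ac) cx.
  have no : nearx x (fun y => (ball (crd c x) e)^° (crd c y)).
    apply: (smx_open hM (F := crd c)); [exact: open_interior| |by move=> j; apply: smx_crd => //; exact: hm].
    by apply: nbhsx_ballx.
  by apply: (nearx2 hM nx no) => y cy /interior_subset.
have [N [ oN Nx NA]] := n1; have [m1 [b1 s2]] := bB N x oN Nx.
have [q [m2 [bq sq]]] := @box_basis R r (ball (t i0 x f) e)^° (t i0 x f) (@open_interior _ _) (nbhsx_ballx _ _ e0).
exists (pickle ((n0, m1), (q, m2))); rewrite pickleK; split; first by split=> //=; rewrite E.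
move=> [y g] [/= h1 [h2]]; rewrite E => h3.
have [cy by'] := NA _ (s2 _ h2); have uy := s1 _ h1.
apply: (OE (y, g)) => //=; apply: he.
have /interior_subset bg := sq _ h3.
have [_ b1'] := by'; have [_ b2'] := bg.
split=> // a l; case: (split_ordP l) => l' ->; rewrite ?row_mxEl ?row_mxEr; [exact: b1'|exact: b2'].
Qed.

Lemma tw_manifold : is_manifold (n + r) tw_space.
Proof.
split; first exact: tw_pman.1.
- by move=> _ [c i ac]; split; [rewrite /= (mfd_chart mM ac).1|exact: tw_mchart].
- exact: tw_hausdorff.
- exact: tw_second_countable.
Qed.

End Twisted.

Section PullBack.
Variable R : realType.

(* the core component of the transpose of [g] : [(q, v)] over the source side, [z] over the target *)
Definition lpb s1 s2 r1 r2 (g : Lm R s1 s2 r1 r2) (q : 'rV[R]_s1) (v : 'rV[R]_r2) (z : 'rV[R]_r1) : 'rV[R]_s1 :=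
  \sum_j v 0 j *: (q *m lw g j) + z *m (la g)^T.

Lemma lpb_id r1 r2 q v z : lpb (lid R r1 r2) q v z = z.
Proof. by rewrite /lpb big1 ?add0r ?trmx1 ?mulmx1// => j _; rewrite mulmx0 scaler0. Qed.

Lemma lpb_comp s1 s2 r1 r2 t1 t2 (g : Lm R r1 r2 t1 t2) (h : Lm R s1 s2 r1 r2) q v z :
  lpb (lcomp g h) q v z = lpb h q (v *m (lb g)^T) (lpb g (q *m la h) v z).
Proof.
rewrite /lpb /= trmx_mul mulmxDl !mulmxA addrA; congr (_ + _).
under eq_bigr => k _ do rewrite mulmxDr scalerDr.
rewrite big_split /= mulmx_suml; congr (_ + _); last first.
  by apply: eq_bigr => k _; rewrite -scalemxAl !mulmxA.
under eq_bigr => k _ do rewrite mulmx_sumr scaler_sumr.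
rewrite exchange_big; apply: eq_bigr => j _ /=; rewrite mxE scaler_suml.
by apply: eq_bigr => k _; rewrite mxE -scalemxAr scalerA.
Qed.

Lemma lpbD s1 s2 r1 r2 (g : Lm R s1 s2 r1 r2) q v v' z z' :
  lpb g q (v + v') (z + z') = lpb g q v z + lpb g q v' z'.
Proof.
rewrite /lpb mulmxDl addrACA; congr (_ + _); rewrite -big_split.
by apply: eq_bigr => j _; rewrite mxE scalerDl.
Qed.

Lemma lpbZ s1 s2 r1 r2 (g : Lm R s1 s2 r1 r2) q t v z : lpb g q (t *: v) (t *: z) = t *: lpb g q v z.
Proof.
rewrite /lpb scalerDr scalemxAl scaler_sumr; congr (_ + _).
by apply: eq_bigr => j _; rewrite mxE scalerA.
Qed.

Lemma lpbD2 s1 s2 r1 r2 (g : Lm R s1 s2 r1 r2) q q' v z z' :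
  lpb g (q + q') v (z + z') = lpb g q v z + lpb g q' v z'.
Proof.
rewrite /lpb mulmxDl addrACA; congr (_ + _); rewrite -big_split.
by apply: eq_bigr => j _; rewrite mulmxDl scalerDr.
Qed.

Lemma lpbZ2 s1 s2 r1 r2 (g : Lm R s1 s2 r1 r2) q t v z : lpb g (t *: q) v (t *: z) = t *: lpb g q v z.
Proof.
rewrite /lpb scalerDr scalemxAl scaler_sumr; congr (_ + _).
by apply: eq_bigr => j _; rewrite -scalemxAl !scalerA mulrC.
Qed.

Lemma dot_lpb s1 s2 r1 r2 (g : Lm R s1 s2 r1 r2) q v z c :
  dot c (lpb g q v z) = \sum_j v 0 j * dot (q *m lw g j) c + dot (c *m la g) z.
Proof.
rewrite /lpb dotC dotDl; congr (_ + _).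
  rewrite (big_morph (fun A => dot A c) (id1 := 0) (op1 := +%R)) ?dot0l//; last by move=> *; exact: dotDl.
  by apply: eq_bigr => j _; rewrite dotZl.
by rewrite dotC dot_mul trmxK.
Qed.

Lemma dot_skew n (A : 'M[R]_n) (q c : 'rV[R]_n) : A^T = - A -> dot (q *m A) c = - dot (c *m A) q.
Proof. by move=> sA; rewrite dotC dot_mul sA mulmxN /dot -sumrN; apply: eq_bigr => j _; rewrite mxE mulNr. Qed.

(** The quadratic terms cancel by skewness, so transport of the core together with the side
    preserves the canonical pairing. *)
Lemma lpb_pair s1 s2 r1 r2 (g : Lm R s1 s2 r1 r2) q q' v z z' : lskew g ->
  dot (lpb g q v z) q' + dot (lpb g q' v z') q = dot z (q' *m la g) + dot z' (q *m la g).
Proof.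
move=> sg; rewrite ![dot (lpb _ _ _ _) _]dotC !dot_lpb addrACA -big_split big1 /= => [|j _].
  by rewrite add0r ![dot (_ *m _) _]dotC.
by rewrite (dot_skew q' q (sg j)) mulrN addrN.
Qed.

End PullBack.

Section SelfDual.
Variables (R : realType) (D : dvb R).
Let L := dvb_dlaw D.
Let hcov : dcov D := @dvb_dcov R D.
Let L' : dlaw (dualA D) := dlaw_dual hcov.
Notation qA := (vproj (opA D)).
Notation pA := (vproj (opDA D)).
Notation pB := (vproj (opDB D)).

(** In decomposed coordinates of [D] and of its dual such an [F] is the identity, hence so is its
    inverse. The maps on the sides are recovered from zeros. It will be applied to [flip E] and the
    metric. *)
Lemma self_dual_iso (F : D -> dualA D) :
  (forall m, exists c ka r (al : dvA D -> 'rV[R]_ka) (be : dvB D -> 'rV[R]_r) (de : D -> 'rV[R]_r),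
    [/\ dom c m, dco c al be de & forall d, dom c (qA (pA d)) ->
      [/\ base (F d) = pA d, gm be de (F d) = be (pB d) & bs be de (F d) = de d]]) ->
  @dvb_iso R D (dualA D) F.
Proof.
move=> H.
have bF d : base (F d) = pA d.
  by have [c [ka [r [al [be [de [cm hc /(_ d cm) []]]]]]]] := H (qA (pA d)).
have injF d d' : F d = F d' -> d = d'.
  move=> e; have pd : pA d = pA d' by rewrite -!bF e.
  have [c [ka [r [al [be [de [cm hc h]]]]]]] := H (qA (pA d)).
  have [_ g1 b1] := h d cm; have [_ g2 b2] := h d' (eq_ind _ (fun a => dom c (qA a)) cm _ pd).
  apply: (dco_inj hc) => //; rewrite ?pd//; first by rewrite -g1 e.
  by rewrite -b1 e.
have surF P : exists d, F d = P.
  have [c [ka [r [al [be [de [cm hc h]]]]]]] := H (qA (base P)).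
  have [h1 h2 h3 h4] := dmkP hc (al (base P)) (gm be de P) (bs be de P) cm.
  exists (dmk al be de (qA (base P)) (al (base P)) (gm be de P) (bs be de P)).
  set d := dmk _ _ _ _ _ _ _ in h1 h2 h3 h4 *.
  have pd : pA d = base P by apply: (vb_inj (dco_A hc)); rewrite ?h1.
  have [_ g1 b1] := h d (eq_ind_r (dom c) cm h1).
  by apply: (form_coord_inj hc); rewrite ?bF ?pd ?g1 ?b1.
have [G GF] := choice surF.
have FG : cancel F G by move=> d; apply: injF; rewrite GF.
have pG P : pA (G P) = base P by rewrite -bF GF.
have [_ zB _ zDB] := dvb_zlaw D.
have coF d c ka r (al : dvA D -> 'rV[R]_ka) (be : dvB D -> 'rV[R]_r) (de : D -> 'rV[R]_r) : dco c al be de ->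
    dom c (qA (pA d)) -> dzeta (core_xi de) (dA_proj (F d)) = gm be de (F d).
  by move=> hc cd; apply: (dA_proj_gm hcov hc); rewrite bF.
pose fB b := dA_proj (F (vzero (opDB D) b)); pose gB k := pB (G (dA_zero k)).
have qfB b : base (fB b) = vproj (opB D) b by rewrite base_dA_proj bF (dl_sq L) zDB.1.
have fBP d : dA_proj (F d) = fB (pB d).
  have [c [ka [r [al [be [de [cm hc h]]]]]]] := H (qA (pA d)).
  have q0 : qA (pA (vzero (opDB D) (pB d))) = qA (pA d) by rewrite (dl_sq L) zDB.1 -(dl_sq L).
  have hz := dco_B (dco_dual hcov hc).
  apply: (vb_inj hz) => /=; rewrite ?base_dA_proj ?bF ?q0//.
  rewrite (coF _ _ _ _ _ _ _ hc)// (coF _ _ _ _ _ _ _ hc) ?q0//.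
  by have [_ -> _] := h d cm; have [|_ -> _] := h (vzero (opDB D) (pB d)); rewrite ?q0 ?zDB.1.
have zk k : base (dA_zero k) = vzero (opA D) (base k).
  have [c [ka [kb [kc [al [be [de [cm hc]]]]]]]] := hcov (base k).
  by have [] := dA_zero_coords hcov hc cm.
have gBP P : pB (G P) = gB (dA_proj P).
  have [c [ka [r [al [be [de [cm hc h]]]]]]] := H (qA (base P)).
  have cP : dom c (base (dA_proj P)) by rewrite base_dA_proj.
  have [zA _ _ _] := dvb_zlaw D.
  have qz : qA (base (dA_zero (dA_proj P))) = qA (base P) by rewrite zk zA.1 base_dA_proj.
  apply: (vb_inj (dco_B hc)); rewrite /gB -?(dl_sq L) ?pG ?qz//.
  have [|_ e1 _] := h (G P); first by rewrite pG.
  have [|_ e2 _] := h (G (dA_zero (dA_proj P))); first by rewrite pG qz.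
  rewrite -e1 -e2 !GF; have [_ [_ z2]] := dA_zero_coords hcov hc cP.
  by rewrite z2 (dA_proj_gm hcov hc).
have hM := dl_M L.
split.
  exists id, fB, id; apply: (dmor_of_coord L L') => //=; first exact: (smat_id hM).
  move=> m; have [c [ka [r [al [be [de [cm hc h]]]]]]] := H m.
  exists c, ka, r, r, al, be, de, c, ka, r, r, al, (dzeta (core_xi de)), (bs be de).
  exists (fun=> 1%:M), (fun=> 1%:M), (fun=> 1%:M), (fun _ _ => 0).
  split=> //; first exact: dco_dual.
  split; try by [move=> *; exact: smm_cst].
  have nc : nearx m (dom c) by apply: mchart_nearx => //; exact: (vb_mchart (dco_A hc)).
  apply: nearx_sub nc => x cx; split=> [e ex|b bx|d dx j]; rewrite ?mulmx1//.
    have cq : dom c (qA (pA (vzero (opDB D) b))) by rewrite (dl_sq L) zDB.1 bx.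
    rewrite /fB (coF _ _ _ _ _ _ _ hc)//.
    by have [_ -> _] := h _ cq; rewrite zDB.1.
  rewrite mulmx0 dot0l addr0.
  by have [|_ _ ->] := h d; rewrite ?dx.
exists G; split=> //.
exists id, gB, id; apply: (dmor_of_coord L' L) => //=; last first.
- move=> m; have [c [ka [r [al [be [de [cm hc h]]]]]]] := H m.
  exists c, ka, r, r, al, (dzeta (core_xi de)), (bs be de), c, ka, r, r, al, be, de.
  exists (fun=> 1%:M), (fun=> 1%:M), (fun=> 1%:M), (fun _ _ => 0).
  split=> //; first exact: dco_dual.
  split; try by [move=> *; exact: smm_cst].
  have nc : nearx m (dom c) by apply: mchart_nearx => //; exact: (vb_mchart (dco_A hc)).
  apply: nearx_sub nc => x cx; split=> [e ex|k kx|P Px j]; rewrite ?mulmx1//.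
    have [zA _ _ _] := dvb_zlaw D.
    have cq : dom c (qA (pA (G (dA_zero k)))) by rewrite pG zk zA.1 [base k]kx.
    have [_ <- _] := h _ cq; rewrite GF.
    by have [|_ []] := dA_zero_coords hcov hc (k := k); rewrite ?[base k]kx.
  rewrite mulmx0 dot0l addr0.
  by have [|_ _ <-] := h (G P); rewrite ?pG ?Px// GF.
- exact: (smat_id hM).
- by move=> k; rewrite /gB -(dl_sq L) pG zk; have [zA _ _ _] := dvb_zlaw D; rewrite zA.1.
Qed.

End SelfDual.

Lemma prod_smat_fst (R : realType) (M : space R) (hM : pman M) r x (v : 'rV[R]_r) :
  smat (X := prod_space M r) (fun e => e.1) (x, v).
Proof.
have [cov hm] := hM; have [c ac cx] := cov x; exists c; split=> //; first exact: hm.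
  exact: (mchart_nearx (prod_pman hM r) (prod_mchart hM r ac) (x := (x, v)) cx).
apply/smm_rV => j; exact: (smx_fst hM (f := fun y => crd c y 0 j) _ (smx_crd hM _ (hm c ac) cx)).
Qed.

(** * The metric double vector bundle of an object of the category of frames *)

Section Concrete.
Variables (R : realType) (k : kobj R).
Let r1 := kr1 k.
Let r2 := kr2 k.
Let hM : pman k := kpman k.

Lemma laK (i : kI k) x : kU i x -> la (kS i x) *m la (kS' i x) = 1%:M.
Proof. by move=> /kS'S /(congr1 (@la _ _ _ _ _)). Qed.
Lemma la'K (i : kI k) x : kU i x -> la (kS' i x) *m la (kS i x) = 1%:M.
Proof. by move=> /kSS' /(congr1 (@la _ _ _ _ _)). Qed.
Lemma lbK (i : kI k) x : kU i x -> lb (kS i x) *m lb (kS' i x) = 1%:M.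
Proof. by move=> /kS'S /(congr1 (@lb _ _ _ _ _)). Qed.
Lemma lb'K (i : kI k) x : kU i x -> lb (kS' i x) *m lb (kS i x) = 1%:M.
Proof. by move=> /kSS' /(congr1 (@lb _ _ _ _ _)). Qed.

(** [A] is a side of the dual, on which [la] acts. [B] is dual to the core of [dualA], on which [lb]
    acts, hence the transposed inverse in [tB]; the core of [E] is transported by [lpb]. *)
Definition tA (i : kI k) (x : k) (q : 'rV[R]_r1) : 'rV[R]_r1 := q *m la (kS i x).
Definition tA' (i : kI k) (x : k) (q : 'rV[R]_r1) : 'rV[R]_r1 := q *m la (kS' i x).
Definition tB (i : kI k) (x : k) (v : 'rV[R]_r2) : 'rV[R]_r2 := v *m (lb (kS' i x))^T.
Definition tB' (i : kI k) (x : k) (v : 'rV[R]_r2) : 'rV[R]_r2 := v *m (lb (kS i x))^T.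

(* [(q, (v, z))], with [q] in the side A, [v] in the side B and [z] in the core *)
Definition tfib := ('rV[R]_r1 * ('rV[R]_r2 * 'rV[R]_r1))%type.

Definition tD (i : kI k) (x : k) (f : tfib) : 'rV[R]_(r1 + (r2 + r1)) :=
  row_mx (tA i x f.1) (row_mx (tB i x f.2.1) (lpb (kS' i x) (tA i x f.1) f.2.1 f.2.2)).
Definition tD' (i : kI k) (x : k) (v : 'rV[R]_(r1 + (r2 + r1))) : tfib :=
  (tA' i x (lsubmx v), (tB' i x (lsubmx (rsubmx v)),
    lpb (kS i x) (tA' i x (lsubmx v)) (lsubmx (rsubmx v)) (rsubmx (rsubmx v)))).

Lemma tAK i x : kU i x -> cancel (tA i x) (tA' i x).
Proof. by move=> ui q; rewrite /tA /tA' -mulmxA laK ?mulmx1. Qed.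
Lemma tA'K i x : kU i x -> cancel (tA' i x) (tA i x).
Proof. by move=> ui q; rewrite /tA /tA' -mulmxA la'K ?mulmx1. Qed.
Lemma tBK i x : kU i x -> cancel (tB i x) (tB' i x).
Proof. by move=> ui q; rewrite /tB /tB' -mulmxA -trmx_mul lbK ?trmx1 ?mulmx1. Qed.
Lemma tB'K i x : kU i x -> cancel (tB' i x) (tB i x).
Proof. by move=> ui q; rewrite /tB /tB' -mulmxA -trmx_mul lb'K ?trmx1 ?mulmx1. Qed.

Lemma tDK i x : kU i x -> cancel (tD i x) (tD' i x).
Proof.
move=> ui [q [v z]]; rewrite /tD' /tD !(row_mxKl, row_mxKr) /= tAK// tBK//.
by rewrite -lpb_comp kS'S// lpb_id.
Qed.

Lemma tD'K i x : kU i x -> cancel (tD' i x) (tD i x).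
Proof.
move=> ui v; rewrite /tD /tD' /= tA'K// tB'K//.
by rewrite -lpb_comp kSS'// lpb_id !hsubmxK.
Qed.

Section ProductSmooth.
Variable r : nat.
Let P := prod_space (km k) r.
Let hP : pman P := prod_pman hM r.

Lemma fst_lsm s1 s2 t1 t2 (h : k -> Lm R s1 s2 t1 t2) x v : lsm h x -> lsm (X := P) (fun e => h e.1) (x, v).
Proof. exact: (lsm_smat hP hM (f := fun e : P => e.1) (prod_smat_fst hM x v)). Qed.

Lemma snd_smm x v : smm (X := P) (fun e => e.2) (x, v).
Proof. by apply/smm_rV => j; exact: smx_snd. Qed.

Lemma fst_near A x v : nearx x A -> nearx (X := P) (x, v) (fun e => A e.1).
Proof. by move=> nA; exact: (smat_near hP hM (prod_smat_fst hM x v) nA). Qed.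

End ProductSmooth.

Lemma tAS i j x v l : kU i x -> kU j x ->
  smx (X := prod_space (km k) r1) (fun e => tA j e.1 (tA' i e.1 e.2) 0 l) (x, v).
Proof.
move=> ui uj; have hP := prod_pman hM r1; have [h _ _] := fst_lsm v (kSsm ui uj).
suff : smm (X := prod_space (km k) r1) (fun e => e.2 *m la (lcomp (kS j e.1) (kS' i e.1))) (x, v).
  by move=> /(_ 0 l); apply: smx_ext => // e; rewrite mulmxA.
by apply: smm_mul => //; exact: snd_smm.
Qed.

Lemma tBS i j x v l : kU i x -> kU j x ->
  smx (X := prod_space (km k) r2) (fun e => tB j e.1 (tB' i e.1 e.2) 0 l) (x, v).
Proof.
move=> ui uj; have hP := prod_pman hM r2; have [_ h _] := fst_lsm v (kSsm uj ui).
suff : smm (X := prod_space (km k) r2) (fun e => e.2 *m (lb (lcomp (kS i e.1) (kS' j e.1)))^T) (x, v).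
  by move=> /(_ 0 l); apply: smx_ext => // e; rewrite /= trmx_mul mulmxA.
by apply: smm_mul => //; [exact: snd_smm|exact: smm_tr].
Qed.

Lemma tD_trans i j x v : kU j x -> let G := lcomp (kS i x) (kS' j x) in
  let q := lsubmx v *m la (lcomp (kS j x) (kS' i x)) in
  tD j x (tD' i x v) = row_mx q (row_mx (lsubmx (rsubmx v) *m (lb G)^T) (lpb G q (lsubmx (rsubmx v)) (rsubmx (rsubmx v)))).
Proof.
move=> uj /=; rewrite /tD /tD' /= /tA /tA' /tB /tB' trmx_mul !mulmxA; congr row_mx; congr row_mx.
rewrite lpb_comp; congr lpb; congr lpb.
by rewrite -[RHS]mulmxA laK// mulmx1.
Qed.

Lemma smm_lpb (X : space R) (hX : pman X) s1 s2 t1 t2 (h : X -> Lm R s1 s2 t1 t2) q v z x :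
  lsm h x -> smm q x -> smm v x -> smm z x -> smm (fun y => lpb (h y) (q y) (v y) (z y)) x.
Proof.
move=> [h1 h2 h3] sq sv sz; apply: smmD => //.
  by apply: smm_sum => // j _; apply: (smmZ hX); [exact: (sv 0 j)|exact: smm_mul].
by apply: smm_mul => //; exact: smm_tr.
Qed.

Lemma tDS i j x v l : kU i x -> kU j x ->
  smx (X := prod_space (km k) (r1 + (r2 + r1))) (fun e => tD j e.1 (tD' i e.1 e.2) 0 l) (x, v).
Proof.
move=> ui uj; have hP := prod_pman hM (r1 + (r2 + r1)).
suff H : smm (X := prod_space (km k) (r1 + (r2 + r1))) (fun e => tD j e.1 (tD' i e.1 e.2)) (x, v) by exact: H.
have sG := fst_lsm v (kSsm ui uj); have sG' := fst_lsm v (kSsm uj ui).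
have sv := @snd_smm (r1 + (r2 + r1)) x v.
have sl : smm (X := prod_space (km k) (r1 + (r2 + r1))) (fun e => lsubmx e.2) (x, v).
  by apply: (smm_smv hP (G := @lsubmx R 1 _ _)) => //; exact: smv_lsub.
have sr : smm (X := prod_space (km k) (r1 + (r2 + r1))) (fun e => rsubmx e.2) (x, v).
  by apply: (smm_smv hP (G := @rsubmx R 1 _ _)) => //; exact: smv_rsub.
have srl : smm (X := prod_space (km k) (r1 + (r2 + r1))) (fun e => lsubmx (rsubmx e.2)) (x, v).
  by apply: (smm_smv hP (G := @lsubmx R 1 _ _)) => //; exact: smv_lsub.
have srr : smm (X := prod_space (km k) (r1 + (r2 + r1))) (fun e => rsubmx (rsubmx e.2)) (x, v).
  by apply: (smm_smv hP (G := @rsubmx R 1 _ _)) => //; exact: smv_rsub.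
have sq : smm (X := prod_space (km k) (r1 + (r2 + r1))) (fun e => lsubmx e.2 *m la (lcomp (kS j e.1) (kS' i e.1))) (x, v).
  by apply: smm_mul => //; have [] := sG.
pose rhs (e : prod_space (km k) (r1 + (r2 + r1))) := let G := lcomp (kS i e.1) (kS' j e.1) in
  let q := lsubmx e.2 *m la (lcomp (kS j e.1) (kS' i e.1)) in
  row_mx q (row_mx (lsubmx (rsubmx e.2) *m (lb G)^T) (lpb G q (lsubmx (rsubmx e.2)) (rsubmx (rsubmx e.2)))).
apply: (smm_eq hP (F := rhs)).
  by apply: nearx_sub (fst_near v (kU_near uj)) => e uj'; rewrite tD_trans.
apply: smm_row_mx => //; apply: smm_row_mx => //.
  by apply: smm_mul => //; apply: smm_tr => //; have [] := sG'.
exact: smm_lpb.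
Qed.

Definition EA : space R := tw_space (@kU R k) tA.
Definition EB : space R := tw_space (@kU R k) tB.
Definition ED : space R := tw_space (@kU R k) tD.

Lemma pman_EA : pman EA.
Proof. by have [n h] := kM k; exact: (tw_pman h (@kUo R k) (@kUc R k) tAK tA'K tAS). Qed.
Lemma pman_EB : pman EB.
Proof. by have [n h] := kM k; exact: (tw_pman h (@kUo R k) (@kUc R k) tBK tB'K tBS). Qed.
Lemma pman_ED : pman ED.
Proof. by have [n h] := kM k; exact: (tw_pman h (@kUo R k) (@kUc R k) tDK tD'K tDS). Qed.

Lemma mfd_EA : exists n, is_manifold n EA.
Proof. by have [n h] := kM k; exists (n + r1)%N; exact: (tw_manifold h (@kUo R k) (@kUc R k) tAK tA'K tAS). Qed.
Lemma mfd_EB : exists n, is_manifold n EB.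
Proof. by have [n h] := kM k; exists (n + r2)%N; exact: (tw_manifold h (@kUo R k) (@kUc R k) tBK tB'K tBS). Qed.
Lemma mfd_ED : exists n, is_manifold n ED.
Proof. by have [n h] := kM k; exists (n + (r1 + (r2 + r1)))%N; exact: (tw_manifold h (@kUo R k) (@kUc R k) tDK tD'K tDS). Qed.

Lemma mchart_EA c i : atlas k c -> @mchart R EA (tw_ch (@kU R k) tA c i).
Proof. by have [n h] := kM k; exact: (tw_mchart h (@kUo R k) (@kUc R k) tAK tA'K tAS). Qed.
Lemma mchart_EB c i : atlas k c -> @mchart R EB (tw_ch (@kU R k) tB c i).
Proof. by have [n h] := kM k; exact: (tw_mchart h (@kUo R k) (@kUc R k) tBK tB'K tBS). Qed.
Lemma mchart_ED c i : atlas k c -> @mchart R ED (tw_ch (@kU R k) tD c i).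
Proof. by have [n h] := kM k; exact: (tw_mchart h (@kUo R k) (@kUc R k) tDK tD'K tDS). Qed.

Definition opEA : vb_ops R k EA := @VbOps R k EA (fun e => e.1) (fun x => (x, 0))
  (fun e e' => (e.1, e.2 + e'.2)) (fun t e => (e.1, t *: e.2)).
Definition opEB : vb_ops R k EB := @VbOps R k EB (fun e => e.1) (fun x => (x, 0))
  (fun e e' => (e.1, e.2 + e'.2)) (fun t e => (e.1, t *: e.2)).
Definition opEDA : vb_ops R EA ED := @VbOps R EA ED (fun d => (d.1, d.2.1)) (fun a => (a.1, (a.2, (0, 0))))
  (fun d d' => (d.1, (d.2.1, (d.2.2.1 + d'.2.2.1, d.2.2.2 + d'.2.2.2))))
  (fun t d => (d.1, (d.2.1, (t *: d.2.2.1, t *: d.2.2.2)))).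
Definition opEDB : vb_ops R EB ED := @VbOps R EB ED (fun d => (d.1, d.2.2.1)) (fun b => (b.1, (0, (b.2, 0))))
  (fun d d' => (d.1, (d.2.1 + d'.2.1, (d.2.2.1, d.2.2.2 + d'.2.2.2))))
  (fun t d => (d.1, (t *: d.2.1, (d.2.2.1, t *: d.2.2.2)))).

Definition Edata : dvb_data R := @DvbData R k EA EB ED opEA opEB opEDA opEDB.

Definition cE (c : chart R k) (i : kI k) : chart R k := Chart (dom c `&` kU i) (crd c).
Definition alE (i : kI k) (e : EA) : 'rV[R]_r1 := tA i e.1 e.2.
Definition beE (i : kI k) (e : EB) : 'rV[R]_r2 := tB i e.1 e.2.
Definition thE (i : kI k) (d : ED) : 'rV[R]_r1 := lpb (kS' i d.1) (tA i d.1 d.2.1) d.2.2.1 d.2.2.2.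

Lemma Edata_dlaw : dlaw Edata.
Proof.
split=> //=; [exact: pman_EA|exact: pman_EB|exact: pman_ED|..].
Qed.

Section Charts.
Variables (c : chart R k) (i : kI k) (ac : atlas k c).

Lemma mchart_cE : mchart (cE c i).
Proof. by apply: mchart_restr => //; [exact: hM.2|exact: kUo]. Qed.

Lemma vb_chart_EA : vb_chart opEA (cE c i) (alE i).
Proof.
split=> /=; [exact: mchart_cE|..|exact: mchart_EA].
- by move=> [x q] [y q'] /= [cx ux] e; subst y; rewrite /alE /tA /= mulmxDl.
- by move=> t [x q] _; rewrite /alE /tA /= scalemxAl.
- by move=> x w [cx ux]; exists (x, tA' i x w); rewrite // /alE /= tA'K.
Qed.

Lemma vb_chart_EB : vb_chart opEB (cE c i) (beE i).
Proof.
split=> /=; [exact: mchart_cE|..|exact: mchart_EB].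
- by move=> [x q] [y q'] /= [cx ux] e; subst y; rewrite /beE /tB /= mulmxDl.
- by move=> t [x q] _; rewrite /beE /tB /= scalemxAl.
- by move=> x w [cx ux]; exists (x, tB' i x w); rewrite // /beE /= tB'K.
Qed.

Lemma vb_chart_EDA : vb_chart opEDA (chA (X := Edata) (cE c i) (alE i)) (fun d => row_mx (beE i (vproj opEDB d)) (thE i d)).
Proof.
split=> /=; [exact: mchart_EA|..].
- move=> [x [q [v z]]] [y [q' [v' z']]] /= [cx ux] [<- <-].
  by rewrite add_row_mx /thE /beE /tB /= lpbD mulmxDl.
- by move=> t [x [q [v z]]] _; rewrite scale_row_mx /thE /beE /tB /= lpbZ scalemxAl.
- move=> [x q] w [/= cx ux]; have := tD'K ux (row_mx (tA i x q) w).
  rewrite /tD /tD' /= !(row_mxKl, row_mxKr) tAK// => /eq_row_mx [_ e].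
  by eexists (x, (q, (_, _))); [by []|exact: e].
pose phi (v : 'rV[R]_(cdim c + (r1 + (r2 + r1)))) : 'rV[R]_((cdim c + r1) + (r2 + r1)) :=
  row_mx (row_mx (lsubmx v) (lsubmx (rsubmx v))) (rsubmx (rsubmx v)).
pose psi (v : 'rV[R]_((cdim c + r1) + (r2 + r1))) : 'rV[R]_(cdim c + (r1 + (r2 + r1))) :=
  row_mx (lsubmx (lsubmx v)) (row_mx (rsubmx (lsubmx v)) (rsubmx v)).
have s1 v : smv phi v.
  apply: smv_row; first apply: smv_row.
  - exact: smv_lsub.
  - by apply: smv_comp; [exact: smv_lsub|exact: smv_rsub].
  - by apply: smv_comp; exact: smv_rsub.
have s2 v : smv psi v.
  apply: smv_row; last apply: smv_row.
  - by apply: smv_comp; exact: smv_lsub.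
  - by apply: smv_comp; [exact: smv_rsub|exact: smv_lsub].
  - exact: smv_rsub.
apply: (mchart_ext _ (mchart_reparam pman_ED (mchart_ED i ac) s1 s2 _ _)) => [e|v|v];
  by rewrite /phi /psi /= /tD !(row_mxKl, row_mxKr, hsubmxK).
Qed.

Lemma dco_E : @dco R Edata (cE c i) r1 r2 r1 (alE i) (beE i) (thE i).
Proof.
apply: (dco_build Edata_dlaw); [exact: vb_chart_EA|exact: vb_chart_EB|exact: vb_chart_EDA|..].
- move=> [x [q [v z]]] [y [q' [v' z']]] /= [cx ux] [<- <-].
  by rewrite /alE /thE /tA /= mulmxDl lpbD2.
- by move=> t [x [q [v z]]] /= _; rewrite /alE /thE /tA /= -scalemxAl lpbZ2.
Qed.

End Charts.

Lemma cE_cover x : exists c i, atlas k c /\ dom (cE c i) x.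
Proof. by have [c ac cx] := hM.1 x; have [i ui] := kUc x; exists c, i. Qed.

Lemma vbundle_EA : is_vbundle r1 opEA.
Proof.
split=> //=; [exact: kM|exact: mfd_EA|by move=> [x q]; rewrite scale0r|].
move=> x; have [c [i [ac cx]]] := cE_cover x.
by exists (cE c i), (alE i); split=> //; exact: vb_chart_EA.
Qed.

Lemma vbundle_EB : is_vbundle r2 opEB.
Proof.
split=> //=; [exact: kM|exact: mfd_EB|by move=> [x q]; rewrite scale0r|].
move=> x; have [c [i [ac cx]]] := cE_cover x.
by exists (cE c i), (beE i); split=> //; exact: vb_chart_EB.
Qed.

Lemma vbundle_EDA : is_vbundle (r2 + r1) opEDA.
Proof.
split=> //=; [exact: mfd_EA|exact: mfd_ED|by case|by move=> [x [q [v z]]]; rewrite !scale0r|].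
move=> a; have [c [i [ac cx]]] := cE_cover a.1.
by exists (chA (X := Edata) (cE c i) (alE i)), (fun d => row_mx (beE i (vproj opEDB d)) (thE i d)); split=> //; exact: vb_chart_EDA.
Qed.

Lemma vbundle_EDB : is_vbundle (r1 + r1) opEDB.
Proof.
split=> //=; [exact: mfd_EB|exact: mfd_ED|by case|by move=> [x [q [v z]]]; rewrite !scale0r|].
move=> a; have [c [i [ac cx]]] := cE_cover a.1.
by exists (chB (X := Edata) (cE c i) (beE i)), (fun d => row_mx (alE i (vproj opEDA d)) (thE i d)); split=> //; exact: dco_DB (dco_E i ac).
Qed.

Lemma Edata_dvb : is_dvb Edata.
Proof.
split=> //=.
- by exists r1; exact: vbundle_EA.
- by exists r2; exact: vbundle_EB.
- by exists (r2 + r1)%N; exact: vbundle_EDA.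
- by exists (r1 + r1)%N; exact: vbundle_EDB.
- by move=> d1 d2 d3 d4 [e1 e2] [e3 e4] [e5 e6] [e7 e8]; rewrite addrACA.
- by move=> t d d' [e1 e2]; rewrite scalerDr.
- by move=> t d d' [e1 e2]; rewrite scalerDr.
- by move=> s t d; rewrite !scalerA mulrC.
Qed.

Definition Edvb : dvb R := Dvb Edata_dvb.

Definition Epair (d d' : Edvb) : R := dot d.2.2.2 d'.2.1 + dot d'.2.2.2 d.2.1.

(** [Epair] is the canonical pairing in the reference frames, which need not be continuous. By
    skewness of the frames it has the same expression in every local frame, so these are
    Lagrangian. *)
Lemma Epair_coord i (d d' : Edvb) : kU i d.1 -> vproj (opDB Edvb) d = vproj (opDB Edvb) d' ->
  Epair d d' = dot (thE i d) (alE i (vproj opEDA d')) + dot (thE i d') (alE i (vproj opEDA d)).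
Proof.
move: d d' => [x [q [v z]]] [y [q' [v' z']]] /= ui [<- <-].
rewrite /Epair /thE /alE /= lpb_pair; last exact: kS'sk.
by rewrite -/(tA' i x _) -/(tA' i x _) !tAK.
Qed.

Lemma Edvb_metric : is_metric Epair.
Proof.
split.
- move=> e e1 e2 /= [h1 h2] [h3 h4]; rewrite /Epair /= dotDr dotDl addrACA; congr (_ + _).
- move=> t e e1 /= _; rewrite /Epair /= dotZr dotZl mulrDr//.
- by move=> e e1 _; rewrite /Epair addrC.
apply: (@self_dual_iso R (flip Edvb)) => m.
have [c [i [ac cx]]] := cE_cover m.
have hc := dco_flip (dco_E i ac).
exists (cE c i), r2, r1, (beE i), (alE i), (thE i); split=> // d cd.
have bE : base (metric_map Epair d : lform (opDA (flip Edvb))) = vproj (opDB Edvb) d by exact: base_mkform.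
have evd d' : vproj (opDB Edvb) d' = vproj (opDB Edvb) d -> ev (metric_map Epair d : lform (opDA (flip Edvb))) d' = Epair d d'.
  move=> e; apply: ev_mkform => //.
  by split=> [e1 e2 _ _|t e1 _]; rewrite /Epair /= ?dotDr ?dotDl ?dotZr ?dotZl ?mulrDr// addrACA.
have [|d' pd|h1 h2] := ev_coords (D := flip Edvb) hc (P := metric_map Epair d) (u := thE i d) (w := alE i (vproj opEDA d)).
- by rewrite bE.
- rewrite bE in pd; rewrite evd// (Epair_coord cd.2)//; congr (_ + _); exact: dotC.
by split.
Qed.

Definition Emdvb : mdvb R := Mdvb Edvb_metric.

Lemma Emdvb_lagr c i : atlas k c -> @lagr R Emdvb (cE c i) r1 r2 (alE i) (beE i) (thE i).
Proof.
move=> ac; split; first exact: dco_E.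
by move=> e e' [_ ui] ee; exact: Epair_coord.
Qed.

End Concrete.

(** * Each object of the category of frames is realized by a metric double vector bundle *)

Section Realization.
Variables (R : realType) (k : kobj R).
Let E : mdvb R := Emdvb k.
Let hM : pman k := kpman k.

Definition Ti (c : chart R k) (i : kI k) (ac : atlas k c) : lco E (kr1 k) (kr2 k) := Lco (Emdvb_lagr i ac).

(** A form is evaluated on one element in both coordinate systems; the transposed transition of [E]
    then reappears on the dual as the transition of the frames themselves. *)
Lemma Ti_rep c i ac c' j ac' x : dom (cE c i) x -> dom (cE c' j) x ->
  rep (id : dualA E -> dualA E) (@Ti c i ac) (@Ti c' j ac') x x (lcomp (kS j x) (kS' i x)).
Proof.
move=> cx cx' X qX.
have aE : Xal (Ti j ac') X = Xal (Ti i ac) X *m la (lcomp (kS j x) (kS' i x)).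
  move: qX; rewrite /Xal /Xq /=; case: (base X) => y q /= ->.
  by rewrite /alE /tA /= !mulmxA -[q *m _ *m _]mulmxA laK ?mulmx1//; exact: cx.2.
have [c1 c1'] : dom (lc (Ti i ac)) (Xq X) /\ dom (lc (Ti j ac')) (Xq X) by rewrite qX.
have evj := ev_X (C := Ti i ac) c1.
have [|e pe|b1 g1] := ev_coords (D := E) (lg_dco (lcP (Ti j ac'))) (P := X)
    (u := \row_l ((Xbe (Ti i ac) X *m lb (lcomp (kS j x) (kS' i x))) 0 l +
       dot (Xal (Ti i ac) X *m lw (lcomp (kS j x) (kS' i x)) l) (Xga (Ti i ac) X)))
    (w := Xga (Ti i ac) X *m la (lcomp (kS j x) (kS' i x))).
- exact: c1'.
- rewrite evj//; set G := lcomp _ _; set be := Xbe _ _; set ga := Xga _ _.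
  have ex : (e : ED k).1 = x by rewrite -qX /Xq -pe.
  have be_e : beE i (vproj (opDB E) e) = beE j (vproj (opDB E) e) *m (lb G)^T.
    rewrite /beE /= ex /tB trmx_mul !mulmxA -[_ *m _ *m (lb (kS j x))^T]mulmxA -trmx_mul lbK ?trmx1 ?mulmx1//.
    exact: cx'.2.
  have th_e : thE i e = lpb G (Xal (Ti i ac) X) (beE j (vproj (opDB E) e)) (thE j e).
    have aX : Xal (Ti i ac) X = tA i x (e : ED k).2.1 by rewrite /Xal -pe /= /alE /= ex.
    have aX' : tA i x (e : ED k).2.1 *m la (kS' i x) = (e : ED k).2.1 by apply: tAK; exact: cx.2.
    rewrite aX lpb_comp aX' /thE /beE /= ex; congr lpb.
      by rewrite -/(tB' j x _) tBK//; exact: cx'.2.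
    by rewrite -/(tA j x _) -lpb_comp kS'S ?lpb_id//; exact: cx'.2.
  rewrite [lbe _ _]be_e [lth _ _]th_e dot_lpb addrA; congr (_ + _).
  rewrite dot_mul trmxK.
  have -> : (\row_l ((be *m lb G) 0 l + dot (Xal (Ti i ac) X *m lw G l) ga)) =
     be *m lb G + \row_l dot (Xal (Ti i ac) X *m lw G l) ga by apply/rowP => l; rewrite !mxE.
  rewrite dotDl; congr (_ + _).
  by rewrite dotC; apply: eq_bigr => l _; rewrite [in RHS]mxE.
by split=> // l; rewrite [Xbe _ _]b1 mxE.
Qed.

Lemma id_rep_near (F : mdvb R) s1 s2 r1 r2 (C : lco F s1 s2) (C' : lco F r1 r2) x :
  dom (lc C) x -> dom (lc C') x -> exists h, lsm h x /\
  nearx x (fun y => [/\ dom (lc C) y, dom (lc C') y, rep id C C' y y (h y) & lskew (h y)]).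
Proof.
move=> cx cx'; have [w0 [_ w0E H]] := mor_rep s1 s2 r1 r2 (mdvb_mor_id F).
have e : w0 = id by apply/funext => y; rewrite -[y in LHS]Xq_zero -w0E Xq_zero.
by subst w0; exact: H.
Qed.

Let kc x : chart R k := s2val (cid2 (hM.1 x)).
Let kcP x : atlas k (kc x) := s2valP (cid2 (hM.1 x)).
Let ki x : kI k := sval (cid (kUc x)).
Let Tx x : lco E (kr1 k) (kr2 k) := Ti (ki x) (kcP x).

Let TxP x : dom (lc (Tx x)) x.
Proof. by split; [exact: (s2valP' (cid2 (hM.1 x)))|exact: svalP (cid (kUc x))]. Qed.

Let kiP x : kU (ki x) x. Proof. exact: (TxP x).2. Qed.

Let Cm (x : k) : lco E (rk1 E) (rk2 E) := @Cx R E x.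

(** [Kof E] has its own reference frames, chosen by [Cx]. They are compared with those of [k]
    through [Tx x], coordinates that come from a frame of [k] around the same point. *)
Definition realize : karr (Kof E) k :=
  (id, fun x => lcomp (kS' (ki x) x) (repm id (Cm x) (Tx x) x x)).
Definition unrealize : karr k (Kof E) :=
  (id, fun x => lcomp (repm id (Tx x) (Cm x) x x) (kS (ki x) x)).

Let repmP s1 s2 t1 t2 (C : lco E s1 s2) (C' : lco E t1 t2) x : dom (lc C) x -> dom (lc C') x ->
  rep id C C' x x (repm id C C' x x) /\ lskew (repm id C C' x x).
Proof.
move=> c c'; have [h [_ /nearx_self [_ _ hr hs]]] := id_rep_near c c'.
by rewrite (repmE c hr).
Qed.

Let sm_id x : smat (@id k) x. Proof. exact: smat_id. Qed.

Lemma realize_khom : khom realize.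
Proof.
apply: khomI => [x|x|x]; first exact: sm_id.
  by apply: lskew_comp; [exact: kS'sk|have [] := repmP (@CxP R E x) (TxP x)].
exists x, (ki x); split; [exact: (@CxP R E)|exact: kiP|].
have [h [sh nh]] := id_rep_near (@CxP R E x) (TxP x).
apply: (lsm_eq hM) sh; apply: nearx_sub nh => y [cy cy' hr _].
have [r1 _] := KrepP cy (@CxP R E y); have [r2 _] := repmP (CxP y) (TxP y).
have r3 := @Ti_rep _ _ (kcP y) _ _ (kcP x) y (TxP y) cy'.
rewrite (rep_uniq cy hr (rep_comp (rep_comp r1 r2) r3)) /kloc /=.
by rewrite -!lcompA.
Qed.

Lemma unrealize_khom : khom unrealize.
Proof.
apply: khomI => [x|x|x]; first exact: sm_id.
  by apply: lskew_comp; [have [] := repmP (TxP x) (@CxP R E x)|exact: kSsk].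
exists (ki x), x; split; [exact: kiP|exact: (@CxP R E)|].
have [h [sh nh]] := id_rep_near (TxP x) (@CxP R E x).
apply: (lsm_eq hM) sh; apply: nearx_sub nh => y [cy cy' hr _].
have [r1 _] := KrepP (@CxP R E y) cy'; have [r2 _] := repmP (TxP y) (CxP y).
have r3 := @Ti_rep _ _ (kcP x) _ _ (kcP y) y cy (TxP y).
rewrite (rep_uniq cy hr (rep_comp (rep_comp r3 r2) r1)) /kloc /=.
by rewrite -!lcompA.
Qed.

Lemma realizeK : kcomp unrealize realize = kid (Kof E).
Proof.
rewrite /kcomp /kid; congr pair; apply/funext => x /=.
have [r1 _] := repmP (@CxP R E x) (TxP x); have [r2 _] := repmP (TxP x) (@CxP R E x).
rewrite -lcompA [lcomp (kS _ _) _]lcompA kSS'// lcomp_idl.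
exact: (rep_uniq (@CxP R E x) (rep_comp r1 r2) (@rep_id _ _ _ _ _ x)).
Qed.

Lemma unrealizeK : kcomp realize unrealize = kid k.
Proof.
rewrite /kcomp /kid; congr pair; apply/funext => x /=.
have [r1 _] := repmP (@CxP R E x) (TxP x); have [r2 _] := repmP (TxP x) (@CxP R E x).
rewrite -lcompA [lcomp (repm _ _ _ _ _) (lcomp _ _)]lcompA.
rewrite (rep_uniq (TxP x) (rep_comp r2 r1) (@rep_id R E _ _ (Tx x) x)) lcomp_idl.
by rewrite kS'S.
Qed.

End Realization.

(** * Superpoints and polynomial functions of them *)

Section Superpoints.
Implicit Type S : pzRingType.

(** The vanishing of squares is listed on its own: in a general ring, where [2] may be a zero
    divisor, it does not follow from anticommutation. *)
Definition scomm S r1 r2 (x : 'I_r1 -> S) (y : 'I_r2 -> S) : Prop :=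
  [/\ forall i j, x i * x j = - (x j * x i), forall i, x i * x i = 0,
      forall i j, x i * y j = y j * x i & forall j l, y j * y l = y l * y j].

Definition mon S r1 r2 (x : 'I_r1 -> S) (y : 'I_r2 -> S) (A : {set 'I_r1}) (e : 'I_r2 -> nat) : S :=
  (\prod_(i in A) x i) * \prod_j y j ^+ e j.

Definition wd r1 (A : {set 'I_r1}) : seq 'I_r1 := [seq i <- index_enum _ | i \in A].

Lemma wd_uniq r1 (A : {set 'I_r1}) : uniq (wd A).
Proof. exact: filter_uniq (index_enum_uniq _). Qed.

Lemma mem_wd r1 (A : {set 'I_r1}) : wd A =i A.
Proof. by move=> i; rewrite mem_filter mem_index_enum andbT. Qed.

Lemma size_wd r1 (A : {set 'I_r1}) : size (wd A) = #|A|.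
Proof. by rewrite -(card_uniqP (wd_uniq A)); apply: eq_card => i; rewrite mem_wd. Qed.

Lemma prod_wd S r1 (A : {set 'I_r1}) (x : 'I_r1 -> S) : \prod_(i in A) x i = \prod_(i <- wd A) x i.
Proof. by rewrite big_filter. Qed.

Section Words.
Variables (S : pzRingType) (r1 r2 : nat) (x : 'I_r1 -> S) (y : 'I_r2 -> S).
Hypothesis (sc : scomm x y).

Lemma sc_swap s t : (\prod_(i <- s) x i) * (\prod_(i <- t) x i) =
  (-1) ^+ (size s * size t)%N * ((\prod_(i <- t) x i) * (\prod_(i <- s) x i)).
Proof.
have [xx _ _ _] := sc.
have one i : x i * (\prod_(i <- t) x i) = (-1) ^+ size t * ((\prod_(i <- t) x i) * x i).
  elim: t => [|j t IH]; first by rewrite big_nil !mul1r mulr1.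
  rewrite big_cons /= exprS mulrA xx !mulNr -mulrA IH mul1r; congr (- _).
  by rewrite !mulrA (commr_sign (x j)).
elim: s => [|i s IH]; first by rewrite big_nil mul1r mulr1 mul1r.
rewrite !big_cons /= -[LHS]mulrA IH [LHS]mulrA (commr_sign (x i)) -[LHS]mulrA [x i * (_ * _)]mulrA one.
by rewrite mulSn addnC exprD !mulrA.
Qed.

Lemma sc_comm A B e f : mon x y A e * mon x y B f =
  (-1) ^+ (#|A| * #|B|)%N * (mon x y B f * mon x y A e).
Proof.
have [_ _ xy yy] := sc.
have cxy (C : {set 'I_r1}) (g : 'I_r2 -> nat) : GRing.comm (\prod_(i in C) x i) (\prod_j y j ^+ g j).
  apply: commr_prod => j _; apply: commrX; apply: commr_sym; apply: commr_prod => i _.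
  by apply: commr_sym; exact: xy.
have cyy (g h : 'I_r2 -> nat) : GRing.comm (\prod_j y j ^+ g j) (\prod_j y j ^+ h j).
  apply: commr_prod => j _; apply: commrX; apply: commr_sym; apply: commr_prod => i _.
  by apply: commrX; exact: yy.
have := sc_swap (wd A) (wd B); rewrite -!prod_wd !size_wd => h.
rewrite /mon mulrA -[_ * _ * \prod_(i in B) _]mulrA -(cxy B e) mulrA h.
rewrite -!mulrA; congr (_ * (_ * _)).
by rewrite cyy mulrA (cxy A f) -!mulrA.
Qed.

End Words.

(** The exponent is quantified before the ring and the elements, so that one sign serves both for
    sections of a sheaf and for operators. *)
Lemma sc_perm r1 (s t : seq 'I_r1) : perm_eq s t -> exists n, forall S r2 (x : 'I_r1 -> S) (y : 'I_r2 -> S),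
  scomm x y -> \prod_(i <- s) x i = (-1) ^+ n * \prod_(i <- t) x i.
Proof.
rewrite perm_sym => ts; apply: (@catCA_perm_ind _ (fun u => exists n, forall S r2 (x : 'I_r1 -> S) (y : 'I_r2 -> S),
  scomm x y -> \prod_(i <- u) x i = (-1) ^+ n * \prod_(i <- t) x i) _ _ _ ts) => [s1 s2 s3 [n h]|].
  exists (size s2 * size s1 + n)%N => S r2 x y sc.
  rewrite exprD -mulrA -(h _ _ _ _ sc) !big_cat /= mulrA (sc_swap sc) -!mulrA.
  by [].
by exists 0%N => S r2 x y _; rewrite mul1r.
Qed.

Lemma sc_dup r1 (s : seq 'I_r1) S r2 (x : 'I_r1 -> S) (y : 'I_r2 -> S) : scomm x y -> ~~ uniq s ->
  \prod_(i <- s) x i = 0.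
Proof.
move=> sc; elim: s => //= i s IH; rewrite negb_and negbK => /orP[is_|/IH h]; last by rewrite big_cons h mulr0.
have [n h] := sc_perm (perm_to_rem is_); rewrite big_cons (h _ _ _ _ sc) big_cons.
by rewrite mulrA (commr_sign (x i)) -mulrA [x i * _]mulrA; have [_ -> _ _] := sc; rewrite mul0r mulr0.
Qed.

Lemma uniq_wd_card r1 (A B : {set 'I_r1}) : uniq (wd A ++ wd B) -> #|A :|: B| = (#|A| + #|B|)%N.
Proof.
move=> u; rewrite -!size_wd -size_cat; apply: perm_size; apply: uniq_perm => // [|i]; first exact: wd_uniq.
by rewrite mem_cat !mem_wd inE.
Qed.

(** A repeated odd generator kills the product; otherwise sorting the concatenated words costs a
    sign, which again depends on [A] and [B] only. *)
Lemma mon_mul r1 r2 (A B : {set 'I_r1}) : exists n, forall S (x : 'I_r1 -> S) (y : 'I_r2 -> S) e f,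
  scomm x y -> mon x y A e * mon x y B f =
   if uniq (wd A ++ wd B) then (-1) ^+ n * mon x y (A :|: B) (fun j => e j + f j)%N else 0.
Proof.
have [n hn] : exists n, forall S r2 (x : 'I_r1 -> S) (y : 'I_r2 -> S), scomm x y ->
    (\prod_(i in A) x i) * (\prod_(i in B) x i) = if uniq (wd A ++ wd B) then (-1) ^+ n * \prod_(i in A :|: B) x i else 0.
  case: (boolP (uniq _)) => [u|nu]; last first.
    by exists 0%N => S r2' x y sc; rewrite !prod_wd -big_cat; exact: (sc_dup sc).
  have /sc_perm [n h] : perm_eq (wd A ++ wd B) (wd (A :|: B)).
    by apply: uniq_perm => // [|i]; [exact: wd_uniq|rewrite mem_cat !mem_wd inE].
  by exists n => S r2' x y sc; rewrite !prod_wd -big_cat /= (h _ _ _ _ sc).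
exists n => S x y e f sc; have [_ _ xy yy] := sc.
have cxy (C : {set 'I_r1}) (g : 'I_r2 -> nat) : GRing.comm (\prod_(i in C) x i) (\prod_j y j ^+ g j).
  apply: commr_prod => j _; apply: commrX; apply: commr_sym; apply: commr_prod => i _.
  by apply: commr_sym; exact: xy.
rewrite /mon mulrA -[_ * _ * \prod_(i in B) _]mulrA -(cxy B e) mulrA (hn _ _ _ _ sc) -mulrA.
have -> : (\prod_j y j ^+ e j) * (\prod_j y j ^+ f j) = \prod_j y j ^+ (e j + f j).
  rewrite -prodrM_comm; first by apply: eq_bigr => j _; rewrite exprD.
  by move=> j l _ _; apply: commrX; apply: commr_sym; apply: commrX; exact: yy.
by case: ifP => _; rewrite ?mul0r// mulrA.
Qed.

Lemma mon_morph (S S' : pzRingType) (F : S -> S') r1 r2 (x : 'I_r1 -> S) (y : 'I_r2 -> S) A e :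
  monoid_morphism F -> F (mon x y A e) = mon (F \o x) (F \o y) A e.
Proof.
move=> [f1 fM]; rewrite /mon fM !(big_morph F fM f1); congr (_ * _).
apply: eq_bigr => j _; elim: (e j) => [|m IH]; first by rewrite !expr0.
by rewrite !exprS fM IH.
Qed.

End Superpoints.

(** * Creation operators on a Fock space *)

Section Fock.
Variable R : realType.

(* Sections of the structure sheaf will be functions with values in the operators on the Fock space of
   countably many fermions and bosons: evaluated at the generic point [pt0] made of creation operators,
   distinct monomials are linearly independent. *)
Definition occ : Type := ((nat -> bool) * (nat -> nat))%type.

Record fop := Fop { fopf :> (occ -> R) -> (occ -> R); fop_lin : linear fopf }.

Lemma fop_eq (a b : fop) : (forall v q, a v q = b v q) -> a = b.
Proof.
case: a => a ha; case: b => b hb /= h.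
have e : a = b by apply/funext => v; apply/funext => q; exact: h.
by case: _ / e in hb *; congr Fop; exact: Prop_irrelevance.
Qed.

HB.instance Definition _ := gen_eqMixin fop.
HB.instance Definition _ := gen_choiceMixin fop.

Lemma fopD_subproof (a b : fop) : linear (fun v => a v + b v).
Proof. by move=> t u v; rewrite !fop_lin scalerDr addrACA. Qed.
Lemma fopN_subproof (a : fop) : linear (fun v => - a v).
Proof. by move=> t u v; rewrite !fop_lin opprD scalerN. Qed.
Lemma fop0_subproof : linear (fun _ : occ -> R => 0 : occ -> R).
Proof. by move=> t u v; rewrite scaler0 addr0. Qed.
Lemma fop1_subproof : linear (fun v : occ -> R => v).
Proof. by []. Qed.
Lemma fopM_subproof (a b : fop) : linear (fun v => a (b v)).
Proof. by move=> t u v; rewrite !fop_lin. Qed.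
Lemma fopZ_subproof (c : R) (a : fop) : linear (fun v => c *: a v).
Proof. by move=> t u v; rewrite !fop_lin scalerDr !scalerA mulrC. Qed.

Lemma fop_addr (a : fop) u v : a (u + v) = a u + a v.
Proof. by have := fop_lin a 1 u v; rewrite !scale1r. Qed.
Lemma fop_zero (a : fop) : a 0 = 0.
Proof. by have := fop_addr a 0 0; rewrite addr0 => /esym/eqP; rewrite -subr_eq0 addrK => /eqP. Qed.
Lemma fop_scal (a : fop) (t : R) u : a (t *: u) = t *: a u.
Proof. by have := fop_lin a t u 0; rewrite fop_zero !addr0. Qed.

Let zfop := Fop fop0_subproof.
Let ofop := Fop fop1_subproof.
Let nfop a := Fop (fopN_subproof a).
Let afop a b := Fop (fopD_subproof a b).
Let mfop a b := Fop (fopM_subproof a b).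
Let sfop c a := Fop (fopZ_subproof c a).

Let addA : associative afop. Proof. by move=> a b c; apply: fop_eq => v q; rewrite /= addrA. Qed.
Let addC : commutative afop. Proof. by move=> a b; apply: fop_eq => v q; rewrite /= addrC. Qed.
Let add0 : left_id zfop afop. Proof. by move=> a; apply: fop_eq => v q; rewrite /= add0r. Qed.
Let addN : left_inverse zfop nfop afop. Proof. by move=> a; apply: fop_eq => v q; rewrite /= addNr. Qed.
HB.instance Definition _ := @GRing.isZmodule.Build fop zfop nfop afop addA addC add0 addN.

Let mulA : associative mfop. Proof. by move=> a b c; exact: fop_eq. Qed.
Let mul1 : left_id ofop mfop. Proof. by move=> a; exact: fop_eq. Qed.
Let mulr1' : right_id ofop mfop. Proof. by move=> a; exact: fop_eq. Qed.
Let mulDl : left_distributive mfop +%R. Proof. by move=> a b c; exact: fop_eq. Qed.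
Let mulDr : right_distributive mfop +%R.
Proof. by move=> a b c; apply: fop_eq => v q; rewrite /= fop_addr. Qed.
Let one0 : ofop != 0.
Proof.
apply/eqP => /(congr1 (fun a : fop => a (fun=> 1) (fun=> false, fun=> 0%N))) /= /eqP.
by rewrite oner_eq0.
Qed.
HB.instance Definition _ := @GRing.Zmodule_isNzRing.Build fop ofop mfop mulA mul1 mulr1' mulDl mulDr one0.

Let sA c d a : sfop c (sfop d a) = sfop (c * d) a.
Proof. by apply: fop_eq => v q; rewrite /= scalerA. Qed.
Let s1 : left_id 1 sfop. Proof. by move=> a; apply: fop_eq => v q; rewrite /= scale1r. Qed.
Let sDr : right_distributive sfop +%R. Proof. by move=> c a b; apply: fop_eq => v q; rewrite /= scalerDr. Qed.
Let sDl a : {morph sfop^~ a : c d / c + d}. Proof. by move=> c d; apply: fop_eq => v q; rewrite /= scalerDl. Qed.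
HB.instance Definition _ := @GRing.Zmodule_isLmodule.Build R fop sfop sA s1 sDr sDl.
Let sAl c (a b : fop) : c *: (a * b) = (c *: a) * b. Proof. exact: fop_eq. Qed.
HB.instance Definition _ := @GRing.Lmodule_isLalgebra.Build R fop sAl.
Let sAr c (a b : fop) : c *: (a * b) = a * (c *: b).
Proof. by apply: fop_eq => v q; rewrite [RHS]/= fop_scal. Qed.
HB.instance Definition _ := @GRing.Lalgebra_isAlgebra.Build R fop sAr.

Lemma fopD (a b : fop) v q : (a + b) v q = a v q + b v q. Proof. by []. Qed.
Lemma fopM (a b : fop) v : (a * b) v = a (b v). Proof. by []. Qed.
Lemma fopZ c (a : fop) v q : (c *: a) v q = c * a v q. Proof. by []. Qed.

Lemma fopN (a : fop) v q : (- a) v q = - a v q. Proof. by []. Qed.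
Lemma occ_scaleE (t : R) (u : occ -> R) q : (t *: u) q = t * u q. Proof. by []. Qed.
Lemma occ_linE (t : R) (u v : occ -> R) q : (t *: u + v) q = t * u q + v q. Proof. by []. Qed.

Definition del (q : occ) i : occ := (fun j => (j != i) && q.1 j, q.2).
Definition dec (q : occ) j : occ := (q.1, fun l => q.2 l - (l == j))%N.
(* the Jordan-Wigner sign, which makes the fermionic creation operators anticommute *)
Definition jw (q : occ) i : R := (-1) ^+ (\sum_(j < i) q.1 j).

Lemma crx_subproof i : linear (fun (v : occ -> R) (q : occ) => if q.1 i then jw q i * v (del q i) else 0).
Proof.
move=> t u v; apply/funext => q; rewrite !occ_linE; case: ifP => _; last by rewrite mulr0 addr0.
by rewrite mulrDr mulrCA.
Qed.
Definition crx i : fop := Fop (crx_subproof i).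

Lemma cry_subproof j : linear (fun (v : occ -> R) (q : occ) => if (0 < q.2 j)%N then v (dec q j) else 0).
Proof.
by move=> t u v; apply/funext => q; rewrite !occ_linE; case: ifP => _ //; rewrite mulr0 addr0.
Qed.
Definition cry j : fop := Fop (cry_subproof j).

(** For [i < k], removing [i] changes by one the number of occupied sites below [k] and so flips the
    sign attached to [k], whereas removing [k] leaves the sign attached to [i] unchanged. *)
Lemma crxx i k : crx i * crx k = - (crx k * crx i).
Proof.
wlog ik : i k / (i <= k)%N => [H|].
  by case/orP: (leq_total i k) => /H // ->; rewrite opprK.
apply: fop_eq => v q; rewrite fopN !fopM /=.
have [->|ne] := eqVneq i k; first by rewrite /= mulr0 if_same oppr0.
have lik : (i < k)%N by rewrite ltn_neqAle ne.
rewrite /=.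
case: (boolP (q.1 i)) => qi; case: (boolP (q.1 k)) => qk /=; rewrite ?mulr0 ?oppr0//.
have e1 : jw (del q i) k = - jw q k.
  rewrite /jw (bigD1 (Ordinal lik))//= eqxx /= [in RHS](bigD1 (Ordinal lik))//= qi /= add0n add1n exprS mulN1r opprK.
  congr (_ ^+ _); apply: eq_bigr => j ji; rewrite (_ : (j != i :> nat) = true)//.
have e2 : jw (del q k) i = jw q i.
  congr (_ ^+ _); apply: eq_bigr => j _ /=; rewrite (_ : (j != k :> nat) = true)//.
  by apply/eqP => jk; have := ltn_ord j; rewrite jk ltnNge ltnW.
rewrite e1 e2 mulNr mulrN mulrCA; congr (- (_ * (_ * v _))).
by rewrite /del /=; congr pair; apply/funext => j; rewrite andbCA.
Qed.

Lemma crxy i j : crx i * cry j = cry j * crx i.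
Proof. by apply: fop_eq => v q; rewrite [LHS]/= [RHS]/=; case: ifP; case: ifP => //; rewrite mulr0. Qed.

Lemma cryy j l : cry j * cry l = cry l * cry j.
Proof.
apply: fop_eq => v q; rewrite [LHS]/= [RHS]/=.
have [->//|ne] := eqVneq j l.
rewrite /= !subn0; case: ifP; case: ifP => // _ _; congr (v _).
by congr pair; apply/funext => i /=; rewrite -!subnDA addnC.
Qed.

End Fock.

Section FockPoints.
Variable R : realType.
Local Notation fop := (fop R).
Local Notation crx := (crx R).
Local Notation cry := (cry R).
Local Notation jw := (jw R).

Definition basis (q' : occ) : occ -> R := fun q => (`[< q = q' >])%:R.
Definition add (q : occ) i : occ := (fun j => (j == i) || q.1 j, q.2).
Definition inc (q : occ) j m : occ := (q.1, fun l => q.2 l + m * (l == j))%N.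

Lemma crx_basis i q : ~~ q.1 i -> crx i (basis q) = jw (add q i) i *: basis (add q i).
Proof.
move=> qi; apply/funext => u; rewrite occ_scaleE /basis /=.
case: (asboolP (u = _)) => [->|ne] /=.
  rewrite eqxx /= (_ : del (add q i) i = q) ?asboolT//.
  rewrite [RHS]surjective_pairing; congr pair; apply/funext => j /=.
  by have [->|] := eqVneq j i; [rewrite (negbTE qi)|].
rewrite mulr0; case: ifP => // ui; case: asboolP => [e|]; last by rewrite mulr0.
case: ne; rewrite -e /add /del /= [LHS]surjective_pairing; congr pair; apply/funext => j.
by have [->|] := eqVneq j i; [rewrite ui|].
Qed.

Lemma cry_basis j q : cry j (basis q) = basis (inc q j 1).
Proof.
apply/funext => u; rewrite /basis /=; case: ifP => uj; last first.
  by case: asboolP => // e; move: uj; rewrite e /= eqxx addn1.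
congr (nat_of_bool _)%:R; apply/asbool_equiv_eq; split=> [e|->]; last first.
  rewrite /dec /= [RHS]surjective_pairing; congr pair; apply/funext => l.
  by rewrite mul1n addnK.
rewrite -e /inc /dec /= [LHS]surjective_pairing; congr pair; apply/funext => l.
by rewrite mul1n subnK//; case: eqP => // ->.
Qed.

Lemma crx_word r1 (s : seq 'I_r1) (n : nat -> bool) : uniq s -> {in s, forall i, ~~ n (val i)} ->
  exists2 c : R, c != 0 & forall f, (\prod_(i <- s) crx i) (basis (n, f)) =
    c *: basis (fun k => (k \in map val s) || n k, f).
Proof.
elim: s => [|i s IH] /= => [_ _|/andP[is_ us] qs].
  by exists 1; rewrite ?oner_eq0// => f; rewrite big_nil scale1r.
have [|c c0 h] := IH us; first by move=> j js; apply: qs; rewrite inE js orbT.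
pose q' f : occ := (fun k => (k \in map val s) || n k, f).
have qi f : ~~ (q' f).1 (val i).
  by rewrite /= negb_or qs ?mem_head// andbT (mem_map val_inj).
exists (c * jw (add (q' (fun=> 0%N)) (val i)) (val i)); first by rewrite mulf_neq0// /jw signr_eq0.
move=> f; rewrite big_cons fopM h fop_scal crx_basis ?qi// scalerA; congr (_ *: basis _).
by congr pair; apply/funext => k; rewrite inE orbA.
Qed.

Lemma cry_pow j m q : (cry j ^+ m) (basis q) = basis (inc q j m).
Proof.
elim: m => [|m IH].
  rewrite expr0 /=; congr basis; rewrite [LHS]surjective_pairing; congr pair.
  by apply/funext => l; rewrite mul0n addn0.
rewrite exprS fopM IH cry_basis; congr basis; congr pair; apply/funext => l /=.
by rewrite -addnA -mulnDl addn1.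
Qed.

Lemma cry_word r2 (s : seq 'I_r2) (e : 'I_r2 -> nat) q : (\prod_(j <- s) cry j ^+ e j) (basis q) =
  basis (q.1, fun l => q.2 l + \sum_(j <- s) e j * (l == j))%N.
Proof.
elim: s => [|j s IH].
  rewrite big_nil /=; congr basis; rewrite [LHS]surjective_pairing; congr pair.
  by apply/funext => l; rewrite big_nil addn0.
rewrite big_cons fopM IH cry_pow; congr basis; congr pair; apply/funext => l /=.
by rewrite big_cons -addnA [X in (_ + X)%N]addnC.
Qed.

(* superpoints: the values of [r1] odd and [r2] even generators in the algebra of operators *)
Record spt r1 r2 := Spt { px : 'I_r1 -> fop; py : 'I_r2 -> fop; pP : scomm px py }.

Lemma spt_eq r1 r2 (p q : spt r1 r2) : px p =1 px q -> py p =1 py q -> p = q.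
Proof.
case: p => x y h; case: q => x' y' h' /= /funext ex /funext ey; subst.
by congr Spt; exact: Prop_irrelevance.
Qed.

Lemma pt0_subproof r1 r2 : scomm (fun i : 'I_r1 => crx i) (fun j : 'I_r2 => cry j).
Proof.
split=> [i j|i|i j|j l]; [exact: crxx| |exact: crxy|exact: cryy].
by apply: fop_eq => v q /=; rewrite eqxx /= mulr0 if_same.
Qed.
Definition pt0 r1 r2 : spt r1 r2 := Spt (pt0_subproof r1 r2).

Notation pmon p := (mon (px p) (py p)).

Definition vac : occ := (fun=> false, fun=> 0%N).
(** The occupation state that a monomial creates from the vacuum, up to a nonzero factor ([pmon0]).
    Distinct monomials create distinct states, whence their independence. *)
Definition qo r1 r2 (A : {set 'I_r1}) (e : 'I_r2 -> nat) : occ :=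
  (fun n : nat => n \in map val (wd A), fun l : nat => \sum_j e j * (l == j))%N.

Lemma qo_inj r1 r2 (A B : {set 'I_r1}) (e f : 'I_r2 -> nat) : qo A e = qo B f -> A = B /\ e =1 f.
Proof.
move=> [h1 h2]; split.
  apply/setP => i; have := congr1 (fun h => h (val i)) h1.
  by rewrite !(mem_map val_inj) !mem_wd.
have H (g : 'I_r2 -> nat) (j : 'I_r2) : (\sum_l g l * (j == l :> nat))%N = g j.
  rewrite (bigD1 j)//= eqxx muln1 big1 ?addn0// => l lj.
  by rewrite (_ : (_ == _) = false) ?muln0//; apply/eqP => /val_inj jl; rewrite jl eqxx in lj.
by move=> j; have := congr1 (fun h => h (val j)) h2; rewrite !H.
Qed.

Lemma pmon0 r1 (A : {set 'I_r1}) : exists c : R, c != 0 /\ forall r2 (e : 'I_r2 -> nat),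
  pmon (pt0 r1 r2) A e (basis vac) = c *: basis (qo A e).
Proof.
have [||c c0 hc] := @crx_word r1 (wd A) vac.1; first exact: wd_uniq.
  by [].
exists c; split=> // r2 e; rewrite /mon fopM cry_word prod_wd hc; congr (_ *: basis _).
by congr pair; apply/funext => k; rewrite orbF.
Qed.

Definition pc r1 (A : {set 'I_r1}) : R := sval (cid (pmon0 A)).

(* reads off the coefficient of a monomial from the value at [pt0] of a polynomial *)
Definition cf r1 r2 (A : {set 'I_r1}) (e : 'I_r2 -> nat) (a : fop) : R := (pc A)^-1 * a (basis vac) (qo A e).

Lemma cf_mon r1 r2 (A B : {set 'I_r1}) (e f : 'I_r2 -> nat) :
  cf A e (pmon (pt0 r1 r2) B f) = (`[< A = B /\ e =1 f >])%:R.
Proof.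
have [c0 h] := svalP (cid (pmon0 B)); rewrite /cf h occ_scaleE /basis.
case: asboolP => [/qo_inj[ab ef]|ne]; case: asboolP => //.
- by move=> _; rewrite ab mulr1 mulVf.
- by case.
- by move=> [ab /funext ef]; case: ne; rewrite ab ef.
- by rewrite !mulr0.
Qed.

Lemma cfD r1 r2 (A : {set 'I_r1}) (e : 'I_r2 -> nat) a b : cf A e (a + b) = cf A e a + cf A e b.
Proof. by rewrite /cf fopD mulrDr. Qed.

Lemma cfZ r1 r2 (A : {set 'I_r1}) (e : 'I_r2 -> nat) c a : cf A e (c *: a) = c * cf A e a.
Proof. by rewrite /cf fopZ mulrCA. Qed.

Lemma cf0 r1 r2 (A : {set 'I_r1}) (e : 'I_r2 -> nat) : cf A e 0 = 0.
Proof. by rewrite -(scale0r 0) cfZ mul0r. Qed.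

Lemma cf_sum r1 r2 (A : {set 'I_r1}) (e : 'I_r2 -> nat) (I : Type) (s : seq I) (P : pred I) (F : I -> fop) :
  cf A e (\sum_(i <- s | P i) F i) = \sum_(i <- s | P i) cf A e (F i).
Proof. by apply: big_morph; [exact: cfD|exact: cf0]. Qed.

End FockPoints.

(** * Substitutions of generators and homogeneous polynomials *)

Section Substitution.
Variable R : realType.
Local Notation fop := (fop R).
Local Notation pmon p := (mon (px p) (py p)).

Lemma fop_half (z : fop) : z = - z -> z = 0.
Proof.
move=> h; have : (2 : R) *: z = 0 by rewrite scaler_nat mulr2n {1}h addNr.
by move/(congr1 ( *:%R 2^-1)); rewrite scalerA mulVf ?pnatr_eq0// scale1r scaler0.
Qed.

Lemma sign_scale n (z : fop) : (-1) ^+ n * z = ((-1) ^+ n : R) *: z.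
Proof.
elim: n => [|n IH]; first by rewrite !expr0 mul1r scale1r.
by rewrite !exprS !mulN1r mulNr IH scaleNr.
Qed.

Lemma sum_mul2 (I J : finType) (u : I -> R) (v : J -> R) (x : I -> fop) (y : J -> fop) :
  (\sum_i u i *: x i) * (\sum_j v j *: y j) = \sum_i \sum_j (u i * v j) *: (x i * y j).
Proof.
rewrite mulr_suml; apply: eq_bigr => i _; rewrite mulr_sumr; apply: eq_bigr => j _.
by rewrite -scalerAl -scalerAr scalerA.
Qed.

Lemma mon_x (S : pzRingType) r1 r2 (x : 'I_r1 -> S) (y : 'I_r2 -> S) i e : (forall j, e j = 0)%N ->
  mon x y [set i]%SET e = x i.
Proof. by move=> e0; rewrite /mon big_set1 big1 ?mulr1// => j _; rewrite e0 expr0. Qed.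

Lemma mon_y (S : pzRingType) r1 r2 (x : 'I_r1 -> S) (y : 'I_r2 -> S) j e :
  (forall l, e l = (l == j) :> nat) -> mon x y finset.set0 e = y j.
Proof.
move=> ej; rewrite /mon big1 ?mul1r => [|i]; last by rewrite inE.
rewrite (eq_bigr (fun l => if l == j then y l else 1)) => [|l _]; last by rewrite ej; case: eqP.
by rewrite -big_mkcond big_pred1_eq.
Qed.

Lemma mon_xx r1 (i l : 'I_r1) : i != l -> exists n, forall (S : pzRingType) r2 (x : 'I_r1 -> S) (y : 'I_r2 -> S) e,
  scomm x y -> (forall j, e j = 0)%N -> mon x y [set i; l]%SET e = (-1) ^+ n * (x i * x l).
Proof.
move=> il; have /sc_perm [n h] : perm_eq (wd [set i; l]%SET) [:: i; l].
  apply: uniq_perm; rewrite ?wd_uniq//= ?inE ?il// => j.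
  by rewrite mem_wd !inE.
exists n => S r2 x y e sc e0; rewrite /mon prod_wd (h _ _ _ _ sc) !big_cons big_nil mulr1.
by rewrite big1 ?mulr1// => j _; rewrite e0 expr0.
Qed.

Section Act.
Variables (s1 s2 r1 r2 : nat).
Implicit Types (h : Lm R s1 s2 r1 r2) (p : spt R s1 s2).

Definition ax h p (j : 'I_r1) : fop := \sum_i la h i j *: px p i.
Definition ay h p (j : 'I_r2) : fop :=
  \sum_i lb h i j *: py p i + \sum_i \sum_l lw h j i l *: (px p i * px p l).

Lemma lact_subproof h p : scomm (ax h p) (ay h p).
Proof.
have [xx x2 xy yy] := pP p.
have anti (u v : 'I_s1 -> R) : (\sum_i u i *: px p i) * (\sum_i v i *: px p i) =
    - ((\sum_i v i *: px p i) * (\sum_i u i *: px p i)).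
  rewrite !sum_mul2 exchange_big /= -sumrN; apply: eq_bigr => i _; rewrite -sumrN.
  by apply: eq_bigr => j _; rewrite xx scalerN mulrC.
have cZ (z w : fop) (c : R) : GRing.comm z w -> GRing.comm z (c *: w).
  by move=> h'; rewrite /GRing.comm -scalerAr -scalerAl h'.
have xxx i k l : GRing.comm (px p i) (px p k * px p l).
  by rewrite /GRing.comm mulrA xx mulNr -mulrA xx mulrN opprK mulrA.
have cay j (z : fop) : (forall l, GRing.comm z (py p l)) -> (forall k l, GRing.comm z (px p k * px p l)) ->
    GRing.comm z (ay h p j).
  move=> h1 h2; apply: commrD; first by apply: commr_sum => l _; apply: cZ.
  by apply: commr_sum => k _; apply: commr_sum => l _; apply: cZ.
have yxx j k l : GRing.comm (py p j) (px p k * px p l).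
  by apply: commrM; rewrite /GRing.comm xy.
split=> [i j|i|i j|j l]; first exact: anti.
- exact/fop_half/anti.
- apply: cay => [l|k l]; apply: commr_sym; apply: commr_sum => m _; apply: cZ.
    by rewrite /GRing.comm xy.
  exact: commr_sym.
- apply: (cay _ _) => [m|k m]; apply: commr_sym; apply: (cay _ _) => //.
  + by move=> n; apply: commr_sym; exact: yxx.
  + by move=> a b; apply: commrM; apply: commr_sym; exact: xxx.
Qed.

(** Points are carried forward, from generators [(s1, s2)] to [(r1, r2)], so that the pull-back of a
    function is its composite with [lact h] and [lact_comp] has no reversal of order. *)
Definition lact h p : spt R r1 r2 := Spt (lact_subproof h p).

End Act.

Lemma lact_id r1 r2 (p : spt R r1 r2) : lact (lid R r1 r2) p = p.
Proof.
apply: spt_eq => j /=.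
  rewrite /ax (bigD1 j)//= mxE eqxx scale1r big1 ?addr0// => i /negbTE ij.
  by rewrite mxE ij scale0r.
rewrite /ay [X in _ + X]big1 ?addr0 => [|i _]; last by rewrite big1// => l _; rewrite mxE scale0r.
rewrite (bigD1 j)//= mxE eqxx scale1r big1 ?addr0// => i /negbTE ij.
by rewrite mxE ij scale0r.
Qed.

Lemma lact_comp s1 s2 r1 r2 t1 t2 (g : Lm R r1 r2 t1 t2) (h : Lm R s1 s2 r1 r2) p :
  lact (lcomp g h) p = lact g (lact h p).
Proof.
have ex m n (a : 'M[R]_(m, n)) k (b : 'M[R]_(n, k)) (z : 'I_m -> fop) j :
    \sum_i (a *m b) i j *: z i = \sum_l b l j *: (\sum_i a i l *: z i).
  under [RHS]eq_bigr => l _ do rewrite scaler_sumr.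
  rewrite exchange_big; apply: eq_bigr => i _ /=; rewrite mxE scaler_suml.
  by apply: eq_bigr => l _; rewrite scalerA mulrC.
apply: spt_eq => j /=; first exact: ex.
rewrite [LHS]/ay ex /= [RHS]/ay /=.
under [X in _ = X + _]eq_bigr => l _ do rewrite /= /ay scalerDr.
rewrite big_split /= -addrA; congr (_ + _).
under eq_bigr => i _ do under eq_bigr => l _ do rewrite mxE scalerDl.
under eq_bigr => i _ do rewrite big_split /=.
rewrite big_split /=; congr (_ + _).
  under [RHS]eq_bigr => k _ do rewrite scaler_sumr.
  rewrite [RHS]exchange_big; apply: eq_bigr => i _ /=.
  under [RHS]eq_bigr => k _ do rewrite scaler_sumr.
  rewrite [RHS]exchange_big; apply: eq_bigr => l _ /=.
  by rewrite summxE scaler_suml; apply: eq_bigr => k _; rewrite mxE scalerA.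
under [RHS]eq_bigr => k _ do under eq_bigr => k' _ do rewrite sum_mul2 scaler_sumr.
under [RHS]eq_bigr => k _ do rewrite exchange_big /=.
rewrite [RHS]exchange_big; apply: eq_bigr => i _ /=.
under [RHS]eq_bigr => k _ do under eq_bigr => k' _ do rewrite scaler_sumr.
under [RHS]eq_bigr => k _ do rewrite exchange_big /=.
rewrite [RHS]exchange_big; apply: eq_bigr => l _ /=.
rewrite mxE scaler_suml exchange_big /=; apply: eq_bigr => k' _.
rewrite !mxE mulr_suml scaler_suml; apply: eq_bigr => k _.
by rewrite scalerA mulrAC mulrC.
Qed.

Definition kmon r1 r2 n (p : spt R r1 r2) (k : expo r1 r2 n) : fop := pmon p k.1 (fun j => k.2 j).

(* [hp n]: homogeneous of degree [n] with constant coefficients; [hl n]: with smooth coefficients, near a point *)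
Definition hp r1 r2 n (a : spt R r1 r2 -> fop) : Prop :=
  exists c : expo r1 r2 n -> R, forall p, a p = \sum_(k | expo_deg k == n) c k *: kmon p k.

Definition ecf r1 r2 n (k : expo r1 r2 n) (a : spt R r1 r2 -> fop) : R := cf k.1 (fun j => k.2 j : nat) (a (pt0 R r1 r2)).

Lemma expo_eq r1 r2 n (k l : expo r1 r2 n) : k.1 = l.1 -> (forall j, k.2 j = l.2 j :> nat) -> k = l.
Proof. by case: k => A e; case: l => B f /= -> h; congr pair; apply/ffunP => j; apply: val_inj; exact: h. Qed.

Lemma ecf_kmon r1 r2 n (k l : expo r1 r2 n) : ecf k (fun p => kmon p l) = (k == l)%:R.
Proof.
rewrite /ecf /kmon cf_mon; congr (nat_of_bool _)%:R; apply/asboolP/eqP => [[h1 h2]|->//].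
by apply: expo_eq.
Qed.

Lemma ecf_sum r1 r2 n (c : expo r1 r2 n -> R) (a : spt R r1 r2 -> fop) k :
  (forall p, a p = \sum_(k | expo_deg k == n) c k *: kmon p k) -> expo_deg k = n -> ecf k a = c k.
Proof.
move=> h kn; rewrite /ecf h cf_sum (bigD1 k) ?kn//= big1 ?addr0 => [|l /andP[_ lk]].
  by rewrite cfZ -[cf _ _ _]/(ecf k (fun p => kmon p k)) ecf_kmon eqxx mulr1.
by rewrite cfZ -[cf _ _ _]/(ecf k (fun p => kmon p l)) ecf_kmon eq_sym (negbTE lk) mulr0.
Qed.

Lemma hpE r1 r2 n (a : spt R r1 r2 -> fop) p : hp n a ->
  a p = \sum_(k : expo r1 r2 n | expo_deg k == n) ecf k a *: kmon p k.
Proof. by move=> [c h]; rewrite h; apply: eq_bigr => k /eqP kn; rewrite (ecf_sum h kn). Qed.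

Section Local.
Variables (X : space R) (hX : pman X) (r1 r2 : nat).
Implicit Types (F G : X -> spt R r1 r2 -> fop) (x : X).

Definition hl n F x : Prop := exists f : expo r1 r2 n -> X -> R, (forall k, smx (f k) x) /\
  nearx x (fun y => forall p, F y p = \sum_(k | expo_deg k == n) f k y *: kmon p k).

Lemma hl_eq n F G x : nearx x (fun y => forall p, F y p = G y p) -> hl n F x -> hl n G x.
Proof.
by move=> e [f [hf h]]; exists f; split=> //; apply: (nearx2 hX h e) => y hy ey p; rewrite -ey hy.
Qed.

Lemma hl_hp n F x : hl n F x -> hp n (F x).
Proof. by move=> [f [_ /nearx_self h]]; exists (f ^~ x). Qed.

Lemma hl_cf n F x (A : {set 'I_r1}) (e : 'I_r2 -> nat) : hl n F x -> smx (fun y => cf A e (F y (pt0 R r1 r2))) x.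
Proof.
move=> [f [hf h]]; apply: (@smx_eq _ X hX (fun y => \sum_(k : expo r1 r2 n | expo_deg k == n)
  f k y * cf A e (kmon (pt0 R r1 r2) k))).
  by apply: nearx_sub h => y h; rewrite h cf_sum; apply: eq_bigr => k _; rewrite cfZ.
apply: smx_sum => // k _; apply: smxM => //; exact: smx_cst.
Qed.

Lemma hlD n F G x : hl n F x -> hl n G x -> hl n (fun y p => F y p + G y p) x.
Proof.
move=> [f [hf h]] [g [hg h']]; exists (fun k y => f k y + g k y); split.
  by move=> k; exact: smxD.
apply: (nearx2 hX h h') => y hy hy' p; rewrite hy hy' -big_split; apply: eq_bigr => k _.
by rewrite scalerDl.
Qed.

Lemma hlZ n (g : X -> R) F x : smx g x -> hl n F x -> hl n (fun y p => g y *: F y p) x.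
Proof.
move=> hg [f [hf h]]; exists (fun k y => g y * f k y); split; first by move=> k; exact: smxM.
by apply: nearx_sub h => y h p; rewrite h scaler_sumr; apply: eq_bigr => k _; rewrite scalerA.
Qed.

Lemma hl0 n x : hl n (fun _ _ => 0) x.
Proof.
exists (fun _ _ => 0); split; first by move=> _; exact: smx_cst.
by apply: (nearx_true hX) => y p; rewrite big1// => k _; rewrite scale0r.
Qed.

Lemma hl_sum n (I : Type) (s : seq I) (P : pred I) (F : I -> X -> spt R r1 r2 -> fop) x :
  (forall i, P i -> hl n (F i) x) -> hl n (fun y p => \sum_(i <- s | P i) F i y p) x.
Proof.
move=> h; elim: s => [|i s IH].
  by apply: hl_eq (hl0 n x); apply: (nearx_true hX) => y p; rewrite big_nil.
case: (boolP (P i)) => Pi.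
  by apply: hl_eq (hlD (h i Pi) IH); apply: (nearx_true hX) => y p; rewrite big_cons Pi.
by apply: hl_eq IH; apply: (nearx_true hX) => y p; rewrite big_cons (negbTE Pi).
Qed.

Lemma hl_mon n (A : {set 'I_r1}) (e : 'I_r2 -> nat) x : (#|A| + 2 * \sum_j e j = n)%N -> hl n (fun _ p => pmon p A e) x.
Proof.
move=> en; pose k0 : expo r1 r2 n := (A, [ffun j => inord (e j)]).
(* [expo] bounds each exponent by the total degree; as the degree of this monomial is [n], [inord]
   truncates nothing. *)
have ke j : k0.2 j = e j :> nat.
  rewrite ffunE inordK// ltnS -en (bigD1 j)//= mulnDr addnCA mul2n -addnn -!addnA.
  exact: leq_addr.
have dk : expo_deg k0 = n.
  by rewrite -[RHS]en /expo_deg; congr (_ + 2 * _)%N; apply: eq_bigr => j _; exact: ke.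
exists (fun k _ => (k == k0)%:R); split; first by move=> k; exact: smx_cst.
apply: (nearx_true hX) => y p; rewrite (bigD1 k0) ?dk//= eqxx scale1r big1 ?addr0 => [|k /andP[_ /negbTE ->]].
  by rewrite /kmon; congr mon; apply/funext => j; rewrite ke.
by rewrite scale0r.
Qed.

Lemma hlM m n F G x : hl m F x -> hl n G x -> hl (m + n) (fun y p => F y p * G y p) x.
Proof.
move=> [f [hf h]] [g [hg h']].
apply: (@hl_eq _ (fun y p => \sum_(k : expo r1 r2 m | expo_deg k == m) \sum_(l : expo r1 r2 n | expo_deg l == n)
   (f k y * g l y) *: (kmon p k * kmon p l))).
  apply: (nearx2 hX h h') => y hy hy' p; rewrite hy hy' mulr_suml; apply: eq_bigr => k _.
  by rewrite mulr_sumr; apply: eq_bigr => l _; rewrite -scalerAl -scalerAr scalerA.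
apply: hl_sum => k /eqP km; apply: hl_sum => l /eqP ln.
apply: hlZ; first exact: smxM.
have [q hq] := mon_mul r2 k.1 l.1.
apply: (@hl_eq _ (fun _ p => if uniq (wd k.1 ++ wd l.1) then ((-1) ^+ q : R) *: pmon p (k.1 :|: l.1) (fun j => k.2 j + l.2 j)%N else 0)).
  apply: (nearx_true hX) => y p; rewrite /kmon hq; last exact: pP.
  by rewrite sign_scale.
case: (boolP (uniq (wd k.1 ++ wd l.1))) => u; last exact: hl0.
apply: hlZ; first exact: smx_cst.
apply: hl_mon; rewrite uniq_wd_card// big_split /= mulnDr addnACA.
by rewrite -[in RHS]km -[in RHS]ln.
Qed.

Lemma hl1 x : hl 0 (fun _ _ => 1) x.
Proof.
have h := @hl_mon 0 finset.set0 (fun=> 0%N) x; apply: hl_eq (h _); last by rewrite cards0 big1.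
apply: (nearx_true hX) => y p; rewrite /mon big1 ?mul1r => [|i]; last by rewrite inE.
by rewrite big1// => j _; rewrite expr0.
Qed.

Lemma hl_prod (I : Type) (s : seq I) (P : pred I) (d : I -> nat) (F : I -> X -> spt R r1 r2 -> fop) x :
  (forall i, P i -> hl (d i) (F i) x) ->
  hl (\sum_(i <- s | P i) d i) (fun y p => \prod_(i <- s | P i) F i y p) x.
Proof.
move=> h; elim: s => [|i s IH].
  by rewrite big_nil; apply: hl_eq (hl1 x); apply: (nearx_true hX) => y p; rewrite big_nil.
rewrite big_cons; case: ifPn => Pi.
  by apply: hl_eq (hlM (h i Pi) IH); apply: (nearx_true hX) => y p; rewrite big_cons Pi.
by apply: hl_eq IH; apply: (nearx_true hX) => y p; rewrite big_cons (negbTE Pi).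
Qed.

Lemma hlX n F x m : hl n F x -> hl (n * m) (fun y p => F y p ^+ m) x.
Proof.
move=> h; elim: m => [|m IH].
  by rewrite muln0; apply: hl_eq (hl1 x); exact: (nearx_true hX).
by rewrite mulnS; apply: hl_eq (hlM h IH); apply: (nearx_true hX) => y p; rewrite exprS.
Qed.

Lemma hl_x i x : hl 1 (fun _ p => px p i) x.
Proof.
have h := @hl_mon 1 [set i]%SET (fun=> 0%N) x; apply: hl_eq (h _); last by rewrite cards1 big1.
by apply: (nearx_true hX) => y p; rewrite mon_x.
Qed.

Lemma hl_y j x : hl 2 (fun _ p => py p j) x.
Proof.
have h := @hl_mon 2 finset.set0 (fun l => (l == j) : nat) x; apply: hl_eq (h _); last first.
  by rewrite cards0 (bigD1 j)//= eqxx big1 // => l /negbTE ->.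
by apply: (nearx_true hX) => y p; rewrite (@mon_y _ _ _ _ _ j).
Qed.

End Local.

Section Subst.
Variables (X Y : space R) (hX : pman X) (hY : pman Y) (s1 s2 r1 r2 : nat).

Lemma hl_ax (h : X -> Lm R s1 s2 r1 r2) x j : lsm h x -> hl 1 (fun y p => ax (h y) p j) x.
Proof.
move=> [h1 _ _]; apply: hl_sum => // i _; apply: hlZ => //; exact: hl_x.
Qed.

Lemma hl_ay (h : X -> Lm R s1 s2 r1 r2) x j : lsm h x -> hl 2 (fun y p => ay (h y) p j) x.
Proof.
move=> [_ h2 h3]; apply: hlD => //; apply: hl_sum => // i _.
  by apply: hlZ => //; exact: hl_y.
apply: hl_sum => // l _; apply: hlZ => //; first exact: h3.
by apply: (@hlM _ hX _ _ 1 1); [exact: hl_x|exact: hl_x].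
Qed.

(** The images of the generators are homogeneous of degrees 1 and 2 with smooth coefficients, so a
    monomial in them keeps its degree. *)
Lemma hl_subst n (f : X -> Y) (h : X -> Lm R s1 s2 r1 r2) (F : Y -> spt R r1 r2 -> fop) x :
  smat f x -> lsm h x -> hl n F (f x) -> hl n (fun y p => F (f y) (lact (h y) p)) x.
Proof.
move=> sf sh [g [hg hn]].
apply: (@hl_eq _ hX _ _ _ (fun y p => \sum_(k : expo r1 r2 n | expo_deg k == n) g k (f y) *: kmon (lact (h y) p) k)).
  by apply: nearx_sub (smat_near hX hY sf hn) => y hy p; rewrite hy.
apply: hl_sum => // k /eqP kn; apply: hlZ => //; first exact: (smat_smx hX hY sf (hg k)).
suff : hl (expo_deg k) (fun y p => kmon (lact (h y) p) k) x by rewrite kn.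
rewrite /expo_deg -sum1_card big_distrr /=; apply: hlM => //; apply: hl_prod => // i _; first exact: hl_ax.
by apply: hlX => //; exact: hl_ay.
Qed.

End Subst.

Section Expansion.
Variables (s1 s2 : nat).

Lemma expo0 n (k : expo s1 s2 n) : (\sum_j k.2 j = 0)%N -> forall j, k.2 j = 0%N :> nat.
Proof. by move=> /eqP; rewrite sum_nat_eq0 => /forallP h j; apply/eqP; exact: h. Qed.

Lemma kmon1 (k : expo s1 s2 1) : expo_deg k = 1%N -> exists i, forall p, kmon p k = px p i.
Proof.
rewrite /expo_deg => dk; have e0 : (\sum_j k.2 j = 0)%N.
  by case: (\sum_j k.2 j)%N dk => // m; rewrite mulnS addnCA.
have /cards1P [i ki] : #|k.1| == 1%N by apply/eqP; rewrite -[RHS]dk e0 muln0 addn0.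
by exists i => p; rewrite /kmon ki mon_x//; exact: expo0.
Qed.

Lemma kmon2 (k : expo s1 s2 2) : expo_deg k = 2 -> (exists j, forall p, kmon p k = py p j) \/
  exists i l (c : R), forall p, kmon p k = c *: (px p i * px p l).
Proof.
rewrite /expo_deg => dk; case e0 : (\sum_j k.2 j)%N => [|m].
  right; have : #|k.1| == 2 by apply/eqP; rewrite -[RHS]dk e0 muln0 addn0.
  move=> /cards2P [i [l [il ki]]]; have [n hn] := mon_xx il.
  exists i, l, ((-1) ^+ n) => p; rewrite /kmon ki hn; [|exact: pP|exact: expo0].
  by rewrite sign_scale.
left; have A0 : k.1 = finset.set0.
  by apply/eqP; rewrite -cards_eq0; case: (#|k.1|) dk => // q; rewrite e0 mulnS addnCA.
have m0 : m = 0%N.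
  by move: dk; rewrite A0 cards0 e0 add0n mulnS => /eqP; rewrite -[X in _ == X]addn0 eqn_add2l muln_eq0 => /eqP.
have [j kj] : exists j, (0 < k.2 j)%N.
  apply/not_existsP => h; suff : (\sum_j k.2 j = 0)%N by rewrite e0.
  by rewrite big1// => j _; apply/eqP; rewrite -leqn0 leqNgt; apply/negP; exact: h.
move: e0; rewrite m0 (bigD1 j)//=; case kE : (nat_of_ord (k.2 j)) kj => [//|q] _.
rewrite addSn => -[] /eqP; rewrite addn_eq0 sum_nat_eq0 => /andP[/eqP q0 /forallP h].
exists j => p; rewrite /kmon A0; apply: mon_y => l.
have [->|lj] := eqVneq l j; first by rewrite kE q0.
by have := h l; rewrite lj /= => /eqP.
Qed.

Lemma hp1_exp (a : spt R s1 s2 -> fop) : hp 1 a -> exists u : 'I_s1 -> R, forall p, a p = \sum_i u i *: px p i.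
Proof.
move=> [c h]; suff [u hu] : exists u : 'I_s1 -> R, forall p,
    \sum_(k : expo s1 s2 1 | expo_deg k == 1%N) c k *: kmon p k = \sum_i u i *: px p i.
  by exists u => p; rewrite h.
elim: (index_enum _) => [|k s [u hu]].
  by exists (fun=> 0) => p; rewrite big_nil big1// => i _; rewrite scale0r.
case: (boolP (expo_deg k == 1%N)) => dk; last by exists u => p; rewrite big_cons (negbTE dk).
have [i hi] := kmon1 (eqP dk); exists (fun j => (c k) * (j == i)%:R + u j) => p.
rewrite big_cons dk hu hi; under [RHS]eq_bigr => j _ do rewrite scalerDl.
rewrite big_split /=; congr (_ + _); rewrite (bigD1 i)//= eqxx mulr1 big1 ?addr0// => j /negbTE ->.
by rewrite mulr0 scale0r.
Qed.

(** The monomials of degree 2 are the even generators and the products of two odd ones. The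
    coefficient of such a product is divided evenly between the two orders, with opposite signs,
    which makes the matrix skew. *)
Lemma hp2_exp (a : spt R s1 s2 -> fop) : hp 2 a -> exists (b : 'I_s2 -> R) (w : 'M[R]_s1), w^T = - w /\
  forall p, a p = \sum_i b i *: py p i + \sum_i \sum_l w i l *: (px p i * px p l).
Proof.
move=> [c h]; suff [b [w [sw hw]]] : exists (b : 'I_s2 -> R) (w : 'M[R]_s1), w^T = - w /\ forall p,
    \sum_(k : expo s1 s2 2 | expo_deg k == 2) c k *: kmon p k =
    \sum_i b i *: py p i + \sum_i \sum_l w i l *: (px p i * px p l).
  by exists b, w; split=> // p; rewrite h.
elim: (index_enum _) => [|k s [b [w [sw hw]]]].
  exists (fun=> 0), 0; rewrite trmx0 oppr0; split=> // p; rewrite big_nil !big1 ?addr0// => i _; last by rewrite scale0r.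
  by rewrite big1// => l _; rewrite mxE scale0r.
case: (boolP (expo_deg k == 2)) => dk; last first.
  by exists b, w; split=> // p; rewrite big_cons (negbTE dk).
have [[i hi]|[i [l [d hd]]]] := kmon2 (eqP dk).
  exists (fun j => (c k) * (j == i)%:R + b j), w; split=> // p.
  rewrite big_cons dk hw hi; under [in RHS]eq_bigr => j _ do rewrite scalerDl.
  rewrite big_split /= -addrA; congr (_ + _); rewrite (bigD1 i)//= eqxx mulr1 big1 ?addr0// => j /negbTE ->.
  by rewrite mulr0 scale0r.
pose t := c k * d / 2; exists b, (t *: (delta_mx i l - delta_mx l i) + w); split.
  rewrite linearD /= sw opprD; congr (_ + _); rewrite linearZ /= linearB /= !trmx_delta.
  by rewrite -scalerN opprB.
move=> p; rewrite big_cons dk hw hd addrCA; congr (_ + _).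
have D (f : 'I_s1 -> 'I_s1 -> fop) i' l' :
    \sum_m \sum_n (delta_mx i' l' : 'M[R]_s1) m n *: f m n = f i' l'.
  rewrite (bigD1 i')//= (bigD1 l')//= mxE !eqxx scale1r !big1 ?addr0// => [m mi|n nl].
    by rewrite big1// => n _; rewrite mxE (negbTE mi) scale0r.
  by rewrite mxE (negbTE nl) andbF scale0r.
have [xx _ _ _] := pP p.
transitivity (t *: ((px p i * px p l) - (px p l * px p i)) + \sum_m \sum_n w m n *: (px p m * px p n)).
  congr (_ + _); rewrite [px p l * _]xx opprK -mulr2n -scaler_nat !scalerA.
  by rewrite /t -[in RHS]mulrA mulVf ?mulr1// pnatr_eq0.
rewrite -(D (fun m n => px p m * px p n) i l) -(D (fun m n => px p m * px p n) l i).
rewrite -sumrB scaler_sumr -big_split; apply: eq_bigr => m _ /=.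
rewrite -sumrB scaler_sumr -big_split; apply: eq_bigr => n _ /=.
by rewrite mxE -scalerBl scalerA -scalerDl !mxE.
Qed.

(** Any prescribed images of the generators, of the right degrees, form a substitution: the triples
    [Lm] with skew [lw] are all the graded morphisms over a point. *)
Lemma lact_exists r1 r2 (a : 'I_r1 -> spt R s1 s2 -> fop) (b : 'I_r2 -> spt R s1 s2 -> fop) :
  (forall j, hp 1 (a j)) -> (forall j, hp 2 (b j)) -> exists h : Lm R s1 s2 r1 r2,
  [/\ lskew h, forall p j, a j p = ax h p j & forall p j, b j p = ay h p j].
Proof.
move=> ha hb; have [u hu] := choice (fun j => hp1_exp (ha j)).
have [v hv] := choice (fun j => hp2_exp (hb j)); have [w hw] := choice hv.
exists (MkLm (\matrix_(i, j) u j i) (\matrix_(i, j) v j i) w); split.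
- by move=> j; have [] := hw j.
- by move=> p j; rewrite hu; apply: eq_bigr => i _; rewrite mxE.
- by move=> p j; have [_ ->] := hw j; congr (_ + _); apply: eq_bigr => i _; rewrite mxE.
Qed.

Variables (r1 r2 : nat).
Implicit Types h : Lm R s1 s2 r1 r2.
Local Notation p0 := (pt0 R s1 s2).
Let n0 : 'I_s2 -> nat := fun=> 0%N.
Let n1 (j : 'I_s2) : 'I_s2 -> nat := fun l => (l == j : nat).

Let cfx i l : cf [set i]%SET n0 (px p0 l) = (i == l)%:R.
Proof.
rewrite -(@mon_x _ _ _ _ (py p0) l n0)// cf_mon; congr (nat_of_bool _)%:R.
by apply/asboolP/eqP => [[/set1_inj]//|->].
Qed.

Let cfyy j l : cf (finset.set0 : {set 'I_s1}) (n1 j) (py p0 l) = (j == l)%:R.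
Proof.
rewrite -(@mon_y _ _ _ (px p0) _ l (n1 l))// cf_mon; congr (nat_of_bool _)%:R.
apply/asboolP/eqP => [[_ /(_ j)]|->//]; rewrite /n1 eqxx.
by case: eqP.
Qed.

Let cfxx (A : {set 'I_s1}) (e : 'I_s2 -> nat) i l : #|A| != 2 -> cf A e (px p0 i * px p0 l) = 0.
Proof.
move=> A2; have [xx x2 _ _] := pP p0.
have [->|il] := eqVneq i l; first by rewrite x2 cf0.
have [n /(_ _ _ _ _ n0 (pP p0) (fun=> erefl)) hn] := mon_xx il.
have := cf_mon R A [set i; l]%SET e n0; rewrite hn asboolF; last first.
  by move=> [AE _]; move: A2; rewrite AE cards2 il.
rewrite sign_scale cfZ => /eqP.
by rewrite mulf_eq0 signr_eq0 /= => /eqP.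
Qed.

Let sg (i l : 'I_s1) : R := cf [set i; l]%SET n0 (px p0 i * px p0 l).

Let sg_neq0 i l : i != l -> sg i l != 0.
Proof.
move=> il; have [n /(_ _ _ _ _ n0 (pP p0) (fun=> erefl)) hn] := mon_xx il.
have := cf_mon R [set i; l]%SET [set i; l]%SET n0 n0; rewrite hn asboolT// sign_scale cfZ -/(sg i l) => e.
by apply/eqP => z; move: e; rewrite z mulr0 => /esym/eqP; rewrite oner_eq0.
Qed.

Lemma la_cf h i j : la h i j = cf [set i]%SET n0 (ax h p0 j).
Proof.
rewrite /ax cf_sum (bigD1 i)//= cfZ cfx eqxx mulr1 big1 ?addr0// => l /negbTE li.
by rewrite cfZ cfx eq_sym li mulr0.
Qed.

Lemma lb_cf h i j : lb h i j = cf (finset.set0 : {set 'I_s1}) (n1 i) (ay h p0 j).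
Proof.
rewrite /ay cfD !cf_sum (bigD1 i)//= cfZ cfyy eqxx mulr1 big1 ?addr0 => [|l /negbTE li]; last first.
  by rewrite cfZ cfyy eq_sym li mulr0.
rewrite big1 ?addr0// => k _; rewrite cf_sum big1// => l _.
by rewrite cfZ cfxx ?mulr0// cards0.
Qed.

(** The entries [(i, l)] and [(l, i)] contribute equally to the coefficient of the monomial on
    [{i, l}], hence the [2]; [sg] is the nonzero factor by which [xi_i xi_l] differs from that
    monomial. *)
Lemma lw_cf h i l j : lskew h -> lw h j i l = if i == l then 0 else
  cf [set i; l]%SET n0 (ay h p0 j) / (2 * sg i l).
Proof.
move=> sk; have skE m n : lw h j m n = - lw h j n m.
  by have /matrixP /(_ n m) := sk j; rewrite !mxE => ->; rewrite ?opprK.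
have d0 m : lw h j m m = 0.
  have : (2 : R) * lw h j m m = 0 by rewrite mulr_natl mulr2n {2}skE subrr.
  by move=> /eqP; rewrite mulf_eq0 pnatr_eq0 /= => /eqP.
have [->//|il] := eqVneq i l.
have [xx x2 _ _] := pP p0.
have z m n : (m, n) != (i, l) -> (m, n) != (l, i) -> lw h j m n * cf [set i; l]%SET n0 (px p0 m * px p0 n) = 0.
  have [->|mn] := eqVneq m n; first by rewrite d0 mul0r.
  move=> m1 m2; have [q /(_ _ _ _ _ n0 (pP p0) (fun=> erefl)) hq] := mon_xx mn.
  have := cf_mon R [set i; l]%SET [set m; n]%SET n0 n0; rewrite hq asboolF; last first.
    move=> [/setP AE _]; have := AE m; have := AE n; rewrite !inE !eqxx !orbT /=.
    by case/orP => /eqP nE; case/orP => /eqP mE; rewrite nE mE ?eqxx in m1 m2 mn.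
  by rewrite sign_scale cfZ => /eqP; rewrite mulf_eq0 signr_eq0 /= => /eqP ->; rewrite mulr0.
suff -> : cf [set i; l]%SET n0 (ay h p0 j) = 2 * sg i l * lw h j i l.
  by rewrite mulrAC mulfV ?mul1r// mulf_neq0 ?pnatr_eq0// sg_neq0.
rewrite /ay cfD !cf_sum big1 ?add0r => [|m _]; last first.
  rewrite cfZ -(@mon_y _ _ _ (px p0) _ m (n1 m))// cf_mon asboolF ?mulr0//.
  by move=> [/setP /(_ i)]; rewrite !inE eqxx.
rewrite (bigD1 i)//= cf_sum (bigD1 l)//= cfZ big1 ?addr0 => [|n nl]; last first.
  by rewrite cfZ z// xpair_eqE ?eqxx ?nl//= negb_and; rewrite il.
rewrite (bigD1 l) 1?eq_sym//= cf_sum (bigD1 i)//= cfZ big1 ?addr0 => [|n ni]; last first.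
  by rewrite cfZ z// xpair_eqE ?eqxx ?ni ?andbF//= eq_sym (negbTE il).
rewrite big1 ?addr0 => [|m /andP[mi ml]]; last first.
  by rewrite cf_sum big1// => n _; rewrite cfZ z// xpair_eqE ?(negbTE mi) ?(negbTE ml).
rewrite -/(sg i l) xx -scaleN1r cfZ -/(sg i l) [lw h j l i]skE mulN1r mulrNN -mulrDl mulrC.
by rewrite mulr_natl mulr2n mulrDl mulrDr.
Qed.

Lemma lact_inj h (g : Lm R s1 s2 r1 r2) : lskew h -> lskew g -> (forall j, ax h p0 j = ax g p0 j) ->
  (forall j, ay h p0 j = ay g p0 j) -> h = g.
Proof.
move=> sh sg' ex ey; apply: Lm_eq => [||j]; apply/matrixP => i l.
- by rewrite !la_cf ex.
- by rewrite !lb_cf ey.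
- by rewrite !lw_cf// ey.
Qed.

(** A matrix is recovered from the images of the generators by the coefficient functionals [cf],
    which preserve smoothness. *)
Lemma lsm_cf (X : space R) (hX : pman X) (h : X -> Lm R s1 s2 r1 r2) x : nearx x (fun y => lskew (h y)) ->
  (forall j, hl 1 (fun y p => ax (h y) p j) x) -> (forall j, hl 2 (fun y p => ay (h y) p j) x) -> lsm h x.
Proof.
move=> sk h1 h2; split=> [i j|i j|k i j].
- by apply: (smx_ext hX _ (hl_cf hX [set i]%SET n0 (h1 j))) => y; rewrite la_cf.
- by apply: (smx_ext hX _ (hl_cf hX finset.set0 (n1 i) (h2 j))) => y; rewrite lb_cf.
- have [->|ij] := eqVneq i j.
    by apply: (smx_eq hX _ (smx_cst hX 0 x)); apply: nearx_sub sk => y sk; rewrite lw_cf// eqxx.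
  apply: (smx_eq hX _ (smxM hX (hl_cf hX [set i; j]%SET n0 (h2 k)) (smx_cst hX (2 * sg i j)^-1 x))).
  by apply: nearx_sub sk => y sk; rewrite lw_cf// (negbTE ij).
Qed.

End Expansion.
End Substitution.

Section HomogeneousPolynomials.
Variables (R : realType) (r1 r2 : nat).
Local Notation fop := (fop R).
Implicit Types (a b : spt R r1 r2 -> fop) (p : spt R r1 r2).

(** Even generators have degree 2, so the number of odd factors of a monomial has the parity of its
    degree; only this parity enters the sign. *)
Lemma hp_comm m n a b p : hp m a -> hp n b -> a p * b p = (-1) ^+ (m * n) * (b p * a p).
Proof.
move=> [c hc] [d hd]; rewrite hc hd mulr_suml mulr_suml [RHS]mulr_sumr.
under eq_bigr => k _ do rewrite mulr_sumr.
under [RHS]eq_bigr => l _ do rewrite !mulr_sumr.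
rewrite [RHS]exchange_big /=; apply: eq_bigr => k /eqP km; apply: eq_bigr => l /eqP ln.
rewrite sign_scale -!scalerAl -!scalerAr /kmon (sc_comm (pP p)) sign_scale !scalerA; congr (_ *: _).
rewrite -mulrA mulrC [d l * _]mulrC; congr (_ * _ * _).
have := congr1 odd km; rewrite /expo_deg oddD oddM /= addbF => om.
have := congr1 odd ln; rewrite /expo_deg oddD oddM /= addbF => ol.
by rewrite -[RHS]signr_odd -[LHS]signr_odd !oddM ol om.
Qed.

(** Monomials of different degrees are different, so the coefficient functional of a monomial of
    degree [n] sees the term [a n] only. *)
Lemma hp_direct N (a : nat -> spt R r1 r2 -> fop) : (forall n, hp n (a n)) ->
  (forall p, \sum_(n < N) a n p = 0) -> forall n, (n < N)%N -> forall p, a n p = 0.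
Proof.
move=> ha h n nN p; rewrite (hpE p (ha n)) big1// => k /eqP kn.
suff -> : ecf k (a n) = 0 by rewrite scale0r.
have := congr1 (cf k.1 (fun j => k.2 j : nat)) (h (pt0 R r1 r2)).
rewrite cf0 cf_sum (bigD1 (Ordinal nN))//= big1 ?addr0// => m mn.
rewrite (hpE _ (ha m)) cf_sum big1// => l /eqP lm; rewrite cfZ cf_mon asboolF ?mulr0// => -[e1 e2].
move: mn; rewrite -val_eqE /= -lm -kn /expo_deg e1.
by under [X in _ == (_ + 2 * X)%N]eq_bigr => j _ do rewrite e2; rewrite eqxx.
Qed.

Lemma hp0_exp a : hp 0 a -> forall p, a p = (cf (finset.set0 : {set 'I_r1}) (fun _ : 'I_r2 => 0%N) (a (pt0 R r1 r2)))%:A.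
Proof.
move=> [c hc]; pose k0 : expo r1 r2 0 := (finset.set0, [ffun => ord0]).
have z p (k : expo r1 r2 0) : expo_deg k = 0%N -> kmon p k = 1.
  rewrite /expo_deg => /eqP; rewrite addn_eq0 muln_eq0 /= cards_eq0 => /andP[/eqP k1 /eqP k2].
  rewrite /kmon k1 /mon big1 ?mul1r => [|i]; last by rewrite inE.
  by rewrite big1// => j _; rewrite expo0.
have E p : a p = (\sum_(k : expo r1 r2 0 | expo_deg k == 0%N) c k)%:A.
  by rewrite hc scaler_suml; apply: eq_bigr => k /eqP /z ->.
move=> p; rewrite !E cfZ; congr (_ *: _); rewrite -[LHS]mulr1; congr (_ * _).
transitivity (cf (finset.set0 : {set 'I_r1}) (fun _ : 'I_r2 => 0%N) (mon (px (pt0 R r1 r2)) (py (pt0 R r1 r2)) finset.set0 (fun=> 0%N))).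
  by rewrite cf_mon asboolT.
congr cf; rewrite /mon big1 ?mul1r => [|i]; last by rewrite inE.
by rewrite big1.
Qed.

End HomogeneousPolynomials.

(** * The [2]-manifold of an object of the category of frames *)

Section Homogeneous.
Variables (R : realType) (k : kobj R).
Local Notation fop := (fop R).
Local Notation sp := (spt R (kr1 k) (kr2 k)).
Local Notation FX := (km k -> sp -> fop).
Let hX : pman k := kpman k.
Implicit Types (a b : FX) (U V : set k).

(** [a] takes superpoints in the reference frame; this is its expression in the local frame [i], the
    one for which smoothness of coefficients makes sense. *)
Definition kfr a i : FX := fun y p => a y (lact (kS' i y) p).

Lemma kfr_ev a i x p : kU i x -> a x p = kfr a i x (lact (kS i x) p).
Proof. by move=> ux; rewrite /kfr -lact_comp kS'S// lact_id. Qed.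

(* the interior of [U] is used so that the unit is defined for every [U] *)
Definition hom U n a : Prop := (forall x, ~ nearx x U -> forall p, a x p = 0) /\
  forall i x, nearx x U -> kU i x -> hl n (kfr a i) x.

Lemma kfr_change n a i j x : kU i x -> kU j x -> hl n (kfr a i) x -> hl n (kfr a j) x.
Proof.
move=> ui uj h.
have := @hl_subst _ _ _ hX hX _ _ _ _ n id (fun y => lcomp (kS i y) (kS' j y)) _ x (smat_id hX x) (kSsm uj ui) h.
apply: hl_eq => //; apply: nearx_sub (kU_near ui) => y uy p.
by rewrite lact_comp -kfr_ev.
Qed.

Lemma homI U n a : (forall x, ~ nearx x U -> forall p, a x p = 0) ->
  (forall x, nearx x U -> exists2 i, kU i x & hl n (kfr a i) x) -> hom U n a.
Proof.
by move=> h0 H; split=> // j x ux uj; have [i ui h] := H x ux; exact: kfr_change h.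
Qed.

Lemma hom0 U n : hom U n 0.
Proof. by split=> // i x _ _; exact: hl0. Qed.

Lemma homD U n a b : hom U n a -> hom U n b -> hom U n (a + b).
Proof.
move=> [a0 ha] [b0 hb]; split=> [x nx p|i x ux ui].
  by rewrite -[LHS]/(a x p + b x p) a0// b0// addr0.
exact: (hlD hX (ha i x ux ui) (hb i x ux ui)).
Qed.

Lemma homN U n a : hom U n a -> hom U n (- a).
Proof.
move=> [a0 ha]; split=> [x nx p|i x ux ui].
  by rewrite -[LHS]/(- a x p) a0// oppr0.
apply: (hl_eq hX _ (hlZ hX (smx_cst hX (-1) x) (ha i x ux ui))).
by apply: (nearx_true hX) => y p; rewrite scaleN1r.
Qed.

Lemma homM U m n a b : hom U m a -> hom U n b -> hom U (m + n) (a * b).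
Proof.
move=> [a0 ha] [b0 hb]; split=> [x nx p|i x ux ui].
  by rewrite -[LHS]/(a x p * b x p) a0// mul0r.
exact: (hlM hX (ha i x ux ui) (hb i x ux ui)).
Qed.

(** Sections are finite sums of homogeneous ones, as the graded algebra is a direct sum and not a
    product of its components. *)
Definition fin U a : Prop := exists N (c : nat -> FX), (forall n, hom U n (c n)) /\ a = \sum_(n < N) c n.

Lemma fin_hom U n a : hom U n a -> fin U a.
Proof.
move=> h; exists n.+1, (fun m => if m == n then a else 0); split.
  by move=> m; case: eqP => [->//|_]; exact: hom0.
by rewrite big_ord_recr /= eqxx big1 ?add0r// => m _; rewrite ltn_eqF.
Qed.

Lemma finD U a b : fin U a -> fin U b -> fin U (a + b).
Proof.
move=> [N [c [hc ->]]] [M [d [hd ->]]].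
exists (N + M)%N, (fun n => (if (n < N)%N then c n else 0) + (if (n < M)%N then d n else 0)); split.
  by move=> n; apply: homD; case: ifP => _ //; exact: hom0.
have E K L (e : nat -> FX) : \sum_(n < K + L) (if (n < K)%N then e n else 0) = \sum_(n < K) e n.
  rewrite big_split_ord /= [X in _ + X]big1 ?addr0 => [|i _]; last by rewrite ltnNge leq_addr.
  by apply: eq_bigr => i _; rewrite ltn_ord.
by rewrite big_split /= E addnC E.
Qed.

Lemma fin0 U : fin U 0. Proof. exact: fin_hom (hom0 U 0). Qed.

Lemma fin_sum U I (s : seq I) (P : pred I) (F : I -> FX) : (forall i, P i -> fin U (F i)) ->
  fin U (\sum_(i <- s | P i) F i).
Proof. by move=> h; apply: (big_ind (fin U)) => //; [exact: fin0|exact: finD]. Qed.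

Lemma finN U a : fin U a -> fin U (- a).
Proof.
move=> [N [c [hc ->]]]; exists N, (fun n => - c n); split; last by rewrite sumrN.
by move=> n; exact: homN.
Qed.

Lemma finM U a b : fin U a -> fin U b -> fin U (a * b).
Proof.
move=> [N [c [hc ->]]] [M [d [hd ->]]]; rewrite mulr_suml; apply: fin_sum => i _.
by rewrite mulr_sumr; apply: fin_sum => j _; apply: fin_hom; exact: homM.
Qed.

Lemma fin_out U a x p : fin U a -> ~ nearx x U -> a x p = 0.
Proof.
move=> [N [c [hc ->]]] nx; rewrite fct_sumE fct_sumE big1// => i _.
by have [h _] := hc i; exact: h.
Qed.

Definition kone U : FX := fun x p => if `[< nearx x U >] then 1 else 0.

Lemma hom_fn U (f : k -> R) : (forall x, nearx x U -> smx f x) ->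
  hom U 0 (fun x p => if `[< nearx x U >] then (f x)%:A else 0).
Proof.
move=> sf; split=> [x nx p|i x ux ui]; first by rewrite asboolF.
apply: (hl_eq hX _ (hlZ hX (sf x ux) (hl1 hX _ _ x))).
by apply: nearx_sub (nearx_near ux) => y uy p; rewrite /kfr asboolT.
Qed.

Lemma hom_kone U : hom U 0 (kone U).
Proof.
have -> : kone U = (fun x p => if `[< nearx x U >] then (1 : R)%:A else 0).
  by apply/funext => x; apply/funext => p; rewrite scale1r.
by apply: hom_fn => x _; exact: smx_cst.
Qed.

End Homogeneous.

Section SectionRing.
Variables (R : realType) (k : kobj R) (U : set k).
Local Notation FX := (km k -> spt R (kr1 k) (kr2 k) -> fop R).

Record ksec := Ksec { kval :> FX; kvalP : fin U kval }.

Lemma ksec_eq (a b : ksec) : (forall x p, kval a x p = kval b x p) -> a = b.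
Proof.
case: a => a ha; case: b => b hb /= h.
have e : a = b by apply/funext => x; apply/funext => p; exact: h.
by case: _ / e in hb *; congr Ksec; exact: Prop_irrelevance.
Qed.

HB.instance Definition _ := gen_eqMixin ksec.
HB.instance Definition _ := gen_choiceMixin ksec.

Let zk := Ksec (fin0 U).
Let ok := Ksec (fin_hom (hom_kone U)).
Let nk (a : ksec) := Ksec (finN (kvalP a)).
Let ak (a b : ksec) := Ksec (finD (kvalP a) (kvalP b)).
Let mk (a b : ksec) := Ksec (finM (kvalP a) (kvalP b)).

Let addA : associative ak. Proof. by move=> a b c; apply: ksec_eq => x p; exact: addrA. Qed.
Let addC : commutative ak. Proof. by move=> a b; apply: ksec_eq => x p; exact: addrC. Qed.
Let add0 : left_id zk ak. Proof. by move=> a; apply: ksec_eq => x p; exact: add0r. Qed.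
Let addN : left_inverse zk nk ak. Proof. by move=> a; apply: ksec_eq => x p; exact: addNr. Qed.
HB.instance Definition _ := @GRing.isZmodule.Build ksec zk nk ak addA addC add0 addN.

Let mulA : associative mk. Proof. by move=> a b c; apply: ksec_eq => x p; exact: mulrA. Qed.
Let mul1 : left_id ok mk.
Proof.
move=> a; apply: ksec_eq => x p; rewrite -[LHS]/(kone U x p * a x p) /kone.
by case: asboolP => [|nx]; rewrite ?mul1r// mul0r (fin_out _ (kvalP a)).
Qed.
Let mulr1' : right_id ok mk.
Proof.
move=> a; apply: ksec_eq => x p; rewrite -[LHS]/(a x p * kone U x p) /kone.
by case: asboolP => [|nx]; rewrite ?mulr1// mulr0 (fin_out _ (kvalP a)).
Qed.
Let mulDl : left_distributive mk +%R. Proof. by move=> a b c; apply: ksec_eq => x p; exact: mulrDl. Qed.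
Let mulDr : right_distributive mk +%R. Proof. by move=> a b c; apply: ksec_eq => x p; exact: mulrDr. Qed.
HB.instance Definition _ := @GRing.Zmodule_isPzRing.Build ksec ok mk mulA mul1 mulr1' mulDl mulDr.

Implicit Types a b : ksec.

Lemma kvalD a b x p : (a + b : ksec) x p = a x p + b x p. Proof. by []. Qed.
Lemma kvalM a b x p : (a * b : ksec) x p = a x p * b x p. Proof. by []. Qed.
Lemma kvalN a x p : (- a : ksec) x p = - a x p. Proof. by []. Qed.
Lemma kval1 x p : nearx x U -> (1 : ksec) x p = 1.
Proof. by move=> ux; rewrite -[LHS]/(kone U x p) /kone asboolT. Qed.

Lemma kval_out a x p : ~ nearx x U -> a x p = 0.
Proof. exact: fin_out (kvalP a). Qed.

Lemma kval_sum I (s : seq I) (P : pred I) (F : I -> ksec) x p :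
  (\sum_(i <- s | P i) F i : ksec) x p = \sum_(i <- s | P i) F i x p.
Proof. by apply: (big_morph (fun a : ksec => a x p)). Qed.

Lemma kval_mon x p : nearx x U -> monoid_morphism (fun a : ksec => a x p).
Proof. by move=> ux; split; [exact: kval1|]. Qed.

Definition kclip (a : FX) : ksec := if pselect (fin U a) is left h then Ksec h else 0.

Lemma kclipE (a : FX) : fin U a -> kval (kclip a) = a.
Proof. by rewrite /kclip; case: pselect. Qed.

End SectionRing.

Section Phi.
Variables (R : realType) (k : kobj R).
Local Notation fop := (fop R).
Local Notation r1 := (kr1 k).
Local Notation r2 := (kr2 k).
Local Notation sp := (spt R r1 r2).
Local Notation FX := (km k -> sp -> fop).
Local Notation p0 := (pt0 R r1 r2).
Let hX : pman k := kpman k.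
Implicit Types (U V W : set k).

(** Sections are functions on the whole base that vanish off their open set, which makes them equal
    as soon as their values there agree; restricting is therefore cutting off. *)
Definition cut V (a : FX) : FX := fun x p => if `[< nearx x V >] then a x p else 0.

Lemma hom_cut U V n a : V `<=` U -> hom U n a -> hom V n (cut V a).
Proof.
move=> VU [_ ha]; split=> [x nx p|i x vx ui]; first by rewrite /cut asboolF.
apply: (hl_eq hX _ (ha i x (nearx_sub VU vx) ui)).
by apply: nearx_sub (nearx_near vx) => y vy p; rewrite /kfr /cut asboolT.
Qed.

Lemma fin_cut U V a : V `<=` U -> fin U a -> fin V (cut V a).
Proof.
move=> VU [N [c [hc ->]]]; exists N, (fun n => cut V (c n)); split; first by move=> n; exact: hom_cut (hc n).
apply/funext => x; apply/funext => p; rewrite /cut !fct_sumE.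
by case: asboolP => // nx; rewrite big1.
Qed.

Definition kres U V (a : ksec U) : ksec V := kclip V (cut V a).

Lemma kresE U V (a : ksec U) x p : V `<=` U -> nearx x V -> kres V a x p = a x p.
Proof.
by move=> VU vx; rewrite /kres kclipE ?/cut ?asboolT//; exact: fin_cut (kvalP a).
Qed.

Definition kfn U (f : k -> R) : ksec U :=
  kclip U (fun x p => if `[< nearx x U >] then (f x)%:A else 0).

Lemma smooth_near U f x : opn U -> smooth_on U f -> nearx x U -> smx f x.
Proof. by move=> oU /(smooth_onP hX _ oU) sf /nearx_self /sf. Qed.

Lemma kfn_hom U f : opn U -> smooth_on U f -> hom U 0 (kfn U f).
Proof.
move=> oU sf; have h : hom U 0 (fun x (p : sp) => if `[< nearx x U >] then (f x)%:A else 0).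
  by apply: hom_fn => x; exact: smooth_near.
by rewrite /kfn kclipE//; exact: fin_hom h.
Qed.

Lemma kfnE U f x p : opn U -> smooth_on U f -> nearx x U -> kfn U f x p = (f x)%:A.
Proof.
move=> oU sf ux; rewrite /kfn kclipE ?asboolT//.
by apply: (@fin_hom _ _ _ 0); apply: hom_fn => y; exact: smooth_near.
Qed.

Definition kfns : gsheaf k :=
  @Gsheaf R k (fun U => ksec U : pzRingType) (fun U n a => hom U n a) kres kfn.

Lemma ksecI U (a b : ksec U) : (forall x p, nearx x U -> a x p = b x p) -> a = b.
Proof.
by move=> h; apply: ksec_eq => x p; have [|nx] := pselect (nearx x U); [exact: h|rewrite !kval_out].
Qed.

Lemma kval_sgn U (a : ksec U) n x p : ((-1) ^+ n * a : ksec U) x p = (-1) ^+ n * a x p.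
Proof.
by rewrite -signr_odd -[in RHS]signr_odd; case: odd; rewrite ?expr0 ?mul1r// !expr1 !mulN1r.
Qed.

Lemma hom_kfr_hp U n a i x : hom U n a -> nearx x U -> kU i x -> hp n (kfr a i x).
Proof. by move=> [_ h] ux ui; exact: hl_hp (h i x ux ui). Qed.

Lemma pure_inj (c d : R) : c%:A = d%:A :> fop -> c = d.
Proof.
move=> /eqP; rewrite -subr_eq0 -scalerBl => /eqP e; apply/eqP; rewrite -subr_eq0; apply/eqP.
have := congr1 (fun a : fop => a (fun=> 1) vac) e; rewrite fopZ /=.
by rewrite mulr1.
Qed.

Lemma hom0_pure U a x p q : hom U 0 a -> nearx x U -> a x p = a x q.
Proof.
move=> ha ux; have [i ui] := kUc x; rewrite (kfr_ev a p ui) (kfr_ev a q ui).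
by rewrite (hp0_exp (hom_kfr_hp ha ux ui)) [RHS](hp0_exp (hom_kfr_hp ha ux ui)).
Qed.

Lemma kfns_graded U : opn U -> is_graded_algebra kfns U.
Proof.
move=> oU; split=> /=.
- by move=> n; exact: hom0.
- by move=> n a b ha hb; apply: homD => //; exact: homN.
- by move=> m n a b; exact: homM.
- move=> m n a b ha hb; apply: ksecI => x p ux; have [i ui] := kUc x.
  rewrite kval_sgn !kvalM (kfr_ev a p ui) (kfr_ev b p ui).
  by apply: hp_comm; [exact: hom_kfr_hp ha _ _|exact: hom_kfr_hp hb _ _].
- move=> a; have [N [c [hc ac]]] := kvalP a; exists N, (fun n => Ksec (fin_hom (hc n))); split=> //.
  by apply: ksec_eq => x p; rewrite ac kval_sum !fct_sumE.
- move=> N c hc sc n nN; apply: ksecI => x p ux; have [i ui] := kUc x.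
  rewrite (kfr_ev _ _ ui); apply: (hp_direct (N := N) (a := fun n => kfr (c n) i x)) => //.
    by move=> m; exact: hom_kfr_hp (hc m) _ _.
  by move=> q; have := congr1 (fun a : ksec U => a x (lact (kS' i x) q)) sc; rewrite kval_sum.
- by move=> f sf; exact: kfn_hom.
- move=> a ha; exists (fun x => cf (finset.set0 : {set 'I_r1}) (fun _ : 'I_r2 => 0%N) (a x p0)).
    apply/(smooth_onP hX _ oU) => x Ux; have ux := nearx_open oU Ux; have [i ui] := kUc x.
    have [_ /(_ i x ux ui) hl0'] := ha.
    apply: (smx_eq hX _ (hl_cf hX finset.set0 (fun=> 0%N) hl0')).
    by apply: nearx_sub (nearx_near ux) => y uy; congr cf; exact: hom0_pure ha _.
  apply: ksecI => x p ux; have [i ui] := kUc x; rewrite kfnE//; last first.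
    apply/(smooth_onP hX _ oU) => z Uz; have uz := nearx_open oU Uz; have [j uj] := kUc z.
    have [_ /(_ j z uz uj) hl0'] := ha.
    apply: (smx_eq hX _ (hl_cf hX finset.set0 (fun=> 0%N) hl0')).
    by apply: nearx_sub (nearx_near uz) => y uy; congr cf; exact: hom0_pure ha _.
  rewrite (kfr_ev _ _ ui) (hp0_exp (hom_kfr_hp ha ux ui)); congr (cf _ _ _ *: _).
  exact: hom0_pure ha ux.
- move=> f g sf sg; split=> [e x Ux|e].
    have ux := nearx_open oU Ux; apply: pure_inj.
    by rewrite -(kfnE p0 oU sf ux) -(kfnE p0 oU sg ux) e.
  by apply: ksecI => x p ux; rewrite !kfnE// e//; exact: nearx_self ux.
- apply: ksecI => x p ux; rewrite kfnE ?kval1// ?scale1r//.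
  by apply/(smooth_onP hX _ oU) => y _; exact: smx_cst.
- move=> f g sf sg; apply: ksecI => x p ux; rewrite kvalD !kfnE ?scalerDl//.
  by apply/(smooth_onP hX _ oU) => y Uy; apply: smxD => //; [exact: ((smooth_onP hX f oU).1 sf y)|exact: ((smooth_onP hX g oU).1 sg y)].
- move=> f g sf sg; apply: ksecI => x p ux; rewrite kvalM !kfnE//; last first.
    by apply/(smooth_onP hX _ oU) => y Uy; apply: smxM => //; [exact: ((smooth_onP hX f oU).1 sf y)|exact: ((smooth_onP hX g oU).1 sg y)].
  by rewrite -scalerAl mul1r scalerA.
Qed.

Lemma kres_hom U V n (a : ksec U) : V `<=` U -> hom U n a -> hom V n (kres V a).
Proof.
move=> VU ha; rewrite /kres kclipE; first exact: hom_cut ha.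
exact: fin_cut (kvalP a).
Qed.

Lemma kfns_sheaf : is_sheaf kfns.
Proof.
split=> /=.
- move=> U V oU oV VU; split.
    by move=> a b; apply: ksecI => x p vx; rewrite kvalD kvalN !kresE.
  split; first by apply: ksecI => x p vx; rewrite kresE// !kval1//; exact: nearx_sub vx.
  by move=> a b; apply: ksecI => x p vx; rewrite kvalM !kresE.
- by move=> U V n a oU oV VU; exact: kres_hom.
- move=> U V f oU oV VU sf; have sf' : smooth_on V f.
    by apply/(smooth_onP hX _ oV) => x /VU; exact: ((smooth_onP hX f oU).1 sf x).
  by apply: ksecI => x p vx; rewrite kresE// !kfnE//; exact: nearx_sub vx.
- by move=> U a oU; apply: ksecI => x p ux; rewrite kresE.
- move=> U V W a oU oV oW WV VU; apply: ksecI => x p wx.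
  by rewrite !kresE//; [exact: (subset_trans WV VU)|exact: nearx_sub wx].
- move=> n F s hF hs; set UF := \bigcup_(V in F) V.
  have oUF : opn UF by apply: opn_bigcup => // V /hF [].
  have sub V : F V -> V `<=` UF by move=> FV x Vx; exists V.
  (* Any member of the family that contains the point supplies the value; [aE] shows from the
     agreement on overlaps that the choice does not matter. *)
  pose a : FX := fun x p => if pselect (exists V, F V /\ V x) is left h then s (sval (cid h)) x p else 0.
  have aE V x p : F V -> V x -> a x p = s V x p.
    move=> FV Vx; rewrite /a; case: pselect => [h|[]]; last by exists V.
    have [] := svalP (cid h); move: (sval (cid h)) => W FW Wx.
    have oI : opn (V `&` W) by apply: opnI => //; [exact: (hF V FV).1|exact: (hF W FW).1].
    have nI : nearx x (V `&` W) by apply: nearx_open.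
    have := congr1 (fun c : ksec (V `&` W) => c x p) (hs V W FV FW).
    by rewrite !kresE// => [|y []|y []].
  have ha : hom UF n a.
    apply: homI => [x nx p|x /nearx_self [V FV Vx]].
      rewrite /a; case: pselect => // -[V [FV Vx]]; case: nx.
      by apply: nearx_open => //; exists V.
    have [i ui] := kUc x; exists i => //; have [oV [_ hV]] := hF V FV.
    have vx := nearx_open oV Vx; apply: (hl_eq hX _ (hV i x vx ui)).
    by apply: nearx_sub vx => y Vy p; rewrite /kfr (aE V).
  exists (Ksec (fin_hom ha)); split.
    split=> // V FV; apply: ksecI => x p vx; rewrite kresE//; last exact: sub.
    by rewrite /= (aE V)//; exact: nearx_self vx.
  move=> b [hb bs]; apply: ksecI => x p /nearx_self [V FV Vx]; rewrite /= (aE V)// -(bs V FV).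
  by rewrite kresE//; [exact: sub|apply: nearx_open => //; exact: (hF V FV).1].
Qed.

Lemma lincombE V n (xi : 'I_r1 -> ksec V) (eta : 'I_r2 -> ksec V) (f : expo r1 r2 n -> k -> R) x p :
  opn V -> V x -> (forall l, smooth_on V (f l)) ->
  (lincomb (A := kfns) (n := n) xi eta f : ksec V) x p =
  \sum_(l : expo r1 r2 n | expo_deg l == n)
     f l x *: mon (fun i => xi i x p) (fun j => eta j x p) l.1 (fun j => l.2 j).
Proof.
move=> oV Vx sf; have vx := nearx_open oV Vx; rewrite kval_sum; apply: eq_bigr => l _.
rewrite kvalM kfnE// -scalerAl mul1r; congr (_ *: _).
exact: (@mon_morph _ _ (fun a : ksec V => a x p) _ _ _ _ _ (fun j => l.2 j) (kval_mon p vx)).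
Qed.

(** The odd coordinates in the local frame [i], as functions of a superpoint in the reference frame;
    with [keta] they are the free generators over [kU i]. *)
Definition kxi i (j : 'I_r1) : FX := fun x p => if `[< nearx x (kU i) >] then ax (kS i x) p j else 0.
Definition keta i (j : 'I_r2) : FX := fun x p => if `[< nearx x (kU i) >] then ay (kS i x) p j else 0.

Lemma kxi_hom i j : hom (kU i) 1 (kxi i j).
Proof.
apply: homI => [x nx p|x ux]; first by rewrite /kxi asboolF.
have ui := nearx_self ux; exists i => //; apply: (hl_eq hX _ (@hl_x _ _ hX _ r2 j x)).
apply: nearx_sub (nearx_near ux) => y uy p; rewrite /kfr /kxi asboolT//.
rewrite -[RHS]/(px (lact (kS i y) (lact (kS' i y) p)) j) -lact_comp kSS' ?lact_id//.
exact: nearx_self uy.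
Qed.

Lemma keta_hom i j : hom (kU i) 2 (keta i j).
Proof.
apply: homI => [x nx p|x ux]; first by rewrite /keta asboolF.
have ui := nearx_self ux; exists i => //; apply: (hl_eq hX _ (@hl_y _ _ hX r1 _ j x)).
apply: nearx_sub (nearx_near ux) => y uy p; rewrite /kfr /keta asboolT//.
rewrite -[RHS]/(py (lact (kS i y) (lact (kS' i y) p)) j) -lact_comp kSS' ?lact_id//.
exact: nearx_self uy.
Qed.

Definition sxi i j : ksec (kU i) := Ksec (fin_hom (kxi_hom i j)).
Definition seta i j : ksec (kU i) := Ksec (fin_hom (keta_hom i j)).

Lemma sxiE i j x p : kU i x -> sxi i j x p = px (lact (kS i x) p) j.
Proof. by move=> ui; rewrite /= /kxi asboolT//; exact: kU_near. Qed.

Lemma setaE i j x p : kU i x -> seta i j x p = py (lact (kS i x) p) j.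
Proof. by move=> ui; rewrite /= /keta asboolT//; exact: kU_near. Qed.

Lemma kL_E i V n (f : expo r1 r2 n -> k -> R) x p : opn V -> V `<=` kU i -> V x -> (forall l, smooth_on V (f l)) ->
  (lincomb (A := kfns) (n := n) (fun j => kres V (sxi i j)) (fun j => kres V (seta i j)) f : ksec V) x p =
  \sum_(l : expo r1 r2 n | expo_deg l == n) f l x *: kmon (lact (kS i x) p) l.
Proof.
move=> oV VU Vx sf; rewrite lincombE//; have vx := nearx_open oV Vx; have ux := VU _ Vx.
apply: eq_bigr => l _; congr (_ *: mon _ _ _ _); apply/funext => j; rewrite kresE//.
  exact: sxiE.
exact: setaE.
Qed.

Lemma hom_lincomb i V n (a : ksec V) : opn V -> V `<=` kU i -> hom V n a ->
  exists2 f : expo r1 r2 n -> k -> R, forall l, smooth_on V (f l) &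
    a = lincomb (A := kfns) (n := n) (fun j => kres V (sxi i j)) (fun j => kres V (seta i j)) f.
Proof.
move=> oV VU ha; have sf (l : expo r1 r2 n) : smooth_on V (fun x => ecf l (kfr a i x)).
  apply/(smooth_onP hX _ oV) => x Vx; have [_ h] := ha.
  by have := hl_cf hX l.1 (fun j => l.2 j : nat) (h i x (nearx_open oV Vx) (VU _ Vx)).
exists (fun l x => ecf l (kfr a i x)) => //.
apply: ksecI => x p vx; have Vx := nearx_self vx; rewrite kL_E//.
by rewrite (kfr_ev _ _ (VU _ Vx)) (hpE _ (hom_kfr_hp ha vx (VU _ Vx))).
Qed.

(** Existence of coefficients is [hom_lincomb]; for uniqueness both combinations are evaluated in
    the frame [i], where [ecf_sum] extracts each coefficient at the generic point. *)
Lemma kfns_free i : is_free_on kfns (kU i) r1 r2.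
Proof.
exists (sxi i), (seta i); split=> [j|j|V n oV VU]; [exact: kxi_hom|exact: keta_hom|split].
  by move=> a ha; exact: hom_lincomb.
move=> f g sf sg e l x ln Vx.
pose a p := \sum_(l : expo r1 r2 n | expo_deg l == n) f l x *: kmon p l.
have e1 p : a p = \sum_(l : expo r1 r2 n | expo_deg l == n) f l x *: kmon p l by [].
have e2 p : a p = \sum_(l : expo r1 r2 n | expo_deg l == n) g l x *: kmon p l.
  have := congr1 (fun c : ksec V => c x (lact (kS' i x) p)) e; rewrite !kL_E//.
  by rewrite -lact_comp kSS' ?lact_id//; exact: VU.
by rewrite -(ecf_sum e1 ln) -(ecf_sum e2 ln).
Qed.

Definition Phi : man2 R.
Proof.
refine (@Man2 R k kfns (kM k) kfns_graded kfns_sheaf _).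
exists r1, r2 => x; have [i ui] := kUc x; exists (kU i); split=> //; [exact: kUo|exact: kfns_free].
Defined.

End Phi.

Section TwoManCategory.
Variable R : realType.

Lemma man2_pman (M : man2 R) : pman M.
Proof. by have [n h] := man2_manifold M; exact: manifold_pman h. Qed.

Lemma man2_preimage (M N : man2 R) (mu : man2_arr M N) V : opn V -> opn (mu @^-1` V).
Proof. exact: (@cfunP R M N mu V). Qed.

Lemma TwoMan_category : is_category (TwoMan R).
Proof.
split=> /=.
- move=> M; split=> //=; first exact: (smooth_map_id (man2_pman M)).
- move=> M N P g f hg hf; split=> /=.
  + exact: (smooth_map_comp (man2_pman M) (man2_pman N) (man2_pman P) (mm_smooth hg) (mm_smooth hf)).
  + move=> V h; have [g1 [g2 g3]] := mm_morph hg h; have [f1 [f2 f3]] := mm_morph hf (@cfunP _ _ _ (mor0 g) _ h).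
    split; first by move=> a b; rewrite g1 f1.
    by split; [rewrite g2 f2|move=> a b; rewrite g3 f3].
  + by move=> V h n a ha; apply: (mm_deg hf); exact: (mm_deg hg).
  + by move=> V W h h' a WV; rewrite (mm_res hg h)// (mm_res hf (@cfunP _ _ _ (mor0 g) _ h))// => x /WV.
  + move=> V h u su; rewrite (mm_fn hg)// (mm_fn hf)//.
    have hM := man2_pman N; apply/(smooth_onP hM _ (@man2_preimage _ _ g V h)) => x Vx.
    have /(smatP hM (man2_pman P)) sg := mm_smooth hg.
    by apply: (smat_smx hM (man2_pman P) (sg x)); exact: ((smooth_onP (man2_pman P) u h).1 su).
- by move=> M N [[c hc] pu].
- by move=> M N [[c hc] pu].
- by move=> M N P Q h g f.
Qed.

End TwoManCategory.

(** * The functor from frames to [2]-manifolds *)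

Section PhiMap.
Variables (R : realType) (N M : kobj R) (w : karr N M) (hw : khom w).
Local Notation FX k := (km k -> spt R (kr1 k) (kr2 k) -> fop R).
Let hN : pman N := kpman N.
Let hM : pman M := kpman M.

Lemma khom_smat x : smat w.1 x. Proof. by case: hw. Qed.

Lemma khom_cont : cont_map (w.1 : N -> M).
Proof. by have /(smatP hN hM) [] := khom_smat. Qed.

Definition kpb (a : FX M) : FX N := fun x p => a (w.1 x) (lact (w.2 x) p).

Lemma preim_near V x : opn V -> nearx x (w.1 @^-1` V) <-> nearx (w.1 x) V.
Proof.
move=> oV; split=> [/nearx_self Vx|]; first exact: nearx_open.
by move=> h; exact: (smat_near hN hM (khom_smat x) h).
Qed.

Lemma hom_kpb V n a : opn V -> hom V n a -> hom (w.1 @^-1` V) n (kpb a).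
Proof.
move=> oV [a0 ha]; apply: homI => [x nx p|x /(preim_near _ oV) vx].
  by apply: a0 => h; apply: nx; apply/(preim_near _ oV).
have [i ui] := kUc x; have [j uj] := kUc (w.1 x); exists i => //.
have [_ _ /(_ i j x ui uj) sl] := hw.
apply: (hl_eq hN _ (hl_subst hN hM (khom_smat x) sl (ha j _ vx uj))).
apply: nearx_sub (smat_near hN hM (khom_smat x) (kU_near uj)) => y uy p.
by rewrite /kfr /kpb /kloc -!lact_comp lcompA kS'S// lcomp_idl.
Qed.

Lemma fin_kpb V a : opn V -> fin V a -> fin (w.1 @^-1` V) (kpb a).
Proof.
move=> oV [n [c [hc ->]]]; exists n, (fun m => kpb (c m)); split; first by move=> m; exact: hom_kpb.
by apply/funext => x; apply/funext => p; rewrite /kpb !fct_sumE.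
Qed.

Definition ppull V (oV : opn V) (a : ksec (k := M) V) : ksec (k := N) (w.1 @^-1` V) :=
  Ksec (fin_kpb oV (kvalP a)).

Definition Pmap : man2_arr (Phi N) (Phi M) :=
  @Man2Arr R (Phi N) (Phi M) (Cmap khom_cont) ppull.

Lemma Pmap_mor : man2_mor Pmap.
Proof.
split=> /=.
- by apply/(smatP hN hM); exact: khom_smat.
- move=> V oV; split; first by move=> a b; exact: ksec_eq.
  split; last by move=> a b; exact: ksec_eq.
  apply: ksecI => x p /[dup] vx /(preim_near _ oV) vx'; rewrite kval1//.
  by rewrite -[LHS]/((1 : ksec (k := M) V) (w.1 x) (lact (w.2 x) p)) kval1.
- by move=> V oV n a ha; exact: hom_kpb.
- move=> V W oV oW a WV; apply: ksecI => x p /[dup] vx /(preim_near _ oW) vx'.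
  rewrite -[LHS]/((kres W (a : ksec (k := M) V)) (w.1 x) (lact (w.2 x) p)) kresE//.
  by rewrite kresE// => y; exact: WV.
- move=> V oV f sf; apply: ksecI => x p /[dup] vx /(preim_near _ oV) vx'.
  have oW : opn (w.1 @^-1` V) by exact: khom_cont.
  rewrite -[LHS]/((kfn V f) (w.1 x) (lact (w.2 x) p)) kfnE// kfnE//.
  apply/(smooth_onP hN _ oW) => y Vy.
  by apply: (smat_smx hN hM (khom_smat y)); exact: ((smooth_onP hM f oV).1 sf).
Qed.

End PhiMap.

Section PhiFunctor.
Variable R : realType.

(** The pulled back sections live over preimages that agree only propositionally. Comparing the
    values of the underlying functions avoids a transport between the two section rings. *)
Lemma parr_eq (N M : kobj R) (mu nu : man2_arr (Phi N) (Phi M)) : (forall x, mu x = nu x) ->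
  (forall V (h : opn V) (a : ksec (k := M) V) x p, kval (k := N) (U := mu @^-1` V) (pull mu h a) x p =
    kval (k := N) (U := nu @^-1` V) (pull nu h a) x p) -> mu = nu.
Proof.
case: mu => -[c hc] pu; case: nu => -[c' hc'] pu' /= /funext ec; subst c'.
have eh : hc' = hc by exact: Prop_irrelevance.
subst hc'; move=> h; congr Man2Arr.
apply: functional_extensionality_dep => V; apply: functional_extensionality_dep => oV.
by apply/funext => a; apply: ksec_eq; exact: h.
Qed.

Lemma Pmap_id (k : kobj R) (h : khom (kid k)) : Pmap h = man2_id (Phi k).
Proof. by apply: parr_eq => // V oV a x p; rewrite /= /kpb /= lact_id. Qed.

Lemma Pmap_comp (P N M : kobj R) (g : karr N M) (f : karr P N) (hg : khom g) (hf : khom f) (h : khom (kcomp g f)) :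
  Pmap h = man2_comp (Pmap hg) (Pmap hf).
Proof. by apply: parr_eq => // V oV a x p; rewrite /= /kpb /= lact_comp. Qed.

Lemma lcomp_inj (k : kobj R) i x s1 s2 (g h : Lm R s1 s2 (kr1 k) (kr2 k)) : kU i x ->
  lcomp (kS (k := k) i x) g = lcomp (kS i x) h -> g = h.
Proof.
by move=> ui /(congr1 (lcomp (kS' i x))); rewrite !lcompA kS'S// !lcomp_idl.
Qed.

(** The pull-backs of the local generators, evaluated at the generic point, determine the matrix by
    [lact_inj]. *)
Lemma Pmap_inj (N M : kobj R) (w w' : karr N M) (hw : khom w) (hw' : khom w') : Pmap hw = Pmap hw' -> w = w'.
Proof.
move=> e; have e1 x : w.1 x = w'.1 x by rewrite -[LHS]/(Pmap hw x) e.
have E x p V (h : opn V) (a : ksec (k := M) V) : a (w.1 x) (lact (w.2 x) p) = a (w.1 x) (lact (w'.2 x) p).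
  have := congr1 (fun mu : man2_arr (Phi N) (Phi M) =>
    kval (k := N) (U := mu @^-1` V) (pull mu h a) x p) e; rewrite /= /kpb /= => ->.
  by rewrite e1.
rewrite [w]surjective_pairing [w']surjective_pairing; congr pair; apply/funext => x //.
have [j uj] := kUc (w.1 x); have [_ sk _] := hw; have [_ sk' _] := hw'.
apply: (lcomp_inj uj); apply: lact_inj; try by apply: lskew_comp => //; exact: kSsk.
  move=> l; have := E x (pt0 R (kr1 N) (kr2 N)) _ (@kUo R M j) (sxi j l); rewrite !sxiE// => h.
  by rewrite -[LHS]/(px (lact _ _) l) -[RHS]/(px (lact _ _) l) !lact_comp.
move=> l; have := E x (pt0 R (kr1 N) (kr2 N)) _ (@kUo R M j) (seta j l); rewrite !setaE// => h.
by rewrite -[LHS]/(py (lact _ _) l) -[RHS]/(py (lact _ _) l) !lact_comp.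
Qed.

Section Full.
Variables (N M : kobj R) (mu : man2_arr (Phi N) (Phi M)) (hmu : man2_mor mu).
Let hN : pman N := kpman N.
Let hM : pman M := kpman M.
Let w0 : N -> M := mu.
Let oV V : opn V -> opn (w0 @^-1` V) := @cfunP _ _ _ (mor0 mu) V.

Definition pl V (h : opn V) (a : ksec (k := M) V) : ksec (k := N) (w0 @^-1` V) := pull mu h a.

Let sI (x : N) : kI N := sval (cid (kUc x)).
Let sIP x : kU (sI x) x := svalP (cid (kUc x)).
Let sJ (x : N) : kI M := sval (cid (kUc (w0 x))).
Let sJP x : kU (sJ x) (w0 x) := svalP (cid (kUc (w0 x))).

Let sw (y : N) : smat w0 y.
Proof. by move: y; apply/(smatP hN hM); exact: (mm_smooth hmu). Qed.
Let oJ x : opn (kU (sJ x)) := @kUo R M (sJ x).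

Lemma pl_deg V (h : opn V) n (a : ksec (k := M) V) : hom V n a -> hom (w0 @^-1` V) n (pl h a).
Proof. exact: (@mm_deg _ _ _ _ hmu V h n a). Qed.

Lemma pl_hp V (h : opn V) n (a : ksec (k := M) V) i x : hom V n a -> V (w0 x) -> kU i x ->
  hp n (kfr (pl h a) i x).
Proof.
move=> ha Vx ui; apply: (hom_kfr_hp (pl_deg h ha)) => //.
by apply: nearx_open => //; exact: oV.
Qed.

Lemma full_subproof x : {g : Lm R (kr1 N) (kr2 N) (kr1 M) (kr2 M) |
  [/\ lskew g, forall p l, kfr (pl (@oJ x) (sxi (sJ x) l)) (sI x) x p = ax g p l &
      forall p l, kfr (pl (@oJ x) (seta (sJ x) l)) (sI x) x p = ay g p l]}.
Proof.
apply: cid; apply: (lact_exists (a := fun l => kfr (pl (@oJ x) (sxi (sJ x) l)) (sI x) x)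
  (b := fun l => kfr (pl (@oJ x) (seta (sJ x) l)) (sI x) x)) => l.
  exact: (@pl_hp _ _ _ (sxi (sJ x) l) _ _ (kxi_hom _ _) (sJP x) (sIP x)).
exact: (@pl_hp _ _ _ (seta (sJ x) l) _ _ (keta_hom _ _) (sJP x) (sIP x)).
Qed.

Let g x := sval (full_subproof x).

(** [g x] describes the images of the generators between the local frames selected at [x] and at its
    image; composing with these frames on both sides expresses it between the reference frames. *)
Definition fullh x : Lm R (kr1 N) (kr2 N) (kr1 M) (kr2 M) :=
  lcomp (kS' (sJ x) (w0 x)) (lcomp (g x) (kS (sI x) x)).

Lemma fullh_skew x : lskew (fullh x).
Proof.
have [sk _ _] := svalP (full_subproof x).
by apply: lskew_comp; [exact: kS'sk|apply: lskew_comp => //; exact: kSsk].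
Qed.

Lemma pl_res V W (h : opn V) (h' : opn W) (a : ksec (k := M) V) x p : W `<=` V -> W (w0 x) ->
  pl h' (kres W a) x p = pl h a x p.
Proof.
move=> WV Wx; have := mm_res hmu h h' a WV; rewrite /pl /= => ->.
rewrite kresE//; first by move=> y; exact: WV.
by apply: nearx_open => //; exact: oV.
Qed.

(** After restriction to the domain of a frame, [a] is a polynomial in the generators with functions
    as coefficients. The pull-back is multiplicative and known on functions, hence determined by the
    images of the generators. *)
Lemma pl_hom V (h : opn V) n (a : ksec (k := M) V) x p : hom V n a -> V (w0 x) ->
  pl h a x p = a (w0 x) (lact (fullh x) p).
Proof.
move=> ha Vx; set j := sJ x; have uj : kU j (w0 x) := sJP x; have ui := sIP x.
have [_ gx gy] := svalP (full_subproof x).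
pose W := V `&` kU j; have oW : opn W by apply: opnI => //; exact: kUo.
have Wx : W (w0 x) by [].
have WV : W `<=` V by move=> y [].
have WU : W `<=` kU j by move=> y [].
rewrite -(pl_res h oW _ _ WV)// -(kresE a _ WV (nearx_open oW Wx)).
have := kres_hom WV ha; move: (kres W a) => {h ha}a ha.
have [f sf ->] := hom_lincomb oW WU ha.
have h0W : nearx x (w0 @^-1` W) by apply: nearx_open => //; exact: oV.
pose ev (c : ksec (k := M) W) := pl oW c x p.
have [pB [p1 pM]] := mm_morph hmu oW.
have ev_mon : monoid_morphism ev.
  split; first by rewrite /ev /pl; transitivity ((1 : ksec (k := N) (w0 @^-1` W)) x p); [rewrite -p1|exact: kval1].
  move=> b c; rewrite /ev /pl.
  by transitivity ((pl oW b * pl oW c : ksec (k := N) (w0 @^-1` W)) x p); [rewrite -pM|].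
have evB b c : ev (b - c) = ev b - ev c.
  by rewrite /ev /pl; transitivity ((pl oW b - pl oW c : ksec (k := N) (w0 @^-1` W)) x p); [rewrite -pB|].
have ev0 : ev 0 = 0 by rewrite -(subrr 0) evB subrr.
have evD b c : ev (b + c) = ev b + ev c by have -> : b + c = b - (0 - c) by [rewrite sub0r opprK]; rewrite !evB ev0 sub0r opprK.
have ev_fn u : smooth_on W u -> ev (kfn W u) = (u (w0 x))%:A.
  move=> su; rewrite /ev /pl; have := mm_fn hmu oW su => /= ->; rewrite kfnE//; first exact: oV.
  apply/(smooth_onP hN _ (@oV _ oW)) => y Wy;
  by apply: (smat_smx hN hM (sw y)); exact: ((smooth_onP hM u oW).1 su).
rewrite kL_E// -[LHS]/(ev _) /lincomb (big_morph ev evD ev0); apply: eq_bigr => l _.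
have [_ evM] := ev_mon; rewrite evM [ev _]ev_fn// -scalerAl mul1r; congr (_ *: _).
rewrite [ev _](@mon_morph _ _ ev _ _ _ _ _ (fun j => l.2 j) ev_mon) /kmon.
have hL : lact (kS j (w0 x)) (lact (fullh x) p) = lact (g x) (lact (kS (sI x) x) p).
  by rewrite -!lact_comp /fullh [lcomp (kS j _) _]lcompA kSS'// lcomp_idl.
rewrite hL; congr mon; apply/funext => m /=.
  by rewrite /ev (pl_res (@oJ x))// (kfr_ev _ _ ui) gx.
by rewrite /ev (pl_res (@oJ x))// (kfr_ev _ _ ui) gy.
Qed.

Lemma pl_all V (h : opn V) (a : ksec (k := M) V) x p : V (w0 x) ->
  pl h a x p = a (w0 x) (lact (fullh x) p).
Proof.
move=> Vx; have [n [c [hc ac]]] := kvalP a.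
have -> : a = \sum_(m < n) (Ksec (fin_hom (hc m)) : ksec (k := M) V).
  by apply: ksec_eq => y q; rewrite ac kval_sum !fct_sumE.
have [pB _] := mm_morph hmu h.
have p0' : pl h 0 = 0 by rewrite -(subrr 0) /pl pB subrr.
have pD b b' : pl h (b + b') = pl h b + pl h b'.
  by have -> : b + b' = b - (0 - b') by [rewrite sub0r opprK]; rewrite /pl !pB -/(pl h 0) p0' sub0r opprK.
rewrite (big_morph (pl h) pD p0') !kval_sum; apply: eq_bigr => m _.
exact: (@pl_hom V h m (Ksec (fin_hom (hc m))) x p (hc m) Vx).
Qed.

Definition fullw : karr N M := (w0, fullh).

(** By [pl_all] the matrix predicts all pull-backs, whatever frames were selected at each point. In
    fixed frames its action on generators is thus the pull-back of generators, which has smooth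
    coefficients, and [lsm_cf] applies. *)
Lemma fullw_khom : khom fullw.
Proof.
apply: khomI => //=; first exact: fullh_skew.
move=> x; have [i ui] := kUc x; have [j uj] := kUc (w0 x); exists i, j; split=> //.
have oj : opn (kU j) := @kUo R M j.
have ni := kU_near ui; have nj := smat_near hN hM (sw x) (kU_near uj).
apply: (lsm_cf hN).
- apply: (nearx2 hN ni nj) => y uy uy'; apply: lskew_comp; first exact: kSsk.
  by apply: lskew_comp; [exact: fullh_skew|exact: kS'sk].
- move=> l; have [_ /(_ i x) h] := pl_deg oj (a := sxi j l) (kxi_hom j l).
  apply: (hl_eq hN _ (h _ ui)); last by apply: nearx_open => //; exact: oV.
  apply: nearx_sub nj => y uy p; rewrite -[LHS]/(pl oj (sxi j l) y (lact (kS' i y) p)) pl_all// sxiE//.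
  by rewrite -[RHS]/(px (lact (kloc fullw i j y) p) l) /kloc !lact_comp.
- move=> l; have [_ /(_ i x) h] := pl_deg oj (a := seta j l) (keta_hom j l).
  apply: (hl_eq hN _ (h _ ui)); last by apply: nearx_open => //; exact: oV.
  apply: nearx_sub nj => y uy p; rewrite -[LHS]/(pl oj (seta j l) y (lact (kS' i y) p)) pl_all// setaE//.
  by rewrite -[RHS]/(py (lact (kloc fullw i j y) p) l) /kloc !lact_comp.
Qed.

Lemma Pmap_full : Pmap fullw_khom = mu.
Proof.
apply: parr_eq => // V h a x p; have [Vx|nx] := pselect (V (w0 x)); last first.
  by rewrite !kval_out// => /nearx_self.
by rewrite -[RHS]/(pl h a x p) pl_all.
Qed.

End Full.

End PhiFunctor.

(** * Every [2]-manifold comes from frames *)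

Section Sheaf.
Variables (R : realType) (A : man2 R).
Local Notation S := (@sec R A (fns A)).
Local Notation rs U V := (@res R A (fns A) U V).
Local Notation fnn V := (@fn R A (fns A) V).
Local Notation dg V := (@deg R A (fns A) V).
Let hA : pman A := man2_pman A.
Implicit Types (U V W : set A).

(** The constant [1/2] is a smooth function, so [2] is invertible in the section ring. It gives the
    vanishing of squares of odd sections. *)
Lemma fn_cst_half V (z : S V) : opn V -> z = - z -> z = 0.
Proof.
move=> oV hz; have G := man2_graded oV.
have sc (c : R) : smooth_on V (fun=> c).
  by apply/(smooth_onP hA _ oV) => x _; exact: smx_cst.
have h : z + z = 0 by rewrite {1}hz addNr.
have : fnn V (fun=> 2^-1) * (z + z) = 0 by rewrite h mulr0.
rewrite mulrDr -mulrDl -(ga_fn_add G)//.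
have -> : (fun x : A => 2^-1 + 2^-1) = (fun=> 1 : R).
  by apply/funext => _; rewrite -mulr2n -[LHS]mulr_natl mulfV// pnatr_eq0.
by rewrite (ga_fn_one G) mul1r.
Qed.

Lemma resD U V (a b : S U) : opn U -> opn V -> V `<=` U ->
  rs U V (a + b) = rs U V a + rs U V b.
Proof.
move=> oU oV VU; have [h _] := sh_res_morph (man2_sheaf A) oU oV VU.
have h0 : rs U V 0 = 0 by rewrite -(subrr 0) h subrr.
by have -> : a + b = a - (0 - b); [rewrite sub0r opprK|rewrite !h h0 sub0r opprK].
Qed.

Lemma resB U V (a b : S U) : opn U -> opn V -> V `<=` U ->
  rs U V (a - b) = rs U V a - rs U V b.
Proof. by move=> oU oV VU; have [h _] := sh_res_morph (man2_sheaf A) oU oV VU; rewrite h. Qed.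

Lemma res0 U V : opn U -> opn V -> V `<=` U -> rs U V 0 = 0.
Proof. by move=> oU oV VU; rewrite -(subrr 0) resB// subrr. Qed.

Lemma fn_comm V f n (a : S V) : opn V -> smooth_on V f -> dg V n a ->
  fnn V f * a = a * fnn V f.
Proof.
move=> oV sf ha; have G := man2_graded oV.
by rewrite (ga_comm G (ga_fn_deg G sf) ha) mul0n expr0 mul1r.
Qed.

Lemma fn0 V : opn V -> fnn V (fun=> 0) = 0.
Proof.
move=> oV; have G := man2_graded oV.
have sc : smooth_on V (fun=> 0 : R) by apply/(smooth_onP hA _ oV) => x _; exact: smx_cst.
have : fnn V (fun=> 0) = fnn V (fun=> 0) + fnn V (fun=> 0).
  by rewrite -(ga_fn_add G)//; congr fn; apply/funext => x; rewrite addr0.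
by move/eqP; rewrite -subr_eq0 opprD addNKr oppr_eq0 => /eqP.
Qed.

Lemma fnN V f : opn V -> smooth_on V f -> fnn V (fun x => - f x) = - fnn V f.
Proof.
move=> oV sf; have G := man2_graded oV; apply/eqP; rewrite -subr_eq0 opprK -(ga_fn_add G)//; last first.
  by apply/(smooth_onP hA _ oV) => x Vx; apply: smxN => //; exact: ((smooth_onP hA f oV).1 sf).
apply/eqP; apply: etrans (fn0 oV); congr fn; apply/funext => x; exact: addNr.
Qed.

(* the indirection through the union avoids transporting sections along an equality of sets *)
Lemma sec_separated V n (a : S V) : opn V -> dg V n a ->
  (forall x, V x -> exists W, [/\ opn W, W x, W `<=` V & rs V W a = 0]) -> a = 0.
Proof.
move=> oV ha H; have hs := man2_sheaf A.
pose F := [set W | [/\ opn W, W `<=` V & rs V W a = 0]].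
pose U := \bigcup_(W in F) W.
have oU : opn U by apply: opn_bigcup => // W [].
have UV : U `<=` V by move=> x [W [_ WV _] /WV].
have VU : V `<=` U by move=> x /H [W [oW Wx WV r0]]; exists W.
have FU W : F W -> W `<=` U by move=> FW x Wx; exists W.
have [|V1 W1 F1 F2|b [_ ub]] := @sh_glue _ _ _ hs n F (fun W => 0 : S W).
- by move=> W [ oW _ _]; split=> //; exact: (ga_zero (man2_graded oW)).
- have [W1o _ _] := F1; have [W2o _ _] := F2; have oI := opnI hA W1o W2o.
  by rewrite !res0// => x [].
have e1 : rs V U a = b.
  apply/esym/ub; split; first exact: (sh_res_deg hs).
  by move=> W FW; have [ oW WV r0] := FW; rewrite (sh_res_comp hs)//; exact: FU.
have e2 : b = 0.
  apply: ub; split; first exact: (ga_zero (man2_graded oU)).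
  by move=> W FW; have [ oW _ _] := FW; rewrite res0//; exact: FU.
by rewrite -(sh_res_id hs a oV) -(sh_res_comp hs (V := U))// e1 e2 res0.
Qed.

Section Frame.
Variables (r1 r2 : nat).
Local Notation sp := (spt R r1 r2).

Record frame := Frame {
  fU : set A; fxi : 'I_r1 -> S fU; feta : 'I_r2 -> S fU;
  fUo : opn fU;
  fxi1 : forall i, dg fU 1 (fxi i);
  feta2 : forall j, dg fU 2 (feta j);
  f_free : forall V n, opn V -> V `<=` fU ->
    let L := @lincomb R A (fns A) V r1 r2 n (fun i => rs fU V (fxi i)) (fun j => rs fU V (feta j)) in
    (forall a, dg V n a -> exists2 f, forall k, smooth_on V (f k) & a = L f) /\
    (forall f g, (forall k, smooth_on V (f k)) -> (forall k, smooth_on V (g k)) -> L f = L g ->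
     forall k x, expo_deg k = n -> V x -> f k x = g k x) }.

Definition fmon (F : frame) W B e : S W :=
  mon (fun i => rs (fU F) W (fxi F i)) (fun j => rs (fU F) W (feta F j)) B e.

Definition fL (F : frame) W n (f : expo r1 r2 n -> A -> R) : S W :=
  \sum_(k | expo_deg k == n) fnn W (f k) * fmon F W k.1 (fun j => k.2 j).

Lemma f_scomm (F : frame) W : opn W -> W `<=` fU F ->
  scomm (fun i => rs (fU F) W (fxi F i)) (fun j => rs (fU F) W (feta F j)).
Proof.
move=> oW WF; have G := man2_graded oW; have hs := man2_sheaf A.
have d1 i := sh_res_deg hs (@fUo F) oW WF (fxi1 F i).
have d2 j := sh_res_deg hs (@fUo F) oW WF (feta2 F j).
split=> [i j|i|i j|j l].
- by rewrite (ga_comm G (d1 i) (d1 j)) mul1n expr1 mulN1r.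
- by apply: fn_cst_half => //; rewrite {1}(ga_comm G (d1 i) (d1 i)) mul1n expr1 mulN1r.
- by rewrite (ga_comm G (d1 i) (d2 j)) mul1n -signr_odd expr0 mul1r.
- by rewrite (ga_comm G (d2 j) (d2 l)) -signr_odd expr0 mul1r.
Qed.

Lemma fmon_deg (F : frame) W (B : {set 'I_r1}) (e : 'I_r2 -> nat) : opn W -> W `<=` fU F ->
  dg W (#|B| + 2 * \sum_j e j) (fmon F W B e).
Proof.
move=> oW WF; have G := man2_graded oW; have hs := man2_sheaf A.
have d1 i := sh_res_deg hs (@fUo F) oW WF (fxi1 F i).
have d2 j := sh_res_deg hs (@fUo F) oW WF (feta2 F j).
have sc : smooth_on W (fun=> 1 : R) by apply/(smooth_onP hA _ oW) => x _; exact: smx_cst.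
have one : dg W 0 1 by rewrite -(ga_fn_one G); exact: ga_fn_deg.
apply: (ga_mul G).
  rewrite -sum1_card; elim: (index_enum _) => [|i s IH]; first by rewrite !big_nil.
  by rewrite !big_cons; case: ifP => // _; apply: (ga_mul G) (d1 i) _.
rewrite big_distrr /=; elim: (index_enum _) => [|i s IH]; first by rewrite !big_nil.
rewrite !big_cons; apply: (ga_mul G) _ IH; elim: (e i) => [|m IHm]; first by rewrite muln0 expr0.
by rewrite mulnS exprS; exact: (ga_mul G (d2 i)).
Qed.

Lemma res_fmon (F : frame) W W' B e : opn W -> opn W' -> W' `<=` W -> W `<=` fU F ->
  rs W W' (fmon F W B e) = fmon F W' B e.
Proof.
move=> oW oW' W'W WF; have [_ h] := sh_res_morph (man2_sheaf A) oW oW' W'W.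
rewrite [LHS]mon_morph//; congr mon; apply/funext => i /=.
  by rewrite (sh_res_comp (man2_sheaf A))//; exact: fUo.
by rewrite (sh_res_comp (man2_sheaf A))//; exact: fUo.
Qed.

(** Some expression of the section as a finite sum of functions times monomials in the frame has the
    value [v] when its coefficients are taken at [x]. As a relation it is stable under the ring
    operations at once; that the value does not depend on the expression is [gen_zero]. *)
Inductive gen (F : frame) x W : S W -> (sp -> fop R) -> Prop :=
| Gen0 : gen F x 0 0
| GenS u B e c v : smooth_on W u -> gen F x c v ->
    gen F x (c + fnn W u * fmon F W B e) (fun p => v p + u x *: mon (px p) (py p) B e).

Section Gen.
Variables (F : frame) (x : A) (W : set A) (oW : opn W) (WF : W `<=` fU F) (Wx : W x).
Let G := man2_graded oW.

Lemma gen_eq (c c' : S W) v v' : gen F x c v -> c = c' -> (forall p, v p = v' p) -> gen F x c' v'.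
Proof. by move=> h <- /funext <-. Qed.

Lemma genD (c c' : S W) v v' : gen F x c v -> gen F x c' v' -> gen F x (c + c') (fun p => v p + v' p).
Proof.
move=> h; elim=> [|u B e d w su _ IH].
  by apply: gen_eq h _ _ => [|p]; rewrite addr0.
by apply: gen_eq (GenS B e su IH) _ _ => [|p]; rewrite addrA.
Qed.

Lemma gen1 u B e : smooth_on W u -> gen F x (fnn W u * fmon F W B e) (fun p => u x *: mon (px p) (py p) B e).
Proof. by move=> su; apply: gen_eq (GenS B e su (Gen0 F x W)) _ _ => [|p]; rewrite add0r. Qed.

Lemma genM (c c' : S W) v v' : gen F x c v -> gen F x c' v' -> gen F x (c * c') (fun p => v p * v' p).
Proof.
move=> h; elim=> [|u' B' e' d' w' su' _ IH].
  by apply: gen_eq (Gen0 F x W) _ _ => [|p]; rewrite mulr0.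
suff h2 : gen F x (c * (fnn W u' * fmon F W B' e')) (fun p => v p * (u' x *: mon (px p) (py p) B' e')).
  by apply: gen_eq (genD IH h2) _ _ => [|p]; rewrite mulrDr.
elim: h => [|u B e d w su _ IH2].
  by apply: gen_eq (Gen0 F x W) _ _ => [|p]; rewrite mul0r.
(* The same [n] serves in the section ring ([hS]) and in the operator algebra ([hT]); the sign is
   absorbed into the coefficient function. *)
have [n hn] := mon_mul r2 B B'.
have s2 : smooth_on W (fun y => u y * u' y).
  apply/(smooth_onP hA _ oW) => y Wy.
  by apply: smxM => //; [exact: ((smooth_onP hA u oW).1 su)|exact: ((smooth_onP hA u' oW).1 su')].
have s3 : smooth_on W (fun y => - (u y * u' y)).
  by apply/(smooth_onP hA _ oW) => y Wy; apply: smxN => //; exact: ((smooth_onP hA _ oW).1 s2).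
have hS : fnn W u * fmon F W B e * (fnn W u' * fmon F W B' e') =
    if uniq (wd B ++ wd B') then fnn W (fun y => if odd n then - (u y * u' y) else u y * u' y) *
      fmon F W (B :|: B') (fun j => e j + e' j)%N else 0.
  rewrite mulrA -[_ * _ * fnn W u']mulrA -(fn_comm oW su' (fmon_deg B e oW WF)) mulrA -[LHS]mulrA.
  rewrite /fmon hn; last exact: f_scomm.
  case: ifP => _; last by rewrite mulr0.
  rewrite -(ga_fn_mul G)// -signr_odd; case: (odd n); rewrite ?expr0 ?expr1 ?mulN1r ?mul1r//.
  by rewrite fnN// mulrN mulNr.
have hT p : (u x *: mon (px p) (py p) B e) * (u' x *: mon (px p) (py p) B' e') =
    if uniq (wd B ++ wd B') then (if odd n then - (u x * u' x) else u x * u' x) *: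
      mon (px p) (py p) (B :|: B') (fun j => e j + e' j)%N else 0.
  rewrite -scalerAl -scalerAr scalerA hn; last exact: pP.
  case: ifP => _; last by rewrite scaler0.
  by rewrite -signr_odd; case: (odd n); rewrite ?expr0 ?expr1 ?mulN1r ?mul1r// scalerN scaleNr.
suff h3 : gen F x (fnn W u * fmon F W B e * (fnn W u' * fmon F W B' e'))
    (fun p => (u x *: mon (px p) (py p) B e) * (u' x *: mon (px p) (py p) B' e')).
  by apply: gen_eq (genD IH2 h3) _ _ => [|p]; rewrite mulrDl.
rewrite hS; case: (boolP (uniq _)) hT => _ hT.
  apply: (gen_eq (v := fun p => (if odd n then - (u x * u' x) else u x * u' x) *:
    mon (px p) (py p) (B :|: B') (fun j => e j + e' j)%N) _ erefl) => [|p]; last by rewrite hT.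
  by apply: (gen1 (u := fun y => if odd n then - (u y * u' y) else u y * u' y)); case: (odd n).
by apply: (gen_eq (Gen0 F x W) erefl) => p; rewrite hT.
Qed.

Lemma genN (c : S W) v : gen F x c v -> gen F x (- c) (fun p => - v p).
Proof.
elim=> [|u B e d w su _ IH]; first by apply: gen_eq (Gen0 F x W) _ _ => [|p]; rewrite oppr0.
have s1 : smooth_on W (fun y => - u y).
  by apply/(smooth_onP hA _ oW) => y Wy; apply: smxN => //; exact: ((smooth_onP hA u oW).1 su).
apply: gen_eq (genD IH (gen1 B e s1)) _ _ => [|p]; first by rewrite fnN// mulNr opprD.
by rewrite scaleNr opprD.
Qed.

Lemma gen_fn u : smooth_on W u -> gen F x (fnn W u) (fun=> (u x)%:A).
Proof.
move=> su; apply: gen_eq (gen1 finset.set0 (fun=> 0%N) su) _ _ => [|p].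
  by rewrite /fmon /mon big1 ?mul1r => [|i]; [rewrite big1 ?mulr1|rewrite inE].
by congr (_ *: _); rewrite /mon big1 ?mul1r => [|i]; [rewrite big1|rewrite inE].
Qed.

Lemma gen_sum (I : Type) (s : seq I) (P : pred I) (c : I -> S W) (v : I -> sp -> fop R) :
  (forall i, P i -> gen F x (c i) (v i)) ->
  gen F x (\sum_(i <- s | P i) c i) (fun p => \sum_(i <- s | P i) v i p).
Proof.
move=> h; elim: s => [|i s IH]; first by apply: gen_eq (Gen0 F x W) _ _ => [|p]; rewrite big_nil.
case: (boolP (P i)) => Pi; last first.
  by apply: gen_eq IH _ _ => [|p]; rewrite big_cons (negbTE Pi).
by apply: gen_eq (genD (h i Pi) IH) _ _ => [|p]; rewrite big_cons Pi.
Qed.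

Lemma gen_fL n (f : expo r1 r2 n -> A -> R) : (forall k, smooth_on W (f k)) ->
  gen F x (fL F W f) (fun p => \sum_(k | expo_deg k == n) f k x *: kmon p k).
Proof. by move=> sf; apply: gen_sum => k _; exact: gen1. Qed.

Lemma gen_res W' (c : S W) v : opn W' -> W' `<=` W -> gen F x c v -> gen F x (rs W W' c) v.
Proof.
move=> oW' W'W; elim=> [|u B e d w su _ IH]; first by rewrite res0//; exact: Gen0.
have s1 : smooth_on W' u.
  by apply/(smooth_onP hA _ oW') => y /W'W Wy; exact: ((smooth_onP hA u oW).1 su).
rewrite resD//; have [_ [_ ->]] := sh_res_morph (man2_sheaf A) oW oW' W'W.
by rewrite res_fmon// (sh_res_fn (man2_sheaf A))//; exact: GenS.
Qed.

(** The ring and the embedding [phi] of functions are parameters, so that one formula covers the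
    section, with [phi] the inclusion of functions, and its value, with [phi] the evaluation at
    [x]. *)
Definition gco (S' : pzRingType) (phi : (A -> R) -> S') (X : 'I_r1 -> S') (Y : 'I_r2 -> S')
  (g : {set 'I_r1} -> ('I_r2 -> nat) -> A -> R) n : S' :=
  \sum_(k : expo r1 r2 n | expo_deg k == n) phi (g k.1 (fun j => k.2 j : nat)) * mon X Y k.1 (fun j => k.2 j).

Lemma gco_elem (S' : pzRingType) (phi : (A -> R) -> S') X Y u (B : {set 'I_r1}) (e : 'I_r2 -> nat) N :
  phi (fun=> 0) = 0 -> (#|B| + 2 * \sum_j e j < N)%N ->
  \sum_(n < N) gco phi X Y (fun B' e' => if `[< B' = B /\ e' =1 e >] then u else (fun=> 0)) n = phi u * mon X Y B e.
Proof.
move=> phi0 dN; set d := (#|B| + 2 * _)%N in dN *.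
rewrite (bigD1 (Ordinal dN))//= [X in _ + X]big1 ?addr0 => [|n nd]; last first.
  rewrite /gco big1// => k /eqP kn; rewrite asboolF ?phi0 ?mul0r// => -[e1 e2].
  move: nd; rewrite -val_eqE /= -kn /expo_deg e1.
  by under [X in (_ + 2 * X)%N]eq_bigr => j _ do rewrite e2; rewrite eqxx.
pose k0 : expo r1 r2 d := (B, [ffun j => inord (e j)]).
have ke j : k0.2 j = e j :> nat.
  rewrite ffunE inordK// ltnS /d (bigD1 j)//= mulnDr addnCA mul2n -addnn -!addnA.
  exact: leq_addr.
have dk : expo_deg k0 = d by rewrite /expo_deg /=; congr (_ + 2 * _)%N; apply: eq_bigr => j _; exact: ke.
rewrite /gco (bigD1 k0) ?dk//= [X in _ + X]big1 ?addr0 => [|k /andP[_ /eqP kk]].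
  by rewrite asboolT//; congr (_ * mon _ _ _ _); apply/funext => j; exact: ke.
rewrite asboolF ?phi0 ?mul0r// => -[e1 e2]; apply: kk; apply: expo_eq => // j.
by rewrite ke e2.
Qed.

(** Terms with equal monomials are collected into one coefficient function [g B e]. The truncation
    [N] is arbitrary beyond a bound, so that a new term of higher degree can be added. *)
Lemma gen_norm (c : S W) v : gen F x c v -> exists N0 g, (forall B e, smooth_on W (g B e)) /\ forall N, (N0 <= N)%N ->
  c = \sum_(n < N) gco (fnn W) (fun i => rs (fU F) W (fxi F i)) (fun j => rs (fU F) W (feta F j)) g n /\
  forall p, v p = \sum_(n < N) gco (fun u => (u x)%:A) (px p) (py p) g n.
Proof.
elim=> [|u B e d w su _ [N0 [g [sg h]]]].
  exists 0%N, (fun _ _ _ => 0); split.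
    by move=> _ _; apply/(smooth_onP hA _ oW) => y _; exact: smx_cst.
  move=> N _; split=> [|p]; rewrite big1// => n _; rewrite /gco big1// => k _.
    by rewrite fn0// mul0r.
  by rewrite scale0r mul0r.
pose g1 B' e' := if `[< B' = B /\ e' =1 e >] then u else (fun=> 0).
have sg1 B' e' : smooth_on W (g1 B' e').
  by rewrite /g1; case: asboolP => // _; apply/(smooth_onP hA _ oW) => y _; exact: smx_cst.
exists (maxn N0 (#|B| + 2 * \sum_j e j).+1), (fun B' e' y => g B' e' y + g1 B' e' y); split.
  move=> B' e'; apply/(smooth_onP hA _ oW) => y Wy.
  by apply: smxD => //; [exact: ((smooth_onP hA _ oW).1 (sg B' e'))|exact: ((smooth_onP hA _ oW).1 (sg1 B' e'))].
move=> N; rewrite geq_max => /andP[N1 N2]; have [-> hw] := h N N1; split=> [|p].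
  rewrite /fmon -(gco_elem _ _ _ (fn0 oW) N2) -big_split; apply: eq_bigr => n _ /=.
  rewrite /gco -big_split; apply: eq_bigr => k _ /=.
  by rewrite -mulrDl (ga_fn_add G)//; exact: sg1.
rewrite hw; have -> : u x *: mon (px p) (py p) B e = (u x)%:A * mon (px p) (py p) B e.
  by rewrite -scalerAl mul1r.
have phi0 : (fun u : A -> R => (u x)%:A : fop R) (fun=> 0) = 0 by rewrite scale0r.
have := @gco_elem _ (fun u : A -> R => (u x)%:A : fop R) (px p) (py p) u B e N phi0 N2; rewrite /= => <-.
rewrite -big_split; apply: eq_bigr => n _ /=.
by rewrite /gco -big_split; apply: eq_bigr => k _ /=; rewrite -mulrDl scalerDl.
Qed.

(** If the section is [0], each of its homogeneous parts is [0] since the sum is direct, and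
    freeness makes the coefficient functions vanish on [W], in particular at [x]. *)
Lemma gen_zero v : gen F x (0 : S W) v -> forall p, v p = 0.
Proof.
move=> /gen_norm [N [g [sg /(_ N (leqnn N)) [h0 hv]]]] p; rewrite hv big1// => n _.
pose L m : S W := gco (fnn W) (fun i => rs (fU F) W (fxi F i)) (fun j => rs (fU F) W (feta F j)) g m.
have LE m : L m = fL F W (fun (k : expo r1 r2 m) => g k.1 (fun j => k.2 j : nat)) by [].
have dL m : dg W m (L m).
  rewrite LE /fL; elim: (index_enum _) => [|k s IH]; first by rewrite big_nil; exact: ga_zero.
  rewrite big_cons; case: eqP => // km.
  have hk : dg W m (fnn W (g k.1 (fun j => k.2 j : nat)) * fmon F W k.1 (fun j => k.2 j)).
    have := ga_mul G (ga_fn_deg G (sg k.1 (fun j => k.2 j : nat))) (fmon_deg k.1 (fun j => k.2 j) oW WF).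
    by rewrite add0n -[X in dg W X]/(expo_deg k) km.
  by rewrite -[X in X + _]opprK; rewrite addrC; apply: (ga_sub G IH); rewrite -sub0r; apply: (ga_sub G (ga_zero G _)).
have L0 : L n = 0 by apply: (ga_direct G dL (esym h0)).
have [_ uq] := f_free n oW WF.
have s0 : smooth_on W (fun=> 0 : R) by apply/(smooth_onP hA _ oW) => y _; exact: smx_cst.
rewrite /gco big1// => k /eqP kn.
have -> : g k.1 (fun j => k.2 j : nat) x = 0.
  apply: (uq (fun (k : expo r1 r2 n) => g k.1 (fun j => k.2 j : nat)) (fun _ _ => 0)) => //.
  by rewrite -[LHS]/(L n) L0 /lincomb big1// => l _; rewrite fn0// mul0r.
by rewrite scale0r mul0r.
Qed.

Lemma gen_deg n (c : S W) : dg W n c -> exists2 f : expo r1 r2 n -> A -> R, forall k, smooth_on W (f k) & c = fL F W f.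
Proof. by have [h _] := f_free n oW WF; exact: h. Qed.

Lemma gen_exists (c : S W) : exists v, gen F x c v.
Proof.
have [N [d [dd ->]]] := ga_sum G c.
have H n : exists v, gen F x (d n) v.
  by have [f sf ->] := gen_deg (dd n); exists (fun p => \sum_(k | expo_deg k == n) f k x *: kmon p k); exact: gen_fL.
have [v hv] := choice H; exists (fun p => \sum_(n < N) v n p).
by apply: gen_sum => n _.
Qed.

End Gen.

(** The value of the germ at [x]: the open set [V] may leave the domain of the frame, so the section
    is first restricted to a small [W]. *)
Definition isev (F : frame) x V (a : S V) v : Prop :=
  exists W, [/\ opn W, W x, W `<=` V, W `<=` fU F & gen F x (rs V W a) v].

Definition fev (F : frame) x V (a : S V) : sp -> fop R := pickd (fun=> 0) (isev F x a).

Section Ev.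
Variables (F : frame) (x : A) (V : set A) (oV : opn V) (Vx : V x) (Fx : fU F x).
Let hs := man2_sheaf A.
Let oI W W' : opn W -> opn W' -> opn (W `&` W'). Proof. exact: (opnI hA). Qed.

Lemma isev_near (a : S V) v W : isev F x a v -> opn W -> W x -> exists W',
  [/\ opn W', W' x, W' `<=` V `&` W, W' `<=` fU F & gen F x (rs V W' a) v].
Proof.
move=> [W1 [ oW1 W1x W1V W1F h]] oW Wx; have oW' := oI oW1 oW.
have s1 : W1 `&` W `<=` W1 by move=> y [].
exists (W1 `&` W); split=> //; first by move=> y [/W1V].
  by move=> y [/W1F].
by rewrite -(sh_res_comp hs (V := W1))//; exact: gen_res.
Qed.

Lemma isev_exists (a : S V) : exists v, isev F x a v.
Proof.
have oW := oI oV (@fUo F); have WF : V `&` fU F `<=` fU F by move=> y [].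
have [v hv] := gen_exists x oW WF (rs V (V `&` fU F) a); exists v, (V `&` fU F).
by split=> // y [].
Qed.

Lemma isev_fun (a : S V) v v' p : isev F x a v -> isev F x a v' -> v p = v' p.
Proof.
move=> h [W [ oW Wx WV WF h']]; have [W' [ oW' W'x W'V W'F g']] := isev_near h oW Wx.
have W'W : W' `<=` W by move=> y /W'V [].
have g2 := gen_res oW WF oW' W'W h'; rewrite (sh_res_comp hs) in g2 => //.
have := gen_zero oW' W'F W'x (gen_eq (genD g' (genN oW' g2)) (subrr _) (fun=> erefl)) p.
by move/eqP; rewrite subr_eq0 => /eqP.
Qed.

Lemma fevP (a : S V) : isev F x a (fev F x a).
Proof. exact: pickdP (isev_exists a). Qed.

Lemma fevE (a : S V) v p : isev F x a v -> fev F x a p = v p.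
Proof. by move=> h; exact: isev_fun (fevP a) h. Qed.

End Ev.

Section EvMorphism.
Variables (F : frame) (x : A).
Let hs := man2_sheaf A.
Hypothesis Fx : fU F x.

Lemma fev_res V W (a : S V) p : opn V -> V x -> opn W -> W `<=` V -> W x -> fev F x (rs V W a) p = fev F x a p.
Proof.
move=> oV Vx oW WV Wx; have [W' [ oW' W'x W'V W'F g']] := isev_near oV (fevP oV Vx Fx a) oW Wx.
have W'W : W' `<=` W by move=> y /W'V [].
by apply: fevE => //; exists W'; split=> //; rewrite (sh_res_comp hs).
Qed.

Section OneOpen.
Variables (V : set A) (oV : opn V) (Vx : V x).

Lemma isev2 (a b : S V) v w : isev F x a v -> isev F x b w -> exists W,
  [/\ opn W, W x, W `<=` V, W `<=` fU F & gen F x (rs V W a) v /\ gen F x (rs V W b) w].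
Proof.
move=> ha [W1 [ oW1 W1x W1V W1F h1]]; have [W [ oW Wx WV WF h]] := isev_near oV ha oW1 W1x.
exists W; split=> //; first by move=> y /WV [].
have WW1 : W `<=` W1 by move=> y /WV [].
by split=> //; rewrite -(sh_res_comp hs (V := W1))//; exact: gen_res.
Qed.

Lemma fevB (a b : S V) p : fev F x (a - b) p = fev F x a p - fev F x b p.
Proof.
have [W [ oW Wx WV WF [h1 h2]]] := isev2 (fevP oV Vx Fx a) (fevP oV Vx Fx b).
apply: (fevE oV Vx Fx (v := fun p => fev F x a p - fev F x b p)); exists W; split=> //.
by rewrite resB//; apply: genD => //; exact: genN.
Qed.

Lemma fevM (a b : S V) p : fev F x (a * b) p = fev F x a p * fev F x b p.
Proof.
have [W [ oW Wx WV WF [h1 h2]]] := isev2 (fevP oV Vx Fx a) (fevP oV Vx Fx b).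
apply: (fevE oV Vx Fx (v := fun p => fev F x a p * fev F x b p)); exists W; split=> //.
have [_ [_ ->]] := sh_res_morph hs oV oW WV; exact: genM.
Qed.

Lemma fev_fn u p : smooth_on V u -> fev F x (fnn V u) p = (u x)%:A.
Proof.
move=> su; apply: (fevE oV Vx Fx (v := fun _ => (u x)%:A)).
have oW : opn (V `&` fU F) by apply: opnI => //; exact: fUo.
have WV : V `&` fU F `<=` V by move=> y [].
have WF : V `&` fU F `<=` fU F by move=> y [].
exists (V `&` fU F); split=> //; rewrite (sh_res_fn hs)//; apply: gen_fn => //.
by apply/(smooth_onP hA _ oW) => y [Vy _]; exact: ((smooth_onP hA u oV).1 su).
Qed.

Lemma fev1 p : fev F x (1 : S V) p = 1.
Proof.
rewrite -(ga_fn_one (man2_graded oV)) fev_fn ?scale1r//.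
by apply/(smooth_onP hA _ oV) => y _; exact: smx_cst.
Qed.

Lemma fev_mon p : monoid_morphism (fun a : S V => fev F x a p).
Proof. by split; [exact: fev1|move=> a b; exact: fevM]. Qed.

Lemma fev0 p : fev F x (0 : S V) p = 0.
Proof. by rewrite -(subrr 0) fevB subrr. Qed.

Lemma fevD (a b : S V) p : fev F x (a + b) p = fev F x a p + fev F x b p.
Proof. by have -> : a + b = a - (0 - b); [rewrite sub0r opprK|rewrite !fevB fev0 sub0r opprK]. Qed.

End OneOpen.

Lemma fev_gen1 W u B e p : opn W -> W `<=` fU F -> W x -> smooth_on W u ->
  fev F x (fnn W u * fmon F W B e) p = u x *: mon (px p) (py p) B e.
Proof.
move=> oW WF Wx su; apply: (fevE oW Wx Fx (v := fun p => u x *: mon (px p) (py p) B e)).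
by exists W; split=> //; rewrite (sh_res_id hs)//; exact: gen1.
Qed.

Lemma fev_fmon p B e : fev F x (fmon F (fU F) B e) p = mon (px p) (py p) B e.
Proof.
have sc : smooth_on (fU F) (fun=> 1 : R) by apply/(smooth_onP hA _ (@fUo F)) => y _; exact: smx_cst.
have := fev_gen1 B e p (@fUo F) (fun y h => h) Fx sc.
by rewrite (ga_fn_one (man2_graded (@fUo F))) mul1r scale1r.
Qed.

Lemma fev_xi i p : fev F x (fxi F i) p = px p i.
Proof.
have := fev_fmon p [set i]%SET (fun=> 0%N); rewrite /fmon !mon_x// => <-.
by rewrite (sh_res_id hs)//; exact: fUo.
Qed.

Lemma fev_eta j p : fev F x (feta F j) p = py p j.
Proof.
have := fev_fmon p finset.set0 (fun l => (l == j) : nat); rewrite /fmon !(@mon_y _ _ _ _ _ j)// => <-.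
by rewrite (sh_res_id hs)//; exact: fUo.
Qed.

End EvMorphism.

Lemma fev_fL F W n (f : expo r1 r2 n -> A -> R) y p : opn W -> W `<=` fU F -> W y ->
  (forall k, smooth_on W (f k)) ->
  fev F y (fL F W f) p = \sum_(k | expo_deg k == n) f k y *: kmon p k.
Proof.
move=> oW WF Wy sf; apply: (fevE oW Wy (WF _ Wy) (v := fun p => \sum_(k | expo_deg k == n) f k y *: kmon p k)).
by exists W; split=> //; rewrite (sh_res_id (man2_sheaf A))//; exact: gen_fL.
Qed.

Lemma fev_hl F V n (a : S V) x : opn V -> V x -> fU F x -> dg V n a -> hl n (fun y p => fev F y a p) x.
Proof.
move=> oV Vx Fx ha; have oW : opn (V `&` fU F) by apply: opnI => //; exact: fUo.
have WV : V `&` fU F `<=` V by move=> y [].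
have WF : V `&` fU F `<=` fU F by move=> y [].
have [f sf e] := gen_deg oW WF (sh_res_deg (man2_sheaf A) oV oW WV ha).
exists f; split; first by move=> k; apply: ((smooth_onP hA (f k) oW).1 (sf k)).
exists (V `&` fU F); split=> // y Wy p.
by rewrite -(fev_res (WF _ Wy) a p oV (WV _ Wy) oW WV Wy) e fev_fL.
Qed.

Lemma fev_hp F V n (a : S V) x : opn V -> V x -> fU F x -> dg V n a -> hp n (fev F x a).
Proof. by move=> oV Vx Fx ha; exact: hl_hp (fev_hl oV Vx Fx ha). Qed.

Lemma fev_sep F V n (a : S V) : opn V -> V `<=` fU F -> dg V n a ->
  (forall y p, V y -> fev F y a p = 0) -> a = 0.
Proof.
move=> oV VF ha h; have [f sf e] := gen_deg oV VF ha; rewrite e /fL big1// => k /eqP kn.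
suff -> : fnn V (f k) = 0 by rewrite mul0r.
have sc : smooth_on V (fun=> 0 : R) by apply/(smooth_onP hA _ oV) => y _; exact: smx_cst.
rewrite -(fn0 oV); apply/(ga_fn_inj (man2_graded oV)) => // y Vy.
have e1 p : fev F y a p = \sum_(k | expo_deg k == n) f k y *: kmon p k by rewrite e fev_fL.
by rewrite -(ecf_sum e1 kn) /ecf h// cf0.
Qed.

Lemma tr_subproof (F F' : frame) x : {t : Lm R r1 r2 r1 r2 | fU F x -> fU F' x -> [/\ lskew t,
   forall p l, fev F x (fxi F' l) p = ax t p l & forall p l, fev F x (feta F' l) p = ay t p l]}.
Proof.
apply: cid; have [[h1 h2]|nh] := pselect (fU F x /\ fU F' x); last first.
  by exists (lid _ _ _) => h1 h2; case: nh.
have [||t [t1 t2 t3]] := @lact_exists R r1 r2 r1 r2 (fun l => fev F x (fxi F' l)) (fun l => fev F x (feta F' l)).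
- by move=> l; apply: (fev_hp (@fUo F') h2 h1); exact: fxi1.
- by move=> l; apply: (fev_hp (@fUo F') h2 h1); exact: feta2.
- by exists t.
Qed.

(* the change of frame from [F] to [F'] at [x] *)
Definition tr F F' x := sval (tr_subproof F F' x).

Lemma trP F F' x : fU F x -> fU F' x -> [/\ lskew (tr F F' x),
   forall p l, fev F x (fxi F' l) p = ax (tr F F' x) p l & forall p l, fev F x (feta F' l) p = ay (tr F F' x) p l].
Proof. exact: svalP (tr_subproof F F' x). Qed.

(** The section is expanded in the frame [F']; evaluating this expansion in [F] replaces the
    generators of [F'] by their values in [F], which [tr] describes. *)
Lemma fev_change F F' x V (a : S V) p : opn V -> V x -> fU F x -> fU F' x ->
  fev F x a p = fev F' x a (lact (tr F F' x) p).
Proof.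
move=> oV Vx Fx F'x; have oFI : opn (fU F `&` fU F') by apply: opnI => //; exact: fUo.
have [W [ oW Wx WV WF' g]] := isev_near oV (fevP oV Vx F'x a) oFI (conj Fx F'x).
have WV' : W `<=` V by move=> y /WV [].
rewrite -(fev_res Fx a p oV Vx oW WV' Wx).
have [sk t1 t2] := trP Fx F'x.
move: (fev F' x a) g => v; move: (rs V W a) => c; elim=> [|u B e d w su _ IH]; first exact: fev0.
rewrite fevD// fevM// fev_fn// IH; congr (_ + _); rewrite -scalerAl mul1r; congr (_ *: _).
rewrite [fev _ _ _ _](mon_morph _ _ _ _ (fev_mon Fx oW Wx p)); congr mon; apply/funext => l /=.
  by rewrite fev_res//; exact: fUo.
by rewrite fev_res//; exact: fUo.
Qed.

Lemma tr_id F x : fU F x -> tr F F x = lid _ _ _.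
Proof.
move=> Fx; have [sk t1 t2] := trP Fx Fx; apply: lact_inj => //; first exact: lskew_id.
  by move=> j; rewrite -t1 fev_xi// -[RHS]/(px (lact (lid R r1 r2) _) j) lact_id.
by move=> j; rewrite -t2 fev_eta// -[RHS]/(py (lact (lid R r1 r2) _) j) lact_id.
Qed.

Lemma tr_comp F F' F'' x : fU F x -> fU F' x -> fU F'' x ->
  lcomp (tr F' F'' x) (tr F F' x) = tr F F'' x.
Proof.
move=> Fx F'x F''x; have [s1 _ _] := trP Fx F'x; have [s2 t2 u2] := trP F'x F''x.
have [s3 t3 u3] := trP Fx F''x; apply: lact_inj => //; first exact: lskew_comp.
  move=> j; rewrite -t3 (@fev_change F F' x (fU F'') _ _ (@fUo F'') F''x Fx F'x).
  by rewrite t2 -[LHS]/(px (lact (lcomp _ _) _) j) lact_comp.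
move=> j; rewrite -u3 (@fev_change F F' x (fU F'') _ _ (@fUo F'') F''x Fx F'x).
by rewrite u2 -[LHS]/(py (lact (lcomp _ _) _) j) lact_comp.
Qed.

Lemma tr_smooth F F' x : fU F x -> fU F' x -> lsm (tr F F') x.
Proof.
move=> Fx F'x; have n1 : nearx x (fU F) by apply: nearx_open => //; exact: fUo.
have n2 : nearx x (fU F') by apply: nearx_open => //; exact: fUo.
apply: (lsm_cf hA).
- by apply: (nearx2 hA n1 n2) => y Fy F'y; have [] := trP Fy F'y.
- move=> j; apply: (hl_eq hA _ (fev_hl (@fUo F') F'x Fx (fxi1 F' j))).
  by apply: (nearx2 hA n1 n2) => y Fy F'y p; have [_ -> _] := trP Fy F'y.
- move=> j; apply: (hl_eq hA _ (fev_hl (@fUo F') F'x Fx (feta2 F' j))).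
  by apply: (nearx2 hA n1 n2) => y Fy F'y p; have [_ _ ->] := trP Fy F'y.
Qed.

End Frame.
End Sheaf.

(** * The frames of a [2]-manifold and the isomorphism of structure sheaves *)

Section Frames.
Variables (R : realType) (A : man2 R).
Local Notation S := (@sec R A (fns A)).
Local Notation rs U V := (@res R A (fns A) U V).
Local Notation fnn V := (@fn R A (fns A) V).
Local Notation dg V := (@deg R A (fns A) V).
Let hA : pman A := man2_pman A.
Implicit Types (U V W : set A).

Lemma frame_exists : {r : nat * nat | forall x, exists F : frame A r.1 r.2, fU F x}.
Proof.
apply: cid; have [r1 [r2 H]] := man2_free A; exists (r1, r2) => x.
by have [U [ oU Ux [xi [eta [h1 h2 h3]]]]] := H x; exists (Frame oU h1 h2 h3).
Qed.

Let r1 := (sval frame_exists).1.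
Let r2 := (sval frame_exists).2.
(** A local frame chosen around each point without coherence: the reference frame at [x], and the
    local frame with index [x], of the object [kA]. *)
Definition Fr x : frame A r1 r2 := sval (cid (svalP frame_exists x)).

Lemma FrP x : fU (Fr x) x.
Proof. exact: svalP (cid (svalP frame_exists x)). Qed.

Definition kA : kobj R.
Proof.
refine (@Kobj R A r1 r2 A (fun m => fU (Fr m)) (fun m x => tr (Fr x) (Fr m) x)
  (fun m x => tr (Fr m) (Fr x) x) (man2_manifold A) _ _ _ _ _ _ _).
- by move=> m; exact: fUo.
- by move=> x; exists x; exact: FrP.
- by move=> m x mx; rewrite tr_comp ?tr_id//; exact: FrP.
- by move=> m x mx; rewrite tr_comp ?tr_id//; exact: FrP.
- by move=> m x mx; have [] := trP (FrP x) mx.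
- by move=> m x mx; have [] := trP mx (FrP x).
- move=> i j x ix jx; apply: (lsm_eq hA _ (tr_smooth ix jx)).
  have n1 : nearx x (fU (Fr i)) by apply: nearx_open => //; exact: fUo.
  have n2 : nearx x (fU (Fr j)) by apply: nearx_open => //; exact: fUo.
  by apply: (nearx2 hA n1 n2) => y iy jy; rewrite tr_comp//; exact: FrP.
Defined.

Local Notation kr W := (@kres R kA _ W).

Definition tf V (a : S V) : km kA -> spt R (kr1 kA) (kr2 kA) -> fop R :=
  fun x p => if `[< nearx x V >] then fev (Fr x) x a p else 0.

Lemma tf_fr V (a : S V) i x p : opn V -> nearx x V -> fU (Fr i) x ->
  kfr (k := kA) (tf a) i x p = fev (Fr i) x a p.
Proof.
move=> oV vx ix; rewrite /kfr /tf asboolT// (fev_change a p oV (nearx_self vx) ix (FrP x)).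
by [].
Qed.

Lemma hom_tf V n (a : S V) : opn V -> dg V n a -> hom (k := kA) V n (tf a).
Proof.
move=> oV ha; split=> [x nx p|i x vx ix]; first by rewrite /tf asboolF.
apply: (hl_eq hA _ (fev_hl oV (nearx_self vx) ix ha)).
have n1 : nearx x (fU (Fr i)) by apply: nearx_open => //; exact: fUo.
by apply: (nearx2 hA (nearx_near vx) n1) => y vy iy p; rewrite tf_fr.
Qed.

Lemma tf_sum V N (c : nat -> S V) : opn V -> tf (\sum_(n < N) c n) = \sum_(n < N) tf (c n).
Proof.
move=> oV; apply/funext => x; apply/funext => p; rewrite !fct_sumE /tf.
case: asboolP => [vx|nx]; last by rewrite big1.
by apply: (big_morph (fun a : S V => fev (Fr x) x a p)) => [a b|];
  [apply: fevD|apply: fev0] => //; [exact: FrP|exact: nearx_self vx|exact: FrP|exact: nearx_self vx].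
Qed.

Lemma fin_tf V (a : S V) : opn V -> fin (k := kA) V (tf a).
Proof.
move=> oV; have [N [c [hc ->]]] := ga_sum (man2_graded oV) a.
by exists N, (fun n => tf (c n)); split; [move=> n; exact: hom_tf|exact: tf_sum].
Qed.

Definition theta V (oV : opn V) (a : S V) : ksec (k := kA) V := Ksec (fin_tf a oV).

Lemma thetaE V (oV : opn V) (a : S V) x p : V x -> theta oV a x p = fev (Fr x) x a p.
Proof. by move=> Vx; rewrite /= /tf asboolT//; exact: nearx_open. Qed.

Lemma theta_zmod V (oV : opn V) : zmod_morphism (theta oV).
Proof.
move=> a b; apply: ksecI => x p /nearx_self Vx; rewrite kvalD kvalN !thetaE//.
by apply: fevB => //; exact: FrP.
Qed.

Lemma theta_monoid V (oV : opn V) : monoid_morphism (theta oV).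
Proof.
split=> [|a b]; apply: ksecI => x p /[dup] vx /nearx_self Vx.
  by rewrite kval1// thetaE//; apply: fev1 => //; exact: FrP.
by rewrite kvalM !thetaE//; apply: fevM => //; exact: FrP.
Qed.

Lemma theta_res V W (oV : opn V) (oW : opn W) (a : S V) : W `<=` V ->
  theta oW (rs V W a) = kr W (theta oV a).
Proof.
move=> WV; apply: ksecI => x p wx; have Wx := nearx_self wx.
rewrite kresE// !thetaE//; last exact: WV.
by apply: fev_res => //; [exact: FrP|exact: WV].
Qed.

Lemma theta_fn V (oV : opn V) f : smooth_on V f -> theta oV (fnn V f) = kfn (k := kA) V f.
Proof.
move=> sf; apply: ksecI => x p vx; have Vx := nearx_self vx.
by rewrite thetaE// kfnE//; apply: fev_fn => //; exact: FrP.
Qed.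

(** Near any [x] the values of [a] in the frame [Fr x] vanish at all points, so [a] vanishes there
    by freeness ([fev_sep]); sections that vanish locally are zero. *)
Lemma theta_deg0 V (oV : opn V) n (a : S V) : dg V n a -> theta oV a = 0 -> a = 0.
Proof.
move=> ha e; apply: (sec_separated oV ha) => x Vx; exists (V `&` fU (Fr x)).
have oW : opn (V `&` fU (Fr x)) by apply: opnI => //; exact: fUo.
have WV : V `&` fU (Fr x) `<=` V by move=> y [].
have WF : V `&` fU (Fr x) `<=` fU (Fr x) by move=> y [].
split=> //; first by split=> //; exact: FrP.
apply: (fev_sep oW WF (sh_res_deg (man2_sheaf A) oV oW WV ha)) => y p Wy.
rewrite (fev_res (WF _ Wy) a p oV (WV _ Wy) oW WV Wy) -tf_fr//; last exact: WF.
  by rewrite /kfr -[tf a]/(kval (theta oV a)) e.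
by apply: nearx_open => //; exact: WV.
Qed.

Lemma theta0 V (oV : opn V) (a : S V) : theta oV a = 0 -> a = 0.
Proof.
have G := man2_graded oV; have [N [c [hc ->]]] := ga_sum G a => e.
rewrite big1// => n _; apply: (theta_deg0 (oV := oV) (hc n)).
apply: (ga_direct (kfns_graded (k := kA) oV) (N := N) (c := fun n => theta oV (c n))) => //.
  by move=> m; exact: hom_tf.
apply: etrans e; apply: ksec_eq => x p; rewrite [RHS]/= tf_sum// !fct_sumE.
exact: (@kval_sum R kA V _ _ _ (fun m : 'I_N => theta oV (c m)) x p).
Qed.

Lemma theta_inj V (oV : opn V) : injective (theta oV).
Proof.
move=> a b e; apply/eqP; rewrite -subr_eq0; apply/eqP; apply: (@theta0 V oV).
by rewrite theta_zmod e subrr.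
Qed.

(** The coefficients of [b] in the frame around [x] are smooth functions; the same combination of
    the generators of the sheaf is a preimage. *)
Lemma theta_loc V (oV : opn V) n (b : ksec (k := kA) V) x : hom (k := kA) V n b -> V x -> exists W (oW : opn W),
  [/\ W x, W `<=` V & exists2 a : S W, dg W n a & theta oW a = kr W b].
Proof.
move=> hb Vx; exists (V `&` fU (Fr x)).
have oW : opn (V `&` fU (Fr x)) by apply: opnI => //; exact: fUo.
have WV : V `&` fU (Fr x) `<=` V by move=> y [].
have WF : V `&` fU (Fr x) `<=` fU (Fr x) by move=> y [].
exists oW; split=> //; first by split=> //; exact: FrP.
pose f (l : expo r1 r2 n) y := ecf l (kfr (k := kA) b x y).
have sf l : smooth_on (V `&` fU (Fr x)) (f l).
  apply/(smooth_onP hA _ oW) => y Wy; have [_ h] := hb.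
  by have := hl_cf hA l.1 (fun j => l.2 j : nat) (h x y (nearx_open oV (WV _ Wy)) (WF _ Wy)).
exists (fL (Fr x) (V `&` fU (Fr x)) f).
  rewrite /fL; elim: (index_enum _) => [|l s IH]; first by rewrite big_nil; exact: ga_zero (man2_graded oW) _.
  rewrite big_cons; case: eqP => // ln; have G := man2_graded oW.
  have hl' := ga_mul G (ga_fn_deg G (sf l)) (fmon_deg l.1 (fun j => l.2 j) oW WF).
  rewrite add0n -[X in dg _ X]/(expo_deg l) ln in hl'.
  rewrite -[X in _ + X]opprK; apply: (ga_sub G hl'); rewrite -sub0r.
  exact: (ga_sub G (ga_zero G _)).
apply: ksecI => y p wy; have Wy := nearx_self wy; rewrite kresE//.
have yx : kU (k := kA) x y by exact: WF.
rewrite (kfr_ev (k := kA) _ _ yx) [RHS](kfr_ev (k := kA) _ _ yx).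
rewrite [LHS](tf_fr _ _ oW wy (WF _ Wy)) fev_fL// (hpE _ (hom_kfr_hp hb (nearx_open oV (WV _ Wy)) yx)).
by [].
Qed.

(** Local preimages exist by [theta_loc] and agree on overlaps because [theta] is injective; they
    are glued in the sheaf of [A]. *)
Lemma theta_surj_deg V (oV : opn V) n (b : ksec (k := kA) V) : hom (k := kA) V n b ->
  exists2 a : S V, dg V n a & theta oV a = b.
Proof.
move=> hb; have hs := man2_sheaf A.
pose F := [set W | W `<=` V /\ exists (oW : opn W) (a : S W), dg W n a /\ theta oW a = kr W b].
(* [theta] depends on a proof of openness; quantifying over it inside the set makes the chosen
   section depend on [W] alone. *)
pose s W : S W := pickd 0 [set a | dg W n a /\ forall oW : opn W, theta oW a = kr W b].
have thP W (o1 o2 : opn W) (a : S W) : theta o1 a = theta o2 a by apply: ksec_eq.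
have sP W : F W -> dg W n (s W) /\ forall oW : opn W, theta oW (s W) = kr W b.
  move=> [WV [oW [a [da ta]]]]; apply: (@pickdP (S W) 0 [set a | dg W n a /\ forall oW : opn W, theta oW a = kr W b]).
  by exists a; split=> // oW'; rewrite (thP _ _ oW).
pose U := \bigcup_(W in F) W.
have oF W : F W -> opn W by move=> [_ [ oW _]].
have FV W : F W -> W `<=` V by case.
have oU : opn U by apply: opn_bigcup => // W /oF.
have UV : U `<=` V by move=> x [W /FV WV /WV].
have VU : V `<=` U.
  by move=> x Vx; have [W [oW [Wx WV [a da ta]]]] := theta_loc oV hb Vx; exists W => //; split=> //; exists oW, a.
have FU W : F W -> W `<=` U by move=> FW x Wx; exists W.
have [|V1 W1 F1 F2|a0 [[da0 sa0] _]] := @sh_glue _ _ _ hs n F s.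
- by move=> W FW; split; [exact: oF|exact: (sP W FW).1].
- have oI : opn (V1 `&` W1) by apply: opnI => //; exact: oF.
  have s1 : V1 `&` W1 `<=` V1 by move=> y [].
  have s2 : V1 `&` W1 `<=` W1 by move=> y [].
  have [_ t1] := sP V1 F1; have [_ t2] := sP W1 F2.
  apply: (@theta_inj _ oI); rewrite (theta_res (oF _ F1))// (theta_res (oF _ F2))// t1 t2.
  apply: ksecI => x p vx; rewrite !kresE//;
    by [exact: FV|exact: (nearx_sub s1 vx)|exact: (nearx_sub s2 vx)].
exists (rs U V a0); first exact: (sh_res_deg hs).
rewrite (theta_res oU)//; apply: ksecI => x p vx; rewrite kresE//.
have [W FW Wx] := VU x (nearx_self vx); have [_ t] := sP W FW.
rewrite thetaE; last exact: FU Wx.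
rewrite -(fev_res (FrP x) a0 p oU (FU _ FW _ Wx) (oF _ FW) (FU _ FW) Wx) sa0// -(thetaE (oF _ FW))// t.
by rewrite kresE//; [exact: FV|apply: nearx_open => //; exact: oF].
Qed.

(** Gluing is available degree by degree, so a finite sum of homogeneous sections is lifted
    termwise. *)
Lemma theta_surj V (oV : opn V) (b : ksec (k := kA) V) : exists a : S V, theta oV a = b.
Proof.
have [N [c [hc bc]]] := kvalP b.
have H n : exists a : S V, theta oV a = Ksec (fin_hom (hc n)).
  by have [a _ ha] := @theta_surj_deg V oV n (Ksec (fin_hom (hc n))) (hc n); exists a.
have [d hd] := choice H; exists (\sum_(n < N) d n).
apply: ksec_eq => x p; rewrite bc /= tf_sum// !fct_sumE; apply: eq_bigr => n _.
by have := congr1 (fun e : ksec (k := kA) V => e x p) (hd n).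
Qed.

Definition thinv V (oV : opn V) (b : ksec (k := kA) V) : S V := sval (cid (theta_surj oV b)).

Lemma thetaK V (oV : opn V) b : theta oV (thinv oV b) = b.
Proof. exact: svalP (cid (theta_surj oV b)). Qed.

Lemma thinvK V (oV : opn V) a : thinv oV (theta oV a) = a.
Proof. by apply: (@theta_inj V oV); rewrite thetaK. Qed.

Definition fwd : man2_arr (Phi kA) A := @Man2Arr R (Phi kA) A (cmap_id A) theta.
Definition bwd : man2_arr A (Phi kA) := @Man2Arr R A (Phi kA) (cmap_id A) thinv.

Lemma fwd_mor : man2_mor fwd.
Proof.
split=> /=.
- exact: (smooth_map_id hA).
- by move=> V oV; split; [exact: theta_zmod|exact: theta_monoid].
- by move=> V oV n a; exact: hom_tf.
- by move=> V W oV oW a WV; exact: theta_res.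
- by move=> V oV f sf; exact: theta_fn.
Qed.

Lemma bwd_mor : man2_mor bwd.
Proof.
split=> /=.
- exact: (smooth_map_id hA).
- move=> V oV; have tM := (theta_monoid oV).2; split=> [a b|].
    by apply: (@theta_inj V oV); rewrite theta_zmod !thetaK.
  split=> [|a b]; first by apply: (@theta_inj V oV); rewrite thetaK (theta_monoid oV).1.
  by apply: (@theta_inj V oV); rewrite tM !thetaK.
- move=> V oV n b hb; have [a da <-] := theta_surj_deg oV hb.
  by rewrite thinvK.
- move=> V W oV oW b WV; apply: (@theta_inj W oW).
  by rewrite thetaK (theta_res oV)// thetaK.
- by move=> V oV f sf; apply: (@theta_inj V oV); rewrite thetaK; apply/esym/theta_fn.
Qed.

Lemma fwdK : man2_comp bwd fwd = man2_id (Phi kA).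
Proof. by apply: parr_eq => // V oV a x p; rewrite /= -/(tf _) -[tf _]/(kval (theta oV (thinv oV a))) thetaK. Qed.

Lemma bwdK : man2_comp fwd bwd = man2_id A.
Proof.
rewrite /man2_comp /man2_id; congr Man2Arr.
by apply: functional_extensionality_dep => V; apply: functional_extensionality_dep => oV;
  apply/funext => a; exact: thinvK.
Qed.

End Frames.

Lemma is_iso_comp (C : category) (x y z : obj C) (g : mor y z) (f : mor x y) :
  is_iso g -> is_iso f -> is_iso (comp g f).
Proof.
move=> [g' [g1 g2]] [f' [f1 f2]]; exists (comp f' g'); split.
  by rewrite -comp_assoc [comp g' _]comp_assoc g1 comp_idl.
by rewrite -comp_assoc [comp f _]comp_assoc f2 comp_idl.
Qed.

(** * The equivalence *)

Section Equivalence.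
Variables (C D : category) (F : functor C D).
Hypothesis faithful : forall x y (f f' : mor x y), fmap F f = fmap F f' -> f = f'.
Hypothesis full : forall x y (g : mor (F x) (F y)), exists f : mor x y, fmap F f = g.
Hypothesis ess_surj : forall d : obj D, exists (c : obj C) (f : mor (F c) d), is_iso f.

Let lift x y (g : mor (F x) (F y)) : mor x y := sval (cid (full g)).
Let liftK x y (g : mor (F x) (F y)) : fmap F (lift g) = g := svalP (cid (full g)).

Let g0 d : obj C := sval (cid (ess_surj d)).
Let v d : mor (F (g0 d)) d := sval (cid (svalP (cid (ess_surj d)))).
Let isov d : is_iso (v d) := svalP (cid (svalP (cid (ess_surj d)))).
Let v' d : mor d (F (g0 d)) := sval (cid (isov d)).
Let vK d : comp (v' d) (v d) = idm _. Proof. exact: (svalP (cid (isov d))).1. Qed.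
Let v'K d : comp (v d) (v' d) = idm _. Proof. exact: (svalP (cid (isov d))).2. Qed.

Let g1 d d' (h : mor d d') : mor (g0 d) (g0 d') := lift (comp (v' d') (comp h (v d))).

Let g1_id d : g1 (idm d) = idm (g0 d).
Proof. by apply: faithful; rewrite liftK comp_idl vK fmap_id. Qed.

Let g1_comp d1 d2 d3 (h : mor d2 d3) (f : mor d1 d2) : g1 (comp h f) = comp (g1 h) (g1 f).
Proof.
apply: faithful; rewrite fmap_comp !liftK -!comp_assoc; congr comp; congr comp.
by rewrite [RHS]comp_assoc v'K comp_idl.
Qed.

(** Choice supplies an object [g0 d] with an isomorphism [v d]; morphisms are conjugated by these
    and lifted through fullness, and faithfulness yields the functor laws and naturality. *)
Lemma ff_ess_surj_equivalent : equivalent C D.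
Proof.
pose G := Functor g1_id g1_comp.
exists F, G, (fun x => lift (v' (F x)) : mor x (G (F x))), v; split=> //.
- move=> x; exists (lift (v (F x))).
  by split; apply: faithful; rewrite fmap_comp !liftK fmap_id ?vK ?v'K.
- move=> x x' f; apply: faithful; rewrite !fmap_comp !liftK -comp_assoc.
  by rewrite -comp_assoc v'K comp_idr.
- by move=> y y' h; rewrite /= liftK comp_assoc v'K comp_idl.
Qed.

End Equivalence.

Lemma category_of_eq (C : precat) (hC : is_category C) (x y : obj (category_of hC)) (f g : mor x y) :
  sval f = sval g -> f = g.
Proof. by move=> e; apply: eq_sig_hprop => // *; exact: Prop_irrelevance. Qed.

Section Main.
Variable R : realType.
Let CM := category_of (MDVB_category R).
Let CT := category_of (TwoMan_category R).

Let fo (E : mdvb R) : man2 R := Phi (Kof E).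
Let fm (F E : obj CM) (w : mor F E) : @mor CT (fo F) (fo E) :=
  exist _ (Pmap (Kmap_khom (svalP w))) (Pmap_mor (Kmap_khom (svalP w))).

Let Pmap_eq (N M : kobj R) (w w' : karr N M) (hw : khom w) (hw' : khom w') : w = w' -> Pmap hw = Pmap hw'.
Proof. by move=> e; subst w'; rewrite (Prop_irrelevance hw hw'). Qed.

Let kid_khom (k : kobj R) : khom (kid k) := cat_id (Kcat R) k.

Let fm_id (E : obj CM) : fm (idm E) = idm (fo E : obj CT).
Proof.
apply: category_of_eq => /=; rewrite -(Pmap_id (kid_khom (Kof E))); apply: Pmap_eq.
exact: Kmap_id.
Qed.

Let fm_comp (E1 E2 E3 : obj CM) (g : mor E2 E3) (f : mor E1 E2) : fm (comp g f) = comp (fm g) (fm f).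
Proof.
apply: category_of_eq => /=.
have h : khom (kcomp (Kmap (sval g)) (Kmap (sval f))) := cat_comp (Kcat R) (Kmap_khom (svalP g)) (Kmap_khom (svalP f)).
rewrite -(Pmap_comp _ _ h); apply: Pmap_eq; apply: Kmap_comp; exact: svalP.
Qed.

Let Fun : functor CM CT := Functor fm_id fm_comp.

Lemma MDVB_TwoMan_equivalent : equivalent CM CT.
Proof.
apply: (ff_ess_surj_equivalent (F := Fun)).
- move=> E E' f f' /(congr1 sval) /= /Pmap_inj e; apply: (@category_of_eq _ (MDVB_category R)).
  by apply: Kmap_inj e; exact: svalP.
- move=> E E' [g hg]; have [w hw wE] := Kmap_surj (fullw_khom hg).
  exists (exist _ w hw); apply: category_of_eq => /=.
  by rewrite -[RHS](Pmap_full hg); exact: Pmap_eq.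
(* The isomorphism onto [A] is composed of the image of [realize], from the frames of the bundle
   built on [k] to [k] itself, and of [fwd], from the [2]-manifold of [k] to [A]. *)
move=> A; pose k := kA A; exists (Emdvb k : obj CM).
have hr := @realize_khom R k; have hu := @unrealize_khom R k.
have hf := fwd_mor A; have hb := bwd_mor A.
have ir : man2_comp (Pmap hu) (Pmap hr) = man2_id _.
  have h := cat_comp (Kcat R) hu hr; rewrite -(Pmap_comp _ _ h) -(Pmap_id (kid_khom _)).
  by apply: Pmap_eq; exact: realizeK.
have iu : man2_comp (Pmap hr) (Pmap hu) = man2_id _.
  have h := cat_comp (Kcat R) hr hu; rewrite -(Pmap_comp _ _ h) -(Pmap_id (kid_khom _)).
  by apply: Pmap_eq; exact: unrealizeK.
pose r : @mor CT (Phi (Kof (Emdvb k))) (Phi k) := exist _ (Pmap hr) (Pmap_mor hr).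
have ri : is_iso r.
  by exists (exist _ (Pmap hu) (Pmap_mor hu)); split; exact: category_of_eq.
have fi : is_iso (exist _ (fwd A) hf : @mor CT (Phi k) A).
  by exists (exist _ (bwd A) hb); split; apply: category_of_eq; [exact: fwdK|exact: bwdK].
by exists (comp (exist _ (fwd A) hf : @mor CT (Phi k) A) r); exact: is_iso_comp.
Qed.

End Main.

Theorem theorem3p17 (R : realType) :
  exists (hM : is_category (MDVB R)) (hN : is_category (TwoMan R)),
    equivalent (category_of hM) (category_of hN).
Proof. exists (MDVB_category R), (TwoMan_category R); exact: MDVB_TwoMan_equivalent. Qed.
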